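(* Let $n,k$ be integers with $2\le k<n$, let $0\le\eta<\frac{(k-2)^2}{4}$ if $k>2$ and $\eta=0$ if $k=2$, let $0\le t<2$ and $p_t=\frac{n+2-2t}{n-2}$. Write points of $\mathbb{R}^n=\mathbb{R}^k\times\mathbb{R}^{n-k}$ as $x=(y,z)$. Then the Hardy-Sobolev-Mazya equation $$-\Delta u-\eta\frac{u}{|y|^2}=\frac{|u|^{p_t-1}u}{|y|^t}\quad\text{in }\mathbb{R}^n,\qquad u\in D^{1,2}(\mathbb{R}^n),$$ admits a sequence $(v_j)_{j\ge1}$ of sign-changing solutions such that $\|\nabla v_j\|_{L^2(\mathbb{R}^n)}\to\infty$ as $j\to\infty$.
   Context: $D^{1,2}(\mathbb{R}^n)$ is the completion of $C_c^\infty(\mathbb{R}^n)$ with respect to the norm $\|\nabla u\|_{L^2(\mathbb{R}^n)}$. Solutions are understood in the weak sense. A function is sign changing if both its positive part and its negative part are nontrivial. *)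

(* Defs.v *)
(* Analysis over an abstract [R : realType]; points of R^n are row vectors. *)
From HB Require Import structures.
From mathcomp Require Import all_boot all_order all_algebra.
From mathcomp Require Import all_classical all_reals all_analysis.

Set Implicit Arguments.
Unset Strict Implicit.
Unset Printing Implicit Defensive.

Import Order.TTheory GRing.Theory Num.Theory.
Import numFieldNormedType.Exports.

Local Open Scope classical_set_scope.
Local Open Scope ring_scope.

(* Row vectors carry the product sigma-algebra, generated by the coordinates;
   this mirrors the library's instance on [n.-tuple T]. *)
Definition measure_rV_display : measure_display -> measure_display.
Proof. exact. Qed.

Section measurable_rV.
Context {d} {T : sigmaRingType d}.
Variable n : nat.

Let coors : 'I_n -> 'rV[T]_n -> T := fun i x => x ord0 i.

Let rV_set0 : g_sigma_preimage coors set0.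
Proof. exact: sigma_algebra0. Qed.

Let rV_setC A : g_sigma_preimage coors A -> g_sigma_preimage coors (~` A).
Proof. exact: sigma_algebraC. Qed.

Let rV_bigcup (F : _^nat) : (forall i, g_sigma_preimage coors (F i)) ->
  g_sigma_preimage coors (\bigcup_i (F i)).
Proof. exact: sigma_algebra_bigcup. Qed.

HB.instance Definition _ := @isMeasurable.Build (measure_rV_display d)
  'rV[T]_n (g_sigma_preimage coors) rV_set0 rV_setC rV_bigcup.

End measurable_rV.

Lemma measurable_coord d (T : sigmaRingType d) n (i : 'I_n) :
  measurable_fun [set: 'rV[T]_n] (fun x => x ord0 i).
Proof.
move=> _ Y mY; rewrite setTI; apply: sub_sigma_algebra => /=.
rewrite -bigcup_seq/=; exists i => /=; first by rewrite mem_index_enum.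
by exists Y => //; rewrite setTI.
Qed.

Lemma measurable_fun_coordP d1 d2 (T1 : measurableType d1)
    (T2 : measurableType d2) n (f : T1 -> 'rV[T2]_n) :
  (forall i, measurable_fun [set: T1] (fun x => f x ord0 i)) ->
  measurable_fun [set: T1] f.
Proof.
move=> mf; apply: (@measurability _ _ _ _ _ _
  (\big[setU/set0]_(i < n) preimage_set_system setT
    (fun x : 'rV[T2]_n => x ord0 i) measurable)) => // _ [A + <-].
rewrite -bigcup_seq => -[i _ [B mB <-]].
by have := mf i measurableT B mB; rewrite !setTI.
Qed.

Definition rV_cons (R : realType) n (p : 'rV[R]_n * R) : 'rV[R]_n.+1 :=
  row_mx (const_mx p.2 : 'rV_1) p.1.

Lemma measurable_rV_cons (R : realType) n :
  measurable_fun [set: 'rV[R]_n * R] (@rV_cons R n).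
Proof.
apply: measurable_fun_coordP => i.
have [j ij|j ij] := split_ordP (i : 'I_(1 + n)).
  apply: (eq_measurable_fun snd) => //.
  by move=> p _; rewrite ij [RHS](row_mxEl (const_mx p.2 : 'rV_1)) mxE.
apply: (eq_measurable_fun (fun p : 'rV[R]_n * R => p.1 ord0 j)).
  by move=> p _; rewrite ij [RHS](row_mxEr (const_mx p.2 : 'rV_1)).
by apply: (measurableT_comp (measurable_coord (n := n) j)).
Qed.

(* The image of [mu \x lebesgue_measure] by [rV_cons]; the bundled measure is
   named explicitly because [pushforward] needs the measurability of the map. *)
Definition rV_cons_measure (R : realType) n (mu : {measure set 'rV[R]_n -> \bar R})
    : {measure set 'rV[R]_n.+1 -> \bar R} :=
  measure_function_pushforward__canonical__measure_function_Measure
    (mu \x @lebesgue_measure R)%E (@measurable_rV_cons R n).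

Fixpoint lebesgue_rV (R : realType) n : {measure set 'rV[R]_n -> \bar R} :=
  match n with
  | 0 => dirac (0 : 'rV[R]_0)
  | m.+1 => rV_cons_measure (lebesgue_rV R m)
  end.

Definition enorm (R : realType) n (x : 'rV[R]_n) : R :=
  Num.sqrt (\sum_(i < n) x ord0 i ^+ 2).

(* |y| for x = (y, z) in R^k * R^(n-k). *)
Definition head_norm (R : realType) n (k : nat) (x : 'rV[R]_n) : R :=
  Num.sqrt (\sum_(i < n | (i < k)%N) x ord0 i ^+ 2).

Definition dotrV (R : realType) n (x y : 'rV[R]_n) : R :=
  \sum_(i < n) x ord0 i * y ord0 i.

Definition partial (R : realType) n (i : 'I_n) (f : 'rV[R]_n -> R)
    : 'rV[R]_n -> R :=
  fun x => 'D_(delta_mx ord0 i : 'rV[R]_n) f x.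

Definition grad (R : realType) n (f : 'rV[R]_n -> R) (x : 'rV[R]_n) : 'rV[R]_n :=
  \row_i partial i f x.

(* All iterated partial derivatives exist and are differentiable everywhere;
   the empty word gives differentiability of [f] itself. *)
Definition smooth (R : realType) n (f : 'rV[R]_n -> R) : Prop :=
  forall (s : seq 'I_n) (x : 'rV[R]_n),
    differentiable (foldr (@partial R n) f s) x.

(* C_c^oo(R^n) *)
Definition test_function (R : realType) n (f : 'rV[R]_n -> R) : Prop :=
  smooth f /\ compact (closure [set x | f x != 0]).

Definition L2norm_field (R : realType) n (G : 'rV[R]_n -> 'rV[R]_n) : \bar R :=
  'N[lebesgue_rV R n]_(2%:E)[EFin \o (fun x => enorm (G x))]%E.

(* The critical exponent 2^*. *)
Definition sobolev_exponent (R : realType) (n : nat) : R :=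
  2 * n%:R / (n%:R - 2).

(* [u] belongs to D^{1,2}(R^n), n >= 3, and [G] is its (weak) gradient.  The
   abstract completion of C_c^oo for the gradient norm is realised as a space of
   functions through the Sobolev inequality: a Cauchy sequence for this norm
   converges in L^{2^*}, and its class is identified with the limit [u], whose
   gradient is the L^2 limit of the gradients. *)
Definition D12 (R : realType) n (u : 'rV[R]_n -> R) (G : 'rV[R]_n -> 'rV[R]_n)
    : Prop :=
  [/\ measurable_fun setT u, measurable_fun setT G &
   exists phi : nat -> 'rV[R]_n -> R,
    [/\ forall m, test_function (phi m),
        (fun m => L2norm_field (fun x => grad (phi m) x - G x)) @ \oo --> 0%E &
        (fun m => 'N[lebesgue_rV R n]_((sobolev_exponent R n)%:E)
           [EFin \o (phi m \- u)%R])%E @ \oo --> 0%E]].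

(* The exponent p_t. *)
Definition hsm_exponent (R : realType) (n : nat) (t : R) : R :=
  (n%:R + 2 - 2 * t) / (n%:R - 2).

(* [u], with gradient [G], solves
     - Delta u - eta u / |y|^2 = |u|^(p_t - 1) u / |y|^t
   weakly.  Integrability is required explicitly since [Rintegral] is total. *)
Definition hsm_weak_solution (R : realType) (n k : nat) (eta t : R)
    (u : 'rV[R]_n -> R) (G : 'rV[R]_n -> 'rV[R]_n) : Prop :=
  let mu := lebesgue_rV R n in
  forall phi : 'rV[R]_n -> R, test_function phi ->
    let energy x := dotrV (G x) (grad phi x) in
    let hardy x := eta * u x * phi x / head_norm k x ^+ 2 in
    let source x :=
      `|u x| `^ (hsm_exponent n t - 1) * u x * phi x / head_norm k x `^ t in
    [/\ mu.-integrable setT (EFin \o energy),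
        mu.-integrable setT (EFin \o hardy),
        mu.-integrable setT (EFin \o source) &
        (\int[mu]_x energy x) - (\int[mu]_x hardy x) = \int[mu]_x source x].

(* Neither the positive nor the negative part vanishes almost everywhere. *)
Definition sign_changing (R : realType) n (u : 'rV[R]_n -> R) : Prop :=
  ~ {ae lebesgue_rV R n, forall x, u^\+ x = 0} /\
  ~ {ae lebesgue_rV R n, forall x, u^\- x = 0}.

(* Main.v *)
Require Import Defs.
From HB Require Import structures.
From mathcomp Require Import all_boot all_order all_algebra.
From mathcomp Require Import all_classical all_reals all_analysis.
From mathcomp Require Import measurable_realfun zify ring lra.

(* Writing c = (n-2)/2 and s = (1 + |x|^2) / (2 |y|), the function
   u(x) = |y|^(-c) f(s) solves the equation away from y = 0 as soon as
   (s^2 - 1) f'' + (2A + 1) s f' + lam f + |f|^(p-1) f = 0 on s >= 1,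
   where A = (n-k)/2, p = p_t and lam = A^2 - (k-2)^2/4 + eta: this is the radial
   equation of the hyperbolic space of dimension n-k+1, for which p is
   subcritical since k >= 2.  Solutions f with f(1) = al have more and more
   zeros on [2, 3] as al grows, because a Pohozaev identity makes their energy
   there unbounded while large energy forces oscillation.  For a value of al
   whose solution decays slowly at infinity the number of zeros is locally
   constant in al, so there are arbitrarily large al whose solution decays fast,
   and these have large energy and change sign.  Fast decay makes u an element
   of D^{1,2} and a weak solution across y = 0, both by a cutoff in s; the
   integrals are controlled on the shells 2^l <= s < 2^(l+1), and in the limiting
   case by a cutoff whose logarithmic slope is O(1/m) over m dyadic scales. *)

Set Implicit Arguments.
Unset Strict Implicit.
Unset Printing Implicit Defensive.

Import Order.TTheory GRing.Theory Num.Theory.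
Import numFieldNormedType.Exports.

Local Open Scope classical_set_scope.
Local Open Scope ring_scope.

(** * Real functions of one variable *)

(** Off y = 0 the metric |dx|^2 / |y|^2 is that of hyperbolic space of dimension n - k + 1 times the
    sphere S^(k-1), and s is the hyperbolic cosine of the distance from (|y|, z) to (1, 0); hence
    the ansatz. The linear part has the modes s^(-A + nu) and s^(-A - nu) at infinity, with nu^2 =
    (k-2)^2/4 - eta. The bound on eta makes nu positive for k > 2, while k = 2 gives nu = 0 and the
    modes s^(-A) log s and s^(-A). This borderline needs its own asymptotics, since s^(-A) is
    exactly the decay at which the basic integral bounds diverge. In both cases slow decay is
    recognised at one finite s by an open condition on (f, f') that excludes all later zeros, so no
    zero enters from infinity when [al] moves. If every [al] beyond a threshold were slow, one bound
    on the number of zeros would hold for all of them. As p is only known to exceed 1, f is handled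
    as a C^2 function, and the test functions approximating u are built from a class of smooth
    profiles closed under differentiation. *)

Notation cont_at f x := ({for x, continuous f}) (only parsing).

Section Real.
Context {R : realType}.
Implicit Types (f g h : R -> R) (x y a b : R).

Definition Dr f x (d : R) := is_derive x (1 : R) f d.

Lemma Dr_derive1 f x d : derivable f x 1 -> f^`()%classic x = d -> Dr f x d.
Proof. by move=> fd <-; split => //; rewrite derive1E. Qed.

Lemma Dr_eq f x d d' : Dr f x d -> d = d' -> Dr f x d'.
Proof. by move=> ? <-. Qed.

Lemma Dr_cst (c : R) x : Dr (fun=> c) x 0.
Proof. exact: is_derive_cst. Qed.

Lemma Dr_id x : Dr (fun y => y) x 1.
Proof. exact: is_derive_id. Qed.

Lemma DrD f g x a b : Dr f x a -> Dr g x b -> Dr (fun y => f y + g y) x (a + b).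
Proof. exact: is_deriveD. Qed.

Lemma DrN f x a : Dr f x a -> Dr (fun y => - f y) x (- a).
Proof. exact: is_deriveN. Qed.

Lemma DrB f g x a b : Dr f x a -> Dr g x b -> Dr (fun y => f y - g y) x (a - b).
Proof. exact: is_deriveB. Qed.

Lemma DrM f g x a b : Dr f x a -> Dr g x b ->
  Dr (fun y => f y * g y) x (f x * b + g x * a).
Proof. exact: is_deriveM. Qed.

Lemma DrX f n x a : Dr f x a -> Dr (fun y => f y ^+ n) x (n%:R * f x ^+ n.-1 * a).
Proof.
move=> fa; have := @is_deriveX _ _ f n x 1 a fa.
by rewrite exprfctE.
Qed.

Lemma DrV f x a : f x != 0 -> Dr f x a ->
  Dr (fun y => (f y)^-1) x (- a / f x ^+ 2).
Proof.
move=> f0 fa; have fa' := @ex_derive _ _ _ _ _ _ _ fa.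
apply: DeriveDef; first exact: derivableV.
rewrite deriveV // (@derive_val _ _ _ _ _ _ _ fa) /GRing.scale/= mulNr mulrC.
by rewrite mulNr.
Qed.

Lemma Dr_continuous f x d : Dr f x d -> cont_at f x.
Proof.
move=> [/derivable1_diffP fd _]; exact: differentiable_continuous.
Qed.

Lemma Dr_comp f g x a b : Dr f x a -> Dr g (f x) b -> Dr (fun y => g (f y)) x (b * a).
Proof. move=> fa gb; exact: (@is_derive1_comp R g f x b a). Qed.

Lemma Dr_near f g x d : (\forall y \near x, f y = g y) -> Dr f x d -> Dr g x d.
Proof.
by move=> fg fd; exact: near_eq_is_derive fg fd.
Qed.

Lemma Dr_expR x : Dr (@expR R) x (expR x).
Proof. exact: is_derive_expR. Qed.

Lemma Dr_ln x : 0 < x -> Dr (@ln R) x x^-1.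
Proof. exact: is_derive1_ln. Qed.

Lemma Dr_powR f x a (r : R) : 0 < f x -> Dr f x a ->
  Dr (fun y => f y `^ r) x (r * f x `^ (r - 1) * a).
Proof.
move=> f0 fa; apply: (@Dr_comp f (fun y => y `^ r) x a _ fa).
apply: DeriveDef; first by apply: derivable_powR; rewrite in_itv/= f0.
by rewrite -derive1E powR_derive1// in_itv/= f0.
Qed.

Lemma Dr_unique f x d d' : Dr f x d -> Dr f x d' -> d = d'.
Proof. by move=> [_ <-] [_ <-]. Qed.

(** A form without quotients: derivatives at junction points (of [spow] at 0, of pasted functions,
    of [bump_pow] at 0) then come from a plain estimate. *)
Lemma Dr_epsP f x d : Dr f x d <-> forall e, 0 < e -> exists2 de : R, 0 < de &
  forall y, `|y - x| < de -> `|f y - f x - d * (y - x)| <= e * `|y - x|.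
Proof.
split=> [fd e e0|H].
  have /cvgrPdist_le/(_ e e0) := @ex_derive _ _ _ _ _ _ _ fd.
  rewrite -/(derive f x 1) (@derive_val _ _ _ _ _ _ _ fd).
  move=> [de/= de0 Hde]; exists de => // y yx.
  have [->|yx0] := eqVneq y x; first by rewrite !subrr mulr0 subr0 normr0 mulr0.
  have := Hde (y - x); rewrite /ball/= sub0r normrN subr_eq0 => /(_ yx yx0).
  rewrite /GRing.scale/= mulr1 subrK => He.
  have -> : f y - f x - d * (y - x) = - (d - (y - x)^-1 * (f y - f x)) * (y - x).
    by field; rewrite subr_eq0.
  by rewrite normrM normrN ler_wpM2r.
have cv : h^-1 *: ((f \o shift x) (h *: (1 : R)) - f x) @[h --> 0^'] --> d.
  apply/cvgrPdist_le => e e0; have [de de0 Hde] := H e e0.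
  exists de => //= y; rewrite /ball/= sub0r normrN => yde y0.
  rewrite /GRing.scale/= mulr1.
  have := Hde (y + x); rewrite addrK => /(_ yde) He.
  have -> : d - y^-1 * (f (y + x) - f x) = - (f (y + x) - f x - d * y) / y by field.
  by rewrite normrM normrN normfV ler_pdivrMr// normr_gt0.
apply: DeriveDef; last exact: cvg_lim cv.
by apply/cvg_ex; exists d.
Qed.

Lemma cont_within f a b : (forall x, a <= x <= b -> cont_at f x) ->
  {within `[a, b], continuous f}.
Proof.
move=> fc; apply: continuous_in_subspaceT => x; rewrite inE/= in_itv/= => xab.
exact: fc.
Qed.

Lemma mvt f df a b : a < b -> (forall x, a < x < b -> Dr f x (df x)) ->
  (forall x, a <= x <= b -> cont_at f x) ->
  exists2 c : R, a < c < b & f b - f a = df c * (b - a).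
Proof.
move=> ab fd fc.
have [|c] := @MVT R f df a b ab _ (cont_within fc).
  by move=> x; rewrite in_itv/=; exact: fd.
by rewrite in_itv/= => cab fE; exists c.
Qed.

Lemma Dr_ndecr f df a b : a <= b -> (forall x, a < x < b -> Dr f x (df x)) ->
  (forall x, a <= x <= b -> cont_at f x) ->
  (forall x, a < x < b -> 0 <= df x) -> f a <= f b.
Proof.
rewrite le_eqVlt => /predU1P[-> //|ab] fd fc df0.
have [c cab fE] := mvt ab fd fc.
by rewrite -subr_ge0 fE mulr_ge0 ?df0// subr_ge0 ltW.
Qed.

Lemma Dr_nincr f df a b : a <= b -> (forall x, a < x < b -> Dr f x (df x)) ->
  (forall x, a <= x <= b -> cont_at f x) ->
  (forall x, a < x < b -> df x <= 0) -> f b <= f a.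
Proof.
rewrite le_eqVlt => /predU1P[-> //|ab] fd fc df0.
have [c cab fE] := mvt ab fd fc.
by rewrite -subr_le0 fE mulr_le0_ge0 ?df0// subr_ge0 ltW.
Qed.

(** Both [f + g] and [g - f] are nondecreasing. With [g] an explicit antiderivative of the bound,
    this replaces the integration of a differential inequality throughout the study of the radial
    equation. *)
Lemma Dr_dom f g df dg a b : a <= b ->
  (forall x, a < x < b -> Dr f x (df x)) -> (forall x, a < x < b -> Dr g x (dg x)) ->
  (forall x, a <= x <= b -> cont_at f x) -> (forall x, a <= x <= b -> cont_at g x) ->
  (forall x, a < x < b -> `|df x| <= dg x) -> `|f b - f a| <= g b - g a.
Proof.
move=> ab fd gd fc gc fg; rewrite ler_norml; apply/andP; split.
  rewrite -subr_ge0.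
  have : f a + g a <= f b + g b.
    apply: (@Dr_ndecr (fun x => f x + g x) (fun x => df x + dg x)) => //.
    - by move=> x /[dup] /fd ? /gd ?; exact: DrD.
    - by move=> x /[dup] /fc ? /gc ?; exact: continuousD.
    - by move=> x /fg; rewrite ler_norml => /andP[+ _]; lra.
  lra.
have : g a - f a <= g b - f b.
  apply: (@Dr_ndecr (fun x => g x - f x) (fun x => dg x - df x)) => //.
  - by move=> x /[dup] /fd ? /gd ?; exact: DrB.
  - by move=> x /[dup] /fc ? /gc ?; exact: continuousB.
  - by move=> x /fg; rewrite ler_norml => /andP[_]; lra.
lra.
Qed.

Lemma ivt0 f a b : a <= b -> (forall x, a <= x <= b -> cont_at f x) ->
  f a * f b <= 0 -> exists2 c : R, a <= c <= b & f c = 0.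
Proof.
move=> ab fc fab.
have [|c] := @IVT R f a b 0 ab (cont_within fc).
  rewrite ge_min le_max.
  have [fa0|fa0] /= := leP (f a) 0; have [fb0|fb0] //= := leP 0 (f b).
  - have [->|fa'] := eqVneq (f a) 0; rewrite ?lexx //=.
    by move: fab; rewrite nmulr_rle0 ?lt_neqAle ?fa'//; rewrite fb0 orbT.
  - by move: fab; rewrite nmulr_lle0 // => ->.
  - by move: fab; rewrite pmulr_rle0 // (ltW fa0) => ->.
  - by move: fab; rewrite pmulr_rle0 // (ltW fa0) => ->.
by rewrite in_itv/= => cab fE; exists c.
Qed.

Lemma cont_gt0 f x : cont_at f x -> 0 < f x ->
  exists2 e : R, 0 < e & forall y, `|y - x| < e -> 0 < f y.
Proof.
move=> fc fx.
have : \forall y \near x, 0 < f y.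
  by have := fc; move=> /(_ _ (lt_nbhsr fx)).
move=> [e/= e0 He]; exists e => // y yx; apply: He.
by rewrite /ball/= distrC.
Qed.

(** The engine of the continuation arguments: the infimum of [S] is the first time at which a
    positive quantity vanishes, and what positivity implies remains available before that time. *)
Lemma first_hit f a b : a <= b -> (forall x, a <= x <= b -> cont_at f x) ->
  0 < f a -> f b <= 0 ->
  exists2 c : R, a < c <= b & f c = 0 /\ forall x, a <= x < c -> 0 < f x.
Proof.
move=> ab fc fa fb.
pose S := [set x | a <= x <= b /\ f x <= 0].
have S0 : S !=set0 by exists b; split => //; rewrite ab lexx.
have Sa : lbound S a by move=> x [/andP[]].
have hS : has_inf S by split => //; exists a.
set c := inf S.
have ac : a <= c by apply: lb_le_inf.
have cb : c <= b by apply: (ge_inf (ex_intro _ a Sa)); split => //; rewrite ab lexx.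
have cab : a <= c <= b by rewrite ac.
have pos x : a <= x < c -> 0 < f x.
  move=> /andP[ax xc]; rewrite ltNge; apply/negP => fx.
  have : c <= x by apply: (ge_inf (ex_intro _ a Sa)); split => //; rewrite ax (le_trans (ltW xc)).
  by rewrite leNgt xc.
have fc0 : f c <= 0.
  rewrite leNgt; apply/negP => /(cont_gt0 (fc _ cab))[e e0 He].
  have [x [[/andP[ax xb] fx] xc]] : exists x, S x /\ x < c + e.
    by have [x Sx xc] := inf_adherent e0 hS; exists x.
  have cx : c <= x by apply: (ge_inf (ex_intro _ a Sa)); split => //; rewrite ax.
  have : 0 < f x by apply: He; rewrite ger0_norm ?subr_ge0//; lra.
  by rewrite ltNge fx.
have ac' : a < c.
  rewrite lt_neqAle ac andbT; apply/eqP => E; by move: fc0; rewrite -E leNgt fa.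
exists c; first by rewrite ac'.
split => //; apply/eqP; rewrite eq_le fc0/= leNgt; apply/negP => fc1.
have [e e0 He] := @cont_gt0 (fun x => - f x) c (continuousN (fc _ cab)) ltac:(by rewrite oppr_gt0).
pose x := Num.max a (c - e / 2).
have xc : a <= x < c by rewrite /x le_max lexx/= gt_max ac'/=; lra.
have := pos _ xc; have := He x; rewrite oppr_gt0.
have : c - e / 2 <= x by rewrite /x le_max lexx orbT.
have -> : `|x - c| = c - x by rewrite distrC gtr0_norm// subr_gt0; case/andP: xc.
by move=> h1 h2 h3; have := h2 ltac:(lra); rewrite ltNge (ltW h3).
Qed.

Lemma evt_max f a b : a <= b -> (forall x, a <= x <= b -> cont_at f x) ->
  exists2 c : R, a <= c <= b & forall x, a <= x <= b -> f x <= f c.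
Proof.
move=> ab fc; have [c] := EVT_max ab (cont_within fc).
rewrite in_itv/= => cab H; exists c => // x xab; apply: H; by rewrite in_itv.
Qed.

(** Connectedness of a segment, for a property instead of a function. Around the infimum [c] of the
    points that disagree with [a] there are both a disagreeing point and, unless [c = a], an
    agreeing one. *)
Lemma locally_constant (P : R -> Prop) a b : a <= b ->
  (forall x, a <= x <= b -> exists2 e : R, 0 < e &
     forall y, a <= y <= b -> `|y - x| < e -> (P y <-> P x)) ->
  P a <-> P b.
Proof.
move=> ab H.
have [//|nab] := pselect (P a <-> P b).
pose S := [set x | a <= x <= b /\ ~ (P x <-> P a)].
have S0 : S !=set0 by exists b; split; rewrite ?ab ?lexx//; tauto.
have Sa : lbound S a by move=> x [/andP[]].
have hS : has_inf S by split => //; exists a.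
set c := inf S.
have ac : a <= c by apply: lb_le_inf.
have cb : c <= b.
  by apply: (ge_inf (ex_intro _ a Sa)); split => //; rewrite ?ab ?lexx//; tauto.
have [e e0 He] := H c ltac:(by rewrite ac).
have [x [[/andP[ax xb] nx] xc]] : exists x, S x /\ x < c + e.
  by have [x Sx xc] := inf_adherent e0 hS; exists x.
have cx : c <= x by apply: (ge_inf (ex_intro _ a Sa)); split => //; rewrite ax.
have xPc : P x <-> P c.
  by apply: He; rewrite ?ax// ger0_norm ?subr_ge0//; lra.
have cPa : P c <-> P a.
  have [E|nE] := eqVneq c a; first by rewrite E.
  have ac' : a < c by rewrite lt_neqAle eq_sym nE.
  pose z := Num.max a (c - e / 2).
  have zc : z < c by rewrite /z gt_max ac'/=; lra.
  have az : a <= z by rewrite /z le_max lexx.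
  have : P z <-> P a.
    have [//|nz] := pselect (P z <-> P a).
    have : c <= z.
      by apply: (ge_inf (ex_intro _ a Sa)); split => //; rewrite az; lra.
    by rewrite leNgt zc.
  have : P z <-> P c.
    apply: He; first by rewrite az; lra.
    have : c - e / 2 <= z by rewrite /z le_max lexx orbT.
    by rewrite distrC ger0_norm; lra.
  tauto.
tauto.
Qed.

Lemma Dr0_cst f a b : a <= b -> (forall x, a <= x <= b -> Dr f x 0) -> f a = f b.
Proof.
move=> ab fd; apply/eqP; rewrite eq_le; apply/andP; split.
  apply: (@Dr_ndecr f (fun=> 0)) => // x xab; last exact: Dr_continuous (fd _ xab).
  by apply: fd; case/andP: xab => *; rewrite !ltW.
apply: (@Dr_nincr f (fun=> 0)) => // x xab; last exact: Dr_continuous (fd _ xab).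
by apply: fd; case/andP: xab => *; rewrite !ltW.
Qed.

Lemma primitive_right f a : continuous f ->
  exists F, forall x, a < x -> Dr F x (f x).
Proof.
move=> fc; exists (fun x => \int[lebesgue_measure]_(t in [set` `[a, x]]) f t) => x ax.
have xu : x < x + 1 by lra.
have fi : lebesgue_measure.-integrable `[a, x + 1] (EFin \o f).
  apply: continuous_compact_integrable; first exact: segment_compact.
  by apply: cont_within => y _; exact: fc.
have [dF FE] := @continuous_FTC1_closed R f a x (x + 1) xu fi ax (fc x).
by apply: Dr_derive1.
Qed.

(** An integral with fixed lower end is a primitive only to the right of that end. Primitives
    started at [a - n.+1] and normalised at [a] agree where both are defined, hence can be glued. *)
Lemma primitive f a : continuous f -> exists F, F a = 0 /\ forall x, Dr F x (f x).
Proof.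
move=> fc.
have /choice[G HG] : forall n : nat, exists F, forall x, a - n.+1%:R < x -> Dr F x (f x).
  by move=> n; exact: primitive_right.
pose H n x := G n x - G n a.
have HD n x : a - n.+1%:R < x -> Dr (H n) x (f x).
  by move=> /HG h; apply: (Dr_eq (DrB h (Dr_cst _ _))); rewrite subr0.
have an n : a - n.+1%:R < a by rewrite ltrBlDr ltrDl ltr0n.
have Ha n : H n a = 0 by rewrite /H subrr.
have HH m n x : a - m.+1%:R < x -> a - n.+1%:R < x -> H m x = H n x.
  move=> mx nx.
  have D0 y : a - m.+1%:R < y -> a - n.+1%:R < y -> Dr (fun y => H m y - H n y) y 0.
    by move=> my ny; apply: (Dr_eq (DrB (HD _ _ my) (HD _ _ ny))); rewrite subrr.
  apply/eqP; rewrite -subr_eq0; apply/eqP.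
  have <- : H m a - H n a = 0 by rewrite !Ha subrr.
  have [ax|xa] := leP a x.
    symmetry; apply: (@Dr0_cst (fun y => H m y - H n y)) => // y /andP[ay _].
    by apply: D0; apply: lt_le_trans ay; exact: an.
  apply: (@Dr0_cst (fun y => H m y - H n y)); first exact: ltW.
  by move=> y /andP[xy _]; apply: D0; apply: lt_le_trans xy.
pose N x := Num.truncn `|x - a|.
have Nx x : a - (N x).+1%:R < x.
  have := truncnS_gt `|x - a|.
  rewrite -/(N x) => h; have := ler_norm (- (x - a)); rewrite normrN; lra.
exists (fun x => H (N x) x); split; first exact: Ha.
move=> x; apply: (@Dr_near (H (N x))); last exact: HD.
near=> y; apply: HH; last exact: Nx.
by near: y; exact: lt_nbhsr.
Unshelve. all: by end_near. Qed.

Lemma lip_continuous (h : R -> R) (L : R) :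
  (forall x y, `|h x - h y| <= L * `|x - y|) -> continuous h.
Proof.
move=> hL x; have L0 : 0 <= L.
  by have := hL 1 0; rewrite subr0 normr1 mulr1; exact: le_trans.
have L1 : 0 < L + 1 by lra.
apply/cvgrPdist_le => /= e e0; near=> t.
have : `|x - t| <= e / (L + 1).
  by near: t; apply: cvgr_dist_le; [exact: cvg_id|exact: divr_gt0].
rewrite ler_pdivlMr// => h'; have := normr_ge0 (x - t); have := hL x t; lra.
Unshelve. all: by end_near. Qed.

End Real.

(* Keeps the equations and inequalities only: [lra] inspects every hypothesis. *)
Ltac trim := repeat match goal with
  | H : ?T |- _ =>
    lazymatch T with
    | is_true (Order.le _ _) => fail
    | is_true (Order.lt _ _) => fail
    | is_true _ => clear H
    | @eq _ _ _ => fail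
    | _ => lazymatch type of T with Prop => clear H end
    end
  end; repeat match goal with x := _ |- _ => clearbody x end.
Ltac trim_lra := first [solve [trim; lra] | lra].

Ltac pos := first
  [ assumption | apply: ltW; assumption
  | lazymatch goal with
    | |- is_true (Order.lt _ (GRing.mul _ _)) => apply: mulr_gt0; pos
    | |- is_true (Order.le _ (GRing.mul _ _)) => apply: mulr_ge0; pos
    | |- is_true (Order.lt _ (GRing.inv _)) => rewrite invr_gt0; pos
    | |- is_true (Order.le _ (GRing.inv _)) => rewrite invr_ge0; pos
    | |- is_true (Order.lt _ (GRing.exp _ _)) => apply: exprn_gt0; pos
    | |- is_true (Order.le _ (GRing.exp _ 2)) => exact: sqr_ge0
    | |- is_true (Order.le _ (GRing.exp _ _)) => apply: exprn_ge0; pos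
    | |- is_true (Order.lt _ (powR _ _)) => apply: powR_gt0; pos
    | |- is_true (Order.le _ (powR _ _)) => exact: powR_ge0
    | |- is_true (Order.lt _ (expR _)) => exact: expR_gt0
    | |- is_true (Order.le _ (expR _)) => exact: expR_ge0
    | |- is_true (Order.le _ (Num.norm _)) => exact: normr_ge0
    | |- is_true (Order.lt _ (GRing.add _ _)) =>
        first [ apply: addr_gt0; pos | trim_lra ]
    | |- is_true (Order.le _ (GRing.add _ _)) =>
        first [ apply: addr_ge0; pos | trim_lra ]
    | |- is_true (Order.lt _ (GRing.natmul _ _)) => by rewrite ltr0n
    | |- is_true (Order.le _ (GRing.natmul _ _)) => exact: ler0n
    | |- is_true (Order.lt _ (GRing.one)) => exact: ltr01
    | |- is_true (Order.le _ (GRing.one)) => exact: ler01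
    | |- _ => first [by [] | exact: expR_gt0 | exact: expR_ge0 | trim_lra]
    end ].

(** * The radial equation: local theory *)

Section Powers.
Context {R : realType}.
Implicit Types (x y a : R).

Lemma powR_max_continuous a : 0 < a -> continuous (fun x => Num.max x 0 `^ a).
Proof.
move=> a0 x; have [x0|x0|->] := ltgtP x 0.
- apply: (@near_cst_continuous _ _ (0 `^ a)) => /=.
  near=> y; rewrite max_r//; apply: ltW; near: y; exact: lt_nbhsl.
- have : Dr (fun y => y `^ a) x (a * x `^ (a - 1) * 1).
    by apply: (@Dr_powR _ (fun y => y)) => //; exact: Dr_id.
  move=> h; apply: (@Dr_continuous _ _ _ (a * x `^ (a - 1) * 1)).
  apply: Dr_near h; near=> y; rewrite max_l//; apply: ltW; near: y.
  exact: lt_nbhsr.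
- apply/cvgrPdist_lt => e e0; rewrite maxxx powR0 ?gt_eqF//.
  near=> y; rewrite sub0r normrN ger0_norm ?powR_ge0//.
  have -> : e = (e `^ a^-1) `^ a.
    by rewrite -powRrM mulVf ?gt_eqF// powRr1// ltW.
  apply: gt0_ltr_powR => //; rewrite ?nnegrE ?powR_ge0 ?le_max ?lexx ?orbT//.
  rewrite gt_max powR_gt0// andbT; near: y; apply: lt_nbhsl; exact: powR_gt0.
Unshelve. all: by end_near. Qed.

Lemma powR_norm_continuous a : 0 < a -> continuous (fun x => `|x| `^ a).
Proof.
move=> a0; have -> : (fun x : R => `|x| `^ a) = (fun x => Num.max `|x| 0 `^ a).
  by apply/funext => x; rewrite max_l.
move=> x; apply: (@continuous_comp _ _ _ (fun x : R => `|x|) (fun x => Num.max x 0 `^ a)).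
  exact: norm_continuous.
exact: powR_max_continuous.
Qed.

Definition spow (p : R) x := `|x| `^ (p - 1) * x.

Lemma spowN p x : spow p (- x) = - spow p x.
Proof. by rewrite /spow normrN mulrN. Qed.

Lemma norm_spow p x : 1 < p -> `|spow p x| = `|x| `^ p.
Proof.
move=> p1; rewrite normrM ger0_norm ?powR_ge0// mulrC mulr_powRB1//; trim_lra.
Qed.

Lemma spow_ge0 p x : 0 <= spow p x * x.
Proof. by rewrite -mulrA mulr_ge0 ?powR_ge0// -expr2 sqr_ge0. Qed.

Lemma spowE p x : 0 < x -> 1 < p -> spow p x = x `^ p.
Proof. by move=> x0 p1; rewrite /spow gtr0_norm// mulrC mulr_powRB1; trim_lra. Qed.

Lemma spow_mul p x : spow p x * x = `|x| `^ (p - 1) * x ^+ 2.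
Proof. by rewrite /spow expr2 mulrA. Qed.

(** Away from 0 this is the power rule and oddness; at 0 the difference quotient is |y|^(p-1), which
    tends to 0 because p > 1. *)
Lemma Dr_spow p x : 1 < p -> Dr (spow p) x (p * `|x| `^ (p - 1)).
Proof.
move=> p1.
have pos y : 0 < y -> Dr (spow p) y (p * `|y| `^ (p - 1)).
  move=> y0; apply: (@Dr_near _ (fun z => z `^ p)).
    by near=> z; rewrite spowE//; near: z; exact: lt_nbhsr.
  rewrite gtr0_norm//.
  by apply: (Dr_eq (@Dr_powR _ (fun z => z) y 1 p y0 (Dr_id _))); rewrite mulr1.
have [x0|x0|->] := ltgtP x 0; last first.
- rewrite normr0 powR0 ?mulr0; last trim_lra.
  apply/Dr_epsP => e e0.
  have := @powR_norm_continuous (p - 1) ltac:(trim_lra) 0.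
  rewrite /continuous_at normr0 powR0; last trim_lra.
  move=> /cvgrPdist_lt/(_ e e0)[de/= de0 H]; exists de => // y.
  rewrite subr0 => yde; rewrite {2}/spow mulr0 subr0 mul0r subr0 normrM ler_wpM2r//.
  have := H y; rewrite /ball/= !sub0r !normrN => /(_ yde) /ltW.
  by [].
- exact: pos.
- have -> : spow p = (fun y => - spow p (- y)).
    by apply/funext => y; rewrite spowN opprK.
  have xN0 : 0 < - x by rewrite oppr_gt0.
  have h : Dr (fun y => spow p (- y)) x _ := Dr_comp (DrN (Dr_id x)) (pos _ xN0).
  by apply: (Dr_eq (DrN h)); rewrite normrN mulrN1 opprK.
Unshelve. all: by end_near. Qed.

(** The tail of the series C / 2^j from m on is 2 C / 2^m, so the segments [[a m, b m]] are nested
    and the supremum of the left ends lies in all of them. *)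
Lemma geometric_cvg (u : nat -> R) C : (forall m, `|u m.+1 - u m| <= C / 2 ^+ m) ->
  exists l, forall m, `|u m - l| <= 2 * C / 2 ^+ m.
Proof.
move=> H.
have C0 : 0 <= C by have := H 0%N; rewrite expr0 divr1; exact: le_trans.
pose a m := u m - 2 * C / 2 ^+ m; pose b m := u m + 2 * C / 2 ^+ m.
have q m : 0 <= C / 2 ^+ m by rewrite divr_ge0// exprn_ge0.
have half m : 2 * C / 2 ^+ m.+1 = C / 2 ^+ m.
  by rewrite exprS; field; rewrite expf_neq0//; apply/eqP; trim_lra.
have tw m : 2 * C / 2 ^+ m = 2 * (C / 2 ^+ m) by rewrite mulrA.
have aS m : a m <= a m.+1.
  by rewrite /a half tw; have := H m; rewrite ler_norml => /andP[]; trim_lra.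
have bS m : b m.+1 <= b m.
  by rewrite /b half tw; have := H m; rewrite ler_norml => /andP[]; trim_lra.
have aD m k : a m <= a (m + k)%N.
  by elim: k => [|k IH]; rewrite ?addn0// addnS (le_trans IH).
have bD m k : b (m + k)%N <= b m.
  by elim: k => [|k IH]; rewrite ?addn0// addnS (le_trans _ IH).
have ab m k : a m <= b k.
  apply: (le_trans (aD m k)); rewrite addnC; apply: le_trans (bD k m).
  by rewrite addnC /a /b tw; have := q (m + k)%N; trim_lra.
have hs : has_sup (range a).
  by split; [exists (a 0%N); exists 0%N | exists (b 0%N) => _ [m _ <-]].
exists (sup (range a)) => m.
have h1 : a m <= sup (range a) by apply: sup_ubound; [case: hs|exists m].
have h2 : sup (range a) <= b m by apply: ge_sup => [|_ [k _ <-]//]; case: hs.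
by rewrite ler_distl; move: h1 h2; rewrite /a /b => h1 h2; apply/andP; split; trim_lra.
Qed.

Lemma half_lim (x y C : R) : (forall m : nat, x <= y + C / 2 ^+ m) -> x <= y.
Proof.
move=> H; rewrite leNgt; apply/negP => yx.
have C0 : 0 < C by have := H 0%N; rewrite expr0 divr1; trim_lra.
have xy : 0 < x - y by rewrite subr_gt0.
have [m Hm] : exists m : nat, C / (x - y) < m%:R.
  exists (Num.truncn (C / (x - y))).+1; exact: truncnS_gt.
have h2 : (m%:R : R) <= 2 ^+ m by rewrite -natrX ler_nat ltnW// ltn_expl.
have p2 : (0 : R) < 2 ^+ m by rewrite exprn_gt0.
have := H m; apply/negP; rewrite -ltNge -ltrBrDl ltr_pdivrMr//.
by move: Hm; rewrite ltr_pdivrMr// mulrC => /lt_le_trans; apply; rewrite ler_pM2l.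
Qed.

End Powers.

Section Radial.
Context {R : realType} (A : R) (hA : 1 / 2 <= A).
Implicit Types (s x al B : R) (gg f v u k : R -> R).

Let N := 2 * A + 1.
(* [lra] ignores section hypotheses. *)
Ltac lraA := have hA_ := hA; lra.
Let N0 : 0 < N. Proof. rewrite /N; lraA. Qed.

(* Volume weights of the hyperbolic space of dimension [N] in the variable
   [s = cosh r]. *)
Definition Wt s := Num.max (s ^+ 2 - 1) 0 `^ (A + 1 / 2).
Definition om s := Num.max (s ^+ 2 - 1) 0 `^ (A - 1 / 2).

Lemma sq1_gt0 s : 1 < s -> 0 < s ^+ 2 - 1.
Proof. by move=> s1; nra. Qed.

Let cont_max : continuous (fun s : R => s ^+ 2 - 1).
Proof.
move=> s; apply: (@Dr_continuous _ _ _ (2%:R * s ^+ 1 * 1 - 0)).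
exact: (DrB (DrX 2 (Dr_id s)) (Dr_cst _ _)).
Qed.

Lemma Wt_continuous : continuous Wt.
Proof.
move=> s; apply: (@continuous_comp _ _ _ (fun s : R => s ^+ 2 - 1)
  (fun x => Num.max x 0 `^ (A + 1 / 2))); first exact: cont_max.
by apply: powR_max_continuous; lraA.
Qed.

Lemma om_continuous : continuous om.
Proof.
have [A12|A12] := eqVneq A (1 / 2).
  have -> : om = fun=> 1 by apply/funext => s; rewrite /om A12 subrr powRr0.
  exact: cst_continuous.
move=> s; apply: (@continuous_comp _ _ _ (fun s : R => s ^+ 2 - 1)
  (fun x => Num.max x 0 `^ (A - 1 / 2))); first exact: cont_max.
by apply: powR_max_continuous; rewrite subr_gt0 lt_neqAle eq_sym A12.
Qed.

Lemma WtE s : 1 < s -> Wt s = (s ^+ 2 - 1) `^ (A + 1 / 2).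
Proof. by move=> /sq1_gt0 s1; rewrite /Wt max_l// ltW. Qed.

Lemma omE s : 1 < s -> om s = (s ^+ 2 - 1) `^ (A - 1 / 2).
Proof. by move=> /sq1_gt0 s1; rewrite /om max_l// ltW. Qed.

Lemma Wt_gt0 s : 1 < s -> 0 < Wt s.
Proof. by move=> s1; rewrite WtE// powR_gt0// sq1_gt0. Qed.

Lemma om_ge0 s : 0 <= om s. Proof. exact: powR_ge0. Qed.

Lemma om_gt0 s : 1 < s -> 0 < om s.
Proof. by move=> s1; rewrite omE// powR_gt0// sq1_gt0. Qed.

Lemma Wt1 : Wt 1 = 0.
Proof. by rewrite /Wt expr1n subrr maxxx powR0//; apply/eqP; lraA. Qed.

Lemma Wt_om s : 1 < s -> Wt s = om s * (s ^+ 2 - 1).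
Proof.
move=> s1; have h := sq1_gt0 s1; rewrite WtE// omE//.
have -> : A + 1 / 2 = (A - 1 / 2) + 1 by trim_lra.
by rewrite powRD ?powRr1 ?ltW//; apply/implyP => _; rewrite gt_eqF.
Qed.

Lemma Dr_Wt s : 1 < s -> Dr Wt s (N * s * om s).
Proof.
move=> s1; apply: (@Dr_near _ (fun s => (s ^+ 2 - 1) `^ (A + 1 / 2))).
  by near=> t; rewrite WtE//; near: t; exact: lt_nbhsr.
have h : Dr (fun s : R => s ^+ 2 - 1) s (2%:R * s ^+ 1 * 1 - 0).
  exact: (DrB (DrX 2 (Dr_id s)) (Dr_cst _ _)).
apply: (Dr_eq (@Dr_powR _ _ _ _ (A + 1 / 2) _ h)); first exact: sq1_gt0.
rewrite omE//; have -> : A + 1 / 2 - 1 = A - 1 / 2 by trim_lra.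
by rewrite /N expr1; field.
Unshelve. all: by end_near. Qed.

(** Here [k] is the weighted average of [u], the integral of [om * u] divided by [Wt]. Since
    [Wt' = N s om >= N om] on s > 1, averaging gains the factor 1 / N. This estimate drives
    existence, continuous dependence and the velocity bounds. *)
Lemma avg_bound u k B (S : R) : 1 < S -> continuous k ->
  (forall s, 1 < s -> Dr (fun s => Wt s * k s) s (om s * u s)) ->
  (forall s, 1 < s < S -> `|u s| <= B) -> `|k S| <= B / N.
Proof.
move=> S1 kc kd uB.
have mS : 1 < (1 + S) / 2 < S by apply/andP; split; trim_lra.
have B0 : 0 <= B by apply: le_trans (uB _ mS).
have W0 := Wt_gt0 S1.
have : `|Wt S * k S - Wt 1 * k 1| <= B / N * Wt S - B / N * Wt 1.
  apply: (@Dr_dom _ (fun s => Wt s * k s) (fun s => B / N * Wt s)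
    (fun s => om s * u s) (fun s => B / N * (N * s * om s))).
  - exact: ltW.
  - by move=> s /andP[s1 _]; exact: kd.
  - move=> s /andP[s1 _].
    by apply: (Dr_eq (DrM (Dr_cst (B / N) s) (Dr_Wt s1))); rewrite mulr0 addr0.
  - by move=> s _; apply: continuousM; [exact: Wt_continuous|exact: kc].
  - by move=> s _; apply: continuousM; [exact: cst_continuous|exact: Wt_continuous].
  - move=> s /andP[s1 sS].
    have -> : B / N * (N * s * om s) = om s * (s * B) by field; rewrite lt0r_neq0.
    rewrite normrM (ger0_norm (om_ge0 s)) ler_wpM2l ?om_ge0//.
    by apply: (le_trans (uB s _)); [rewrite s1|rewrite ler_peMl// ltW].
rewrite Wt1 mul0r mulr0 !subr0 normrM gtr0_norm// mulrC.
by rewrite ler_pM2r.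
Qed.

(** Inverts the singular divergence operator. The value [u 1 / N] at s = 1 is forced by l'Hospital's
    rule, [om u] against [Wt' = N s om]; the constant continuation to s <= 1 keeps [k] continuous on
    the whole line. *)
Lemma avg_exists u : continuous u -> exists k, [/\ continuous k,
  forall s, s <= 1 -> k s = u 1 / N &
  forall s, 1 < s -> Dr (fun s => Wt s * k s) s (om s * u s)].
Proof.
move=> uc.
have [I [I1 ID]] : exists I, I 1 = 0 /\ forall s, Dr I s (om s * u s).
  by apply: primitive => s; apply: continuousM; [exact: om_continuous|exact: uc].
pose k s := if s <= 1 then u 1 / N else I s / Wt s.
have kI s : 1 < s -> Wt s * k s = I s.
  by move=> s1; rewrite /k leNgt s1/= mulrC divfK// gt_eqF// Wt_gt0.
have kd s : 1 < s -> Dr (fun s => Wt s * k s) s (om s * u s).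
  move=> s1; apply: Dr_near (ID s); near=> t; rewrite kI//; near: t.
  exact: lt_nbhsr.
exists k; split => //; last by move=> s s1; rewrite /k s1.
move=> s; have [s1|s1|->] := ltgtP s 1.
- apply: (@near_cst_continuous _ _ (u 1 / N)).
  near=> t; rewrite /k ifT//; apply: ltW; near: t; exact: lt_nbhsl.
- have h : Dr (fun s => (Wt s)^-1) s _ := DrV (lt0r_neq0 (Wt_gt0 s1)) (Dr_Wt s1).
  have := Dr_continuous (Dr_near _ (DrM (ID s) h)); apply.
  near=> t; rewrite /k leNgt ifN// negbK; near: t; exact: lt_nbhsr.
- apply/cvgrPdist_le => /= e e0.
  have cu : continuous (fun t => u t - t * u 1).
    move=> t; have h := Dr_continuous (DrM (Dr_id t) (Dr_cst (u 1) t)).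
    exact: (continuousB (uc t) h).
  have := cu 1; rewrite /continuous_at mul1r subrr => /cvgrPdist_le/(_ _ (mulr_gt0 N0 e0)).
  move=> [de/= de0 H]; exists de => //= t tde.
  have -> : k 1 = u 1 / N by rewrite /k lexx.
  have [t1|t1] := leP t 1; first by rewrite /k t1 subrr normr0 ltW.
  have W0 := Wt_gt0 t1.
  have : `|(I t - Wt t * (u 1 / N)) - (I 1 - Wt 1 * (u 1 / N))| <= e * Wt t - e * Wt 1.
    apply: (@Dr_dom _ (fun s => I s - Wt s * (u 1 / N)) (fun s => e * Wt s)
      (fun s => om s * (u s - s * u 1)) (fun s => e * (N * s * om s))).
    - exact: ltW.
    - move=> x /andP[x1 _].
      apply: (Dr_eq (DrB (ID x) (DrM (Dr_Wt x1) (Dr_cst (u 1 / N) x)))).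
      by field; rewrite lt0r_neq0.
    - move=> x /andP[x1 _].
      by apply: (Dr_eq (DrM (Dr_cst e x) (Dr_Wt x1))); rewrite mulr0 addr0.
    - move=> x _; apply: continuousB; first exact: Dr_continuous (ID x).
      by apply: continuousM; [exact: Wt_continuous|exact: cst_continuous].
    - by move=> x _; apply: continuousM; [exact: cst_continuous|exact: Wt_continuous].
    - move=> x /andP[x1 xt].
      have -> : e * (N * x * om x) = om x * (x * (N * e)) by ring.
      rewrite normrM (ger0_norm (om_ge0 x)) ler_wpM2l ?om_ge0//.
      have := H x; rewrite /ball/= !sub0r !normrN => /(_ _)/le_trans; apply.
        rewrite ltr0_norm ?subr_lt0// opprB; move: tde; rewrite /ball_/= ltr0_norm ?subr_lt0//; trim_lra.
      by rewrite ler_peMl ?ltW// mulr_gt0.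
  rewrite Wt1 I1 mul0r mulr0 !subr0 => h.
  have -> : u 1 / N - k t = - (I t - Wt t * (u 1 / N)) / Wt t.
    by rewrite /k leNgt t1/=; field; rewrite !gt_eqF.
  by rewrite normrM normrN normfV (gtr0_norm W0) ler_pdivrMr.
Unshelve. all: by end_near. Qed.

(** The equation in divergence form, [(Wt f')' = - om gg(f)]; expanded on s > 1 it reads
    [(s^2 - 1) f'' + N s f' + gg(f) = 0]. At the singular point s = 1 it forces [f' = - gg al / N],
    and the constant velocity below 1 is only a continuous continuation. *)
Definition issol gg al f v := [/\ f 1 = al, forall s, Dr f s (v s), continuous v,
  forall s, s <= 1 -> v s = - gg al / N &
  forall s, 1 < s -> Dr (fun s => Wt s * v s) s (- (om s * gg (f s)))].

Lemma issol_v gg al f v s : issol gg al f v -> 1 < s ->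
  Dr v s (- (N * s * v s + gg (f s)) / (s ^+ 2 - 1)).
Proof.
move=> [_ _ _ _ H] s1; have W0 := Wt_gt0 s1.
apply: (@Dr_near _ (fun s => (Wt s * v s) * (Wt s)^-1)).
  near=> t; rewrite mulrC mulKf// gt_eqF// Wt_gt0//; near: t; exact: lt_nbhsr.
apply: (Dr_eq (DrM (H s s1) (DrV (lt0r_neq0 W0) (Dr_Wt s1)))).
rewrite Wt_om//; field.
by rewrite (lt0r_neq0 (om_gt0 s1)) (lt0r_neq0 (sq1_gt0 s1)).
Unshelve. all: by end_near. Qed.

Lemma expR_lin_bound c x : 0 < c -> 0 <= x -> 2 * c * x <= expR (2 * c * x).
Proof. by move=> c0 x0; apply: le_trans (expR_ge1Dx _); trim_lra. Qed.

Lemma Dr_exp_shift c s : Dr (fun s => expR (c * (s - 1))) s (c * expR (c * (s - 1))).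
Proof.
have h : Dr (fun s => c * (s - 1)) s (c * (1 - 0) + (s - 1) * 0).
  exact: (DrM (Dr_cst _ _) (DrB (Dr_id _) (Dr_cst _ _))).
by apply: (Dr_eq (Dr_comp h (Dr_expR _))); ring.
Qed.

(** Iteration of [f -> al - (integral of the average of gg(f))]. In the norm weighted by
    exp(-2c(s-1)) with c = L / N, [avg_bound] gives the factor c and the integration of the
    exponential the factor 1 / (2c), so the map contracts by 1/2 on the whole half-line at once. *)
Lemma picard gg al (L B : R) : continuous gg -> 0 < L ->
  (forall x y, `|gg x - gg y| <= L * `|x - y|) -> (forall x, `|gg x| <= B) ->
  exists f v, issol gg al f v.
Proof.
move=> gc L0 gL gB.
have B0 : 0 <= B by apply: le_trans (gB 0).
have /choice[T HT] : forall f, exists Tk : (R -> R) * (R -> R), continuous f ->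
    [/\ continuous Tk.2, forall s, s <= 1 -> Tk.2 s = gg (f 1) / N,
     forall s, 1 < s -> Dr (fun s => Wt s * Tk.2 s) s (om s * gg (f s)),
     Tk.1 1 = al & forall s, Dr Tk.1 s (- Tk.2 s)].
  move=> f; have [fc|nfc] := pselect (continuous f); last by exists (f, f).
  have gfc : continuous (fun s => gg (f s)).
    by move=> s; apply: continuous_comp; [exact: fc|exact: gc].
  have [k [kc k1 kD]] := avg_exists gfc.
  have [F [F1 FD]] : exists F, F 1 = 0 /\ forall s, Dr F s (- k s).
    by apply: primitive => s; apply: continuousN; exact: kc.
  exists ((fun s => F s + al), k) => _; split => //=; first by rewrite F1 add0r.
  by move=> s; apply: (Dr_eq (DrD (FD s) (Dr_cst al s))); rewrite addr0.
pose F m := iter m (fun f => (T f).1) (fun=> al).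
have Fc m : continuous (F m).
  elim: m => [|m IH]; first exact: cst_continuous.
  by move=> s; have [_ _ _ _ D] := HT _ IH; exact: Dr_continuous (D s).
have F1 m : F m 1 = al by case: m => [//|m]; have [] := HT _ (Fc m).
have kB f : continuous f -> forall s, `|(T f).2 s| <= B / N.
  move=> fc s; have [kc k1 kD _ _] := HT _ fc.
  have [s1|s1] := leP s 1.
    by rewrite k1// normrM normfV (gtr0_norm N0) ler_pM2r ?invr_gt0.
  by apply: (avg_bound s1 kc kD) => t _; exact: gB.
have kdiff (f h : R -> R) (s D : R) : continuous f -> continuous h -> f 1 = h 1 -> 1 < s ->
    (forall t, 1 < t < s -> `|f t - h t| <= D) -> `|(T f).2 s - (T h).2 s| <= L * D / N.
  move=> fc hc fh s1 fhD.
  have [kc k1 kD _ _] := HT _ fc; have [kc' k1' kD' _ _] := HT _ hc.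
  apply: (@avg_bound (fun t => gg (f t) - gg (h t)) (fun t => (T f).2 t - (T h).2 t) (L * D) s s1).
  - by move=> t; exact: (continuousB (kc t) (kc' t)).
  - move=> t t1; have := DrB (kD t t1) (kD' t t1); rewrite -mulrBr => h1.
    by apply: Dr_near h1; near=> r; rewrite mulrBr.
  - by move=> t tS; apply: (le_trans (gL _ _)); rewrite ler_pM2l//; exact: fhD.
pose c := L / N.
have c0 : 0 < c by rewrite divr_gt0.
(* Chosen so that the first increment, at most [B / N * (s - 1)], is below [K * ex s], from
   [x <= expR x]. *)
pose K := B / N / (2 * c).
have K0 : 0 <= K by rewrite /K; pos.
pose ex s := expR (2 * c * (s - 1)).
have exD s : Dr ex s (2 * c * ex s) by exact: Dr_exp_shift.
have exc : continuous ex by move=> s; exact: Dr_continuous (exD s).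
have ex0 s : 0 < ex s by exact: expR_gt0.
have contr (f h : R -> R) (K' s : R) : continuous f -> continuous h -> f 1 = h 1 -> 1 <= s -> 0 <= K' ->
    (forall t, 1 <= t -> `|f t - h t| <= K' * ex t) ->
    `|(T f).1 s - (T h).1 s| <= K' / 2 * ex s.
  move=> fc hc fh s1 K'0 H.
  have [_ _ _ f1 fD] := HT _ fc; have [_ _ _ h1 hD] := HT _ hc.
  have : `|((T f).1 s - (T h).1 s) - ((T f).1 1 - (T h).1 1)|
      <= K' / 2 * ex s - K' / 2 * ex 1.
    apply: (@Dr_dom _ (fun s => (T f).1 s - (T h).1 s) (fun s => K' / 2 * ex s)
      (fun s => - (T f).2 s - - (T h).2 s) (fun s => K' * c * ex s)) => //.
    - by move=> t _; exact: DrB.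
    - by move=> t _; apply: (Dr_eq (DrM (Dr_cst (K' / 2) t) (exD t))); field.
    - by move=> t _; exact: Dr_continuous (DrB (fD t) (hD t)).
    - by move=> t _; exact: Dr_continuous (DrM (Dr_cst (K' / 2) t) (exD t)).
    - move=> t /andP[t1 ts]; rewrite opprK addrC distrC.
      have -> : K' * c * ex t = L * (K' * ex t) / N by rewrite /c; ring.
      apply: kdiff => // r /andP[r1 rt]; apply: (le_trans (H r (ltW r1))).
      apply: ler_wpM2l => //; rewrite /ex ler_expR ler_pM2l; [trim_lra|pos].
  by rewrite f1 h1 subrr subr0; have := ex0 1; have := mulr_ge0 K'0 (ltW (ex0 1)); nra.
have step0 s : 1 <= s -> `|F 1%N s - F 0%N s| <= K * ex s.
  move=> s1; have [_ _ _ f1 fD] := HT _ (Fc 0%N).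
  have : `|F 1%N s - F 1%N 1| <= B / N * s - B / N * 1.
    apply: (@Dr_dom _ _ (fun s => B / N * s) (fun s => - (T (F 0%N)).2 s) (fun=> B / N)) => //.
    - by move=> t _; apply: (Dr_eq (DrM (Dr_cst _ t) (Dr_id t))); rewrite mulr0 addr0 mulr1.
    - by move=> t _; exact: Fc.
    - by move=> t _; exact: Dr_continuous (DrM (Dr_cst _ t) (Dr_id t)).
    - by move=> t _; rewrite normrN kB//; exact: Fc.
  rewrite F1 /= => /le_trans; apply.
  have -> : B / N * s - B / N * 1 = K * (2 * c * (s - 1)).
    by rewrite /K; field; rewrite (lt0r_neq0 c0) lt0r_neq0.
  by rewrite ler_wpM2l// expR_lin_bound// subr_ge0.
have step m s : 1 <= s -> `|F m.+1 s - F m s| <= K * ex s / 2 ^+ m.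
  elim: m s => [|m IH] s s1; first by rewrite expr0 divr1; exact: step0.
  have -> : K * ex s / 2 ^+ m.+1 = K / 2 ^+ m / 2 * ex s.
    by rewrite exprS; field; rewrite expf_neq0//; apply/eqP; trim_lra.
  apply: (contr (F m.+1) (F m) (K / 2 ^+ m) s (Fc _) (Fc _) _ s1); first by rewrite !F1.
    by pos.
  by move=> t t1; apply: (le_trans (IH t t1)); rewrite mulrAC.
(* To the left of 1 the image of any admissible function is the same affine function, so no limit
   has to be taken there. *)
have low (h : R -> R) s : continuous h -> h 1 = al -> s <= 1 ->
    (T h).1 s = al - (s - 1) * (gg al / N).
  move=> hc h1 s1; have [_ k1 _ f1 fD] := HT _ hc.
  have : (T h).1 s + s * (gg al / N) = (T h).1 1 + 1 * (gg al / N).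
    apply: (@Dr0_cst _ (fun s => (T h).1 s + s * (gg al / N))) => // t /andP[_ t1].
    apply: (Dr_eq (DrD (fD t) (DrM (Dr_id t) (Dr_cst (gg al / N) t)))).
    by rewrite k1// h1; ring.
  by rewrite f1 => ?; rewrite mulrBl; trim_lra.
have /choice[f Hf] : forall s, exists l,
    (1 <= s -> forall m, `|F m s - l| <= 2 * (K * ex s) / 2 ^+ m) /\
    (s <= 1 -> l = al - (s - 1) * (gg al / N)).
  move=> s; have [s1|s1] := leP s 1.
    exists (al - (s - 1) * (gg al / N)); split => // s1' m.
    have -> : s = 1 by apply/eqP; rewrite eq_le s1.
    rewrite F1 subrr mul0r subr0 subrr normr0.
    by have := ex0 s => ?; pos.
  have [l Hl] := geometric_cvg (fun m => step m s (ltW s1)).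
  by exists l; split => // s1'; move: s1; rewrite ltNge s1'.
have f1 : f 1 = al by rewrite (Hf 1).2// subrr mul0r subr0.
have fF s m : `|F m.+1 s - f s| <= 2 * (K * ex s) / 2 ^+ m.+1.
  have [s1|s1] := leP 1 s; first exact: (Hf s).1.
  have FE : F m.+1 s = _ := low (F m) s (Fc m) (F1 m) (ltW s1).
  rewrite FE (Hf s).2 ?(ltW s1)// subrr normr0.
  by have := ex0 s => ?; pos.
have FL m s t : `|F m.+1 s - F m.+1 t| <= B / N * `|s - t|.
  wlog ts : s t / t <= s => [H|].
    by have [|/ltW] := leP t s => h; [exact: H|rewrite distrC (distrC s); exact: H].
  have [_ _ _ _ fD] := HT _ (Fc m).
  rewrite (ger0_norm (_ : 0 <= s - t)) ?subr_ge0// mulrBr.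
  apply: (@Dr_dom _ _ (fun s => B / N * s) (fun s => - (T (F m)).2 s) (fun=> B / N)) => //.
  - by move=> r _; apply: (Dr_eq (DrM (Dr_cst _ r) (Dr_id r))); rewrite mulr0 addr0 mulr1.
  - by move=> r _; exact: (Fc m.+1).
  - by move=> r _; exact: Dr_continuous (DrM (Dr_cst _ r) (Dr_id r)).
  - by move=> r _; rewrite normrN kB//; exact: Fc.
have fL s t : `|f s - f t| <= B / N * `|s - t|.
  apply: (@half_lim _ _ _ (2 * (K * ex s) + 2 * (K * ex t))) => m.
  have -> : f s - f t = - (F m.+1 s - f s) + (F m.+1 s - F m.+1 t) + (F m.+1 t - f t) by ring.
  apply: (le_trans (ler_normD _ _)); apply: (le_trans (lerD (ler_normD _ _) (lexx _))).
  have h1 := fF s m; have h2 := fF t m; have h3 := FL m s t.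
  have h4 : (2 * (K * ex s) + 2 * (K * ex t)) / 2 ^+ m.+1 <=
    (2 * (K * ex s) + 2 * (K * ex t)) / 2 ^+ m.
    apply: ler_wpM2l; first by have := ex0 s; have := ex0 t => ? ?; pos.
    by rewrite lef_pV2 ?posrE ?exprn_gt0// exprS ler_peMl ?exprn_ge0//; trim_lra.
  move: h4; rewrite normrN mulrDl => h4; trim_lra.
have fc : continuous f by exact: lip_continuous fL.
have Tf : (T f).1 = f.
  apply/funext => s; have [s1|s1] := leP s 1; first by rewrite low// (Hf s).2.
  apply/eqP; rewrite -subr_eq0 -normr_le0.
  apply: (@half_lim _ _ _ (2 * (K * ex s))) => m; rewrite add0r.
  have -> : (T f).1 s - f s = ((T f).1 s - F m.+1 s) + (F m.+1 s - f s) by ring.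
  apply: (le_trans (ler_normD _ _)).
  have h1 : `|(T f).1 s - F m.+1 s| <= (2 * K / 2 ^+ m) / 2 * ex s.
    apply: (contr f (F m) (2 * K / 2 ^+ m) s fc (Fc m) _ (ltW s1)).
    - by rewrite F1.
    - by pos.
    move=> t t1; rewrite distrC; apply: (le_trans ((Hf t).1 t1 m)).
    by rewrite le_eqVlt; apply/orP; left; apply/eqP; ring.
  have := fF s m; rewrite exprS.
  have -> : 2 * (K * ex s) / (2 * 2 ^+ m) = K * ex s / 2 ^+ m.
    by field; rewrite expf_neq0//; apply/eqP; trim_lra.
  move: h1; have -> : 2 * K / 2 ^+ m / 2 * ex s = K * ex s / 2 ^+ m.
    by field; rewrite expf_neq0//; apply/eqP; trim_lra.
  have -> : 2 * (K * ex s) / 2 ^+ m = K * ex s / 2 ^+ m + K * ex s / 2 ^+ m.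
    by field; rewrite expf_neq0//; apply/eqP; trim_lra.
  by move=> h1 h2; exact: lerD.
have [kc k1 kD _ fD] := HT _ fc.
exists f, (fun s => - (T f).2 s); split => //.
- by move=> s; have := fD s; rewrite Tf.
- by move=> s; exact: (continuousN (kc s)).
- by move=> s s1; rewrite k1// f1 mulNr.
- move=> s s1; have := DrN (kD s s1); apply: Dr_near; near=> t.
  by rewrite mulrN.
Unshelve. all: by end_near. Qed.

End Radial.

(** * Continuous dependence and simplicity of zeros *)

Section Dependence.
Context {R : realType} (A : R) (hA : 1 / 2 <= A).
Implicit Types (s x al : R) (gg f v u k : R -> R).

Let N := 2 * A + 1.
Let N0 : 0 < N. Proof. have h := hA; rewrite /N; lra. Qed.

(** The exponential weight of [picard] again. If [K] is the maximum of the weighted difference on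
    [1, s], integrating the velocity bound up to the maximum point gives
    [K <= |a1 - a2| + K / 2]. *)
Lemma issol_dep gg a1 a2 f1 v1 f2 v2 (L M : R) :
  issol A gg a1 f1 v1 -> issol A gg a2 f2 v2 -> 0 < L ->
  (forall x y, `|x| <= M -> `|y| <= M -> `|gg x - gg y| <= L * `|x - y|) ->
  (forall s, 1 <= s -> `|f1 s| <= M) -> (forall s, 1 <= s -> `|f2 s| <= M) ->
  forall s, 1 <= s ->
    `|f1 s - f2 s| <= 2 * `|a1 - a2| * expR (2 * (L / N) * (s - 1)) /\
    `|v1 s - v2 s| <= 2 * (L / N) * `|a1 - a2| * expR (2 * (L / N) * (s - 1)).
Proof.
move=> S1 S2 L0 gL f1M f2M s s1.
have [f11 f1D v1c v1l v1D] := S1; have [f21 f2D v2c v2l v2D] := S2.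
have c0 : 0 < L / N by rewrite divr_gt0.
set c := L / N in c0 *.
pose ex s := expR (2 * c * (s - 1)).
have exD t : Dr ex t (2 * c * ex t) by exact: Dr_exp_shift.
have ex0 t : 0 < ex t by exact: expR_gt0.
have exm t r : t <= r -> ex t <= ex r.
  by move=> tr; rewrite /ex ler_expR ler_pM2l; [trim_lra|pos].
have ex1 : ex 1 = 1 by rewrite /ex subrr mulr0 expR0.
have hD t : Dr (fun s => f1 s - f2 s) t (v1 t - v2 t) by exact: DrB.
pose d := `|a1 - a2|.
have vb (T K' : R) : 1 <= T -> (forall t, 1 <= t <= T -> `|f1 t - f2 t| <= K' * ex t) -> 0 <= K' ->
    `|v1 T - v2 T| <= c * K' * ex T.
  move=> T1 H K'0; move: T1; rewrite le_eqVlt => /predU1P[T1|T1].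
    rewrite -T1 v1l// v2l// ex1 mulr1.
    have -> : - gg a1 / N - - gg a2 / N = - (gg a1 - gg a2) / N by ring.
    rewrite normrM normrN normfV (gtr0_norm N0) /c mulrAC ler_pM2r ?invr_gt0//.
    apply: le_trans (gL _ _ _ _) _; rewrite -?f11 -?f21 ?f1M ?f2M//.
    rewrite ler_pM2l//; have := H 1; rewrite ex1 mulr1 -T1 lexx; exact.
  have -> : c * K' * ex T = L * (K' * ex T) / N by rewrite /c; ring.
  apply: (@avg_bound _ _ hA (fun t => - (gg (f1 t) - gg (f2 t))) (fun t => v1 t - v2 t) _ T T1).
  - by move=> t; exact: (continuousB (v1c t) (v2c t)).
  - move=> t t1; have := DrB (v1D t t1) (v2D t t1) => h.
    apply: (Dr_eq (@Dr_near _ _ (fun t => Wt A t * (v1 t - v2 t)) _ _ _ h)); last by ring.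
    by near=> r; rewrite mulrBr.
  - move=> t /andP[t1 tT]; rewrite normrN.
    apply: le_trans (gL _ _ (f1M _ (ltW t1)) (f2M _ (ltW t1))) _.
    rewrite ler_pM2l//; apply: (le_trans (H t _)); first by rewrite !ltW.
    by apply: ler_wpM2l => //; apply: exm; exact: ltW.
have [cs csb csm] : exists2 cs : R, 1 <= cs <= s & forall t, 1 <= t <= s ->
    `|f1 t - f2 t| / ex t <= `|f1 cs - f2 cs| / ex cs.
  apply: (@evt_max _ (fun t => `|f1 t - f2 t| / ex t)) => // t _.
  have h1 : {for t, continuous (fun t => `|f1 t - f2 t|)}.
    apply: (@continuous_comp _ _ _ (fun t => f1 t - f2 t) (fun x => `|x|)).
      exact: Dr_continuous (hD t).
    exact: norm_continuous.
  have h2 := Dr_continuous (DrV (lt0r_neq0 (ex0 t)) (exD t)).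
  exact: (continuousM h1 h2).
set K := `|f1 cs - f2 cs| / ex cs in csm.
have K0 : 0 <= K by have := ex0 cs => ?; rewrite /K; pos.
have Kb t : 1 <= t <= s -> `|f1 t - f2 t| <= K * ex t.
  by move=> /csm; rewrite ler_pdivrMr.
have K2 : K <= 2 * d.
  have /andP[cs1 css] := csb.
  have : `|(f1 cs - f2 cs) - (f1 1 - f2 1)| <= K / 2 * ex cs - K / 2 * ex 1.
    apply: (@Dr_dom _ (fun s => f1 s - f2 s) (fun s => K / 2 * ex s)
      (fun s => v1 s - v2 s) (fun s => c * K * ex s)) => //.
    - by move=> t _; apply: (Dr_eq (DrM (Dr_cst (K / 2) t) (exD t))); field.
    - by move=> t _; exact: Dr_continuous (hD t).
    - by move=> t _; exact: Dr_continuous (DrM (Dr_cst (K / 2) t) (exD t)).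
    - move=> t /andP[t1 tc]; apply: vb => //; first exact: ltW.
      by move=> r /andP[r1 rt]; apply: Kb; rewrite r1/=; trim_lra.
  rewrite f11 f21 ex1 => h.
  have KE : K * ex cs = `|f1 cs - f2 cs| by rewrite /K divfK// lt0r_neq0.
  have h2 : `|f1 cs - f2 cs| <= `|f1 cs - f2 cs - (a1 - a2)| + d.
    rewrite -{1}[f1 cs - f2 cs](subrK (a1 - a2)); exact: ler_normD.
  have h3 : 1 <= ex cs by rewrite -ex1 exm.
  rewrite -/d; nra.
have d0 : 0 <= d by exact: normr_ge0.
have fb t : 1 <= t <= s -> `|f1 t - f2 t| <= 2 * d * ex t.
  by move=> ts; apply: (le_trans (Kb t ts)); apply: ler_wpM2r => //; exact: ltW.
split; first by apply: fb; rewrite s1 lexx.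
have := vb s (2 * d) s1 fb ltac:(pos); rewrite -/d -/(ex s).
by have -> : c * (2 * d) * ex s = 2 * c * d * ex s by ring.
Unshelve. all: by end_near. Qed.

(** Backward uniqueness: on [t, s] with t > 1 the quantity (f^2 + v^2) exp(C(r-1)) is nondecreasing,
    so a double zero at s makes f vanish at t. The constant [C] blows up as t tends to the singular
    point 1, hence the value [al] at 1 is reached by continuity only. *)
Lemma issol_simple_zero gg al f v (L : R) s :
  issol A gg al f v -> 0 < L -> (forall t, 1 <= t -> `|gg (f t)| <= L * `|f t|) ->
  al != 0 -> 1 < s -> f s = 0 -> v s != 0.
Proof.
move=> S L0 gL al0 s1 fs0; apply/eqP => vs0.
have [f1 fD vc _ _] := S.
have f0 t : 1 < t < s -> f t = 0.
  move=> /andP[t1 ts].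
  have t2 := sq1_gt0 t1.
  pose C := 1 + (2 * N * s + L) / (t ^+ 2 - 1).
  pose q r := f r ^+ 2 + v r ^+ 2.
  pose dv r := - (N * r * v r + gg (f r)) / (r ^+ 2 - 1).
  pose dq r := 2 * f r * v r + 2 * v r * dv r.
  have qD r : 1 < r -> Dr q r (dq r).
    move=> r1; have h := issol_v S r1.
    by apply: (Dr_eq (DrD (DrX 2 (fD r)) (DrX 2 h))); rewrite /dq /dv /= !expr1.
  have exD r : Dr (fun r => expR (C * (r - 1))) r (C * expR (C * (r - 1))).
    exact: Dr_exp_shift.
  have : q t * expR (C * (t - 1)) <= q s * expR (C * (s - 1)).
    apply: (@Dr_ndecr _ (fun r => q r * expR (C * (r - 1)))
      (fun r => q r * (C * expR (C * (r - 1))) + expR (C * (r - 1)) * dq r)).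
    - exact: ltW.
    - by move=> r /andP[tr _]; apply: DrM => //; apply: qD; trim_lra.
    - by move=> r /andP[tr _]; apply: Dr_continuous (DrM (qD r _) (exD r)); trim_lra.
    - move=> r /andP[tr rs].
      have -> : q r * (C * expR (C * (r - 1))) + expR (C * (r - 1)) * dq r =
        expR (C * (r - 1)) * (C * q r + dq r) by ring.
      apply: mulr_ge0; first exact: expR_ge0.
      have r1 : 1 < r by trim_lra.
      have r2 := sq1_gt0 r1.
      pose D := (r ^+ 2 - 1)^-1.
      have D0 : 0 < D by rewrite invr_gt0.
      have DT : D <= (t ^+ 2 - 1)^-1 by rewrite lef_pV2 ?posrE//; nra.
      set T := (t ^+ 2 - 1)^-1 in DT.
      have -> : C = 1 + (2 * N * s + L) * T by [].
      have -> : dq r = 2 * f r * v r + 2 * v r * (- (N * r * v r + gg (f r)) * D) by [].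
      have g1 : `|gg (f r)| <= L * `|f r| by apply: gL; exact: ltW.
      have fv : 2 * (`|f r| * `|v r|) <= q r.
        have := sqr_ge0 (`|f r| - `|v r|); rewrite sqrrB !real_normK ?num_real// /q.
        by rewrite -mulr_natl; trim_lra.
      have h1 : - q r <= 2 * f r * v r.
        have := ler_norm (- (f r * v r)); rewrite normrN normrM; trim_lra.
      have h2 : 2 * v r * (N * r * v r + gg (f r)) <= (2 * N * s + L) * q r.
        have e1 : v r * gg (f r) <= L * (`|f r| * `|v r|).
          apply: le_trans (ler_norm _) _; rewrite normrM mulrC mulrA.
          by apply: ler_wpM2r.
        have e2 : N * r * v r ^+ 2 <= N * s * q r.
          rewrite /q; have := sqr_ge0 (f r); have := sqr_ge0 (v r) => a b.
          have : r * v r ^+ 2 <= s * (f r ^+ 2 + v r ^+ 2) by nra.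
          by move=> /(ler_wpM2l (ltW N0)); rewrite !mulrA.
        have -> : 2 * v r * (N * r * v r + gg (f r)) =
          2 * (N * r * v r ^+ 2) + 2 * (v r * gg (f r)) by ring.
        have e3 : L * (2 * (`|f r| * `|v r|)) <= L * q r by rewrite ler_pM2l.
        trim_lra.
      have q0 : 0 <= q r by rewrite /q addr_ge0 ?sqr_ge0.
      have k0 : 0 <= (2 * N * s + L) * q r.
        by have sp : 0 < s := lt_trans ltr01 s1; pos.
      have h3 : 2 * v r * (N * r * v r + gg (f r)) * D <= (2 * N * s + L) * q r * T.
        apply: le_trans (_ : (2 * N * s + L) * q r * D <= _).
          by rewrite ler_pM2r.
        exact: ler_wpM2l.
      trim_lra.
  rewrite {2}/q fs0 vs0 expr0n/= addr0 mul0r pmulr_lle0 ?expR_gt0// => h.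
  apply/eqP; rewrite -sqrf_eq0; apply/eqP.
  have := sqr_ge0 (f t); have := sqr_ge0 (v t); move: h; rewrite /q; trim_lra.
have : f 1 = 0.
  have fc := Dr_continuous (fD 1).
  apply/eqP; apply/negPn/negP => f10.
  have h0 : 0 < `|f 1| by rewrite normr_gt0.
  have hc : {for 1, continuous (fun t => `|f t|)}.
    by apply: continuous_comp; [exact: fc|exact: norm_continuous].
  have [e e0 He] := cont_gt0 hc h0.
  pose t := Num.min (1 + e / 2) ((1 + s) / 2).
  have t1 : 1 < t by rewrite /t lt_min; apply/andP; split; trim_lra.
  have t2 : t <= 1 + e / 2 by rewrite /t ge_min lexx.
  have t3 : t <= (1 + s) / 2 by rewrite /t ge_min lexx orbT.
  have := He t; rewrite f0 ?normr0 ?ltxx; last by rewrite t1; trim_lra.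
  by rewrite gtr0_norm ?subr_gt0// => /(_ ltac:(trim_lra)).
by rewrite f1 => /eqP; rewrite (negPf al0).
Qed.

End Dependence.

(** * Energy, a priori bounds and global existence *)

Section Energy.
Context {R : realType} (A lam p : R) (hA : 1 / 2 <= A) (p1 : 1 < p).
Implicit Types (s x al : R) (gg f v u k : R -> R).

Let N := 2 * A + 1.
Let N0 : 0 < N. Proof. have h := hA; rewrite /N; lra. Qed.

Definition gnl x := lam * x + spow p x.
Definition Gnl x := lam * x ^+ 2 / 2 + spow p x * x / (p + 1).
(** In the hyperbolic distance r, with s = cosh r, the first term is (df/dr)^2 / 2, so this is the
    mechanical energy of a damped oscillator. *)
Definition energy f v s := (s ^+ 2 - 1) * v s ^+ 2 / 2 + Gnl (f s).

Let pp : 0 < p + 1. Proof. have h := p1; lra. Qed.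

Lemma gnlN x : gnl (- x) = - gnl x.
Proof. by rewrite /gnl spowN mulrN opprD. Qed.

Lemma GnlN x : Gnl (- x) = Gnl x.
Proof. by rewrite /Gnl spowN sqrrN mulrNN. Qed.

Lemma Dr_gnl x : Dr gnl x (lam + p * `|x| `^ (p - 1)).
Proof.
apply: (Dr_eq (DrD (DrM (Dr_cst lam x) (Dr_id x)) (Dr_spow x p1))); ring.
Qed.

Lemma gnl_continuous : continuous gnl.
Proof. by move=> x; exact: Dr_continuous (Dr_gnl x). Qed.

Lemma Dr_Gnl x : Dr Gnl x (gnl x).
Proof.
have h := DrD (DrM (DrM (Dr_cst lam x) (DrX 2 (Dr_id x))) (Dr_cst 2^-1 x))
  (DrM (DrM (Dr_spow x p1) (Dr_id x)) (Dr_cst (p + 1)^-1 x)).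
by apply: (Dr_eq h); rewrite /gnl /spow; field; rewrite lt0r_neq0.
Qed.

Lemma gnl_lip (M x y : R) : 0 <= M -> `|x| <= M -> `|y| <= M ->
  `|gnl x - gnl y| <= (`|lam| + p * M `^ (p - 1)) * `|x - y|.
Proof.
move=> M0; wlog yx : x y / y <= x => [H xM yM|xM yM].
  by have [|/ltW] := leP y x => h; [exact: H|rewrite distrC (distrC x); exact: H].
rewrite (ger0_norm (_ : 0 <= x - y)) ?subr_ge0// mulrBr.
pose L := `|lam| + p * M `^ (p - 1); rewrite -/L.
apply: (@Dr_dom _ gnl (fun x => L * x) (fun x => lam + p * `|x| `^ (p - 1)) (fun=> L)) => //.
- by move=> z _; exact: Dr_gnl.
- by move=> z _; apply: (Dr_eq (DrM (Dr_cst L z) (Dr_id z))); rewrite mulr0 addr0 mulr1.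
- by move=> z _; exact: gnl_continuous.
- by move=> z _; exact: Dr_continuous (DrM (Dr_cst L z) (Dr_id z)).
- move=> z /andP[yz zx]; apply: le_trans (ler_normD _ _) _; rewrite lerD2l.
  have p0 : 0 < p by have h := p1; trim_lra.
  rewrite normrM gtr0_norm// ler_pM2l// ger0_norm ?powR_ge0//.
  apply: ge0_ler_powR; rewrite ?nnegrE//; first by have h := p1; trim_lra.
  rewrite ler_norml; move: xM yM; rewrite !ler_norml => /andP[? ?] /andP[? ?].
  by apply/andP; split; trim_lra.
Qed.

Lemma Gnl_ge (B : R) : exists2 M : R, 1 <= M & forall x, M <= `|x| -> x ^+ 2 <= Gnl x /\ B < Gnl x.
Proof.
pose X := (p + 1) * (`|lam| / 2 + 1).
have X0 : 0 < X by have := normr_ge0 lam => ?; rewrite /X; have ? := pp; pos.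
exists (Num.max (X `^ (p - 1)^-1) (Num.max (B + 1) 1)).
  by rewrite !le_max lexx !orbT.
move=> x; rewrite !ge_max => /andP[h1 /andP[h2 h3]].
have q0 : 0 < p - 1 by rewrite subr_gt0.
have Xx : X <= `|x| `^ (p - 1).
  have -> : X = (X `^ (p - 1)^-1) `^ (p - 1).
    by rewrite -powRrM mulVf ?lt0r_neq0// powRr1// ltW.
  by apply: ge0_ler_powR; rewrite ?nnegrE ?powR_ge0// ltW.
have x2 : `|x| <= x ^+ 2 by rewrite -real_normK ?num_real// expr2 ler_peMl.
have : x ^+ 2 <= Gnl x.
  have e : (`|lam| / 2 + 1) * x ^+ 2 <= spow p x * x / (p + 1).
    rewrite ler_pdivlMr// spow_mul mulrAC; apply: ler_wpM2r; first exact: sqr_ge0.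
    by rewrite mulrC.
  have := ler_wpM2r (sqr_ge0 x) (ler_norm (- lam)); rewrite normrN mulNr /Gnl; trim_lra.
by move=> h; split => //; trim_lra.
Qed.

Lemma Gnl_le (x L : R) : `|x| <= L -> Gnl x <= `|lam| * L ^+ 2 / 2 + L `^ (p - 1) * L ^+ 2 / (p + 1).
Proof.
move=> xL; have x2 : x ^+ 2 <= L ^+ 2.
  by rewrite -real_normK ?num_real// ler_sqr ?nnegrE// (le_trans _ xL).
have L0 : 0 <= L by apply: le_trans xL.
rewrite /Gnl lerD//.
  rewrite ler_pM2r; last trim_lra.
  by apply: le_trans (ler_wpM2r (sqr_ge0 x) (ler_norm lam)) _; apply: ler_wpM2l.
rewrite ler_pM2r ?invr_gt0// spow_mul; apply: ler_pM; rewrite ?powR_ge0 ?sqr_ge0//.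
by apply: ge0_ler_powR; rewrite ?nnegrE//; have h := p1; trim_lra.
Qed.

Section Solution.
Variables (gg : R -> R) (al : R) (f v : R -> R).
Hypothesis S : issol A gg al f v.

Lemma Dr_energy s : 1 < s -> gg (f s) = gnl (f s) ->
  Dr (energy f v) s (- (2 * A * s * v s ^+ 2)).
Proof.
move=> s1 gE; have [f1 fD vc _ _] := S; have h := issol_v S s1.
have s2 := sq1_gt0 s1.
have H := DrD (DrM (DrM (DrB (DrX 2 (Dr_id s)) (Dr_cst 1 s)) (DrX 2 h)) (Dr_cst 2^-1 s))
  (Dr_comp (fD s) (Dr_Gnl (f s))).
apply: (Dr_eq H); rewrite gE /= !expr1; field; exact: lt0r_neq0.
Qed.

Lemma energy_continuous : continuous (energy f v).
Proof.
have [f1 fD vc _ _] := S; move=> s.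
have h1 := Dr_continuous (DrB (DrX 2 (Dr_id s)) (Dr_cst (1 : R) s)).
have h2 := Dr_continuous (Dr_comp (fD s) (Dr_Gnl (f s))).
have h3 := continuousM (continuousM h1 (continuousM (vc s) (vc s)))
  (@cst_continuous _ _ (2^-1 : R) s).
have := continuousD h3 h2; apply: cvg_trans.
by apply: near_eq_cvg; near=> t; rewrite /energy /= expr2.
Unshelve. all: by end_near. Qed.

Lemma energy_nincr a b : 1 <= a -> a <= b ->
  (forall s, a <= s <= b -> gg (f s) = gnl (f s)) -> energy f v b <= energy f v a.
Proof.
move=> a1 ab gE.
apply: (@Dr_nincr _ (energy f v) (fun s => - (2 * A * s * v s ^+ 2))) => //.
- move=> s /andP[sa sb]; apply: Dr_energy; first by trim_lra.
  by apply: gE; rewrite !ltW.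
- by move=> s _; exact: energy_continuous.
- move=> s /andP[sa sb]; rewrite oppr_le0; have h := hA.
  have ? : 0 < s by trim_lra.
  have ? : 0 < A by trim_lra.
  by have ? := sqr_ge0 (v s); pos.
Qed.

(** An energy barrier: the energy starts at [Gnl al], does not increase, and would be at least
    [Gnl M] at the first time with |f| = M. Up to that time only values within [-M, M] occur, so
    agreement of [gg] with [gnl] there suffices. *)
Lemma issol_bounded (M : R) : `|al| < M -> Gnl al < Gnl M ->
  (forall x, `|x| <= M -> gg x = gnl x) -> forall s, 1 <= s -> `|f s| < M.
Proof.
move=> alM GM gE s s1; rewrite ltNge; apply/negP => Mf.
have [f1 fD _ _ _] := S.
have [|||c /andP[c1 cs] [fc H]] := @first_hit _ (fun t => M - `|f t|) 1 s s1.
- move=> t _; apply: continuousB; first exact: cst_continuous.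
  by apply: continuous_comp; [exact: Dr_continuous (fD t)|exact: norm_continuous].
- by rewrite f1 subr_gt0.
- by rewrite subr_le0.
have fM : `|f c| = M by move: fc; trim_lra.
have : energy f v c <= energy f v 1.
  apply: energy_nincr => //; first exact: ltW.
  move=> t /andP[t1]; rewrite le_eqVlt => /predU1P[->|tc]; first by rewrite gE ?fM.
  by rewrite gE//; have := H t; rewrite t1 tc subr_gt0 => /(_ isT) /ltW.
rewrite /energy expr1n subrr !mul0r add0r f1 => h.
have : Gnl M <= energy f v c.
  have -> : Gnl M = Gnl (f c).
    by rewrite -fM; have [_|_] := ger0P (f c); rewrite ?GnlN.
  rewrite /energy lerDr; have ? := sq1_gt0 c1; have ? := sqr_ge0 (v c); pos.
rewrite /energy; trim_lra.
Qed.

End Solution.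

(** [picard] wants a bounded Lipschitz nonlinearity, so [gnl] is composed with the truncation [cl]
    at level M; the barrier of [issol_bounded] shows that the truncation is never active. The same M
    serves all data of size at most L, which continuous dependence requires. *)
Lemma issol_exists (L : R) : 0 < L -> exists2 M : R, L < M &
  (forall al f v, `|al| <= L -> issol A gnl al f v -> forall s, 1 <= s -> `|f s| <= M) /\
  (forall al, `|al| <= L -> exists f v, issol A gnl al f v).
Proof.
move=> L0.
pose B := `|lam| * L ^+ 2 / 2 + L `^ (p - 1) * L ^+ 2 / (p + 1).
have [M0 M1 HM] := Gnl_ge B.
pose M := Num.max M0 (L + 1).
have LM : L < M by rewrite /M lt_max; apply/orP; right; trim_lra.
have M_ge : M0 <= M by rewrite /M le_max lexx.
have Mp : 0 < M by trim_lra.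
have GM al : `|al| <= L -> Gnl al < Gnl M.
  move=> /Gnl_le/le_lt_trans; apply; apply: (HM M _).2.
  by rewrite gtr0_norm.
exists M => //; split.
  move=> al f v alL S s s1; apply: ltW; apply: (issol_bounded S) => //.
  - exact: le_lt_trans LM.
  - exact: GM.
move=> al alL.
pose cl x := Num.max (- M) (Num.min x M).
have clM x : `|cl x| <= M.
  by rewrite ler_norml /cl le_max lexx/= ge_max ge_min lexx orbT andbT; trim_lra.
have clE x : `|x| <= M -> cl x = x.
  by rewrite ler_norml => /andP[? ?]; rewrite /cl min_l// max_r.
have cl_lip x y : `|cl x - cl y| <= `|x - y|.
  wlog yx : x y / y <= x => [H|].
    by have [|/ltW] := leP y x => h; [exact: H|rewrite distrC (distrC x); exact: H].
  rewrite (ger0_norm (_ : 0 <= x - y)) ?subr_ge0// ler_norml /cl.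
  have [hx|hx] := ltP x M; have [hy|hy] := ltP y M.
  - by case: (ltP (- M) x) => ?; case: (ltP (- M) y) => ?; apply/andP; split; trim_lra.
  - by exfalso; trim_lra.
  - by case: (ltP (- M) M) => ?; case: (ltP (- M) y) => ?; apply/andP; split; trim_lra.
  - by case: (ltP (- M) M) => ?; apply/andP; split; trim_lra.
pose gg x := gnl (cl x).
have ggL x y : `|gg x - gg y| <= (`|lam| + p * M `^ (p - 1) + 1) * `|x - y|.
  have h0 : 0 <= `|lam| + p * M `^ (p - 1).
    have ? : 0 < p by have h := p1; trim_lra.
    by apply: addr_ge0 => //; pos.
  apply: le_trans (gnl_lip (ltW Mp) (clM x) (clM y)) _.
  apply: le_trans (_ : (`|lam| + p * M `^ (p - 1)) * `|x - y| <= _).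
    exact: ler_wpM2l.
  by apply: ler_wpM2r => //; trim_lra.
pose L' := `|lam| + p * M `^ (p - 1) + 1.
have L'0 : 0 < L'.
  have ? := normr_ge0 lam; have ? := powR_ge0 M (p - 1).
  have ? : 0 < p by have h := p1; trim_lra.
  by rewrite /L'; apply: ltr_wpDl => //; pos.
have [||f [v S]] := @picard _ _ hA gg al L' (L' * M) _ L'0 ggL.
- exact: lip_continuous ggL.
- move=> x; have -> : gg x = gnl (cl x) - gnl 0.
    by rewrite /gnl /spow !mulr0 addr0 subr0.
  have M0' : `|0 : R| <= M by rewrite normr0 ltW.
  apply: le_trans (gnl_lip (ltW Mp) (clM x) M0') _; rewrite subr0.
  by apply: ler_pM => //; rewrite /L'; have ? := powR_ge0 M (p - 1); have h := p1; rewrite ?lerDl//; pos.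
have alM : `|al| < M by exact: le_lt_trans LM.
have gE x : `|x| <= M -> gg x = gnl x by move=> xM; rewrite /gg clE.
have fM := issol_bounded S alM (GM _ alL) gE.
exists f, v; have [f1 fD vc vl vD] := S; split => //.
- by move=> s s1; rewrite vl// gE// ltW.
- by move=> s s1; apply: (Dr_eq (vD s s1)); rewrite gE// ltW// fM// ltW.
Qed.

End Energy.

(** * Large data: many zeros *)

Ltac nz := repeat (apply/andP; split); apply: lt0r_neq0; pos.

Section Large.
Context {R : realType}.
Implicit Types (s x al X : R).

Lemma powRDp (x r s : R) : 0 < x -> x `^ (r + s) = x `^ r * x `^ s.
Proof. by move=> x0; rewrite powRD// (lt0r_neq0 x0) implybT. Qed.

Lemma powR_large d X : 0 < d -> exists2 a0 : R, 1 <= a0 & forall a, a0 <= a -> X <= a `^ d.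
Proof.
move=> d0; exists (Num.max 1 (Num.max X 1 `^ d^-1)); first by rewrite le_max lexx.
move=> a; rewrite ge_max => /andP[a1 aX].
have X1 : 0 < Num.max X 1 by rewrite lt_max ltr01 orbT.
apply: (@le_trans _ _ (Num.max X 1)); first by rewrite le_max lexx.
have -> : Num.max X 1 = (Num.max X 1 `^ d^-1) `^ d.
  by rewrite -powRrM mulVf ?lt0r_neq0// powRr1// ltW.
by apply: ge0_ler_powR; rewrite ?nnegrE ?powR_ge0 ?(ltW d0)//; trim_lra.
Qed.

(** While 0 < f <= K the speed is at least [v0], so the velocity cannot pass through 0 and stays
    negative; f then descends by more than K before time d. *)
Lemma run_to_zero (f v : R -> R) (c d K v0 : R) : c <= d ->
  (forall s, Dr f s (v s)) -> continuous v -> 0 < f c -> f c <= K -> v c < 0 -> 0 < v0 ->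
  (forall s, c <= s <= d -> 0 < f s -> f s <= K -> v0 <= `|v s|) -> K < v0 * (d - c) ->
  exists2 z, c <= z <= d & f z = 0.
Proof.
move=> cd fD vc fc0 fcK vc0 v00 H KB.
have [[z zcd fz]|nz] := pselect (exists2 z, c <= z <= d & f z = 0); first by exists z.
have fcont s : {for s, continuous f} by exact: Dr_continuous (fD s).
have fpos s : c <= s <= d -> 0 < f s.
  move=> /andP[cs sd]; rewrite ltNge; apply/negP => fs; apply: nz.
  have [|z /andP[cz zs] fz] := ivt0 cs (fun x _ => fcont x).
    by rewrite pmulr_rle0.
  by exists z => //; rewrite cz (le_trans zs).
have fle e : c <= e <= d -> (forall s, c < s < e -> v s <= 0) -> f e <= f c.
  move=> /andP[ce ed] vs; apply: (@Dr_nincr _ f v) => // s _; exact: fcont.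
have vneg s : c <= s <= d -> v s < 0.
  move=> /andP[cs sd]; rewrite ltNge; apply/negP => vs.
  have [|||e /andP[ce es] [ve He]] := @first_hit _ (fun t => - v t) c s cs.
  - by move=> x _; exact: (continuousN (vc x)).
  - by rewrite oppr_gt0.
  - by rewrite oppr_le0.
  have ed : c <= e <= d by rewrite (ltW ce) (le_trans es).
  have fe : f e <= K.
    apply: le_trans fcK; apply: fle => // r /andP[cr re].
    by have := He r; rewrite oppr_gt0 (ltW cr) re => /(_ isT)/ltW.
  have := H e ed (fpos _ ed) fe.
  by move: ve => /eqP; rewrite oppr_eq0 => /eqP ->; rewrite normr0 leNgt v00.
have fK s : c <= s <= d -> f s <= K.
  move=> /[dup] sd /andP[cs sd']; apply: le_trans fcK; apply: fle => // r /andP[cr rs].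
  by apply: ltW; apply: vneg; trim_lra.
have : f d + v0 * d <= f c + v0 * c.
  apply: (@Dr_nincr _ (fun s => f s + v0 * s) (fun s => v s + v0)) => //.
  - move=> s _; apply: (Dr_eq (DrD (fD s) (DrM (Dr_cst v0 s) (Dr_id s)))); ring.
  - by move=> s _; exact: Dr_continuous (DrD (fD s) (DrM (Dr_cst v0 s) (Dr_id s))).
  - move=> s /andP[cs sd]; have sd' : c <= s <= d by rewrite !ltW.
    by have := H s sd' (fpos _ sd') (fK _ sd'); rewrite ltr0_norm ?vneg//; trim_lra.
have := fpos d; rewrite cd lexx => /(_ isT); trim_lra.
Qed.

Lemma run_to_zero_left (f v : R -> R) (c d K v0 : R) : d <= c ->
  (forall s, Dr f s (v s)) -> continuous v -> 0 < f c -> f c <= K -> 0 < v c -> 0 < v0 ->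
  (forall s, d <= s <= c -> 0 < f s -> f s <= K -> v0 <= `|v s|) -> K < v0 * (c - d) ->
  exists2 z, d <= z <= c & f z = 0.
Proof.
move=> dc fD vc fc0 fcK vc0 v00 H KB.
have [|||||||||z /andP[z1 z2] fz] := @run_to_zero (fun s => f (- s)) (fun s => - v (- s)) (- c) (- d) K v0.
- by rewrite lerN2.
- by move=> s; apply: (Dr_eq (Dr_comp (DrN (Dr_id s)) (fD (- s)))); rewrite mulrN1.
- move=> s; apply: continuousN; apply: (@continuous_comp _ _ _ (fun s : R => - s) v).
    exact: (Dr_continuous (DrN (Dr_id s))).
  exact: vc.
- by rewrite opprK.
- by rewrite opprK.
- by rewrite opprK oppr_lt0.
- by [].
- move=> s /andP[s1 s2] f0 fK; rewrite normrN; apply: H => //; apply/andP; split; trim_lra.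
- by move: KB; rewrite opprK addrC.
by exists (- z) => //; apply/andP; split; trim_lra.
Qed.

Context (A lam p : R) (hA : 1 / 2 <= A) (p1 : 1 < p).
Let N := 2 * A + 1.
Let N0 : 0 < N. Proof. have h := hA; rewrite /N; lra. Qed.
Let pp : 0 < p + 1. Proof. have h := p1; lra. Qed.
Notation g := (gnl lam p).
Notation G := (Gnl lam p).
Notation E := (energy lam p).

Lemma sq_le_spow (e : R) : 0 < e -> exists2 K : R, 0 <= K & forall x, x ^+ 2 <= e * (spow p x * x) + K.
Proof.
move=> e0; exists ((e^-1 `^ (p - 1)^-1) ^+ 2); first exact: sqr_ge0.
have q0 : 0 < p - 1 by rewrite subr_gt0.
move=> x; have [h|h] := leP (e^-1) (`|x| `^ (p - 1)).
  apply: (@le_trans _ _ (e * (spow p x * x))); last by rewrite lerDl sqr_ge0.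
  rewrite spow_mul mulrA ler_peMl ?sqr_ge0//.
  by rewrite -ler_pdivrMl// mulr1.
have xb : `|x| <= e^-1 `^ (p - 1)^-1.
  rewrite leNgt; apply/negP => hx; move: h; apply/negP; rewrite -leNgt.
  have {1}-> : e^-1 = (e^-1 `^ (p - 1)^-1) `^ (p - 1).
    by rewrite -powRrM mulVf ?lt0r_neq0// powRr1// invr_ge0 ltW.
  by apply: ge0_ler_powR; rewrite ?nnegrE ?powR_ge0 ?(ltW q0)// ltW.
apply: (@le_trans _ _ ((e^-1 `^ (p - 1)^-1) ^+ 2)).
  by rewrite -real_normK ?num_real// ler_sqr ?nnegrE ?powR_ge0.
by rewrite lerDr; apply: mulr_ge0; [exact: ltW|exact: spow_ge0].
Qed.

Lemma Gnl_lower : exists2 C : R, 0 <= C & forall x, x ^+ 2 - C <= G x.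
Proof.
have e0 : 0 < (`|lam| / 2 + 1)^-1 / (p + 1).
  have ? := normr_ge0 lam; have ? := pp.
  by apply: mulr_gt0; rewrite invr_gt0//; trim_lra.
have [K K0 HK] := sq_le_spow e0.
have l0 : 0 < `|lam| / 2 + 1 by have ? := normr_ge0 lam; trim_lra.
exists ((`|lam| / 2 + 1) * K); first by apply: mulr_ge0 => //; exact: ltW.
move=> x; have := HK x; rewrite -(ler_pM2l l0) mulrDr.
have -> : (`|lam| / 2 + 1) * ((`|lam| / 2 + 1)^-1 / (p + 1) * (spow p x * x)) =
  spow p x * x / (p + 1) by field; rewrite !lt0r_neq0.
by have := ler_wpM2r (sqr_ge0 x) (ler_norm (- lam)); rewrite normrN mulNr /Gnl; trim_lra.
Qed.

(** For large [al] the potential [Gnl] increases beyond [al], and the energy never exceeds its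
    initial value [Gnl al], so |f| cannot exceed [al]. The velocity bound is [avg_bound] applied to
    |g| <= 2 al^p. *)
Lemma issol_le_data : exists2 a0 : R, 1 <= a0 & forall al f v, a0 <= al ->
  issol A g al f v -> forall s, 1 <= s ->
  `|f s| <= al /\ `|v s| <= 2 * al `^ p / N.
Proof.
have q0 : 0 < p - 1 by rewrite subr_gt0.
have [a0 a1 Ha] := powR_large (`|lam| + 1) q0.
exists a0 => // al f v aal S.
have al0 : 0 < al by trim_lra.
have gpos x : al <= x -> 0 < g x.
  move=> ax; have x0 : 0 < x by trim_lra.
  rewrite /gnl /spow gtr0_norm// -mulrDl; apply: mulr_gt0 => //.
  have := Ha x ltac:(trim_lra); have := ler_norm (- lam); rewrite normrN; trim_lra.
have Gmono x : al < x -> G al < G x.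
  move=> ax; have [||c /andP[c1 c2] H] := @mvt _ G g al x ax.
  - by move=> y _; exact: Dr_Gnl.
  - by move=> y _; exact: Dr_continuous (Dr_Gnl lam p1 y).
  by rewrite -subr_gt0 H; apply: mulr_gt0; [apply: gpos; exact: ltW|rewrite subr_gt0].
have Gabs x : G `|x| = G x by have [_|_] := ger0P x; rewrite ?GnlN.
have fb s : 1 <= s -> `|f s| <= al.
  move=> s1; rewrite leNgt; apply/negP => /Gmono; apply/negP; rewrite -leNgt Gabs.
  have := energy_nincr hA p1 S (lexx 1) s1 (fun _ _ => erefl).
  rewrite /energy expr1n subrr !mul0r add0r; have [-> _ _ _ _] := S => h.
  apply: le_trans h; rewrite lerDr.
  have ? : 0 <= s ^+ 2 - 1 by nra.
  by have ? := sqr_ge0 (v s); pos.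
have gb x : `|x| <= al -> `|g x| <= 2 * al `^ p.
  move=> xa; apply: le_trans (ler_normD _ _) _; rewrite norm_spow// normrM.
  have h1 : `|x| `^ p <= al `^ p.
    by apply: ge0_ler_powR; rewrite ?nnegrE ?(ltW al0)//; have h := p1; trim_lra.
  have h2 : `|lam| * `|x| <= al `^ p.
    rewrite -(mulr_powRB1 (ltW al0)); last by have h := p1; trim_lra.
    rewrite mulrC; apply: ler_pM => //; have := Ha al aal; trim_lra.
  trim_lra.
move=> s s1; split; first exact: fb.
have [f1 fD vc vl vD] := S.
move: s1; rewrite le_eqVlt => /predU1P[<-|s1].
  rewrite vl// mulNr normrN normrM normfV (gtr0_norm N0) ler_pM2r ?invr_gt0//.
  by apply: gb; rewrite gtr0_norm.
apply: (@avg_bound _ _ hA (fun t => - g (f t)) v _ s s1 vc).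
  by move=> t t1; apply: (Dr_eq (vD t t1)); rewrite mulrN.
by move=> t /andP[t1 _]; rewrite normrN; apply: gb; apply: fb; exact: ltW.
Qed.

(* No positive solution survives on an interval where the equation oscillates
   fast: the angle of [(v, f)] would turn by more than [pi]. *)
Lemma no_large_positive al f v (a b q Q : R) : issol A g al f v -> 2 <= a -> a < b -> b <= 3 ->
  0 < Q -> 8 * (Q ^+ 2 + N ^+ 2) <= q -> 4 * 2 < Q * (b - a) ->
  (forall s, a <= s <= b -> 0 < f s /\ q <= lam + `|f s| `^ (p - 1)) -> False.
Proof.
move=> S a2 ab b3 Q0 qQ Qab H.
have [f1 fD vc vl vD] := S.
have fp s : a <= s <= b -> 0 < f s by move=> /H[].
have fc s : {for s, continuous f} by exact: Dr_continuous (fD s).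
(* The slope v / f is scaled by Q so that the angle [atan w] turns at speed at least Q / 2. In the
   condition on q the factor 8 bounds [s^2 - 1] on [2, 3], and [N^2] pays for the damping term. *)
pose w s := v s * (f s)^-1 / Q.
pose dv s := - (N * s * v s + g (f s)) / (s ^+ 2 - 1).
pose dw s := (v s * (- v s / f s ^+ 2) + (f s)^-1 * dv s) / Q.
have wD s : a <= s <= b -> Dr w s (dw s).
  move=> /[dup] h /andP[sa sb].
  have s1 : 1 < s by trim_lra.
  have h1 := DrV (lt0r_neq0 (fp s h)) (fD s).
  apply: (Dr_eq (DrM (DrM (issol_v S s1) h1) (Dr_cst Q^-1 s))).
  by rewrite /dw mulr0 add0r mulrC.
have wD' s : a <= s <= b -> Dr (fun s => atan (w s)) s ((1 + w s ^+ 2)^-1 * dw s).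
  by move=> h; apply: (Dr_comp (wD s h)); exact: is_derive1_atan.
have dw_le s : a <= s <= b -> (1 + w s ^+ 2)^-1 * dw s <= - (Q / 2).
  move=> /[dup] h /andP[sa sb].
  have [fs fq] := H s h.
  have w0 : 0 < 1 + w s ^+ 2 by have ? := sqr_ge0 (w s); trim_lra.
  rewrite mulrC ler_pdivrMr//.
  pose z := v s / f s.
  have wz : w s = z / Q by [].
  have -> : dw s = (- z ^+ 2 - (N * s * z + (lam + `|f s| `^ (p - 1))) / (s ^+ 2 - 1)) / Q.
    have h2 : 0 < s ^+ 2 - 1 by apply: sq1_gt0; trim_lra.
    by rewrite /dw /dv /z /gnl /spow; field; nz.
  rewrite wz ler_pdivrMr//.
  have -> : - (Q / 2) * (1 + (z / Q) ^+ 2) * Q = - (Q ^+ 2 + z ^+ 2) / 2.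
    by field; exact: lt0r_neq0.
  have s3 : 3 <= s ^+ 2 - 1 by nra.
  have s8 : s ^+ 2 - 1 <= 8 by nra.
  set B := lam + _ in fq *.
  have h1 : q / 8 <= B / (s ^+ 2 - 1).
    have q0 : 0 <= q.
      by apply: le_trans qQ; apply: mulr_ge0 => //; apply: addr_ge0; exact: sqr_ge0.
    have i8 : (8 : R)^-1 <= (s ^+ 2 - 1)^-1 by rewrite lef_pV2 ?posrE//; trim_lra.
    apply: (@le_trans _ _ (q / (s ^+ 2 - 1))); first exact: ler_wpM2l.
    by rewrite ler_pM2r// invr_gt0; trim_lra.
  have h2 : - (N * s * z) / (s ^+ 2 - 1) <= N * `|z|.
    have zz : - z <= `|z| by have := ler_norm (- z); rewrite normrN.
    rewrite ler_pdivrMr; last trim_lra.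
    have e1 : N * s * `|z| <= N * `|z| * (s ^+ 2 - 1).
      have -> : N * s * `|z| = N * `|z| * s by ring.
      by apply: ler_wpM2l; [pos|nra].
    apply: le_trans e1; rewrite -mulrN; apply: ler_wpM2l => //.
    by have ? : 0 < s by [trim_lra]; pos.
  have h3 : N * `|z| <= (N ^+ 2 + z ^+ 2) / 2.
    have := sqr_ge0 (N - `|z|); rewrite sqrrB real_normK ?num_real//; trim_lra.
  have := sqr_ge0 Q; have := sqr_ge0 N; rewrite mulrDl; move: h2; rewrite mulNr; trim_lra.
(* The angle drops by Q (b - a) / 2 > 4, whereas the range of [atan] has length pi < 4. *)
have : atan (w b) + Q / 2 * b <= atan (w a) + Q / 2 * a.
  apply: (@Dr_nincr _ (fun s => atan (w s) + Q / 2 * s)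
    (fun s => (1 + w s ^+ 2)^-1 * dw s + Q / 2)).
  - exact: ltW.
  - move=> s /andP[sa sb]; apply: (Dr_eq (DrD (wD' s _) (DrM (Dr_cst (Q / 2) s) (Dr_id s)))).
      by rewrite !ltW.
    by ring.
  - move=> s h.
    exact: Dr_continuous (DrD (wD' s h) (DrM (Dr_cst (Q / 2) s) (Dr_id s))).
  - move=> s /andP[sa sb]; have sab : a <= s <= b by rewrite !ltW.
    by have := dw_le s sab; trim_lra.
have := atan_gtNpi2 (w b); have := atan_ltpi2 (w a).
have := @pihalf_lt2 R.
trim_lra.
Qed.

(** Cut the interval into thirds. If f stays above K on the middle third, [no_large_positive] is
    contradicted. Otherwise f < K at some c there; large energy makes the velocity large whenever 0
    < f <= K, so f reaches 0 within a neighbouring third, forward or backward according to the sign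
    of v(c). *)
Lemma zero_of_energy (l : R) : 0 < l -> exists E0 : R, forall al f v (a b : R),
  issol A g al f v -> 2 <= a -> b <= 3 -> l <= b - a ->
  (forall s, a <= s <= b -> E0 <= E f v s) -> exists2 z, a <= z <= b & f z = 0.
Proof.
move=> l0.
(* On a third of the interval [Q * (l / 3) = 10] exceeds the required 8, and
   [v0 * (l / 3) = 4 K / 3] exceeds K. The term [4 * v0 ^ 2] in the threshold comes from
   [(s^2 - 1) / 2 <= 4] on [2, 3]. *)
pose Q := 30 / l.
have Q0 : 0 < Q by rewrite /Q; pos.
pose q := 8 * (Q ^+ 2 + N ^+ 2).
have q0 : 0 < p - 1 by rewrite subr_gt0.
have [K K1 HK] := powR_large (q + `|lam|) q0.
pose GK := `|lam| * K ^+ 2 / 2 + K `^ (p - 1) * K ^+ 2 / (p + 1).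
pose v0 := 4 * K / l.
have v00 : 0 < v0 by rewrite /v0; pos.
exists (GK + 4 * v0 ^+ 2) => al f v a b S a2 b3 lab HE.
wlog fa0 : al f v S HE / 0 < f a => [H|].
  have [h|h|h] := ltgtP (f a) 0; last by exists a => //; rewrite lexx; trim_lra.
    have SN : issol A g (- al) (fun s => - f s) (fun s => - v s).
      have [f1 fD vc vl vD] := S; split.
      - by rewrite f1.
      - by move=> s; exact: DrN.
      - by move=> s; exact: (continuousN (vc s)).
      - by move=> s s1; rewrite vl// gnlN opprK mulNr opprK.
      - move=> s s1; apply: (Dr_eq (@Dr_near _ _ _ _ _ _ (DrN (vD s s1)))).
          by near=> t; rewrite mulrN.
        by rewrite gnlN mulrN.
    have [||z zab /eqP] := H _ _ _ SN.
    - by move=> s /HE; rewrite /energy GnlN sqrrN.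
    - by rewrite oppr_gt0.
    - by rewrite oppr_eq0 => /eqP fz; exists z.
  exact: H S HE h.
have [f1 fD vc vl vD] := S.
have fcont s : {for s, continuous f} by exact: Dr_continuous (fD s).
have [//|nz] := pselect (exists2 z, a <= z <= b & f z = 0).
exfalso.
have fpos s : a <= s <= b -> 0 < f s.
  move=> /andP[sa sb]; rewrite ltNge; apply/negP => fs; apply: nz.
  have [|z /andP[cz zs] fz] := ivt0 sa (fun x _ => fcont x).
    by rewrite pmulr_rle0.
  by exists z => //; rewrite cz (le_trans zs).
have vbig s : a <= s <= b -> 0 < f s -> f s <= K -> v0 <= `|v s|.
  move=> /[dup] h /andP[sa sb] fs fK.
  have := HE s h; rewrite /energy.
  have : G (f s) <= GK by apply: Gnl_le => //; rewrite gtr0_norm.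
  have s8 : (s ^+ 2 - 1) * v s ^+ 2 <= 8 * v s ^+ 2.
    by apply: ler_wpM2r; [exact: sqr_ge0|nra].
  move=> h1 h2; have h3 : v0 ^+ 2 <= `|v s| ^+ 2 by rewrite real_normK ?num_real//; trim_lra.
  by move: h3; rewrite ler_sqr ?nnegrE// ltW.
pose c1 := a + l / 3; pose c2 := a + 2 * l / 3.
have [[c /andP[cc1 cc2] fcK]|nc] := pselect (exists2 c, c1 <= c <= c2 & f c < K); last first.
  apply: (@no_large_positive al f v c1 c2 q Q S) => //; rewrite /c1 /c2; try trim_lra.
    have -> : Q * (a + 2 * l / 3 - (a + l / 3)) = 10 by rewrite /Q; field; exact: lt0r_neq0.
    trim_lra.
  move=> s /andP[sa sb]; have sab : a <= s <= b by apply/andP; split; trim_lra.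
  split; first exact: fpos.
  have fK : K <= f s.
    by rewrite leNgt; apply/negP => h; apply: nc; exists s => //; rewrite /c1 /c2 sa.
  rewrite gtr0_norm ?fpos//.
  by have := HK _ fK; have := ler_norm (- lam); rewrite normrN; trim_lra.
have cab : a <= c <= b by rewrite /c1 /c2 in cc1 cc2; apply/andP; split; trim_lra.
have /andP[ac cb] := cab.
have vne : v0 <= `|v c| by apply: vbig => //; [exact: fpos|exact: ltW].
have Kb (x : R) : l / 3 <= x -> K < v0 * x.
  move=> h; apply: (@lt_le_trans _ _ (v0 * (l / 3))); last by rewrite ler_pM2l.
  have -> : v0 * (l / 3) = 4 / 3 * K by rewrite /v0; field; exact: lt0r_neq0.
  trim_lra.
have [vc0|vc0|vc0] := ltgtP (v c) 0.
- apply: nz; have [||z /andP[z1 z2] fz] := @run_to_zero f v c b K v0 cb fD vc (fpos c cab) (ltW fcK) vc0 v00.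
  + by move=> s /andP[s1 s2]; apply: vbig; rewrite s2 andbT; trim_lra.
  + by apply: Kb; rewrite /c1 /c2 in cc1 cc2; trim_lra.
  by exists z => //; rewrite z2 andbT; trim_lra.
- apply: nz; have [||z /andP[z1 z2] fz] := @run_to_zero_left f v c a K v0 ac fD vc (fpos c cab) (ltW fcK) vc0 v00.
  + by move=> s /andP[s1 s2]; apply: vbig; rewrite s1; trim_lra.
  + by apply: Kb; rewrite /c1 /c2 in cc1 cc2; trim_lra.
  by exists z => //; rewrite z1; trim_lra.
- by move: vne; rewrite vc0 normr0 leNgt v00.
Unshelve. all: by end_near. Qed.

End Large.

(** * Pohozaev identity and blow-up of the energy *)

Section Blowup.
Context {R : realType}.
Implicit Types (s x al X : R).
Context (A lam p : R) (hA : 1 / 2 <= A) (p1 : 1 < p).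
Let N := 2 * A + 1.
Let N0 : 0 < N. Proof. have h := hA; rewrite /N; lra. Qed.
Let pp : 0 < p + 1. Proof. have h := p1; lra. Qed.
Notation g := (gnl lam p).
Notation G := (Gnl lam p).
Notation E := (energy lam p).

(* The multiplier of the Pohozaev identity; it exists because the equation is
   subcritical in dimension [N]. *)
Context (m : R) (m_gt : (N - 2) / 2 < m) (m_lt : m < N / (p + 1)).

Let m0 : 0 < m. Proof. have h := hA; have h' := m_gt; rewrite /N in h'; lra. Qed.

(* Clears all hypotheses but those of the section, which [lra] ignores. *)
Ltac cl := repeat match goal with H : ?T |- _ => lazymatch type of T with Prop =>
  tryif first [constr_eq H hA|constr_eq H p1|constr_eq H N0|constr_eq H pp|
    constr_eq H m_gt|constr_eq H m_lt|constr_eq H m0] then fail else clear H end end.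

Definition pohozaev f v s := Wt A s * (E f v s + m * f s * v s).

Lemma Dr_pohozaev al f v s : issol A g al f v -> 1 < s ->
  Dr (pohozaev f v) s (Wt A s * v s ^+ 2 * (m - s * (N - 2) / 2) +
    om A s * ((N * s / (p + 1) - m) * (spow p (f s) * f s) + lam * (N * s / 2 - m) * f s ^+ 2)).
Proof.
move=> S s1; have h := issol_v S s1; have [_ fD _ _ _] := S.
have H := DrM (Dr_Wt A s1) (DrD (Dr_energy p1 S s1 erefl) (DrM (DrM (Dr_cst m s) (fD s)) h)).
apply: (Dr_eq H); rewrite Wt_om// /energy /Gnl /gnl.
have ? := sq1_gt0 s1.
rewrite /N; have ? := pp; field; nz.
Qed.

Definition dpohozaev f v s := Wt A s * v s ^+ 2 * (m - s * (N - 2) / 2) +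
    om A s * ((N * s / (p + 1) - m) * (spow p (f s) * f s) + lam * (N * s / 2 - m) * f s ^+ 2).

(** For s near 1 the lower condition on [m] makes the coefficient of v^2 nonnegative, and the upper
    one makes that of the superlinear term at least [N / (p + 1) - m]. Half of the latter absorbs
    the quadratic term in [lam], at the price of the constant K. *)
Lemma dpohozaev_ge : exists s1 ka K : R, [/\ 1 < s1, s1 <= 2, 0 < ka, 0 <= K &
  forall f v s, 1 < s -> s <= s1 ->
    om A s * (ka * (spow p (f s) * f s) - K) <= dpohozaev f v s].
Proof.
pose ka := N / (p + 1) - m.
have ka0 : 0 < ka by rewrite subr_gt0.
pose e := Num.min 1 ((m - (N - 2) / 2) / N).
have e0 : 0 < e by rewrite /e lt_min ltr01/= divr_gt0// subr_gt0.
have e1 : e <= 1 by rewrite /e ge_min lexx.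
have eN : e * N <= m - (N - 2) / 2.
  by rewrite -ler_pdivlMr// /e ge_min lexx orbT.
have s1b s : 1 < s -> s <= 1 + e -> 0 <= m - s * (N - 2) / 2.
  move=> h1 h2; have h3 : 0 < s - 1 by trim_lra.
  have h4 : (s - 1) * N <= e * N by rewrite ler_pM2r//; trim_lra.
  have : 0 <= e * N by pos.
  trim_lra.
pose C1 := `|lam| * (N + m) + 1.
have C10 : 0 < C1.
  by have ? := normr_ge0 lam; rewrite /C1; apply: ltr_wpDl => //; pos.
have [K K0 HK] : exists2 K : R, 0 <= K & forall x, C1 * x ^+ 2 <= ka / 2 * (spow p x * x) + K.
  have [|K K0 HK] := @sq_le_spow _ p p1 (ka / 2 / C1); first by pos.
  exists (C1 * K); first by pos.
  move=> x; have := HK x; rewrite -(ler_pM2l C10) mulrDr.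
  by have -> : C1 * (ka / 2 / C1 * (spow p x * x)) = ka / 2 * (spow p x * x)
    by field; exact: lt0r_neq0.
exists (1 + e), (ka / 2), K; split => //; [trim_lra|trim_lra|pos|].
move=> f v s h1 h2; rewrite /dpohozaev.
have w1 := Wt_gt0 A h1.
have := s1b s h1 h2 => b1.
have h3 : 0 <= Wt A s * v s ^+ 2 * (m - s * (N - 2) / 2).
  by have ? := sqr_ge0 (v s); pos.
rewrite -[leLHS]add0r; apply: lerD => //; apply: ler_wpM2l; first exact: om_ge0.
have h4 : ka * (spow p (f s) * f s) <= (N * s / (p + 1) - m) * (spow p (f s) * f s).
  apply: ler_wpM2r; first exact: spow_ge0.
  rewrite /ka lerD2r ler_pM2r ?invr_gt0//.
  by rewrite ler_peMr// ltW.
have h5 : - (C1 * f s ^+ 2) <= lam * (N * s / 2 - m) * f s ^+ 2.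
  rewrite -mulNr; apply: ler_wpM2r; first exact: sqr_ge0.
  have : `|lam * (N * s / 2 - m)| <= C1.
    rewrite normrM /C1; apply: (@le_trans _ _ (`|lam| * (N + m))); last trim_lra.
    apply: ler_wpM2l => //; rewrite ler_norml.
    have := m0; have : N * s <= N * 2 by rewrite ler_pM2l//; trim_lra.
    have : 0 <= N * s by pos.
    by cl => *; apply/andP; split; trim_lra.
  by rewrite ler_norml => /andP[].
have := HK (f s); trim_lra.
Qed.

(** The speed is at most 2 al^p / N, so a descent by al / 2 takes a time of at least (N / 4)
    al^(1-p). *)
Lemma issol_near_start : exists2 a0 : R, 1 <= a0 & forall al f v, a0 <= al ->
  issol A g al f v -> forall s, 1 <= s -> s <= 1 + N / 4 * al `^ (1 - p) -> al / 2 <= f s.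
Proof.
have [a0 a01 Ha0] := issol_le_data lam hA p1.
exists a0 => // al f v ala0 S s h1 h2.
have alp : 0 < al by trim_lra.
have bnd := Ha0 al f v ala0 S; have [f1 fD _ _ _] := S.
have : `|f s - f 1| <= 2 * al `^ p / N * s - 2 * al `^ p / N * 1.
  apply: (@Dr_dom _ f (fun s => 2 * al `^ p / N * s) v (fun=> 2 * al `^ p / N)) => //.
  - by move=> x _; apply: (Dr_eq (DrM (Dr_cst _ x) (Dr_id x))); rewrite mulr0 addr0 mulr1.
  - by move=> x _; exact: Dr_continuous (fD x).
  - by move=> x _; exact: Dr_continuous (DrM (Dr_cst _ x) (Dr_id x)).
  - by move=> x /andP[x1 _]; have [] := bnd x (ltW x1).
rewrite f1 ler_norml => /andP[h3 _].
have tE : 2 * al `^ p / N * (N / 4 * al `^ (1 - p)) = al / 2.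
  have E1 : al `^ p * al `^ (1 - p) = al by rewrite -powRDp// addrC subrK powRr1// ltW.
  by rewrite -[in RHS]E1; field; exact: lt0r_neq0.
have k0 : 0 < 2 * al `^ p / N by have ? := powR_gt0 p alp; pos.
have : 2 * al `^ p / N * (s - 1) <= al / 2.
  by rewrite -tE ler_pM2l//; move: h2; cl; trim_lra.
by move: h3; cl; trim_lra.
Qed.

(** On the initial layer of length [tau], of order al^(1-p), the derivative is at least [om] times a
    quantity of order al^(p+1), which produces a value of order al^(p+1) tau^(A + 1/2), that is
    al^dl. Positivity of [dl] is exactly subcriticality of p in dimension N. Between the layer and
    [s1] at most [K / N * Wt A s1] is lost. *)
Lemma pohozaev_large : exists2 s1 : R, 1 < s1 <= 2 & forall T : R, exists2 a0 : R, 1 <= a0 &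
  forall al f v, a0 <= al -> issol A g al f v -> T <= pohozaev f v s1.
Proof.
have [s1 [ka [K [s11 s12 ka0 K0 HK]]]] := dpohozaev_ge.
exists s1; first by rewrite s11.
move=> T.
have h12 : 0 < (1 / 2 : R) `^ (p + 1) by apply: powR_gt0; trim_lra.
have q0 : 0 < p - 1 by rewrite subr_gt0.
have [a0 a01 Ha0] := issol_near_start.
pose dl := p + 1 + (1 - p) * (A + 1 / 2).
have dl0 : 0 < dl.
  have := lt_trans m_gt m_lt; rewrite ltr_pdivlMr//.
  rewrite /dl /N => h; have h' := p1; nra.
pose W1 := Wt A s1.
have W10 : 0 < W1 by exact: Wt_gt0.
pose al1 := (N / 4) `^ (A + 1 / 2) * (ka / 2 * (1 / 2) `^ (p + 1)) / (2 * N).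
have al10 : 0 < al1.
  rewrite /al1; have ? : 0 < (N / 4) `^ (A + 1 / 2) by apply: powR_gt0; pos.
  by pos.
have [aa aa1 Haa] := powR_large ((T + K / N * W1) / al1) dl0.
have [ab ab1 Hab] := powR_large (K / (ka / 2 * (1 / 2) `^ (p + 1))) pp.
have [ac ac1 Hac] := powR_large (N / (4 * (s1 - 1))) q0.
exists (Num.max (Num.max a0 aa) (Num.max ab ac)); first by rewrite !le_max a01.
move=> al f v; rewrite !ge_max => /andP[/andP[ala0 alaa] /andP[alab alac]] S.
have [f1 fD vc vl vD] := S.
have alp : 0 < al by trim_lra.
pose P s := spow p (f s) * f s.
have P0 s : 0 <= P s by exact: spow_ge0.
pose H := pohozaev f v.
have HD s : 1 < s -> Dr H s (dpohozaev f v s) by move=> h; exact: Dr_pohozaev S h.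
have Hc : continuous H.
  move=> s; have h1 := @Wt_continuous _ A hA s.
  have h2 := @energy_continuous _ A lam p p1 _ _ _ _ S s.
  have h3 := continuousM (continuousM (@cst_continuous _ _ m s) (Dr_continuous (fD s))) (vc s).
  exact: (continuousM h1 (continuousD h2 h3)).
have H1 : H 1 = 0 by rewrite /H /pohozaev Wt1// mul0r.
have W1c : continuous (Wt A) by exact: Wt_continuous.
pose tau := N / 4 * al `^ (1 - p).
have tau0 : 0 < tau by have ? := powR_gt0 (1 - p) alp; rewrite /tau; pos.
have tau_e : 1 + tau <= s1.
  have := Hac al alac; rewrite ler_pdivrMr; last by pos.
  have ap : 0 < al `^ (p - 1) by exact: powR_gt0.
  move=> h; rewrite addrC -lerBrDr /tau -opprB powRN ler_pdivrMr//.
  by move: h; cl; trim_lra.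
have fhalf := Ha0 al f v ala0 S.
pose D := ka / 2 * (1 / 2) `^ (p + 1) * al `^ (p + 1).
have D0 : 0 < D by rewrite /D; have ? := powR_gt0 (p + 1) alp; pos.
have pow2D s : 1 <= s -> s <= 1 + tau -> D <= ka * P s - K.
  move=> h1 h2; have h3 := fhalf s h1 h2.
  have fs : 0 < f s by move: h3 alp; cl; trim_lra.
  have h4 : (1 / 2) `^ (p + 1) * al `^ (p + 1) <= P s.
    have -> : (1 / 2) `^ (p + 1) * al `^ (p + 1) = (al / 2) `^ (p + 1).
      by rewrite mulrC -powRM ?(ltW alp)// mul1r.
    rewrite /P spowE// -{2}[f s]powRr1 ?(ltW fs)// -powRDp//.
    by apply: ge0_ler_powR; rewrite ?nnegrE ?(ltW pp) ?(ltW fs)//; move: alp; cl; trim_lra.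
  have h5 : K <= D by rewrite /D mulrC -ler_pdivrMr ?Hab//; pos.
  have := ler_wpM2l (ltW ka0) h4; move: h5; rewrite /D; cl; trim_lra.
have t1 : 1 < 1 + tau by move: tau0; cl; trim_lra.
have Htau : D / (2 * N) * Wt A (1 + tau) <= H (1 + tau).
  have : H 1 - D / (2 * N) * Wt A 1 <= H (1 + tau) - D / (2 * N) * Wt A (1 + tau).
    apply: (@Dr_ndecr _ (fun s => H s - D / (2 * N) * Wt A s)
      (fun s => dpohozaev f v s - D / (2 * N) * (N * s * om A s))).
    - exact: ltW.
    - move=> x /andP[x1 _].
      by apply: (Dr_eq (DrB (HD x x1) (DrM (Dr_cst (D / (2 * N)) x) (Dr_Wt A x1)))); rewrite mulr0 addr0.
    - move=> x _; apply: (continuousB (Hc x)).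
      by apply: continuousM; [exact: cst_continuous|exact: W1c].
    - move=> x /andP[x1 xt]; rewrite subr_ge0.
      have xs : x <= s1 by exact: le_trans (ltW xt) tau_e.
      apply: le_trans (HK f v x x1 xs).
      have -> : D / (2 * N) * (N * x * om A x) = om A x * (D * (x / 2)).
        by field; exact: lt0r_neq0.
      apply: ler_wpM2l; first exact: om_ge0.
      apply: le_trans (pow2D x (ltW x1) (ltW xt)); rewrite ler_piMr ?(ltW D0)//.
      by move: xs s12; cl; trim_lra.
  by rewrite H1 Wt1// mulr0 !subr0 subr_ge0.
have Hs1 : H (1 + tau) - K / N * W1 <= H s1.
  have : H (1 + tau) + K / N * Wt A (1 + tau) <= H s1 + K / N * Wt A s1.
    apply: (@Dr_ndecr _ (fun s => H s + K / N * Wt A s)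
      (fun s => dpohozaev f v s + K / N * (N * s * om A s))) => //.
    - move=> x /andP[x1 _]; have x1' := lt_trans t1 x1.
      by apply: (Dr_eq (DrD (HD x x1') (DrM (Dr_cst (K / N) x) (Dr_Wt A x1')))); rewrite mulr0 addr0.
    - move=> x _; apply: (continuousD (Hc x)).
      by apply: continuousM; [exact: cst_continuous|exact: W1c].
    - move=> x /andP[x1 xs]; have x1' := lt_trans t1 x1.
      have := HK f v x x1' (ltW xs).
      have -> : K / N * (N * x * om A x) = om A x * (K * x) by field; exact: lt0r_neq0.
      have := om_ge0 A x => o0; have := P0 x => px.
      have h1 : 0 <= om A x * (ka * P x) by pos.
      have h2 : om A x * K <= om A x * (K * x).
        by apply: ler_wpM2l => //; rewrite ler_peMr// ltW.
      rewrite -/(P x) mulrBr; move: h1 h2; cl; trim_lra.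
  have : 0 <= K / N * Wt A (1 + tau) by have ? := Wt_gt0 A t1; pos.
  rewrite -/W1; cl; trim_lra.
have Wtau : (N / 4) `^ (A + 1 / 2) * al `^ ((1 - p) * (A + 1 / 2)) <= Wt A (1 + tau).
  rewrite WtE// powRrM -powRM ?powR_ge0//; last by pos.
  have h := hA; apply: ge0_ler_powR; rewrite ?nnegrE.
  - by move: h; cl; trim_lra.
  - exact: ltW.
  - by apply: ltW; exact: sq1_gt0.
  - by rewrite -/tau; move: tau0; cl; nra.
have h1 : al1 * al `^ dl <= H (1 + tau).
  apply: le_trans Htau.
  have -> : al1 * al `^ dl = D / (2 * N) *
      ((N / 4) `^ (A + 1 / 2) * al `^ ((1 - p) * (A + 1 / 2))).
    have -> : al `^ dl = al `^ (p + 1) * al `^ ((1 - p) * (A + 1 / 2)) by rewrite /dl powRDp.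
    rewrite /al1 /D.
    by field; exact: lt0r_neq0.
  by apply: ler_wpM2l => //; pos.
have := Haa al alaa; rewrite ler_pdivrMr// mulrC.
by move: h1 Hs1; rewrite /H; cl; trim_lra.
Qed.

Lemma energy_lower_bounds : exists2 C : R, 0 <= C & forall f v s, 1 < s ->
  [/\ 0 <= E f v s + C, f s ^+ 2 <= E f v s + C &
      v s ^+ 2 <= 2 / (s ^+ 2 - 1) * (E f v s + C)].
Proof.
have [C C0 HC] := Gnl_lower lam p1.
exists C => // f v s s1; have h2 := sq1_gt0 s1; have := HC (f s); have := sqr_ge0 (f s).
have h3 : 0 <= (s ^+ 2 - 1) * v s ^+ 2 by have ? := sqr_ge0 (v s); pos.
rewrite /energy => h4 h5; split; [trim_lra|trim_lra|].
rewrite mulrAC ler_pdivlMr// mulrC; trim_lra.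
Qed.

(* Damping is bounded away from [s = 1], hence the energy decays at most
   exponentially. *)
Lemma energy_slow_decay (s1 C : R) al f v : issol A g al f v -> 1 < s1 -> s1 <= 3 ->
  (forall s, 1 < s -> v s ^+ 2 <= 2 / (s ^+ 2 - 1) * (E f v s + C)) ->
  (forall s, 1 < s -> 0 <= E f v s + C) ->
  forall s, s1 <= s <= 3 ->
  (E f v s1 + C) <= (E f v s + C) * expR (2 * (12 * A / (s1 ^+ 2 - 1))).
Proof.
move=> S s11 s13 HV EC s /andP[ss s3].
have A0 : 0 < A by have h := hA; trim_lra.
pose Q := 12 * A / (s1 ^+ 2 - 1).
have hs1 := sq1_gt0 s11.
have Q0 : 0 < Q by rewrite /Q; pos.
have : (E f v s1 + C) * expR (Q * (s1 - 1)) <= (E f v s + C) * expR (Q * (s - 1)).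
  apply: (@Dr_ndecr _ (fun s => (E f v s + C) * expR (Q * (s - 1)))
    (fun s => (E f v s + C) * (Q * expR (Q * (s - 1))) +
      expR (Q * (s - 1)) * (- (2 * A * s * v s ^+ 2) + 0))) => //.
  - move=> x /andP[x1 _]; have x1' := lt_trans s11 x1.
    exact: (DrM (DrD (Dr_energy p1 S x1' erefl) (Dr_cst C x)) (Dr_exp_shift Q x)).
  - move=> x _; have h1 := @energy_continuous _ A lam p p1 _ _ _ _ S x.
    exact: (continuousM (continuousD h1 (@cst_continuous _ _ C x)) (Dr_continuous (Dr_exp_shift Q x))).
  - move=> x /andP[x1 xs]; have x1' := lt_trans s11 x1.
    have -> : (E f v x + C) * (Q * expR (Q * (x - 1))) +
      expR (Q * (x - 1)) * (- (2 * A * x * v x ^+ 2) + 0) =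
      expR (Q * (x - 1)) * (Q * (E f v x + C) - 2 * A * x * v x ^+ 2) by ring.
    apply: mulr_ge0; first exact: expR_ge0.
    have h2 := HV x x1'; have h1 := EC x x1'.
    have h3 : 2 * A * x * v x ^+ 2 <= 6 * A * v x ^+ 2.
      apply: ler_wpM2r; first exact: sqr_ge0.
      have : A * x <= A * 3 by rewrite ler_pM2l//; trim_lra.
      trim_lra.
    have h4 : v x ^+ 2 <= 2 / (s1 ^+ 2 - 1) * (E f v x + C).
      apply: le_trans h2 _; apply: ler_wpM2r => //; rewrite ler_pM2l//.
      rewrite lef_pV2 ?posrE ?sq1_gt0//; move: x1 s11; cl; nra.
    have -> : Q = 6 * A * (2 / (s1 ^+ 2 - 1)) by rewrite /Q; ring.
    have A6 : 0 <= 6 * A by pos.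
    by have := ler_wpM2l A6 h4; move: h3; rewrite mulrA; cl; trim_lra.
have ex1 : expR (Q * (s - 1)) <= expR (2 * Q).
  rewrite ler_expR mulrC; apply: ler_wpM2r; [exact: ltW|trim_lra].
have ex2 : 1 <= expR (Q * (s1 - 1)).
  have := expR_ge1Dx (Q * (s1 - 1)); have : 0 <= Q * (s1 - 1) by apply: mulr_ge0; trim_lra.
  by cl; trim_lra.
move=> h; apply: (@le_trans _ _ ((E f v s1 + C) * expR (Q * (s1 - 1)))).
  by rewrite ler_peMr// EC.
by apply: le_trans h _; apply: ler_wpM2l => //; apply: EC; exact: lt_le_trans ss.
Qed.

(** At [s1] the product f v is at most f^2 + v^2, hence a multiple of the energy plus a constant, so
    a large Pohozaev quantity means large energy there; [energy_slow_decay] carries it to [2, 3]. *)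
Lemma energy_blowup (E0 : R) : exists2 a0 : R, 1 <= a0 & forall al f v, a0 <= al ->
  issol A g al f v -> forall s, 2 <= s <= 3 -> E0 <= E f v s.
Proof.
have [s1 /andP[s11 s12] HT] := pohozaev_large.
have [C C0 HC] := energy_lower_bounds.
have hs1 := sq1_gt0 s11.
pose c1 := 2 / (s1 ^+ 2 - 1).
have c10 : 0 < c1 by rewrite /c1; pos.
pose ex := expR (2 * (12 * A / (s1 ^+ 2 - 1))).
have ex0 : 0 < ex by exact: expR_gt0.
have W0 := Wt_gt0 A s11.
have mc : 0 < 1 + m * (1 + c1).
  by apply: addr_gt0 => //; apply: mulr_gt0; [exact: m0|exact: addr_gt0].
have [a0 a01 Ha] := HT (Wt A s1 * (1 + m * (1 + c1)) * ((`|E0| + C) * ex)).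
exists a0 => // al f v ala S s /andP[s2 s3].
have [ec0 fb ev] := HC f v s1 s11.
have hm : pohozaev f v s1 <= Wt A s1 * ((1 + m * (1 + c1)) * (E f v s1 + C)).
  rewrite /pohozaev ler_pM2l//.
  have h1 : f s1 * v s1 <= (1 + c1) * (E f v s1 + C).
    have := sqr_ge0 (f s1 - v s1); have := sqr_ge0 (f s1); have := sqr_ge0 (v s1).
    by rewrite -/c1 in ev; move: ev fb; rewrite sqrrB; cl; trim_lra.
  by have := ler_wpM2l (ltW m0) h1; move: C0; cl; trim_lra.
have Es1 : (`|E0| + C) * ex <= E f v s1 + C.
  by have := le_trans (Ha al f v ala S) hm; rewrite -mulrA !ler_pM2l.
have := @energy_slow_decay s1 C al f v S s11 _ _ _ s.
rewrite -/ex => h.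
have : (`|E0| + C) * ex <= (E f v s + C) * ex.
  apply: le_trans Es1 (h _ _ _ _); first by move: s12; cl; trim_lra.
  - by move=> r r1; have [] := HC f v r r1.
  - by move=> r r1; have [] := HC f v r r1.
  - by rewrite s3 andbT; exact: le_trans s12 s2.
by rewrite ler_pM2r//; have := ler_norm E0; cl; trim_lra.
Qed.

End Blowup.

(** Counting by an increasing chain of zeros beyond [a] lets inductions on j move the base point
    from one zero to the next. *)
Fixpoint zeros {R : realType} (j : nat) (f : R -> R) (a : R) : Prop :=
  if j is j'.+1 then exists2 z : R, a < z & f z = 0 /\ zeros j' f z else True.

Section ManyZeros.
Context {R : realType} (A lam p : R) (hA : 1 / 2 <= A) (p1 : 1 < p).
Context (subcrit : (2 * A - 1) / 2 < (2 * A + 1) / (p + 1)).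
Implicit Types (al : R) (f v : R -> R).

(** [2, 3] is divided into 2(j+2) intervals of length l, and [zero_of_energy] is used on every other
    one, so the zeros are distinct. There are at least two of them; at a critical point c between
    the first two the energy is purely potential, which forces |f(c)| >= M. *)
Lemma many_zeros (j : nat) (M : R) : exists2 a0 : R, 1 <= a0 & forall al f v, a0 <= al ->
  issol A (gnl lam p) al f v ->
  zeros j f 1 /\ exists z : R, exists2 c : R, 2 <= z <= 3 & 2 <= c <= 3 /\ (f z = 0 /\ M <= `|f c|).
Proof.
have l0 : 0 < 1 / (2 * j.+2%:R) :> R by apply: divr_gt0 => //; rewrite mulr_gt0// ltr0n.
set l := 1 / _ in l0.
have [E0 HE0] := zero_of_energy lam hA p1 l0.
pose GM := `|lam| * M ^+ 2 / 2 + M `^ (p - 1) * M ^+ 2 / (p + 1).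
pose m := ((2 * A + 1 - 2) / 2 + (2 * A + 1) / (p + 1)) / 2.
have sc := subcrit.
have m1 : (2 * A + 1 - 2) / 2 < m by rewrite /m; trim_lra.
have m2 : m < (2 * A + 1) / (p + 1) by rewrite /m; trim_lra.
have [a0 a01 Ha0] := energy_blowup lam hA p1 m1 m2 (`|E0| + `|GM| + 1).
exists a0 => // al f v ala S.
have HE s : 2 <= s <= 3 -> `|E0| + `|GM| + 1 <= energy lam p f v s by exact: Ha0 S s.
have HE' s : 2 <= s <= 3 -> E0 <= energy lam p f v s.
  by move=> /HE; have := ler_norm E0; have := normr_ge0 GM; trim_lra.
have l1 : l * (2 * j.+2%:R) = 1 by rewrite /l divfK// lt0r_neq0// mulr_gt0// ltr0n.
have Z i : (i < j.+2)%N -> exists2 z, 2 + 2 * l * i%:R <= z <= 2 + 2 * l * i%:R + l & f z = 0.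
  move=> ij.
  have i1 : (i%:R : R) + 1 <= j.+2%:R by rewrite -natr1 -[1]/(1%:R) -?natrD ?addn1 ler_nat.
  have i2 : l * (i%:R + 1) <= l * j.+2%:R by rewrite ler_pM2l.
  have i3 : 0 <= l * i%:R by apply: mulr_ge0; [exact: ltW|exact: ler0n].
  apply: (HE0 al f v _ _ S); [trim_lra|trim_lra|trim_lra|].
  by move=> s /andP[s1 s2]; apply: HE'; apply/andP; split; trim_lra.
have [fD vc] : (forall s, Dr f s (v s)) /\ continuous v by case: S.
split.
  have main k i : (i + k <= j.+2)%N -> forall a, a < 2 + 2 * l * i%:R -> zeros k f a.
    elim: k i => [//|k IH] i ik a ai /=.
    have [|z /andP[z1 z2] fz] := Z i; first by rewrite (leq_trans _ ik)// -addSnnS leq_addr.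
    exists z; first exact: lt_le_trans z1.
    split => //; apply: (IH i.+1); first by rewrite addSnnS.
    have : (i.+1%:R : R) = i%:R + 1 by rewrite -natr1.
    by move=> ->; trim_lra.
  apply: (main j 0%N); first by rewrite add0n !leqW.
  by rewrite mulr0; trim_lra.
have [z0 /andP[z01 z02] fz0] := Z 0%N isT.
have [z1 /andP[z11 z12] fz1] := Z 1%N isT.
rewrite mulr0 in z01 z02; rewrite mulr1 in z11 z12.
have j2 : 2 <= (j.+2%:R : R) by rewrite ler_nat.
have l2 : l * 2 <= l * j.+2%:R by rewrite ler_pM2l.
have z01' : z0 < z1 by trim_lra.
have [|c /andP[c1 c2]] := @mvt _ f v z0 z1 z01' (fun s _ => fD s).
  by move=> s _; exact: Dr_continuous (fD s).
rewrite fz0 fz1 subrr => /esym/eqP; rewrite mulf_eq0 subr_eq0 (gt_eqF z01') orbF => /eqP vc0.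
have c23 : 2 <= c <= 3 by apply/andP; split; trim_lra.
exists z0, c; first by apply/andP; split; trim_lra.
split => //; split => //; rewrite leNgt; apply/negP => h.
have := HE c c23; rewrite /energy vc0 expr0n/= mulr0 mul0r add0r.
have := Gnl_le lam p1 (ltW h); rewrite -/GM.
have := normr_ge0 E0; have := ler_norm GM; trim_lra.
Qed.

End ManyZeros.

(** * Zeros of a continuous family *)

Section Family.
Context {R : realType}.
Implicit Types (a s t d : R).

(** Compactness of [l, S] by continuous induction: the existence of a common radius on [l, x] is a
    locally constant property of x. *)
Lemma uniform_radius (P : R -> R -> Prop) (l S : R) : l <= S ->
  (forall t d d', d' <= d -> P t d -> P t d') ->
  (forall t, l <= t <= S -> exists2 d : R, 0 < d &
     forall t', l <= t' <= S -> `|t' - t| < d -> P t' d) ->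
  exists2 d : R, 0 < d & forall t, l <= t <= S -> P t d.
Proof.
move=> lS mono H.
pose Q x := exists2 d : R, 0 < d & forall t, l <= t <= x -> P t d.
have ext x y d : l <= x <= S -> l <= y <= S -> 0 < d ->
    (forall t', l <= t' <= S -> `|t' - x| < d -> P t' d) -> `|y - x| < d -> Q x -> Q y.
  move=> /andP[lx xS] /andP[ly yS] d0 Hd yx [e e0 He].
  exists (Num.min d e) => [|t /andP[lt ty]]; first by rewrite lt_min d0.
  have [tx|xt] := leP t x.
    by apply: (mono _ e); [rewrite ge_min lexx orbT|apply: He; rewrite lt].
  apply: (mono _ d); first by rewrite ge_min lexx.
  apply: Hd; first by rewrite lt (le_trans ty).
  by apply: le_lt_trans yx; rewrite !ger0_norm ?subr_ge0//; trim_lra.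
suff : Q l <-> Q S.
  case=> h _; apply: h; have [|d d0 Hd] := H l; first by rewrite lexx.
  exists d => // t /andP[lt tl]; have -> : t = l by apply/eqP; rewrite eq_le tl.
  by apply: Hd; rewrite ?lexx ?lS// subrr normr0.
apply: locally_constant => // x xlS; have [d d0 Hd] := H x xlS.
exists d => // y ylS yx; split; last exact: ext yx.
move=> [e e0 He]; exists (Num.min d e) => [|t /andP[lt tx]]; first by rewrite lt_min d0.
have [ty|yt] := leP t y.
  by apply: (mono _ e); [rewrite ge_min lexx orbT|apply: He; rewrite lt].
apply: (mono _ d); first by rewrite ge_min lexx.
move/andP: xlS => [lx xS].
apply: Hd; first by rewrite lt (le_trans tx).
apply: le_lt_trans yx; rewrite distrC (distrC y) !ger0_norm ?subr_ge0//; trim_lra.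
Qed.

Context (beta : R) (F V : R -> R -> R).
Hypothesis HD : forall a, beta <= a -> forall s, Dr (F a) s (V a s).
Hypothesis jcF : forall a s e, beta <= a -> 1 <= s -> 0 < e -> exists2 d : R, 0 < d &
  forall a' s', beta <= a' -> 1 <= s' -> `|a' - a| < d -> `|s' - s| < d ->
    `|F a' s' - F a s| < e.
Hypothesis jcV : forall a s e, beta <= a -> 1 <= s -> 0 < e -> exists2 d : R, 0 < d &
  forall a' s', beta <= a' -> 1 <= s' -> `|a' - a| < d -> `|s' - s| < d ->
    `|V a' s' - V a s| < e.
Hypothesis simple : forall a s, beta <= a -> 1 <= s -> F a s = 0 -> V a s != 0.
Hypothesis start : forall a, beta <= a -> F a 1 != 0.
Hypothesis trap : forall a, beta <= a -> exists S : R, 1 <= S /\ exists2 d : R, 0 < d &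
  forall a' s, beta <= a' -> `|a' - a| < d -> S <= s -> F a' s != 0.

Let Fc a : beta <= a -> forall s, {for s, continuous (F a)}.
Proof. by move=> ba s; exact: Dr_continuous (HD ba s). Qed.

(** A simple zero z is a sign change between z - r and z + r, which survives a small change of the
    parameter; the remaining zeros follow by induction from the displaced zero. For this the base
    point has to vary together with the parameter. *)
Lemma zeros_open j a s0 : beta <= a -> 1 <= s0 -> zeros j (F a) s0 ->
  exists2 d : R, 0 < d & forall a' s0', beta <= a' -> 1 <= s0' -> `|a' - a| < d -> `|s0' - s0| < d ->
    zeros j (F a') s0'.
Proof.
elim: j s0 => [|j IH] s0 ba s01 /=; first by exists 1.
move=> [z s0z [Fz Zz]].
have z1 : 1 <= z by trim_lra.
have [d1 d10 H1] := IH z ba z1 Zz.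
have Vz := simple ba z1 Fz.
have Vz0 : 0 < `|V a z| / 2 by rewrite divr_gt0// normr_gt0.
have [d2 d20 H2] := (Dr_epsP _ _ _).1 (HD ba z) _ Vz0.
pose r := Num.min (Num.min (d1 / 2) (d2 / 2)) ((z - s0) / 3).
have r0 : 0 < r by rewrite /r !lt_min; apply/andP; split; [apply/andP; split|]; trim_lra.
have r1 : r <= d1 / 2 by rewrite /r !ge_min lexx.
have r2 : r <= d2 / 2 by rewrite /r !ge_min lexx orbT.
have r3 : r <= (z - s0) / 3 by rewrite /r !ge_min lexx !orbT.
have Fm : `|F a (z - r) + V a z * r| <= `|V a z| / 2 * r.
  have := H2 (z - r); rewrite Fz subr0.
  have -> : z - r - z = - r by ring.
  rewrite normrN (gtr0_norm r0) mulrN opprK; apply; trim_lra.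
have Fp : `|F a (z + r) - V a z * r| <= `|V a z| / 2 * r.
  have := H2 (z + r); rewrite Fz subr0.
  have -> : z + r - z = r by ring.
  by rewrite (gtr0_norm r0); apply; trim_lra.
pose e := `|V a z| / 4 * r.
have e0 : 0 < e by rewrite /e mulr_gt0// divr_gt0// normr_gt0.
have zm1 : 1 <= z - r by trim_lra.
have zp1 : 1 <= z + r by trim_lra.
have [d3 d30 H3] := jcF ba zm1 e0.
have [d4 d40 H4] := jcF ba zp1 e0.
pose d := Num.min (Num.min d3 d4) (Num.min d1 ((z - s0) / 3)).
exists d => [|a' s0' ba' s01' aa' ss'].
  by rewrite /d !lt_min d30 d40 d10; trim_lra.
have dd3 : d <= d3 by rewrite /d !ge_min lexx.
have dd4 : d <= d4 by rewrite /d !ge_min lexx orbT.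
have dd1 : d <= d1 by rewrite /d !ge_min lexx !orbT.
have ddz : d <= (z - s0) / 3 by rewrite /d !ge_min lexx !orbT.
have Gm : `|F a' (z - r) + V a z * r| < `|V a z| * r.
  have -> : F a' (z - r) + V a z * r =
    (F a' (z - r) - F a (z - r)) + (F a (z - r) + V a z * r) by ring.
  apply: le_lt_trans (ler_normD _ _) _.
  have := H3 a' (z - r) ba' zm1 (lt_le_trans aa' dd3); rewrite subrr normr0 => /(_ d30).
  rewrite /e; move: Fm r0 Vz0; clear; nra.
have Gp : `|F a' (z + r) - V a z * r| < `|V a z| * r.
  have -> : F a' (z + r) - V a z * r =
    (F a' (z + r) - F a (z + r)) + (F a (z + r) - V a z * r) by ring.
  apply: le_lt_trans (ler_normD _ _) _.
  have := H4 a' (z + r) ba' zp1 (lt_le_trans aa' dd4); rewrite subrr normr0 => /(_ d40).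
  rewrite /e; move: Fp r0 Vz0; clear; nra.
have zz : z - r <= z + r by trim_lra.
have [|z' /andP[z1' z2'] Fz'] := @ivt0 _ (F a') (z - r) (z + r) zz (fun x _ => Fc ba' (s := x)).
  have rr : 0 < `|V a z| * r by rewrite mulr_gt0// normr_gt0.
  have [v0|v0] := ltP 0 (V a z).
    move: Gm Gp; rewrite (gtr0_norm v0) !ltr_norml => /andP[_ h1] /andP[h2 _].
    by rewrite nmulr_rle0 ?ltW//; trim_lra.
  move: Gm Gp; rewrite (ler0_norm v0) !ltr_norml => /andP[h1 _] /andP[_ h2].
  by rewrite pmulr_rle0 ?ltW//; trim_lra.
exists z'; first by move: ss'; rewrite ltr_distl => /andP[_]; trim_lra.
split=> //; apply: H1 => //; [trim_lra|exact: lt_le_trans dd1|].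
by rewrite ltr_distl; apply/andP; split; trim_lra.
Qed.

(** [trap] confines the first zero of a chain to [1, S], uniformly for nearby parameters, and by
    [uniform_radius] it is enough to exclude such zeros near each fixed t. Where F(a, t) = 0 with t
    > s0, the induction hypothesis at t applies. *)
Lemma zeros_closed j a s0 : beta <= a -> 1 <= s0 -> ~ zeros j (F a) s0 ->
  exists2 d : R, 0 < d & forall a' s0', beta <= a' -> 1 <= s0' -> `|a' - a| < d -> `|s0' - s0| < d ->
    (F a' s0' = 0 \/ s0' = 1) -> ~ zeros j (F a') s0'.
Proof.
elim: j s0 => [|j IH] s0 ba s01 nz; first by exfalso; apply: nz.
have [S [S1 [d1 d10 H1]]] := trap ba.
have [||d d0 Hd] := @uniform_radius (fun t d => forall a' s0', beta <= a' -> 1 <= s0' ->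
    `|a' - a| < d -> `|s0' - s0| < d -> (F a' s0' = 0 \/ s0' = 1) -> s0' < t -> F a' t = 0 ->
    ~ zeros j (F a') t) 1 S S1.
- move=> t d d' dd H a' s0' ba' s01' h1 h2.
  by apply: H => //; exact: lt_le_trans dd.
- move=> t /andP[t1 tS].
  have [ts0|s0t] := ltP t s0.
    exists ((s0 - t) / 2) => [|t' /andP[t1' tS'] tt' a' s0' ba' s01' h1 h2 _ h3]; first trim_lra.
    by move: tt' h2; rewrite !ltr_distl => /andP[_ ?] /andP[? _]; trim_lra.
  have [Ft|Ft] := eqVneq (F a t) 0; last first.
    have Ft0 : 0 < `|F a t| by rewrite normr_gt0.
    have [d d0 H] := jcF ba t1 Ft0.
    exists d => // t' /andP[t1' tS'] tt' a' s0' ba' s01' h1 h2 _ h3 Ft'.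
    by have := H a' t' ba' t1' h1 tt'; rewrite Ft' sub0r normrN ltxx.
  (* Here the next zero would merge with the base point. If the base point is itself a zero, Rolle's
     theorem gives a zero of the velocity close to t, against simplicity; the base point 1 is
     excluded because t = s0 is a zero and hence exceeds 1. *)
  have [ts0|ts0] := eqVneq t s0.
    have V0 : 0 < `|V a t| by rewrite normr_gt0; exact: simple.
    have [d d0 H] := jcV ba t1 V0.
    have t11 : 1 < t.
      rewrite lt_neqAle t1 andbT; apply/eqP => E; have := start ba.
      by rewrite E Ft eqxx.
    exists (Num.min d (t - 1)) => [|t' /andP[t1' tS'] tt' a' s0' ba' s01' h1 h2 h3 h4 Ft'].
      by rewrite lt_min d0 subr_gt0.
    move: h1 h2 tt'; rewrite !lt_min => /andP[h1 _] /andP[h2 h2'] /andP[tt' _].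
    exfalso; case: h3 => [Fs'|s1'].
      have [|c /andP[c1 c2]] := @mvt _ (F a') (V a') s0' t' h4 (fun x _ => HD ba' x).
        by move=> x _; exact: Fc.
      rewrite Ft' Fs' subrr => /esym/eqP; rewrite mulf_eq0 subr_eq0 (gt_eqF h4) orbF => /eqP Vc.
      have := H a' c ba' _ h1 _; rewrite Vc sub0r normrN ltxx => H'.
      suff : false by [].
      apply: H'; first trim_lra.
      by move: h2 tt'; rewrite -ts0 !ltr_distl => /andP[? ?] /andP[? ?]; apply/andP; split; trim_lra.
    by move: h2'; rewrite s1' -ts0 distrC gtr0_norm ?subr_gt0// ltxx.
  have tgt : s0 < t by rewrite lt_neqAle eq_sym ts0.
  have [|d d0 H] := IH t ba t1; first by move=> h; apply: nz; exists t.
  exists d => // t' /andP[t1' tS'] tt' a' s0' ba' s01' h1 h2 _ h3 Ft'.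
  by apply: H => //; left.
exists (Num.min d d1) => [|a' s0' ba' s01' h1 h2 h3 /= [z sz [Fz Zz]]].
  by rewrite lt_min d0.
move: h1 h2; rewrite !lt_min => /andP[h1 h1'] /andP[h2 _].
have zS : z < S.
  by rewrite ltNge; apply/negP => h; have := H1 a' z ba' h1' h; rewrite Fz eqxx.
apply: (Hd z _ a' s0' ba' s01' h1 h2 h3 sz Fz Zz).
by rewrite (ltW zS) andbT; trim_lra.
Qed.

(** Zeros lie below S by [trap], and simplicity with compactness gives a uniform gap d between
    consecutive ones, so the number is at most about (S - 1) / d. *)
Lemma zeros_finite : exists m, ~ zeros m (F beta) 1.
Proof.
have bb : beta <= beta by [].
have [S [S1 [d1 d10 H1]]] := trap bb.
have zS z : F beta z = 0 -> z < S.
  move=> Fz; rewrite ltNge; apply/negP => h; have := H1 beta z bb; rewrite subrr normr0.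
  by move=> /(_ d10 h); rewrite Fz eqxx.
have [||d d0 Hd] := @uniform_radius (fun t d => F beta t = 0 -> forall z, t < z < t + d ->
    F beta z != 0) 1 S S1.
- move=> t d d' dd H Ft z /andP[z1 z2]; apply: H => //; rewrite z1/=; trim_lra.
- move=> t /andP[t1 tS].
  have [Ft|Ft] := eqVneq (F beta t) 0; last first.
    have Ft0 : 0 < `|F beta t| by rewrite normr_gt0.
    have [d d0 H] := jcF bb t1 Ft0.
    exists d => // t' /andP[t1' tS'] tt' Ft'.
    by have := H beta t' bb t1'; rewrite subrr normr0 Ft' sub0r normrN ltxx => /(_ d0 tt').
  have V0 : 0 < `|V beta t| by rewrite normr_gt0; exact: simple.
  have [d d0 H] := jcV bb t1 V0.
  exists (d / 2) => [|t' /andP[t1' tS'] tt' Ft' z /andP[z1 z2]]; first trim_lra.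
  apply/eqP => Fz.
  have [|c /andP[c1 c2]] := @mvt _ (F beta) (V beta) t' z z1 (fun x _ => HD bb x).
    by move=> x _; exact: Fc.
  rewrite Ft' Fz subrr => /esym/eqP; rewrite mulf_eq0 subr_eq0 (gt_eqF z1) orbF => /eqP Vc.
  have := H beta c bb _ _ _; rewrite subrr normr0 Vc sub0r normrN ltxx => H'.
  suff : false by [].
  apply: H' => //; first trim_lra.
  by move: tt'; rewrite !ltr_distl => /andP[? ?]; apply/andP; split; trim_lra.
have count j : forall t, 1 <= t -> F beta t = 0 -> zeros j (F beta) t -> t + j%:R * d <= S.
  elim: j => [|j IH] t t1 Ft /=; first by rewrite mul0r addr0 => _; apply: ltW; exact: zS.
  move=> [z tz [Fz Zz]].
  have := IH z ltac:(trim_lra) Fz Zz.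
  have zd : t + d <= z.
    rewrite leNgt; apply/negP => h.
    have tS : 1 <= t <= S by rewrite t1 ltW// zS.
    by have := Hd t tS Ft z; rewrite tz h Fz eqxx => /(_ isT).
  rewrite -natr1 mulrDl mul1r; trim_lra.
exists (Num.truncn ((S - 1) / d)).+2 => /= [[z z1 [Fz Zz]]].
have := count (Num.truncn ((S - 1) / d)).+1 z (ltW z1) Fz Zz.
have := truncnS_gt ((S - 1) / d); rewrite ltr_pdivrMr//; trim_lra.
Qed.

(** Having [m] zeros is an open and closed condition on the parameter, so the bound found at [beta]
    propagates to the whole half-line. *)
Lemma zeros_bounded : exists m, forall a, beta <= a -> ~ zeros m (F a) 1.
Proof.
have [m Hm] := zeros_finite; exists m => a ba Za; apply: Hm.
apply: (locally_constant (P := fun a => zeros m (F a) 1) ba _).2 Za => x /andP[bx xa].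
have [Zx|nZx] := pselect (zeros m (F x) 1).
  have [d d0 H] := zeros_open bx (lexx 1) Zx.
  exists d => // y /andP[yb _] yx; split=> // _.
  by apply: H; rewrite // subrr normr0.
have [d d0 H] := zeros_closed bx (lexx 1) nZx.
exists d => // y /andP[yb _] yx; split=> // Zy.
by exfalso; apply: (H y 1 yb (lexx 1) yx _ _ Zy); [rewrite subrr normr0|right].
Qed.

End Family.

(** * Behaviour at infinity *)

Section Lyapunov.
Context {R : realType} (A nu p th : R).
Hypotheses (hA : 1 / 2 <= A) (p1 : 1 < p) (th0 : 0 < th) (thA : th < A).
Implicit Types (s x al : R) (f v : R -> R).

Let lam := A ^+ 2 - nu ^+ 2.
Let N := 2 * A + 1.
Notation g := (gnl lam p).

(* [lh] is the value of [lam] seen by [Y = s^th f]; the functional is the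
   energy of [Y], corrected by [Y^2 / s^2] to make it monotone. *)
Definition lh := (A - th) ^+ 2 - nu ^+ 2.
Definition qth f v s := v s + th * f s / s.
Definition lyap0 f v s := (s ^+ 2 - 1) * qth f v s ^+ 2 / 2 + (lh / 2 + s ^- 2) * f s ^+ 2
  + spow p (f s) * f s / (p + 1).
Definition lyap f v s := s `^ (2 * th) * lyap0 f v s.
Definition dlyap f v s := s `^ (2 * th) * (- (2 * A * s - 2 * th * (s - s^-1)) * qth f v s ^+ 2
  + (th * (th + 1) + 2) * s ^- 2 * f s * qth f v s - 2 * s ^- 3 * f s ^+ 2
  - th * (p - 1) / (p + 1) * s^-1 * (spow p (f s) * f s)).

Lemma Dr_powRs (a s : R) : 0 < s -> Dr (fun s => s `^ a) s (a * s `^ a / s).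
Proof.
move=> s0; apply: (Dr_eq (@Dr_powR _ (fun s => s) s 1 a s0 (Dr_id s))).
by rewrite mulr1 powRDp// powRN powRr1 ?mulrA// ltW.
Qed.

Lemma Dr_lyap al f v s : issol A g al f v -> 1 < s -> Dr (lyap f v) s (dlyap f v s).
Proof.
move=> S s1; have [f1 fD _ _ _] := S.
have s0 : 0 < s by trim_lra.
have s2 := sq1_gt0 s1.
have sX : s ^+ 2 != 0 by rewrite lt0r_neq0// exprn_gt0.
have pp : 0 < p + 1 by have h := p1; trim_lra.
have Dq : Dr (qth f v) s _ :=
  DrD (issol_v S s1) (DrM (DrM (Dr_cst th s) (fD s)) (DrV (lt0r_neq0 s0) (Dr_id s))).
have D2 : Dr (fun s : R => (s ^+ 2)^-1) s _ := @DrV _ (fun s => s ^+ 2) s _ sX (DrX 2 (Dr_id s)).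
have DP := DrM (DrM (Dr_spow (f s) p1) (Dr_id (f s))) (Dr_cst (p + 1)^-1 (f s)).
have H := DrM (Dr_powRs (2 * th) s0) (DrD (DrD
  (DrM (DrM (DrB (DrX 2 (Dr_id s)) (Dr_cst 1 s)) (DrX 2 Dq)) (Dr_cst 2^-1 s))
  (DrM (DrD (Dr_cst (lh / 2) s) D2) (DrX 2 (fD s)))) (Dr_comp (fD s) DP)).
apply: (Dr_eq H); rewrite /dlyap /qth /lh /gnl /lam /spow /=.
set P := `|f s| `^ (p - 1); set X := s `^ (2 * th).
by field; nz.
Qed.

Lemma lyap_continuous al f v : issol A g al f v -> forall s, 1 < s -> {for s, continuous (lyap f v)}.
Proof. by move=> S s s1; exact: Dr_continuous (Dr_lyap S s1). Qed.

Let a0 := A - th.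
Let a00 : 0 < a0. Proof. by rewrite /a0 subr_gt0. Qed.
Let ka := th * (p - 1) / (p + 1).
Let ka0 : 0 < ka.
Proof. by have h := p1; have h' := th0; rewrite /ka; pos. Qed.

Local Ltac cl := repeat match goal with H : ?T |- _ => lazymatch type of T with Prop =>
  tryif first [constr_eq H hA|constr_eq H p1|constr_eq H th0|constr_eq H thA|constr_eq H a00|constr_eq H ka0] then fail else clear H end end.

(** The cross term in f q is split by Young's inequality for s large. Its f^2 part, of order s^(-3),
    is paid by the term - 2 s^(-3) f^2, which the correction s^(-2) f^2 in [lyap0] was added to
    produce. *)
Lemma dlyap_le : exists2 s0 : R, 2 <= s0 & forall f v s, s0 <= s ->
  dlyap f v s <= - (s `^ (2 * th) * (a0 * s * qth f v s ^+ 2 + ka * s^-1 * (spow p (f s) * f s))).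
Proof.
pose c := th * (th + 1) + 2.
have c0 : 0 < c by have h := th0; rewrite /c; pos.
exists (2 + c ^+ 2 / (4 * a0)) => [|f v s hs].
  by rewrite lerDl; have h := a00; pos.
have h0 : 0 <= c ^+ 2 / (4 * a0) by have h := a00; pos.
have s2 : 2 <= s by move: hs h0; cl; lra.
have s0 : 0 < s by trim_lra.
have sc : c ^+ 2 <= 4 * a0 * s ^+ 2.
  have h : c ^+ 2 / (4 * a0) <= s ^+ 2 by move: hs h0 s2; cl; nra.
  have d0 : 0 < 4 * a0 by rewrite pmulr_rgt0.
  by move: h; rewrite ler_pdivrMr// [X in _ <= X]mulrC.
rewrite -[leRHS]mulrN /dlyap ler_pM2l ?powR_gt0// -/c -/ka.
set q := qth f v s; set P := spow p (f s) * f s; set F := f s.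
have i0 : 0 < s^-1 by rewrite invr_gt0.
have e1 : 0 <= 2 * th * s^-1 * q ^+ 2 by have h := th0; have ? := sqr_ge0 q; pos.
have e2 : c * s ^- 2 * F * q <= a0 * s * q ^+ 2 + s ^- 3 * F ^+ 2.
  have := sqr_ge0 (c * s ^- 2 * F - 2 * a0 * s * q).
  have -> : (c * s ^- 2 * F - 2 * a0 * s * q) ^+ 2 =
    c ^+ 2 * (s ^- 4 * F ^+ 2) - 4 * a0 * s * (c * s ^- 2 * F * q) + 4 * a0 ^+ 2 * s ^+ 2 * q ^+ 2.
    by field; nz.
  have h : c ^+ 2 * (s ^- 4 * F ^+ 2) <= 4 * a0 * s ^+ 2 * (s ^- 4 * F ^+ 2).
    apply: ler_wpM2r => //; apply: mulr_ge0; [by rewrite invr_ge0 exprn_ge0// ltW|exact: sqr_ge0].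
  have as0 : 0 < 4 * a0 * s by have ? := a00; pos.
  move=> h'; rewrite -(ler_pM2l as0).
  have -> : 4 * a0 * s * (a0 * s * q ^+ 2 + s ^- 3 * F ^+ 2) =
     4 * a0 ^+ 2 * s ^+ 2 * q ^+ 2 + 4 * a0 * s ^+ 2 * (s ^- 4 * F ^+ 2) by field; nz.
  by move: h h'; cl; lra.
have e3 : 0 <= s ^- 3 * F ^+ 2.
  by apply: mulr_ge0; [rewrite invr_ge0 exprn_ge0// ltW|exact: sqr_ge0].
have -> : - (2 * A * s - 2 * th * (s - s^-1)) * q ^+ 2 =
  - 2 * (a0 * s * q ^+ 2) - 2 * th * s^-1 * q ^+ 2 by rewrite /a0; ring.
have e4 : 0 <= a0 * s * q ^+ 2 by have ? := a00; have ? := sqr_ge0 q; pos.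
by move: e1 e2 e3; cl; lra.
Qed.

Lemma lyap_nincr : exists2 s0 : R, 2 <= s0 & forall al f v, issol A g al f v ->
  forall s t, s0 <= s -> s <= t -> lyap f v t <= lyap f v s.
Proof.
have [s0 s02 H] := dlyap_le; exists s0 => // al f v S s t s0s st.
have s1 : 1 < s by trim_lra.
apply: (@Dr_nincr _ (lyap f v) (dlyap f v)) => //.
- by move=> x /andP[sx _]; apply: (Dr_lyap S); exact: lt_trans sx.
- by move=> x /andP[sx _]; apply: (lyap_continuous S); exact: lt_le_trans sx.
- move=> x /andP[sx xt]; have x0 : 0 < x by trim_lra.
  apply: le_trans (H f v x ltac:(trim_lra)) _; rewrite oppr_le0.
  have ? := a00; have ? := ka0; have ? := sqr_ge0 (qth f v x); have ? := spow_ge0 p (f x).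
  by apply: mulr_ge0; [exact: powR_ge0|apply: addr_ge0; pos].
Qed.

Lemma Dr_Y2 f v s : 0 < s -> Dr f s (v s) ->
  Dr (fun s => s `^ (2 * th) * f s ^+ 2) s (2 * s `^ (2 * th) * f s * qth f v s).
Proof.
move=> s0 fD; apply: (Dr_eq (DrM (Dr_powRs (2 * th) s0) (DrX 2 fD))).
by rewrite /qth; field; nz.
Qed.

(** At a zero of f only the kinetic part of the functional is left. Together with monotonicity, one
    negative value therefore excludes every later zero. *)
Lemma lyap_lt0_nonzero f v s : 1 <= s -> lyap f v s < 0 -> f s != 0.
Proof.
move=> s1; apply: contraTneq => fs; rewrite -leNgt /lyap /lyap0 fs.
rewrite expr0n/= !mulr0 mul0r !addr0.
have ? : 0 <= s ^+ 2 - 1 by nra.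
by have ? := sqr_ge0 (qth f v s); have ? := powR_ge0 s (2 * th); pos.
Qed.

End Lyapunov.

(** * Fast decay when nu > 0 *)

Section Supercritical.
Context {R : realType} (A nu p : R).
Hypotheses (hA : 1 / 2 <= A) (p1 : 1 < p) (nu0 : 0 < nu).
Implicit Types (s x al : R) (f v : R -> R).

Let lam := A ^+ 2 - nu ^+ 2.
Notation g := (gnl lam p).

(** The bound by nu / 2 makes [lh = a0^2 - nu^2] at most -3 a0^2, so a negative value of the
    functional is possible; the bound by A / 2 keeps [th = A - a0] positive. *)
Let a0 : R := Num.min nu A / 2.
Let th := A - a0.
Let A0 : 0 < A. Proof. by have h := hA; lra. Qed.
Let a00 : 0 < a0.
Proof. by rewrite /a0 divr_gt0// lt_min nu0 A0. Qed.
Let a0A : a0 <= A / 2.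
Proof. by rewrite /a0 ler_pM2r// ge_min lexx orbT. Qed.
Let a0nu : a0 <= nu / 2.
Proof. by rewrite /a0 ler_pM2r// ge_min lexx. Qed.
Let th0 : 0 < th. Proof. by have h1 := a0A; have h2 := A0; rewrite /th; lra. Qed.
Let thA : th < A. Proof. by have h1 := a00; rewrite /th; lra. Qed.

Notation Ly := (lyap A nu p th).
Notation q := (qth th).
Let lhE : lh A nu th <= - (3 * a0 ^+ 2).
Proof.
rewrite /lh; have -> : A - th = a0 by rewrite /th; ring.
have h1 := a00; have h2 := a0nu; have h3 : (2 * a0) ^+ 2 <= nu ^+ 2 by rewrite ler_sqr ?nnegrE//; lra.
lra.
Qed.

Local Ltac cl := repeat match goal with H : ?T |- _ => lazymatch type of T with Prop =>
  tryif first [constr_eq H hA|constr_eq H p1|constr_eq H nu0|constr_eq H A0|constr_eq H a00|constr_eq H a0A|constr_eq H a0nu|constr_eq H th0|constr_eq H thA|constr_eq H lhE] then fail else clear H end end.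

(** Put Y = s^th f, so that s^th q is Y'. If the functional never becomes negative, its kinetic and
    nonlinear parts dominate f^2 since [lh < 0]. This bounds Y, so f tends to 0, the nonlinear term
    becomes negligible, and [b |f| <= s |q|] with b > a0. Hence f q keeps its sign: growth
    contradicts the bound on Y, and decay at rate b gives f = O(s^(-th - b)). *)
Lemma decay_supercritical : exists2 s0 : R, 2 <= s0 & forall al f v, issol A g al f v ->
  (forall s t, s0 <= s -> s <= t -> Ly f v t <= Ly f v s) /\
  ((forall s, s0 <= s -> 0 <= Ly f v s) ->
  exists C s2 : R, [/\ 0 <= C, s0 <= s2 & forall s, s2 <= s -> `|f s| <= C * s `^ (- (A + a0 / 4))]).
Proof.
have [s0' s02' Hd] := @dlyap_le _ A p th th0 thA.
have [s1' s12' Hn] := @lyap_nincr _ A nu p th p1 th0 thA.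
pose c0 := 3 * a0 ^+ 2.
have c00 : 0 < c0 by have h := a00; rewrite /c0; pos.
pose s0 := s0' + 4 / c0 + s1'.
exists s0 => [|al f v S]; first by have ? : 0 < 4 / c0 by [pos]; rewrite /s0; trim_lra.
have fc0 : 0 < 4 / c0 by pos.
have s02 : 2 <= s0 by rewrite /s0; trim_lra.
have ss0 : s0' <= s0 by rewrite /s0; trim_lra.
split=> [s t ss st|Lpos]; first by apply: (Hn _ _ _ S) => //; move: ss; rewrite /s0; trim_lra.
have [f1 fD vc _ _] := S.
have qc : forall s, 0 < s -> {for s, continuous (q f v)}.
  move=> s sp.
  have h1 := Dr_continuous (DrM (DrM (Dr_cst th s) (fD s)) (DrV (lt0r_neq0 sp) (Dr_id s))).
  exact: (continuousD (vc s) h1).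
pose ka := th * (p - 1) / (p + 1).
have pp : 0 < p + 1 by have h := p1; trim_lra.
have ka0 : 0 < ka by have h := p1; have h' := th0; rewrite /ka; pos.
pose Y2 s := s `^ (2 * th) * f s ^+ 2.
pose c3 := Num.min a0 (ka * (p + 1)).
have c30 : 0 < c3 by rewrite /c3 lt_min a00/=; pos.
pose c4 := Num.min (a0 / 2) (c3 * (c0 / 4)).
have c40 : 0 < c4 by rewrite /c4 lt_min; have ? := a00; apply/andP; split; pos.
pose P s := spow p (f s) * f s.
have P0 s : 0 <= P s by exact: spow_ge0.
have isq s : s0 <= s -> s ^- 2 <= c0 / 4.
  move=> h; have s_gt0 : 0 < s by trim_lra.
  have h1 : 4 / c0 <= s ^+ 2 by have h2 : 4 / c0 <= s by [rewrite /s0 in h; trim_lra]; nra.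
  have -> : c0 / 4 = (4 / c0)^-1 by field; nz.
  by rewrite lef_pV2 ?posrE ?exprn_gt0.
have key s : s0 <= s -> (c0 / 2 - s ^- 2) * f s ^+ 2 <= (s ^+ 2 - 1) * q f v s ^+ 2 / 2 + P s / (p + 1).
  move=> h; have s_gt0 : 0 < s by trim_lra.
  have := Lpos s h; rewrite /lyap pmulr_rge0 ?powR_gt0// /lyap0 -/(P s).
  have : lh A nu th / 2 * f s ^+ 2 <= - (c0 / 2) * f s ^+ 2.
    by apply: ler_wpM2r; [exact: sqr_ge0|have := lhE; rewrite /c0; trim_lra].
  rewrite mulrDl mulrBl; trim_lra.
(* Adding a small multiple of Y^2 keeps the functional nonincreasing: the new cross term is absorbed
   by the dissipation, which by [key] controls f^2 as well as q^2. *)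
have Y2b s : s0 <= s -> c4 * Y2 s <= Ly f v s0 + c4 * Y2 s0.
  move=> s0s.
  have : Ly f v s + c4 * Y2 s <= Ly f v s0 + c4 * Y2 s0.
    apply: (@Dr_nincr _ (fun s => Ly f v s + c4 * Y2 s)
      (fun s => dlyap A p th f v s + c4 * (2 * s `^ (2 * th) * f s * q f v s))) => //.
    - move=> x /andP[x0 _]; have xp : 0 < x by trim_lra.
      have x1 : 1 < x by trim_lra.
      have D1 := DrM (Dr_cst c4 x) (@Dr_Y2 _ th f v x xp (fD x)).
      by apply: (Dr_eq (DrD (@Dr_lyap _ A nu p th p1 _ f v x S x1) D1)); rewrite mulr0 addr0.
    - move=> x /andP[x0 _]; have xp : 0 < x by trim_lra.
      have x1 : 1 < x by trim_lra.
      have D1 := DrM (Dr_cst c4 x) (@Dr_Y2 _ th f v x xp (fD x)).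
      exact: Dr_continuous (DrD (@Dr_lyap _ A nu p th p1 _ f v x S x1) D1).
    - move=> x /andP[x0 _]; have xp : 0 < x by trim_lra.
      have X0 : 0 < x `^ (2 * th) by exact: powR_gt0.
      have := Hd f v x ltac:(trim_lra); rewrite -/ka -/(P x).
      have -> : A - th = a0 by rewrite /th; ring.
      set Q := q f v x; set F := f x.
      have i0 : 0 < x^-1 by rewrite invr_gt0.
      have e1 : c3 * x^-1 * ((x ^+ 2 - 1) * Q ^+ 2 / 2 + P x / (p + 1)) <=
          a0 / 2 * x * Q ^+ 2 + ka * x^-1 * P x.
        rewrite mulrDr; apply: lerD.
          have c3a : c3 <= a0 by rewrite /c3 ge_min lexx.
          apply: (@le_trans _ _ (a0 * x^-1 * (x ^+ 2 * Q ^+ 2 / 2))).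
            apply: ler_pM; [pos| |by rewrite ler_pM2r|].
              by have ? : 0 <= x ^+ 2 - 1 by [nra]; have ? := sqr_ge0 Q; pos.
            rewrite ler_pM2r// ; apply: ler_wpM2r; [exact: sqr_ge0|trim_lra].
          by rewrite le_eqVlt; apply/orP; left; apply/eqP; field; nz.
        have c3k : c3 <= ka * (p + 1) by rewrite /c3 ge_min lexx orbT.
        have -> : ka * x^-1 * P x = ka * (p + 1) * x^-1 * (P x / (p + 1)) by field; nz.
        by apply: ler_wpM2r; [have ? := P0 x; pos|rewrite ler_pM2r].
      have e2 : c0 / 4 * F ^+ 2 <= (x ^+ 2 - 1) * Q ^+ 2 / 2 + P x / (p + 1).
        apply: le_trans (key x ltac:(trim_lra)); apply: ler_wpM2r; first exact: sqr_ge0.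
        by have := isq x ltac:(trim_lra); trim_lra.
      have e3 : c3 * (c0 / 4) * x^-1 * F ^+ 2 <= a0 / 2 * x * Q ^+ 2 + ka * x^-1 * P x.
        apply: le_trans e1; have -> : c3 * (c0 / 4) * x^-1 * F ^+ 2 = c3 * x^-1 * (c0 / 4 * F ^+ 2) by ring.
        by apply: ler_wpM2l => //; pos.
      have e4 : 2 * c4 * F * Q <= a0 / 2 * x * Q ^+ 2 + c3 * (c0 / 4) * x^-1 * F ^+ 2.
        have c4a : c4 <= a0 / 2 by rewrite /c4 ge_min lexx.
        have c4c : c4 <= c3 * (c0 / 4) by rewrite /c4 ge_min lexx orbT.
        apply: (@le_trans _ _ (c4 * (x * Q ^+ 2) + c4 * (x^-1 * F ^+ 2))).
          have := sqr_ge0 (x * Q - F).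
          have -> : c4 * (x * Q ^+ 2) + c4 * (x^-1 * F ^+ 2) =
            c4 * x^-1 * (x * Q - F) ^+ 2 + 2 * c4 * F * Q by field; nz.
          by move=> ?; rewrite lerDr; pos.
        rewrite -(mulrA (a0 / 2)) -(mulrA (c3 * (c0 / 4))); apply: lerD.
          by apply: ler_wpM2r => //; have ? := sqr_ge0 Q; pos.
        by apply: ler_wpM2r => //; have ? := sqr_ge0 F; pos.
      have e5 : 2 * c4 * F * Q <= a0 * x * Q ^+ 2 + ka * x^-1 * P x.
        by move: e3 e4; cl; lra.
      have -> : c4 * (2 * x `^ (2 * th) * F * Q) = x `^ (2 * th) * (2 * c4 * F * Q) by ring.
      by have := ler_wpM2l (ltW X0) e5; cl; lra.
  by have := Lpos s s0s; trim_lra.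
pose K := (Ly f v s0 + c4 * Y2 s0) / c4.
have Y2K s : s0 <= s -> Y2 s <= K.
  by move=> /Y2b; rewrite /K ler_pdivlMr// mulrC.
have K0 : 0 <= K.
  by apply: le_trans (Y2K s0 (lexx _)); rewrite mulr_ge0 ?powR_ge0 ?sqr_ge0.
have q0 : 0 < (p - 1) * th by have h := p1; have h' := th0; pos.
have Vs : exists2 s1 : R, s0 <= s1 & forall s, s1 <= s -> `|f s| `^ (p - 1) <= a0 ^+ 2 / 4 * (p + 1).
  pose D := a0 ^+ 2 / 4 * (p + 1).
  have D0 : 0 < D by have h := a00; rewrite /D; pos.
  have [s1 s11 H1] := powR_large (Num.sqrt K `^ (p - 1) / D) q0.
  exists (Num.max s0 s1) => [|s]; first by rewrite le_max lexx.
  rewrite ge_max => /andP[h1 h2]; have sp : 0 < s by trim_lra.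
  have X0 : 0 < s `^ th by exact: powR_gt0.
  have fb : `|f s| <= Num.sqrt K / s `^ th.
    rewrite ler_pdivlMr// -sqrtr_sqr -[X in _ * X](@gtr0_norm _ (s `^ th))// -sqrtr_sqr -sqrtrM ?sqr_ge0//.
    rewrite ler_sqrt//; apply: le_trans (Y2K s h1); rewrite /Y2 mulrC.
    have -> // : s `^ (2 * th) = s `^ th ^+ 2 by rewrite -powR_mulrn ?powR_ge0// -powRrM mulrC.
  have h3 := H1 s h2; rewrite ler_pdivrMr// in h3.
  apply: (@le_trans _ _ ((Num.sqrt K / s `^ th) `^ (p - 1))).
    have h := p1; apply: ge0_ler_powR; rewrite ?nnegrE//; first trim_lra.
    by apply: le_trans fb.
  rewrite powRM ?sqrtr_ge0 ?invr_ge0 ?powR_ge0// -powRN -powRrM -/D.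
  have -> : - th * (p - 1) = - ((p - 1) * th) by ring.
  by rewrite powRN ler_pdivrMr ?powR_gt0// mulrC.
have [s1 s01 Vs1] := Vs.
(* The rate must exceed [a0], so that [th + b = A + a0 / 4] is beyond A, and its square must stay
   below the 2 a0^2 that [key] provides. *)
pose b := 5 / 4 * a0.
have b0 : 0 < b by have h := a00; rewrite /b; trim_lra.
pose s2 := s1 + 4 / a0 ^+ 2.
have fa0 : 0 < 4 / a0 ^+ 2 by have h := a00; pos.
have s12 : s1 <= s2 by rewrite /s2; trim_lra.
have qf s : s2 <= s -> b ^+ 2 * f s ^+ 2 <= s ^+ 2 * q f v s ^+ 2.
  move=> h; have s_gt0 : 0 < s by trim_lra.
  have ss0' : s0 <= s by trim_lra.
  have isq2 : s ^- 2 <= a0 ^+ 2 / 4.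
    have h1 : 4 / a0 ^+ 2 <= s ^+ 2.
      by have h2 : 4 / a0 ^+ 2 <= s by [rewrite /s2 in h; trim_lra]; nra.
    have -> : a0 ^+ 2 / 4 = (4 / a0 ^+ 2)^-1 by have h2 := a00; field; nz.
    by rewrite lef_pV2 ?posrE ?exprn_gt0.
  have h1 := key s ss0'.
  have h2 : P s / (p + 1) <= a0 ^+ 2 / 4 * f s ^+ 2.
    rewrite /P spow_mul ler_pdivrMr// mulrAC; apply: ler_wpM2r; first exact: sqr_ge0.
    by apply: Vs1; exact: le_trans h.
  have h3 : s ^- 2 * f s ^+ 2 <= a0 ^+ 2 / 4 * f s ^+ 2.
    by apply: ler_wpM2r => //; exact: sqr_ge0.
  have h4 := sqr_ge0 (q f v s); have h5 : 0 <= a0 ^+ 2 * f s ^+ 2 by rewrite mulr_ge0 ?sqr_ge0.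
  by move: h1 h2 h3 h4 h5; rewrite /b /c0; cl; lra.
have sp s : s2 <= s -> 0 < s by move=> h; trim_lra.
have abs_q s : s2 <= s -> b * `|f s| <= s * `|q f v s|.
  move=> h; have := qf s h.
  rewrite -[f s ^+ 2]real_normK ?num_real// -[q f v s ^+ 2]real_normK ?num_real// -!exprMn.
  by have s_gt0 := sp s h; rewrite ler_sqr ?nnegrE; pos.
(* If f q is positive once it remains so: by [abs_q] a first zero of f q would be a zero of f,
   although Y^2 has increased until then. Consequently Y^2 grows at least like s^(2b), against the
   bound K. *)
have sgn s : s2 <= s -> f s * q f v s <= 0.
  move=> h; rewrite leNgt; apply/negP => fq.
  have s_gt0 := sp s h.
  have DY x : 0 < x -> Dr Y2 x (2 * x `^ (2 * th) * f x * q f v x).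
    by move=> x0; exact: Dr_Y2.
  have Y2s : 0 < Y2 s.
    rewrite mulr_gt0 ?powR_gt0// lt0r sqr_ge0 andbT sqrf_eq0.
    by apply: contraTneq fq => ->; rewrite mul0r ltxx.
  have pos x : s <= x -> 0 < f x * q f v x.
    move=> sx; rewrite ltNge; apply/negP => fqx.
    have [|||c /andP[sc cx] [fqc Hc]] := @first_hit _ (fun x => f x * q f v x) s x sx.
    - move=> t /andP[st _]; apply: continuousM; first exact: Dr_continuous (fD t).
      by apply: qc; trim_lra.
    - by [].
    - by [].
    have : Y2 s <= Y2 c.
      apply: (@Dr_ndecr _ Y2 (fun x => 2 * x `^ (2 * th) * f x * q f v x)); first exact: ltW.
      - by move=> t /andP[st _]; apply: DY; trim_lra.
      - by move=> t /andP[st _]; apply: Dr_continuous (DY t _); trim_lra.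
      - move=> t /andP[st tc]; rewrite -mulrA; apply: mulr_ge0; first by rewrite mulr_ge0 ?powR_ge0.
        by apply: ltW; apply: Hc; rewrite (ltW st).
    rewrite leNgt => /negP; apply; have := abs_q c ltac:(trim_lra).
    move: fqc => /eqP; rewrite mulf_eq0 => /orP[/eqP fc00 _|/eqP qc0].
      by rewrite /Y2 fc00 expr0n/= mulr0.
    rewrite qc0 normr0 mulr0 pmulr_rle0// normr_le0 => /eqP fc00.
    by rewrite /Y2 fc00 expr0n/= mulr0.
  have grow x : s <= x -> Y2 s * s `^ (- (2 * b)) <= Y2 x * x `^ (- (2 * b)).
    move=> sx; apply: (@Dr_ndecr _ (fun x => Y2 x * x `^ (- (2 * b)))
      (fun x => Y2 x * (- (2 * b) * x `^ (- (2 * b)) / x) +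
         x `^ (- (2 * b)) * (2 * x `^ (2 * th) * f x * q f v x))) => //.
    - move=> t /andP[st _]; have t0 : 0 < t by trim_lra.
      exact: (DrM (DY t t0) (Dr_powRs (- (2 * b)) t0)).
    - move=> t /andP[st _]; have t0 : 0 < t by trim_lra.
      exact: Dr_continuous (DrM (DY t t0) (Dr_powRs (- (2 * b)) t0)).
    - move=> t /andP[st _]; have t0 : 0 < t by trim_lra.
      have -> : Y2 t * (- (2 * b) * t `^ (- (2 * b)) / t) +
         t `^ (- (2 * b)) * (2 * t `^ (2 * th) * f t * q f v t) =
         2 * t `^ (- (2 * b)) * t `^ (2 * th) / t * (t * (f t * q f v t) - b * f t ^+ 2).
        by rewrite /Y2; field; nz.
      have ? := powR_ge0 t (- (2 * b)); have ? := powR_ge0 t (2 * th).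
      apply: mulr_ge0; first pos.
      rewrite subr_ge0 -(gtr0_norm (pos t (ltW st))) normrM -real_normK ?num_real// expr2.
      have := ler_wpM2r (normr_ge0 (f t)) (abs_q t ltac:(trim_lra)).
      by cl; lra.
  have b20 : 0 < 2 * b by pos.
  have [s3 s31 H3] := powR_large ((K + 1) / (Y2 s * s `^ (- (2 * b)))) b20.
  have sx : s <= Num.max s s3 by rewrite le_max lexx.
  have := H3 (Num.max s s3); rewrite le_max lexx orbT => /(_ isT).
  set x := Num.max s s3 in sx *; have x0 : 0 < x by trim_lra.
  rewrite ler_pdivrMr; last by rewrite mulr_gt0// powR_gt0.
  have := grow x sx; rewrite (powRN x) ler_pdivlMr ?powR_gt0// => h1 h2.
  have := Y2K x ltac:(trim_lra); move: h1 h2; cl; lra.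
have s2_gt0 : 0 < s2 by apply: sp.
pose C2 := Y2 s2 * s2 `^ (2 * b).
have C20 : 0 <= C2.
  by rewrite /C2 /Y2; have ? := powR_ge0 s2 (2 * b); have ? := powR_ge0 s2 (2 * th);
    have ? := sqr_ge0 (f s2); pos.
exists (Num.sqrt C2), s2; split; [exact: sqrtr_ge0|trim_lra|] => s hs.
have s_gt0 := sp s hs.
have Yd : Y2 s * s `^ (2 * b) <= C2.
  apply: (@Dr_nincr _ (fun x => Y2 x * x `^ (2 * b))
      (fun x => Y2 x * (2 * b * x `^ (2 * b) / x) +
         x `^ (2 * b) * (2 * x `^ (2 * th) * f x * q f v x))) => //.
  - move=> t /andP[st _]; have t0 : 0 < t by trim_lra.
    exact: (DrM (@Dr_Y2 _ th f v t t0 (fD t)) (Dr_powRs (2 * b) t0)).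
  - move=> t /andP[st _]; have t0 : 0 < t by trim_lra.
    exact: Dr_continuous (DrM (@Dr_Y2 _ th f v t t0 (fD t)) (Dr_powRs (2 * b) t0)).
  - move=> t /andP[st _]; have t0 : 0 < t by trim_lra.
    have -> : Y2 t * (2 * b * t `^ (2 * b) / t) +
       t `^ (2 * b) * (2 * t `^ (2 * th) * f t * q f v t) =
       2 * t `^ (2 * b) * t `^ (2 * th) / t * (b * f t ^+ 2 - t * (- (f t * q f v t))).
      by rewrite /Y2; field; nz.
    have ? := powR_ge0 t (2 * b); have ? := powR_ge0 t (2 * th).
    apply: mulr_ge0_le0; first pos.
    rewrite subr_le0 -(ler0_norm (sgn t (ltW st))) normrM -real_normK ?num_real// expr2.
    have := ler_wpM2r (normr_ge0 (f t)) (abs_q t (ltW st)).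
    by cl; lra.
have E2 : A + a0 / 4 = th + b by rewrite /th /b; field.
have X0 : 0 < s `^ (A + a0 / 4) by exact: powR_gt0.
rewrite powRN ler_pdivlMr// -sqrtr_sqr -[X in _ * X](@gtr0_norm _ (s `^ (A + a0 / 4)))//.
rewrite -sqrtr_sqr -sqrtrM ?sqr_ge0// ler_sqrt//; apply: le_trans Yd.
have -> : s `^ (A + a0 / 4) ^+ 2 = s `^ (2 * th) * s `^ (2 * b).
  by rewrite -powRDp// -powR_mulrn ?powR_ge0// -powRrM E2; congr (_ `^ _); ring.
by rewrite /Y2 le_eqVlt; apply/orP; left; apply/eqP; ring.
Qed.

End Supercritical.

(** * Decay of exceptional solutions *)

Lemma Dr_gt0_left {R : realType} (f : R -> R) (x d a : R) : Dr f x d -> 0 < d -> a < x ->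
  exists2 y, a < y < x & f y < f x.
Proof.
move=> fD d0 ax; have [de de0 H] := (Dr_epsP f x d).1 fD (d / 2) ltac:(trim_lra).
pose t := Num.min (de / 2) ((x - a) / 2).
have t0 : 0 < t by rewrite /t lt_min; apply/andP; split; trim_lra.
have t1 : t <= de / 2 by rewrite /t ge_min lexx.
have t2 : t <= (x - a) / 2 by rewrite /t ge_min lexx orbT.
exists (x - t); first by apply/andP; split; trim_lra.
have E : `|x - t - x| = t by rewrite addrAC subrr add0r normrN gtr0_norm.
have := H (x - t); rewrite E => /(_ ltac:(trim_lra)) /(le_trans (ler_norm _)) h.
by move: h d0 t0; clear; nra.
Qed.

(** * A linear system with integrable potential *)

Section LinearSystem.
Context {R : realType} (Y Z m h : R -> R) (S c C de K : R).
Hypotheses (S1 : 1 <= S) (c0 : 0 < c) (C0 : 0 <= C) (de0 : 0 < de) (K0 : 0 < K).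
Hypotheses (DY : forall s, S <= s -> Dr Y s (Z s / m s))
  (DZ : forall s, S <= s -> Dr Z s (h s * Y s))
  (mc : forall s, S <= s -> c * s <= m s) (ms : forall s, S <= s -> m s <= s)
  (hC : forall s, S <= s -> `|h s| <= C * s^-1 * s `^ (- de)).

Let s_gt0 s : S <= s -> 0 < s. Proof. by move=> h'; have h1 := S1; lra. Qed.
Let m_gt0 s : S <= s -> 0 < m s.
Proof. by move=> h'; apply: lt_le_trans (mc h'); exact: mulr_gt0 c0 (s_gt0 h'). Qed.

Local Ltac cl := repeat match goal with H : ?T |- _ => lazymatch type of T with Prop =>
  tryif first [constr_eq H S1|constr_eq H c0|constr_eq H C0|constr_eq H de0|constr_eq H K0|constr_eq H DY|constr_eq H DZ|constr_eq H mc|constr_eq H ms|constr_eq H hC|constr_eq H s_gt0|constr_eq H m_gt0] then fail else clear H end end.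

(** The cone Y > 0, Z > K s^(-de) Y is forward invariant: on its boundary the derivative of r = Z -
    K s^(-de) Y is at least Y s^(-1-de) (de K - C - K^2 s^(-de) / c), which is positive by the
    choice of K and S. A first return of r to 0 would need a nonpositive derivative. *)
Lemma linear_trap : K ^+ 2 * S `^ (- de) / c + C < de * K ->
  0 < Y S -> K * S `^ (- de) * Y S < Z S -> forall s, S <= s -> 0 < Y s.
Proof.
move=> KS YS ZS.
pose r s := Z s - K * s `^ (- de) * Y s.
have Drr s : S <= s -> Dr r s (h s * Y s - (K * s `^ (- de) * (Z s / m s) +
    Y s * (K * (- de * s `^ (- de) / s)))).
  move=> Ss; have D := DrB (DZ Ss) (DrM (DrM (Dr_cst K s) (Dr_powRs (- de) (s_gt0 Ss))) (DY Ss)).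
  by apply: (Dr_eq D); rewrite mulr0 addr0.
have grow b : S <= b -> (forall s, S <= s < b -> 0 < Y s) -> (forall s, S <= s < b -> 0 < r s) -> Y S <= Y b.
  move=> Sb Y0 r0; apply: (@Dr_ndecr _ Y (fun s => Z s / m s)) => //.
  - by move=> x /andP[Sx _]; apply: DY; exact: ltW.
  - by move=> x /andP[Sx _]; exact: Dr_continuous (DY Sx).
  - move=> x /andP[Sx xb]; have x1 : S <= x < b by rewrite (ltW Sx).
    have ? := m_gt0 (ltW Sx); have ? := Y0 x x1; have h1 := r0 x x1.
    apply: divr_ge0; last by rewrite ltW.
    have h2 : 0 <= K * x `^ (- de) * Y x by have ? := powR_ge0 x (- de); have ? := K0; pos.
    by move: h1 h2; rewrite /r; trim_lra.
have rpos b : S <= b -> (forall s, S <= s < b -> 0 < Y s) -> forall s, S <= s <= b -> 0 < r s.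
  move=> Sb Y0 s /andP[Ss sb]; rewrite ltNge; apply/negP => rs.
  have [|||d /andP[Sd ds] [rd Hd]] := @first_hit _ r S s Ss.
  - by move=> x /andP[Sx _]; exact: Dr_continuous (Drr x Sx).
  - by rewrite /r subr_gt0.
  - by [].
  have Sd' := ltW Sd.
  have Yd : 0 < Y d.
    apply: lt_le_trans YS _; apply: (grow d Sd' _ Hd) => x /andP[Sx xd].
    by apply: Y0; rewrite Sx (lt_le_trans xd)// (le_trans ds).
  have d0 := s_gt0 Sd'; have md := m_gt0 Sd'.
  have [|y /andP[Sy yd]] := Dr_gt0_left (Drr d Sd') _ Sd.
    have ZE : Z d = K * d `^ (- de) * Y d by apply/eqP; rewrite -subr_eq0; apply/eqP.
    have X0 : 0 < d `^ (- de) by exact: powR_gt0.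
    have XS : d `^ (- de) <= S `^ (- de).
      rewrite !powRN lef_pV2 ?posrE ?powR_gt0 ?s_gt0//.
      by apply: ge0_ler_powR; rewrite ?nnegrE; have ? := de0; have ? := s_gt0 (lexx S); trim_lra.
    have -> : h d * Y d - (K * d `^ (- de) * (Z d / m d) + Y d * (K * (- de * d `^ (- de) / d))) =
      Y d * (h d + d^-1 * d `^ (- de) * (de * K - K ^+ 2 * d `^ (- de) * d / m d)).
      by rewrite ZE; field; nz.
    apply: mulr_gt0 => //.
    have i0 : 0 < d^-1 by rewrite invr_gt0.
    have h1 : - (C * d^-1 * d `^ (- de)) <= h d.
      by have := hC Sd'; rewrite ler_norml => /andP[].
    have h2 : d / m d <= c^-1.
      by rewrite ler_pdivrMr// mulrC ler_pdivlMr// mulrC; exact: mc.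
    have h3 : K ^+ 2 * d `^ (- de) * d / m d <= K ^+ 2 * S `^ (- de) / c.
      rewrite -(mulrA _ d); apply: ler_pM => //; last by rewrite ler_pM2l// exprn_gt0.
      - by have ? := K0; pos.
      - by rewrite divr_ge0// ltW.
    have h4 : 0 < d^-1 * d `^ (- de) * ((de * K - K ^+ 2 * d `^ (- de) * d / m d) - C).
      by apply: mulr_gt0; [exact: mulr_gt0|move: KS h3; cl; lra].
    by move: h1 h4; cl; lra.
  by rewrite rd ltNge => /negP; apply; apply: ltW; apply: Hd; rewrite (ltW Sy).
move=> s Ss; rewrite ltNge; apply/negP => Ys.
have [|||d /andP[Sd ds] [Yd Hd]] := @first_hit _ Y S s Ss => //.
  by move=> x /andP[Sx _]; exact: Dr_continuous (DY Sx).
have := grow d (ltW Sd) Hd; rewrite Yd leNgt YS => /(_ _)/negP; apply=> // x /andP[Sx xd].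
by apply: (rpos d (ltW Sd) Hd); rewrite Sx ltW.
Qed.

(** Never entering the cone or its opposite makes Y^2 exp(k s^(-de)) nonincreasing, so Y is bounded
    and Z converges at rate s^(-de). The limit of Z must be 0: otherwise Y' = Z / m, of order 1 / s,
    would make Y grow like log s. *)
Lemma linear_bounded : (forall s, S <= s -> Y s * Z s <= K * s `^ (- de) * Y s ^+ 2) ->
  exists2 B : R, 0 <= B & forall s, S <= s -> `|Y s| <= B /\ `|Z s| <= B * s `^ (- de).
Proof.
move=> YZ; pose k := 2 * K / (c * de).
have DX s : S <= s -> Dr (fun s => Y s ^+ 2 * expR (k * s `^ (- de))) s
   (expR (k * s `^ (- de)) * (2 * Y s * Z s / m s - 2 * K / c * s^-1 * s `^ (- de) * Y s ^+ 2)).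
  move=> Ss; have s0 := s_gt0 Ss.
  have D := DrM (DrX 2 (DY Ss)) (Dr_comp (DrM (Dr_cst k s) (Dr_powRs (- de) s0)) (Dr_expR (k * s `^ (- de)))).
  apply: (Dr_eq D); have ? := c0; have ? := de0; have ? := m_gt0 Ss.
  by rewrite /k; field; nz.
pose P := Y S ^+ 2 * expR (k * S `^ (- de)).
have Y2 s : S <= s -> Y s ^+ 2 <= P.
  move=> Ss; apply: (@le_trans _ _ (Y s ^+ 2 * expR (k * s `^ (- de)))).
    rewrite ler_peMr ?sqr_ge0// -expR0 ler_expR /k; have ? := powR_ge0 s (- de).
    by have ? := c0; have ? := de0; have ? := K0; pos.
  apply: (@Dr_nincr _ _ _ S s Ss (fun x _ => DX x _)).
  - by move=> x /andP[Sx _]; exact: ltW.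
  - by move=> x /andP[Sx _]; exact: Dr_continuous (DX x Sx).
  - move=> x /andP[/ltW Sx _]; apply: mulr_ge0_le0; first exact: expR_ge0.
    have x0 := s_gt0 Sx; have m0 := m_gt0 Sx; have X0 := powR_ge0 x (- de).
    rewrite subr_le0.
    have T0 : 0 <= K * x `^ (- de) * Y x ^+ 2 by have ? := K0; have ? := sqr_ge0 (Y x); pos.
    apply: (@le_trans _ _ (2 * (K * x `^ (- de) * Y x ^+ 2 / m x))).
      have -> : 2 * Y x * Z x / m x = 2 * (Y x * Z x / m x) by ring.
      by rewrite ler_pM2l// ler_pM2r ?invr_gt0//; exact: YZ.
    have -> : 2 * K / c * x^-1 * x `^ (- de) * Y x ^+ 2 = 2 * (K * x `^ (- de) * Y x ^+ 2 / (c * x)).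
      by have ? := c0; field; nz.
    rewrite ler_pM2l//; apply: ler_wpM2l => //.
    by rewrite lef_pV2 ?posrE ?mulr_gt0//; exact: mc.
have P0 : 0 <= P by apply: mulr_ge0; [exact: sqr_ge0|exact: expR_ge0].
pose B : R := Num.sqrt P; have B0 : 0 <= B by exact: sqrtr_ge0.
have YB s : S <= s -> `|Y s| <= B.
  by move=> Ss; rewrite -sqrtr_sqr /B ler_sqrt// Y2.
pose D := C * B / de.
have D0 : 0 <= D by have ? := C0; have ? := de0; rewrite /D; pos.
have ZZ a b : S <= a -> a <= b -> `|Z b - Z a| <= D * a `^ (- de).
  move=> Sa ab; apply: (@le_trans _ _ (- D * b `^ (- de) - - D * a `^ (- de))).
    have DD x : S <= x -> Dr (fun s => - D * s `^ (- de)) x (C * B * x^-1 * x `^ (- de)).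
      move=> Sx; have x0 := s_gt0 Sx.
      apply: (Dr_eq (DrM (Dr_cst (- D) x) (Dr_powRs (- de) x0))).
      by have ? := de0; rewrite /D; field; nz.
    apply: (@Dr_dom _ Z (fun s => - D * s `^ (- de)) (fun x => h x * Y x)
       (fun x => C * B * x^-1 * x `^ (- de)) a b ab).
    - by move=> x /andP[ax _]; apply: DZ; trim_lra.
    - by move=> x /andP[ax _]; apply: DD; trim_lra.
    - by move=> x /andP[ax _]; apply: Dr_continuous (DZ _); trim_lra.
    - by move=> x /andP[ax _]; apply: Dr_continuous (DD x _); trim_lra.
    - move=> x /andP[ax _]; have Sx : S <= x by trim_lra.
      rewrite normrM; have -> : C * B * x^-1 * x `^ (- de) = C * x^-1 * x `^ (- de) * B by ring.
      by apply: ler_pM => //; [exact: hC|exact: YB].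
  by rewrite !mulNr opprK gerDr oppr_le0 mulr_ge0 ?powR_ge0.
have aux (X W : R -> R) s1 : S <= s1 -> (forall s, S <= s -> Dr X s (W s / m s)) ->
    (forall s, S <= s -> `|X s| <= B) -> (forall s, s1 <= s -> `|W s - W s1| <= D * s1 `^ (- de)) ->
    W s1 <= D * s1 `^ (- de).
  move=> Ss1 DX' XB WW; rewrite leNgt; apply/negP => h1.
  pose z0 := W s1 - D * s1 `^ (- de); have z00 : 0 < z0 by rewrite /z0; trim_lra.
  have Wz s : s1 <= s -> z0 <= W s.
    by move=> /WW; rewrite ler_norml /z0 => /andP[]; trim_lra.
  have s10 := s_gt0 Ss1.
  (* Between s1 and s2 the logarithmic growth adds at least 2 B + z0, more than the bound B on |X|
     at both ends allows. *)
  pose s2 := s1 * expR (2 * B / z0 + 1).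
  have e0 : 0 <= 2 * B / z0 + 1 by apply: addr_ge0 => //; pos.
  have s12 : s1 <= s2 by rewrite /s2 ler_peMr ?(ltW s10)// -[leLHS](@expR0 R) ler_expR.
  have : X s1 - z0 * ln s1 <= X s2 - z0 * ln s2.
    have DDx x : s1 <= x -> Dr (fun s => X s - z0 * ln s) x (W x / m x - z0 * x^-1).
      move=> sx; have x0 : 0 < x by trim_lra.
      have Sx : S <= x by trim_lra.
      by apply: (Dr_eq (DrB (DX' x Sx) (DrM (Dr_cst z0 x) (Dr_ln x0)))); rewrite mulr0 addr0.
    apply: (@Dr_ndecr _ _ _ s1 s2 s12 (fun x _ => DDx x _)).
    - by move=> x /andP[Sx _]; exact: ltW.
    - by move=> x /andP[Sx _]; exact: Dr_continuous (DDx x Sx).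
    - move=> x /andP[/ltW Sx _]; have Sx' : S <= x by trim_lra.
      rewrite subr_ge0; have x0 : 0 < x by trim_lra.
      apply: ler_pM; [exact: ltW|by rewrite invr_ge0 ltW|exact: Wz|].
      by rewrite lef_pV2 ?posrE// ?m_gt0//; exact: ms.
  rewrite /s2 lnM ?posrE ?expR_gt0// expRK -/s2.
  have := XB s1 Ss1; have := XB s2 (le_trans Ss1 s12); rewrite !ler_norml => /andP[_ h3] /andP[h4 _].
  have E : z0 * (2 * B / z0 + 1) = 2 * B + z0 by field; nz.
  by rewrite mulrDr E => h5; move: h3 h4 h5 z00; cl; lra.
exists (B + D) => [|s Ss]; first by rewrite addr_ge0.
split; first by apply: le_trans (YB s Ss) _; rewrite lerDl.
apply: (@le_trans _ _ (D * s `^ (- de))); last first.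
  by apply: ler_wpM2r; [exact: powR_ge0|rewrite lerDr].
rewrite ler_norml lerNl; apply/andP; split.
  apply: (aux (fun s => - Y s) (fun s => - Z s)) => //.
  - by move=> x Sx; apply: (Dr_eq (DrN (DY Sx))); rewrite mulNr.
  - by move=> x Sx; rewrite normrN; exact: YB.
  - by move=> x sx; rewrite -opprD normrN; exact: ZZ.
by apply: (aux Y Z) => // x sx; exact: ZZ.
Qed.

End LinearSystem.

Section Weights.
Context {R : realType} (A : R) (hA : 1 / 2 <= A).
Implicit Types s : R.

(** For s >= 2 one has s^2 - 1 >= s^2 / 2; this is the factor it leaves in [Wt]. *)
Definition wtc : R := (1 / 2) `^ (A + 1 / 2).

Lemma wtc_gt0 : 0 < wtc. Proof. by apply: powR_gt0; trim_lra. Qed.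

Lemma Wt_ge s : 2 <= s -> wtc * s `^ (2 * A + 1) <= Wt A s.
Proof.
move=> s2; rewrite WtE ?/wtc; last trim_lra.
have -> : s `^ (2 * A + 1) = (s ^+ 2) `^ (A + 1 / 2).
  by rewrite -powR_mulrn -?powRrM; [congr (_ `^ _); field|trim_lra].
rewrite -powRM; [|trim_lra|exact: sqr_ge0].
by have h := hA; apply: ge0_ler_powR; rewrite ?nnegrE; nra.
Qed.

Lemma Wt_le s : 2 <= s -> Wt A s <= s `^ (2 * A + 1).
Proof.
move=> s2; rewrite WtE; last trim_lra.
have -> : s `^ (2 * A + 1) = (s ^+ 2) `^ (A + 1 / 2).
  by rewrite -powR_mulrn -?powRrM; [congr (_ `^ _); field|trim_lra].
by have h := hA; apply: ge0_ler_powR; rewrite ?nnegrE; nra.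
Qed.

Lemma om_le s : 2 <= s -> om A s <= s `^ (2 * A - 1).
Proof.
move=> s2; rewrite omE; last trim_lra.
have -> : s `^ (2 * A - 1) = (s ^+ 2) `^ (A - 1 / 2).
  by rewrite -powR_mulrn -?powRrM; [congr (_ `^ _); field|trim_lra].
by have h := hA; apply: ge0_ler_powR; rewrite ?nnegrE; nra.
Qed.

End Weights.

(** * The borderline case nu = 0 *)

Section Critical.
Context {R : realType} (A p : R).
Hypotheses (hA : 1 / 2 <= A) (p1 : 1 < p).
Implicit Types (s x y al : R) (f v : R -> R).

Notation g := (gnl (A ^+ 2) p).
Let A0 : 0 < A. Proof. by have h := hA; lra. Qed.

(* The amplitude [s^A f] and the momentum conjugate to it solve a linear system
   whose potential is integrable at infinity. *)
Definition ampl s x := s `^ A * x.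
Definition mom s x y := Wt A s * s `^ (- A) * (y + A * x / s).
Definition mass s := Wt A s * s `^ (- (2 * A)).
Definition pot f s := om A s * s `^ (- (2 * A)) * (A * (A + 1) * s ^- 2 - `|f s| `^ (p - 1)).

Lemma powRN2 s : s `^ (- (2 * A)) = (s `^ A ^+ 2)^-1.
Proof. by rewrite powRN mulrC powRrM powR_mulrn// powR_ge0. Qed.

Lemma Dr_ampl al f v s : issol A g al f v -> 2 <= s ->
  Dr (fun s => ampl s (f s)) s (mom s (f s) (v s) / mass s).
Proof.
move=> S s2; have [_ fD _ _ _] := S; have s0 : 0 < s by trim_lra.
apply: (Dr_eq (DrM (Dr_powRs A s0) (fD s))).
have W0 : 0 < Wt A s by apply: Wt_gt0; trim_lra.
have X0 : 0 < s `^ A by exact: powR_gt0.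
rewrite /mom /mass powRN2 powRN; set X := s `^ A in X0 *; set W := Wt A s in W0 *.
by field; nz.
Qed.

Lemma Dr_mom al f v s : issol A g al f v -> 2 <= s ->
  Dr (fun s => mom s (f s) (v s)) s (pot f s * ampl s (f s)).
Proof.
move=> S s2; have [_ fD _ _ HW] := S; have s0 : 0 < s by trim_lra.
have s1 : 1 < s by trim_lra.
have -> : (fun s => mom s (f s) (v s)) = fun s => s `^ (- A) * (Wt A s * v s) + A * f s * (Wt A s * (s `^ (- A) * s^-1)).
  by apply/funext => t; rewrite /mom; ring.
have D1 := DrM (Dr_powRs (- A) s0) (DrV (lt0r_neq0 s0) (Dr_id s)).
have D := DrD (DrM (Dr_powRs (- A) s0) (HW s s1)) (DrM (DrM (Dr_cst A s) (fD s)) (DrM (Dr_Wt A s1) D1)).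
apply: (Dr_eq D); have X0 : 0 < s `^ A by exact: powR_gt0.
rewrite /pot /ampl Wt_om// powRN2 !powRN /gnl /spow.
set X := s `^ A in X0 *; set W := om A s; set V := `|f s| `^ _.
by field; nz.
Qed.

Lemma mass_bounds s : 2 <= s -> wtc A * s <= mass s <= s.
Proof.
move=> s2; have s0 : 0 < s by trim_lra.
have E : s = s `^ (2 * A + 1) * s `^ (- (2 * A)).
  by rewrite -powRDp// addrAC subrr add0r powRr1// ltW.
apply/andP; split.
  by rewrite {1}E mulrA /mass ler_pM2r ?powR_gt0// Wt_ge.
by rewrite {2}E /mass ler_pM2r ?powR_gt0// Wt_le.
Qed.

Let lh0 := lh A 0 (A / 2).
Let lh0_gt0 : 0 < lh0.
Proof. by rewrite /lh0 /lh; have h := A0; nra. Qed.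

(** With th = A / 2 and nu = 0 the coefficient [lh = A^2 / 4] is positive, so the nonincreasing
    functional is coercive and bounds s^A f^2. The constant depends only on a bound for the data at
    [s0], hence is common to neighbouring solutions. *)
Lemma crit_decay : exists2 s0 : R, 2 <= s0 & forall B : R, 0 <= B -> exists2 K : R, 0 <= K &
  forall al f v, issol A g al f v -> `|f s0| <= B -> `|v s0| <= B ->
  forall s, s0 <= s -> `|f s| <= K * s `^ (- (A / 2)).
Proof.
have th0 : 0 < A / 2 by have h := A0; trim_lra.
have thA : A / 2 < A by have h := A0; trim_lra.
have [s0 s02 H] := @lyap_nincr _ A 0 p (A / 2) p1 th0 thA; exists s0 => // B B0.
have lE : A ^+ 2 - 0 ^+ 2 = A ^+ 2 by rewrite expr0n subr0.
rewrite lE in H.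
have pp : 0 < p + 1 by have h := p1; trim_lra.
pose Bq := B + A / 2 * B.
pose LB := s0 `^ (2 * (A / 2)) * (s0 ^+ 2 * Bq ^+ 2 / 2 + (lh0 / 2 + 1) * B ^+ 2 + B `^ (p - 1) * B ^+ 2 / (p + 1)).
exists (Num.sqrt (2 / lh0 * LB)) => [|al f v S fB vB s s0s]; first exact: sqrtr_ge0.
have s_gt0 : 0 < s by trim_lra.
have sp : 0 < s0 by trim_lra.
have i1 : s0^-1 <= 1 by rewrite invf_le1//; trim_lra.
have i0 : 0 <= s0^-1 by rewrite invr_ge0 ltW.
have sqB (x b : R) : `|x| <= b -> x ^+ 2 <= b ^+ 2.
  by move=> xb; rewrite -real_normK ?num_real// ler_sqr ?nnegrE// (le_trans _ xb).
have qB : `|qth (A / 2) f v s0| <= Bq.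
  apply: le_trans (ler_normD _ _) _; apply: lerD => //.
  rewrite normrM normrM (ger0_norm i0) (gtr0_norm th0) -[leRHS]mulr1; apply: ler_pM => //; first by pos.
  by rewrite ler_pM2l.
have h1 : lyap A 0 p (A / 2) f v s0 <= LB.
  rewrite /lyap /LB ler_pM2l ?powR_gt0//; apply: lerD; first apply: lerD.
  - apply: ler_wpM2r => //; apply: ler_pM; [|exact: sqr_ge0| |exact: sqB].
      by rewrite subr_ge0 expr_ge1//; trim_lra.
    by rewrite gerBl.
  - apply: ler_pM; [|exact: sqr_ge0| |exact: sqB].
      have h := lh0_gt0; rewrite -/lh0; have ? : 0 <= s0 ^- 2 by rewrite invr_ge0 sqr_ge0.
      by trim_lra.
    by rewrite lerD2l invf_le1 ?exprn_gt0// expr_ge1//; trim_lra.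
  - apply: ler_wpM2r; first by rewrite invr_ge0 ltW.
    rewrite spow_mul; apply: ler_pM; [exact: powR_ge0|exact: sqr_ge0| |exact: sqB].
    by have h := p1; apply: ge0_ler_powR; rewrite ?nnegrE//; trim_lra.
have h2 := H al f v S s0 s (lexx _) s0s.
have h3 : s `^ (2 * (A / 2)) * (lh0 / 2 * f s ^+ 2) <= lyap A 0 p (A / 2) f v s.
  rewrite /lyap ler_pM2l ?powR_gt0// /lyap0 -/lh0.
  have e1 : 0 <= (s ^+ 2 - 1) * qth (A / 2) f v s ^+ 2 / 2.
    have ? := sqr_ge0 (qth (A / 2) f v s); have ? : 0 <= s ^+ 2 - 1 by rewrite subr_ge0 expr_ge1//; trim_lra.
    by pos.
  have e2 : 0 <= s ^- 2 * f s ^+ 2 by rewrite mulr_ge0 ?sqr_ge0// invr_ge0 sqr_ge0.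
  have e3 : 0 <= spow p (f s) * f s / (p + 1) by rewrite divr_ge0 ?spow_ge0// ltW.
  by rewrite mulrDl; trim_lra.
rewrite powRN ler_pdivlMr ?powR_gt0// -sqrtr_sqr -[X in _ * X](@gtr0_norm _ (s `^ (A / 2))) ?powR_gt0//.
rewrite -[X in _ * X]sqrtr_sqr -sqrtrM ?sqr_ge0// ler_sqrt; last first.
  have ? := lh0_gt0; apply: mulr_ge0; first by pos.
  apply: le_trans (le_trans h3 (le_trans h2 h1)).
  by have ? := powR_ge0 s (2 * (A / 2)); have ? := sqr_ge0 (f s); pos.
have -> : s `^ (A / 2) ^+ 2 = s `^ (2 * (A / 2)).
  by rewrite -powR_mulrn ?powR_ge0// -powRrM mulrC.
have -> : f s ^+ 2 * s `^ (2 * (A / 2)) = 2 / lh0 * (s `^ (2 * (A / 2)) * (lh0 / 2 * f s ^+ 2)).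
  by have ? := lh0_gt0; field; nz.
have ? := lh0_gt0; apply: ler_wpM2l; first by pos.
exact: le_trans h3 (le_trans h2 h1).
Qed.

(** Decay of the potential beyond 1 / s: the term in s^(-2) provides at least 1, and [crit_decay]
    provides (p - 1) A / 2 for |f|^(p-1). *)
Let de := Num.min 1 ((p - 1) * (A / 2)).
Let de0 : 0 < de.
Proof. by rewrite /de lt_min ltr01/=; have h := p1; have h' := A0; pos. Qed.

Lemma pot_le (K : R) f s : 2 <= s -> 0 <= K -> `|f s| <= K * s `^ (- (A / 2)) ->
  `|pot f s| <= (A * (A + 1) + K `^ (p - 1)) * s^-1 * s `^ (- de).
Proof.
move=> s2 K0 fK; have s0 : 0 < s by trim_lra.
have h := p1; have X0 := powR_ge0 s (- (2 * A)).
rewrite /pot normrM normrM (ger0_norm (om_ge0 _ _)) (ger0_norm X0) -mulrA [leRHS]mulrAC [leRHS]mulrC.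
rewrite mulrA; apply: ler_pM => //; first by rewrite mulr_ge0// om_ge0.
  have -> : s^-1 = s `^ (2 * A - 1) * s `^ (- (2 * A)).
    by rewrite -powRDp// addrAC subrr add0r powR_inv1// ltW.
  by apply: ler_wpM2r => //; exact: om_le.
apply: le_trans (ler_normB _ _) _; rewrite [leRHS]mulrDl; apply: lerD.
  rewrite normrM ger0_norm; last by have ? := A0; pos.
  apply: ler_wpM2l; first by have ? := A0; pos.
  rewrite ger0_norm ?invr_ge0 ?sqr_ge0//; apply: (@le_trans _ _ (s `^ (-1))); last first.
    by apply: ler_powR; [trim_lra|rewrite lerN2 /de ge_min lexx].
  by rewrite powR_inv1 ?lef_pV2 ?posrE ?exprn_gt0//; nra.
rewrite ger0_norm ?powR_ge0//; apply: (@le_trans _ _ ((K * s `^ (- (A / 2))) `^ (p - 1))).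
  by apply: ge0_ler_powR; rewrite ?nnegrE ?mulr_ge0 ?powR_ge0//; trim_lra.
rewrite powRM ?powR_ge0// -powRrM; apply: ler_wpM2l; first exact: powR_ge0.
by apply: ler_powR; [trim_lra|rewrite mulNr mulrC lerN2 /de ge_min lexx orbT].
Qed.

(** [T > 0] says that (Y, Z) or its opposite lies in the cone of [linear_trap]; [T <= 0] for all
    large s is the hypothesis of [linear_bounded]. Up to a positive factor Z is A f + s v, and this
    explains why that combination gains s^(-de) while f itself is only O(s^(-A)). *)
Lemma crit_dichotomy : exists2 s0 : R, 2 <= s0 & forall B : R, 0 <= B -> exists2 S : R, s0 <= S &
  exists K : R, forall al f v, issol A g al f v -> `|f s0| <= B -> `|v s0| <= B ->
  let T s := ampl s (f s) * (mom s (f s) (v s) - K * s `^ (- de) * ampl s (f s)) in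
  (forall s, S <= s -> 0 < T s -> forall t, s <= t -> f t != 0) /\
  ((forall s, S <= s -> T s <= 0) -> exists2 C : R, 0 <= C & forall s, S <= s ->
     `|f s| <= C * s `^ (- A) /\ `|A * f s + s * v s| <= C * s `^ (- (A + de))).
Proof.
have [s0 s02 H] := crit_decay; exists s0 => // B B0; have [K1 K10 HK1] := H B B0.
pose C := A * (A + 1) + K1 `^ (p - 1).
have C0 : 0 <= C by have ? := A0; have ? := powR_ge0 K1 (p - 1); rewrite /C; pos.
have c0 := @wtc_gt0 R A.
have dd := de0.
(* Makes [de * K = C + 2]; beyond S the quadratic term of the cone condition is at most 1, and the
   strict inequality holds. *)
pose K := (C + 2) / de.
have K0 : 0 < K by rewrite /K divr_gt0//; trim_lra.
have [S0 S01 HS0] := powR_large (K ^+ 2 / wtc A) dd.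
pose S := Num.max s0 S0.
have sS : s0 <= S by rewrite /S le_max lexx.
exists S => //; exists K => al f v So fB vB T.
have DY s : S <= s -> Dr (fun s => ampl s (f s)) s (mom s (f s) (v s) / mass s).
  by move=> Ss; apply: (Dr_ampl So); trim_lra.
have DZ s : S <= s -> Dr (fun s => mom s (f s) (v s)) s (pot f s * ampl s (f s)).
  by move=> Ss; apply: (Dr_mom So); trim_lra.
have mc s : S <= s -> wtc A * s <= mass s.
  by move=> Ss; have /mass_bounds/andP[] : 2 <= s by trim_lra.
have ms s : S <= s -> mass s <= s.
  by move=> Ss; have /mass_bounds/andP[] : 2 <= s by trim_lra.
have hC s : S <= s -> `|pot f s| <= C * s^-1 * s `^ (- de).
  by move=> Ss; apply: pot_le => //; [trim_lra|apply: (HK1 _ _ _ So fB vB); trim_lra].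
have KS s : S <= s -> K ^+ 2 * s `^ (- de) / wtc A + C < de * K.
  move=> Ss; have -> : de * K = C + 2 by rewrite /K; field; nz.
  have h1 : K ^+ 2 / wtc A <= s `^ de by apply: HS0; apply: le_trans Ss; rewrite /S le_max lexx orbT.
  have s_gt0 : 0 < s by trim_lra.
  suff : K ^+ 2 * s `^ (- de) / wtc A <= 1 by trim_lra.
  by rewrite powRN mulrAC ler_pdivrMr ?powR_gt0// mul1r.
have ge1 s : S <= s -> 1 <= s by trim_lra.
have rest s : S <= s -> forall t, s <= t -> S <= t by move=> a t b; trim_lra.
split.
  move=> s Ss Ts t st; have s_gt0 : 0 < s by trim_lra.
  have t_gt0 : 0 < t by trim_lra.
  have KSs := KS s Ss.
  suff : 0 < ampl t (f t) \/ 0 < - ampl t (f t).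
    by rewrite /ampl; case; apply: contraTneq => ->; rewrite mulr0 ?oppr0 ltxx.
  have [Y0|Y0] := ltP 0 (ampl s (f s)).
    left; apply: (@linear_trap _ (fun s => ampl s (f s)) (fun s => mom s (f s) (v s)) mass (pot f) s
      (wtc A) C de K) => //.
    - exact: ge1.
    - by move=> x sx; apply: DY; trim_lra.
    - by move=> x sx; apply: DZ; trim_lra.
    - by move=> x sx; apply: mc; trim_lra.
    - by move=> x sx; apply: hC; trim_lra.
    - by move: Ts; rewrite /T pmulr_rgt0// subr_gt0.
  right; apply: (@linear_trap _ (fun s => - ampl s (f s)) (fun s => - mom s (f s) (v s)) mass (pot f) s
      (wtc A) C de K) => //.
  - exact: ge1.
  - by move=> x sx; apply: (Dr_eq (DrN (DY x _))); [trim_lra|rewrite mulNr].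
  - by move=> x sx; apply: (Dr_eq (DrN (DZ x _))); [trim_lra|rewrite mulrN].
  - by move=> x sx; apply: mc; trim_lra.
  - by move=> x sx; apply: hC; trim_lra.
  - rewrite oppr_gt0 lt_neqAle Y0 andbT; apply: contraTneq Ts => E.
    by rewrite /T E mul0r ltxx.
  - have Y1 : ampl s (f s) < 0.
      rewrite lt_neqAle Y0 andbT; apply: contraTneq Ts => E.
      by rewrite /T E mul0r ltxx.
    by move: Ts; rewrite /T nmulr_rgt0// subr_lt0 mulrN ltrN2.
move=> T0.
have [|||||||||||b b0 Hb] := @linear_bounded _ (fun s => ampl s (f s)) (fun s => mom s (f s) (v s)) mass (pot f) S
      (wtc A) C de K => //.
- exact: ge1.
- move=> s /T0; rewrite /T mulrBr subr_le0 => h; apply: le_trans h _.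
  by rewrite le_eqVlt; apply/orP; left; apply/eqP; ring.
exists (b + b / wtc A) => [|s Ss]; first by have ? : 0 <= b / wtc A by [rewrite divr_ge0// ltW]; trim_lra.
have s_gt0 : 0 < s by trim_lra.
have X0 : 0 < s `^ A by exact: powR_gt0.
have D0 : 0 < s `^ de by exact: powR_gt0.
have [h1 h2] := Hb s Ss.
have W0 : 0 < Wt A s by apply: Wt_gt0; trim_lra.
have bw : 0 <= b / wtc A by rewrite divr_ge0// ltW.
split.
  apply: (@le_trans _ _ (b * s `^ (- A))); last by apply: ler_wpM2r; [exact: powR_ge0|trim_lra].
  by rewrite powRN ler_pdivlMr// mulrC -[X in X * _](gtr0_norm X0) -normrM.
apply: (@le_trans _ _ (b / wtc A * s `^ (- (A + de)))); last first.
  by apply: ler_wpM2r; [exact: powR_ge0|trim_lra].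
have -> : A * f s + s * v s = mom s (f s) (v s) * (s * s `^ A / Wt A s).
  by rewrite /mom powRN; field; nz.
have q0 : 0 <= s * s `^ A / Wt A s by pos.
rewrite normrM (ger0_norm q0) opprD powRDp// !powRN.
rewrite powRN in h2.
apply: (@le_trans _ _ (b / s `^ de * (s * s `^ A / Wt A s))); first exact: ler_wpM2r.
have h3 : s * s `^ A / Wt A s <= (wtc A * s `^ A)^-1.
  have := @Wt_ge _ A hA s ltac:(trim_lra).
  have -> : s `^ (2 * A + 1) = s `^ A ^+ 2 * s.
    by rewrite powRDp// powRr1 ?ltW// (mulrC 2) powRrM powR_mulrn// powR_ge0.
  move=> h3.
  rewrite ler_pdivrMr// ler_pdivlMl ?mulr_gt0//; apply: le_trans h3.
  by rewrite le_eqVlt; apply/orP; left; apply/eqP; ring.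
apply: (@le_trans _ _ (b / s `^ de * (wtc A * s `^ A)^-1)).
  by apply: ler_wpM2l => //; pos.
by rewrite le_eqVlt; apply/orP; left; apply/eqP; field; nz.
Qed.

End Critical.

(** * Radial solutions of fast decay *)

Section Radial.
Context {R : realType} (A nu p : R).
Hypotheses (hA : 1 / 2 <= A) (p1 : 1 < p) (nu0 : 0 <= nu).
Implicit Types (s x y al a : R) (f v : R -> R).

Let lam := A ^+ 2 - nu ^+ 2.
Let N := 2 * A + 1.
Notation g := (gnl lam p).
Let A0 : 0 < A. Proof. by have h := hA; lra. Qed.

Lemma decay_from1 (h : R -> R) (r C S : R) : continuous h -> 0 <= C ->
  (forall s, S <= s -> `|h s| <= C * s `^ (- r)) ->
  exists2 C' : R, C <= C' & forall s, 1 <= s -> `|h s| <= C' * s `^ (- r).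
Proof.
move=> hc C0 H; pose S' := Num.max 1 S.
have S1 : 1 <= S' by rewrite /S' le_max lexx.
have [c _ Hc] : exists2 c : R, 1 <= c <= S' & forall x, 1 <= x <= S' -> `|h x| * x `^ r <= `|h c| * c `^ r.
  apply: (evt_max (f := fun s => `|h s| * s `^ r)) => // x /andP[x1 _].
  have x0 : 0 < x by trim_lra.
  apply: continuousM; last exact: Dr_continuous (Dr_powRs r x0).
  by apply: continuous_comp; [exact: hc|exact: norm_continuous].
exists (C + `|h c| * c `^ r) => [|s s1]; first by rewrite lerDl mulr_ge0// powR_ge0.
have s0 : 0 < s by trim_lra.
have M0 : 0 <= `|h c| * c `^ r by rewrite mulr_ge0// powR_ge0.
have [sS|Ss] := leP s S'.
  by rewrite powRN ler_pdivlMr ?powR_gt0//; have := Hc s; rewrite s1 sS => /(_ isT); trim_lra.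
apply: le_trans (H s _) _; first by move: Ss; rewrite /S' gt_max => /andP[_ /ltW].
by apply: ler_wpM2r; [exact: powR_ge0|trim_lra].
Qed.

Lemma gnl_le x (M : R) : `|x| <= M -> `|g x| <= (`|lam| + M `^ (p - 1)) * `|x|.
Proof.
move=> xM; apply: le_trans (ler_normD _ _) _; rewrite /spow !normrM mulrDl lerD2l.
apply: ler_wpM2r => //; rewrite ger0_norm ?powR_ge0//.
by have h := p1; apply: ge0_ler_powR; rewrite ?nnegrE ?(le_trans _ xM)//; trim_lra.
Qed.

(** Integrating [(Wt v)' = - om g(f)] gives at most a constant plus a multiple of s^(A - e). As e <
    A the constant is absorbed, and dividing by [Wt], of order s^(2A+1), yields the claim. *)
Lemma velocity_decay al f v (C e S : R) : issol A g al f v -> 0 < e -> e < A -> 2 <= S -> 0 <= C ->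
  (forall s, S <= s -> `|f s| <= C * s `^ (- (A + e))) ->
  exists2 C' : R, 0 <= C' & forall s, S <= s -> `|s * v s| <= C' * s `^ (- (A + e)).
Proof.
move=> So e0 eA S2 C0 H; have [_ fD vc _ HW] := So.
have fC s : S <= s -> `|f s| <= C.
  move=> Ss; apply: le_trans (H s Ss) _; rewrite -[leRHS]mulr1; apply: ler_wpM2l => //.
  by rewrite -(powRr0 s); apply: ler_powR; have h := A0; trim_lra.
pose L := `|lam| + C `^ (p - 1).
have L0 : 0 <= L by rewrite /L addr_ge0// powR_ge0.
pose D : R := L * C / (A - e).
have Ae : 0 < A - e by trim_lra.
have D0 : 0 <= D by rewrite /D; pos.
have DD s : 0 < s -> Dr (fun s => D * s `^ (A - e)) s (L * C * s `^ (A - e) * s^-1).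
  move=> s0; apply: (Dr_eq (DrM (Dr_cst D s) (Dr_powRs (A - e) s0))).
  by rewrite /D; field; nz.
have WB s : S <= s -> `|Wt A s * v s| <= (`|Wt A S * v S| + D) * s `^ (A - e).
  move=> Ss; have s0 : 0 < s by trim_lra.
  have h1 : `|Wt A s * v s - Wt A S * v S| <= D * s `^ (A - e) - D * S `^ (A - e).
    apply: (@Dr_dom _ (fun s => Wt A s * v s) (fun s => D * s `^ (A - e)) (fun s => - (om A s * g (f s)))
      (fun s => L * C * s `^ (A - e) * s^-1) S s Ss).
    - by move=> x /andP[Sx _]; apply: HW; trim_lra.
    - by move=> x /andP[Sx _]; apply: DD; trim_lra.
    - move=> x /andP[Sx _]; apply: Dr_continuous (HW x _); trim_lra.
    - move=> x /andP[Sx _]; apply: Dr_continuous (DD x _); trim_lra.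
    - move=> x /andP[/ltW Sx _]; have x0 : 0 < x by trim_lra.
      rewrite normrN normrM ger0_norm ?om_ge0//.
      have -> : L * C * x `^ (A - e) * x^-1 = x `^ (2 * A - 1) * (L * (C * x `^ (- (A + e)))).
        have -> : x `^ (A - e) = x `^ (2 * A - 1) * x `^ (- (A + e)) * x.
          by rewrite -[X in _ * X]powRr1 ?ltW// -!powRDp//; congr (_ `^ _); ring.
        by field; nz.
      apply: ler_pM => //; first exact: om_ge0.
        by apply: om_le => //; trim_lra.
      apply: le_trans (gnl_le (fC x Sx)) _; apply: ler_wpM2l => //; exact: H.
  have h2 : 1 <= s `^ (A - e) by rewrite -(powRr0 s); apply: ler_powR; trim_lra.
  have h3 := powR_ge0 S (A - e).
  have h4 : `|Wt A s * v s| <= `|Wt A s * v s - Wt A S * v S| + `|Wt A S * v S|.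
    by rewrite -{1}(subrK (Wt A S * v S) (Wt A s * v s)) ler_normD.
  rewrite mulrDl; have h5 : `|Wt A S * v S| <= `|Wt A S * v S| * s `^ (A - e) by rewrite ler_peMr.
  have h6 : 0 <= D * S `^ (A - e) by rewrite mulr_ge0.
  trim_lra.
have c0 := @wtc_gt0 R A.
set B := `|_| + D in WB.
have B0 : 0 <= B by rewrite /B addr_ge0.
exists (B / wtc A) => [|s Ss]; first by rewrite divr_ge0// ltW.
have s0 : 0 < s by trim_lra.
have W0 : 0 < Wt A s by apply: Wt_gt0; trim_lra.
have -> : s * v s = s / Wt A s * (Wt A s * v s) by field; nz.
rewrite normrM ger0_norm; last by pos.
apply: (@le_trans _ _ (s / Wt A s * (B * s `^ (A - e)))).
  by apply: ler_wpM2l; [pos|exact: WB].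
have X0 : 0 < s `^ (A - e) by exact: powR_gt0.
have -> : B / wtc A * s `^ (- (A + e)) = s / (wtc A * s `^ N) * (B * s `^ (A - e)).
  have -> : s `^ N = s `^ (A - e) * s `^ (A + e) * s.
    by rewrite -[X in _ * X]powRr1 ?ltW// -!powRDp//; congr (_ `^ _); rewrite /N; ring.
  by rewrite powRN; have ? : 0 < s `^ (A + e) by [exact: powR_gt0]; field; nz.
apply: ler_wpM2r; first by pos.
apply: ler_wpM2l; first exact: ltW.
have W1 : 0 < wtc A * s `^ N by apply: mulr_gt0 => //; exact: powR_gt0.
by rewrite lef_pV2 ?posrE//; apply: Wt_ge => //; trim_lra.
Qed.

(** For nu = 0 the good mode is s^(-A) itself, so only the combination A f + s v, which annihilates
    it, decays faster. For nu > 0 both f and s v gain a power. *)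
Definition fast f v (C e : R) := forall s, 1 <= s ->
  [/\ `|f s| <= C * s `^ (- A), `|s * v s| <= C * s `^ (- A),
      nu = 0 -> `|A * f s + s * v s| <= C * s `^ (- (A + e)) &
      0 < nu -> `|f s| <= C * s `^ (- (A + e)) /\ `|s * v s| <= C * s `^ (- (A + e))].

Lemma powR_dec s (r e : R) : 1 <= s -> 0 <= e -> s `^ (- (r + e)) <= s `^ (- r).
Proof. by move=> s1 e0; apply: ler_powR => //; trim_lra. Qed.

Lemma fast_crit al f v (C e S : R) : nu = 0 -> issol A g al f v -> 0 < e -> 0 <= C ->
  (forall s, S <= s -> `|f s| <= C * s `^ (- A) /\ `|A * f s + s * v s| <= C * s `^ (- (A + e))) ->
  exists C' : R, fast f v C' e.
Proof.
move=> nuE So e0 C0 H; have [_ fD vc _ _] := So.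
have fc : continuous f by move=> x; exact: Dr_continuous (fD x).
have svc : continuous (fun s => s * v s).
  by move=> x; apply: continuousM; [exact: cvg_id|exact: vc].
have [C1 C1C H1] := decay_from1 fc C0 (fun s Ss => (H s Ss).1).
have kc : continuous (fun s => A * f s + s * v s).
  move=> x; have e1 := continuousM (@cst_continuous _ _ A x) (fc x).
  exact: continuousD e1 (svc x).
have [C2 C2C H2] := decay_from1 kc C0 (fun s Ss => (H s Ss).2).
have [C10 C20] : 0 <= C1 /\ 0 <= C2 by split; trim_lra.
exists (C1 + C2 + A * C1) => s s1; have h1 := H1 s s1; have h2 := H2 s s1.
have AC : 0 <= A * C1 by have ? := A0; pos.
have X0 := powR_ge0 s (- A); have Y0 := powR_ge0 s (- (A + e)).
have XY := powR_dec A s1 (ltW e0).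
split.
- by apply: le_trans h1 _; apply: ler_wpM2r => //; trim_lra.
- have -> : s * v s = (A * f s + s * v s) - A * f s by ring.
  apply: le_trans (ler_normB _ _) _; rewrite normrM (gtr0_norm A0) !mulrDl.
  have h3 : A * `|f s| <= A * C1 * s `^ (- A) by rewrite -mulrA ler_pM2l.
  have h4 : C2 * s `^ (- (A + e)) <= C2 * s `^ (- A) by rewrite ler_wpM2l.
  have h5 : 0 <= C1 * s `^ (- A) by rewrite mulr_ge0.
  trim_lra.
- by move=> _; apply: le_trans h2 _; apply: ler_wpM2r => //; trim_lra.
- by rewrite nuE ltxx.
Qed.

Lemma fast_super al f v (C e S : R) : issol A g al f v -> 0 < e -> e < A -> 0 <= C ->
  (forall s, S <= s -> `|f s| <= C * s `^ (- (A + e))) -> 0 < nu ->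
  exists C' : R, fast f v C' e.
Proof.
move=> So e0 eA C0 H nup; have [_ fD vc _ _] := So.
have fc : continuous f by move=> x; exact: Dr_continuous (fD x).
have svc : continuous (fun s => s * v s).
  by move=> x; apply: continuousM; [exact: cvg_id|exact: vc].
have [C1 C1C H1] := decay_from1 fc C0 H.
have [C10 S2] : 0 <= C1 /\ 2 <= Num.max 2 S by rewrite le_max lexx; split => //; trim_lra.
have H' s : Num.max 2 S <= s -> `|f s| <= C1 * s `^ (- (A + e)).
  by rewrite ge_max => /andP[s2 _]; apply: H1; trim_lra.
have [C2 C20 HC2] := velocity_decay So e0 eA S2 C10 H'.
have [C3 C3C H3] := decay_from1 svc C20 HC2.
exists (C1 + C3) => s s1; have h1 := H1 s s1; have h3 := H3 s s1.
have X0 := powR_ge0 s (- A); have Y0 := powR_ge0 s (- (A + e)).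
have XY := powR_dec A s1 (ltW e0).
have [h4 h5] : `|f s| <= (C1 + C3) * s `^ (- (A + e)) /\ `|s * v s| <= (C1 + C3) * s `^ (- (A + e)).
  by split; [apply: le_trans h1 _|apply: le_trans h3 _]; apply: ler_wpM2r => //; trim_lra.
have h6 : (C1 + C3) * s `^ (- (A + e)) <= (C1 + C3) * s `^ (- A) by apply: ler_wpM2l => //; trim_lra.
split=> //; [exact: le_trans h4 h6|exact: le_trans h5 h6|].
by move=> nuE; have := nup; rewrite nuE ltxx.
Qed.

(** The common shape of the two slow-decay indicators: at fixed s they are quadratic in the
    velocity, with continuous dependence on the value of f. *)
Lemma open_positive (a b : R) (h : R -> R) x y : continuous h -> 0 < a * y ^+ 2 + b * x * y + h x ->
  exists2 d : R, 0 < d & forall x' y', `|x' - x| < d -> `|y' - y| < d ->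
    0 < a * y' ^+ 2 + b * x' * y' + h x'.
Proof.
move=> hc T0; pose T (z : R * R) := a * (z.2 * z.2) + b * z.1 * z.2 + h z.1.
have c1 : {for (x, y), continuous (fun z : R * R => z.1)} by exact: cvg_fst.
have c2 : {for (x, y), continuous (fun z : R * R => z.2)} by exact: cvg_snd.
have Tc : {for (x, y), continuous T}.
  have e1 := continuousM (continuousM (@cst_continuous _ _ b _) c1) c2.
  have e2 := continuousM (@cst_continuous _ _ a _) (continuousM c2 c2).
  have e3 : {for (x, y), continuous (fun z : R * R => h z.1)}.
    by apply: (@continuous_comp _ _ _ fst h); [exact: c1|exact: hc].
  exact: continuousD (continuousD e2 e1) e3.
have : \forall z \near (x, y), 0 < T z by have := Tc; move=> /(_ _ (lt_nbhsr T0)).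
move=> /nbhs_ballP[d /= d0 H]; exists d => // x' y' hx hy; apply: (H (x', y')).
by split; rewrite /= /ball/= distrC.
Qed.

(** A single interface for both cases: the indicator [T] is the cone condition when nu = 0 and minus
    the Lyapunov functional when nu > 0. [S] and [T] depend only on a bound for the data at [s0], so
    the same indicator serves all nearby solutions. *)
Lemma dichotomy : exists2 s0 : R, 2 <= s0 & forall B : R, 0 <= B -> exists2 S : R, s0 <= S &
  exists2 T : R -> R -> R -> R,
  (forall s x y, 0 < T s x y -> exists2 d : R, 0 < d &
    forall x' y', `|x' - x| < d -> `|y' - y| < d -> 0 < T s x' y') &
  forall al f v, issol A g al f v -> `|f s0| <= B -> `|v s0| <= B ->
  (forall s, S <= s -> 0 < T s (f s) (v s) -> forall t, s <= t -> f t != 0) /\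
  ((forall s, S <= s -> T s (f s) (v s) <= 0) -> exists C e : R, 0 < e /\ fast f v C e).
Proof.
have [nuE|nuN] := eqVneq nu 0.
  have lE : lam = A ^+ 2 by rewrite /lam nuE expr0n subr0.
  have [s0 s02 H] := crit_dichotomy hA p1; exists s0 => // B B0.
  have [S sS [K HK]] := H B B0; exists S => //.
  set de := Num.min _ _ in HK.
  have de0 : 0 < de by rewrite /de lt_min ltr01/=; have ? := p1; have ? := A0; pos.
  exists (fun s x y => ampl A s x * (mom A s x y - K * s `^ (- de) * ampl A s x)).
    move=> s x y; pose b := s `^ A * (Wt A s * s `^ (- A)).
    pose h x : R := (b * A / s - K * s `^ (- de) * s `^ A ^+ 2) * (x * x).
    have E x' y' : ampl A s x' * (mom A s x' y' - K * s `^ (- de) * ampl A s x') =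
        0 * y' ^+ 2 + b * x' * y' + h x' by rewrite /ampl /mom /h /b; ring.
    rewrite E => T0; have [d d0 H'] : exists2 d : R, 0 < d & forall x' y', `|x' - x| < d -> `|y' - y| < d ->
        0 < 0 * y' ^+ 2 + b * x' * y' + h x'.
      suff hc : continuous h by exact: open_positive hc T0.
      have ci : continuous (fun x : R => x) by move=> z; exact: cvg_id.
      move=> z; have e1 := continuousM (@cst_continuous _ _ (b * A / s - K * s `^ (- de) * s `^ A ^+ 2) z)
        (continuousM (ci z) (ci z)).
      exact: e1.
    by exists d => // x' y' hx hy; rewrite E; exact: H'.
  move=> al f v; rewrite lE => So fB vB; have [H1 H2] := HK al f v So fB vB.
  split=> // T0; have [C C0 HC] := H2 T0.
  rewrite -lE in So; have [C' HC'] := fast_crit nuE So de0 C0 HC.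
  by exists C', de.
have nup : 0 < nu by rewrite lt_neqAle eq_sym nuN.
pose a0 : R := Num.min nu A / 2.
pose th := A - a0.
have a00 : 0 < a0 by rewrite /a0 divr_gt0// lt_min nup A0.
have a0A : a0 <= A / 2 by rewrite /a0 ler_pM2r// ge_min lexx orbT.
have th0 : 0 < th by have h2 := A0; rewrite /th; trim_lra.
have thA : th < A by rewrite /th; trim_lra.
have [s0 s02 H] := decay_supercritical hA p1 nup; rewrite -/a0 -/th in H.
exists s0 => // B B0; exists s0 => //.
(* At a fixed s the functional sees only the values of f and v there, so constant functions may
   stand in for them. *)
exists (fun s x y => - lyap A nu p th (fun=> x) (fun=> y) s).
  move=> s x y; pose X := - (s `^ (2 * th)); pose k := (s ^+ 2 - 1) / 2.
  pose h x : R := X * ((k * (th / s) ^+ 2 + lh A nu th / 2 + s ^- 2) * (x * x) +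
    (p + 1)^-1 * (`|x| `^ (p - 1) * x * x)).
  have E x' y' : - lyap A nu p th (fun=> x') (fun=> y') s =
      X * k * y' ^+ 2 + X * k * 2 * (th / s) * x' * y' + h x'.
    by rewrite /lyap /lyap0 /qth /spow /h /X /k; ring.
  rewrite E => T0; have [d d0 H'] : exists2 d : R, 0 < d & forall x' y', `|x' - x| < d -> `|y' - y| < d ->
        0 < X * k * y' ^+ 2 + X * k * 2 * (th / s) * x' * y' + h x'.
    suff hc : continuous h by exact: open_positive hc T0.
    move=> z.
    have ci : {for z, continuous (fun x : R => x)} by exact: cvg_id.
    have cp : {for z, continuous (fun x : R => `|x| `^ (p - 1))}.
      by apply: powR_norm_continuous; have ? := p1; trim_lra.
    have e1 := continuousM (@cst_continuous _ _ (k * (th / s) ^+ 2 + lh A nu th / 2 + s ^- 2) z) (continuousM ci ci).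
    have e2 := continuousM (@cst_continuous _ _ ((p + 1)^-1) z) (continuousM (continuousM cp ci) ci).
    exact: continuousM (@cst_continuous _ _ X z) (continuousD e1 e2).
  by exists d => // x' y' hx hy; rewrite E; exact: H'.
move=> al f v So _ _; have [Hn Hd] := H al f v So; split=> [s Ss Ts t st|T0].
  apply: (@lyap_lt0_nonzero _ A nu p th f v t); first trim_lra.
  by apply: le_lt_trans (Hn s t Ss st) _; rewrite -oppr_gt0.
have [|C [s2 [C0 s02' HC]]] := Hd.
  by move=> s s0s; rewrite -oppr_le0; exact: T0.
have e0 : 0 < a0 / 4 by trim_lra.
have [|C' HC'] := fast_super So e0 _ C0 HC nup; first by have := A0; trim_lra.
by exists C', (a0 / 4).
Qed.

Lemma joint_continuity (G : R -> R -> R) (K a s e : R) : 0 <= K -> {for s, continuous (G a)} ->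
  (forall a' s', `|a' - a| < 1 -> 1 <= s' -> s' <= s + 1 -> `|G a' s' - G a s'| <= K * `|a' - a|) ->
  0 < e -> exists2 d : R, 0 < d & forall a' s', 1 <= s' -> `|a' - a| < d -> `|s' - s| < d ->
    `|G a' s' - G a s| < e.
Proof.
move=> K0 Gc H e0; have e2 : 0 < e / 2 by trim_lra.
have [d1/= d10 Hd1] := @cvgr_dist_lt _ _ _ _ _ _ _ Gc _ e2.
have k0 : 0 < e / 2 / (K + 1) by apply: divr_gt0 => //; trim_lra.
exists (Num.min (Num.min 1 d1) (e / 2 / (K + 1))) => [|a' s' s1]; first by rewrite !lt_min ltr01 d10 k0.
rewrite !lt_min => /andP[/andP[a1 _] ak] /andP[/andP[sa sd] _].
have h1 : `|G a' s' - G a s'| <= e / 2.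
  apply: le_trans (H a' s' a1 s1 _) _.
    by have := ler_norm (s' - s); trim_lra.
  rewrite -(@divfK _ (K + 1) _ (e / 2)) ?gt_eqF//; last by trim_lra.
  have := ltW ak; rewrite -[leLHS]mul1r => h; rewrite mulrC.
  by apply: ler_pM => //; [rewrite -[leLHS]mul1r|trim_lra].
have h2 : `|G a s' - G a s| < e / 2.
  by rewrite distrC; apply: Hd1; rewrite /ball /= distrC.
have -> : G a' s' - G a s = (G a' s' - G a s') + (G a s' - G a s) by ring.
by apply: le_lt_trans (ler_normD _ _) _; trim_lra.
Qed.

Hypothesis subcrit : (2 * A - 1) / 2 < (2 * A + 1) / (p + 1).

Lemma radial_solution (M : R) : exists al f v, [/\ issol A g al f v,
  exists C e : R, 0 < e /\ fast f v C e &
  exists z c : R, [/\ 2 <= z <= 3, f z = 0, v z != 0, 2 <= c <= 3 & M <= `|f c|]].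
Proof.
have [b1 b11 Hb1] := many_zeros lam hA p1 subcrit 1 M.
have Lp (K : R) : 0 <= K -> 0 < `|lam| + p * K `^ (p - 1) + 1.
  move=> K0; have h : 0 <= p * K `^ (p - 1) by apply: mulr_ge0; [have ? := p1; trim_lra|exact: powR_ge0].
  by have ? := normr_ge0 lam; trim_lra.
have lip (K x y : R) : 0 <= K -> `|x| <= K -> `|y| <= K ->
    `|g x - g y| <= (`|lam| + p * K `^ (p - 1) + 1) * `|x - y|.
  move=> K0 xK yK; apply: le_trans (gnl_lip lam p1 K0 xK yK) _.
  by apply: ler_wpM2r => //; trim_lra.
(* Beyond [b1] the large value and the zero in [2, 3] come for free, so only fast decay remains to
   be found there. *)
suff [al [f [v [ba So Hf]]]] : exists al f v, [/\ b1 <= al, issol A g al f v & exists C e : R, 0 < e /\ fast f v C e].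
  exists al, f, v; split=> //; have [_ [z [c z23 [c23 [fz Mc]]]]] := Hb1 al f v ba So.
  exists z, c; split=> //.
  have al0 : 0 < `|al| by rewrite normr_gt0 gt_eqF//; trim_lra.
  have [K aK [HK _]] := issol_exists lam hA p1 al0.
  have K0 : 0 <= K by trim_lra.
  apply: (@issol_simple_zero _ A hA g al f v (`|lam| + p * K `^ (p - 1) + 1) z So _ _ _ _ fz).
  - exact: Lp.
  - move=> t t1; have := lip K (f t) 0 K0 (HK al f v (lexx _) So t t1).
    have g0 : g 0 = 0 by rewrite /gnl /spow !mulr0 addr0.
    by rewrite normr0 g0 !subr0; apply.
  - by rewrite gt_eqF//; trim_lra.
  - by move/andP: z23 => []; trim_lra.
apply: contrapT => nofast.
have ex a : exists fv : (R -> R) * (R -> R), b1 <= a -> issol A g a fv.1 fv.2.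
  have [ba|ab] := leP b1 a; last by exists (fun=> 0, fun=> 0).
  have a0 : 0 < a by trim_lra.
  have [K _ [_ /(_ a)]] := issol_exists lam hA p1 a0.
  rewrite ger0_norm; last exact: ltW.
  by rewrite lexx => /(_ isT)[f [v So]]; exists (f, v).
have [FV HFV] := choice ex.
pose F a := (FV a).1; pose V a := (FV a).2.
have So a : b1 <= a -> issol A g a (F a) (V a) by exact: HFV.
have near_dep a s : b1 <= a -> 1 <= s -> exists2 K : R, 0 <= K & forall a' s', b1 <= a' -> `|a' - a| < 1 ->
    1 <= s' -> s' <= s + 1 -> `|F a' s' - F a s'| <= K * `|a' - a| /\ `|V a' s' - V a s'| <= K * `|a' - a|.
  move=> ba s1; have a0 : 0 < a + 1 by trim_lra.
  have [K aK [HK _]] := issol_exists lam hA p1 a0.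
  have K0 : 0 <= K by trim_lra.
  pose L := `|lam| + p * K `^ (p - 1) + 1.
  have L0 : 0 < L by exact: Lp.
  have N0 : 0 < N by rewrite /N; have ? := A0; trim_lra.
  have LN : 0 < L / N by pos.
  exists ((2 + 2 * (L / N)) * expR (2 * (L / N) * s)) => [|a' s' ba' a'1 s1' s's]; first by pos.
  have bnd b : b1 <= b -> `|b - a| < 1 -> forall t, 1 <= t -> `|F b t| <= K.
    move=> bb ba1; apply: (HK b _ (V b)) => //; last exact: So.
    by rewrite ger0_norm; have := ler_norm (b - a); trim_lra.
  have aa1 : `|a - a| < 1 by rewrite subrr normr0.
  have [h1 h2] := issol_dep hA (So a' ba') (So a ba) L0 (fun x y => @lip K x y K0) (bnd a' ba' a'1)
    (bnd a ba aa1) s1'.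
  have E : expR (2 * (L / N) * (s' - 1)) <= expR (2 * (L / N) * s).
    by rewrite ler_expR; apply: ler_wpM2l; [pos|trim_lra].
  have e0 := expR_ge0 (2 * (L / N) * (s' - 1)); have n0 := normr_ge0 (a' - a).
  have c1 : 2 <= 2 + 2 * (L / N) by trim_lra.
  have c2 : 2 * (L / N) <= 2 + 2 * (L / N) by trim_lra.
  split; [apply: le_trans h1 _|apply: le_trans h2 _].
    rewrite [leLHS]mulrAC; apply: ler_wpM2r => //; apply: ler_pM => //.
  rewrite [leLHS]mulrAC; apply: ler_wpM2r => //; apply: ler_pM => //; pos.
pose nd (G : R -> R -> R) := forall a s, b1 <= a -> 1 <= s -> exists2 K : R, 0 <= K &
  forall a' s', b1 <= a' -> `|a' - a| < 1 -> 1 <= s' -> s' <= s + 1 -> `|G a' s' - G a s'| <= K * `|a' - a|.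
have ndF : nd F.
  move=> a s ba s1; have [K K0 HK] := near_dep a s ba s1; exists K => // a' s' h1 h2 h3 h4.
  by have [] := HK a' s' h1 h2 h3 h4.
have ndV : nd V.
  move=> a s ba s1; have [K K0 HK] := near_dep a s ba s1; exists K => // a' s' h1 h2 h3 h4.
  by have [] := HK a' s' h1 h2 h3 h4.
have jc (G : R -> R -> R) : (forall a, b1 <= a -> continuous (G a)) ->
   nd G ->
   forall a s e, b1 <= a -> 1 <= s -> 0 < e -> exists2 d : R, 0 < d &
    forall a' s', b1 <= a' -> 1 <= s' -> `|a' - a| < d -> `|s' - s| < d -> `|G a' s' - G a s| < e.
  move=> Gc GK a s e ba s1 e0; have [K K0 HK] := GK a s ba s1.
  pose G' a' s' := if b1 <= a' then G a' s' else G a s'.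
  have [||d d0 Hd] := @joint_continuity G' K a s e K0 _ _ e0.
  - by rewrite /G' ba; exact: Gc.
  - move=> a' s' h1 h2 h3; rewrite /G' ba; case: ifP => h4; first exact: HK.
    by rewrite subrr normr0 mulr_ge0.
  - exists d => // a' s' ba' s1' h1 h2; have := Hd a' s' s1' h1 h2.
    by rewrite /G' ba ba'.
have FD a : b1 <= a -> forall s, Dr (F a) s (V a s) by move=> /So[].
have VC a : b1 <= a -> continuous (V a) by move=> /So[].
have jcF := jc F (fun a ba s => Dr_continuous (FD a ba s)) ndF.
have jcV := jc V VC ndV.
have [|||m Hm] := @zeros_bounded _ b1 F V FD jcF jcV.
- move=> a s ba; rewrite le_eqVlt => /predU1P[<-|s1] Fs.
    have [F1 _ _ _ _] := So a ba; have : a = 0 by rewrite -F1.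
    by move=> a0; move: ba b11; rewrite a0; trim_lra.
  have a0 : 0 < a by trim_lra.
  have [K aK [HK _]] := issol_exists lam hA p1 a0.
  have K0 : 0 <= K by trim_lra.
  have aa : `|a| <= a by rewrite ger0_norm// ltW.
  apply: (@issol_simple_zero _ A hA g a (F a) (V a) (`|lam| + p * K `^ (p - 1) + 1) s (So a ba) _ _ _ _ Fs).
  - exact: Lp.
  - move=> t t1; have := lip K (F a t) 0 K0 (HK a _ _ aa (So a ba) t t1).
    have g0 : g 0 = 0 by rewrite /gnl /spow !mulr0 addr0.
    by rewrite normr0 g0 !subr0; apply.
  - by rewrite gt_eqF.
  - exact: s1.
- by move=> a ba; have [-> _ _ _ _] := So a ba; rewrite gt_eqF//; trim_lra.
- move=> a ba; have [s0 s02 HD] := dichotomy.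
  (* The margin 1 lets solutions with nearby data satisfy the same bound at [s0], so that one
     indicator [T] applies to all of them. *)
  have [B [B0 FB VB]] : exists B : R, [/\ 0 <= B, `|F a s0| + 1 <= B & `|V a s0| + 1 <= B].
    exists (`|F a s0| + `|V a s0| + 1).
    by have ? := normr_ge0 (F a s0); have ? := normr_ge0 (V a s0); split; trim_lra.
  have [S sS [T Topen HT]] := HD B B0.
  have [FB' VB'] : `|F a s0| <= B /\ `|V a s0| <= B by split; trim_lra.
  have [_ H2] := HT a _ _ (So a ba) FB' VB'.
  have [s Ss Ts] : exists2 s : R, S <= s & 0 < T s (F a s) (V a s).
    apply: contrapT => no; apply: nofast; exists a, (F a), (V a); split => //; first exact: So.
    apply: H2 => s Ss; rewrite leNgt; apply/negP => Ts; apply: no; exists s => //.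
  have [d d0 Hd] := Topen _ _ _ Ts.
  have s1 : 1 <= s by trim_lra.
  have s01 : 1 <= s0 by trim_lra.
  have [d1 d10 Hd1] := jcF a s d ba s1 d0.
  have [d2 d20 Hd2] := jcV a s d ba s1 d0.
  have [d3 d30 Hd3] := jcF a s0 1 ba s01 ltr01.
  have [d4 d40 Hd4] := jcV a s0 1 ba s01 ltr01.
  exists s; split=> //; exists (Num.min (Num.min d1 d2) (Num.min d3 d4)).
    by rewrite !lt_min d10 d20 d30 d40.
  move=> a' t ba'; rewrite !lt_min => /andP[/andP[h1 h2] /andP[h3 h4]] st.
  have z1 (d' : R) x : 0 < d' -> `|x - x| < d' by rewrite subrr normr0.
  have k3 := Hd3 a' s0 ba' s01 h3 (z1 _ _ d30).
  have k4 := Hd4 a' s0 ba' s01 h4 (z1 _ _ d40).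
  have fB : `|F a' s0| <= B.
    by have := ler_normD (F a' s0 - F a s0) (F a s0); rewrite subrK; trim_lra.
  have vB : `|V a' s0| <= B.
    by have := ler_normD (V a' s0 - V a s0) (V a s0); rewrite subrK; trim_lra.
  have [H1 _] := HT a' _ _ (So a' ba') fB vB.
  apply: (H1 s Ss _ t st); apply: Hd.
    exact: Hd1 ba' s1 h1 (z1 _ _ d10).
  exact: Hd2 ba' s1 h2 (z1 _ _ d20).
have [b2 b21 Hb2] := many_zeros lam hA p1 subcrit m M.
have bb : b1 <= Num.max b1 b2 by rewrite le_max lexx.
apply: (Hm (Num.max b1 b2) bb).
have [] := Hb2 (Num.max b1 b2) _ _ _ (So _ bb) => //.
by rewrite le_max lexx orbT.
Qed.

End Radial.

(** * Regularity at the centre *)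

Section Centre.
Context {R : realType} (A lam p : R).
Hypotheses (hA : 1 / 2 <= A) (p1 : 1 < p).
Implicit Types (s al : R) (f v : R -> R).

Let N := 2 * A + 1.
Notation g := (gnl lam p).

Section Solution.
Context (al : R) (f v : R -> R).
Hypothesis S : issol A g al f v.

Let b0 : R := - g al / N.
(** The value of f''(1), obtained by differentiating the equation once at s = 1. *)
Let b1 : R := - (N * b0 + (lam + p * `|al| `^ (p - 1)) * b0) / (N + 2).
Let N1 : 1 <= N. Proof. by have h := hA; rewrite /N; lra. Qed.

(* The solution for [s >= 1], continued by its Taylor polynomial for [s < 1]. *)
Definition ext0 s := if s <= 1 then al + b0 * (s - 1) + b1 * (s - 1) ^+ 2 / 2 else f s.
Definition ext1 s := if s <= 1 then b0 + b1 * (s - 1) else v s.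
Definition ext2 s := if s <= 1 then b1 else - (N * s * v s + g (f s)) / (s ^+ 2 - 1).

Let P s := b0 + b1 * (s - 1).
Let Bk s := g (f s) + N * s * P s + (s ^+ 2 - 1) * b1.

(** [Bk] is the residual left in the equation by the Taylor polynomial [P] of v; the choice of b0
    and b1 makes it vanish at 1 together with its derivative. Since [(Wt (v - P))' = - om Bk],
    comparison with [e Wt (s - 1)] bounds v - P. *)
Lemma centre_expansion (e : R) : 0 < e -> exists2 d : R, 0 < d & forall s, 1 < s -> s < 1 + d ->
  `|v s - P s| <= e * (s - 1) /\ `|Bk s| <= e * (s - 1).
Proof.
move=> e0; have [f1 fD vc v1 HW] := S; have N0 : 0 < N by have h := N1; trim_lra.
have N2 : 0 < N + 2 by trim_lra.
have vb : v 1 = b0 by rewrite v1.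
have DB : Dr Bk 1 0.
  have D1 := Dr_comp (fD 1) (Dr_gnl lam p1 (f 1)).
  have D2 := DrM (DrM (Dr_cst N 1) (Dr_id 1)) (DrD (Dr_cst b0 1) (DrM (Dr_cst b1 1) (DrB (Dr_id 1) (Dr_cst 1 1)))).
  have D3 := DrM (DrB (DrX 2 (Dr_id 1)) (Dr_cst 1 1)) (Dr_cst b1 1).
  apply: (Dr_eq (DrD (DrD D1 D2) D3)); rewrite f1 vb /b1 /=.
  by field; nz.
have B1 : Bk 1 = 0.
  by rewrite /Bk /P f1 /b0; field; nz.
have [d d0 Hd] := (Dr_epsP Bk 1 0).1 DB e e0.
have HB s : 1 < s -> s < 1 + d -> `|Bk s| <= e * (s - 1).
  move=> s1 sd; have E : `|s - 1| = s - 1 by rewrite gtr0_norm//; trim_lra.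
  have := Hd s; rewrite E B1 subr0 mul0r subr0; apply; trim_lra.
exists d => // s s1 sd; split; last exact: HB.
have W0 := Wt_gt0 A s1.
have DWP x : 1 < x -> Dr (fun s => Wt A s * (v s - P s)) x (- (om A x * Bk x)).
  move=> x1; have -> : (fun s => Wt A s * (v s - P s)) = (fun s => Wt A s * v s - Wt A s * P s).
    by apply/funext => t; rewrite mulrBr.
  have D2 := DrM (Dr_Wt A x1) (DrD (Dr_cst b0 x) (DrM (Dr_cst b1 x) (DrB (Dr_id x) (Dr_cst 1 x)))).
  apply: (Dr_eq (DrB (HW x x1) D2)); rewrite Wt_om// /Bk /P -/N /=; ring.
have DWe x : 1 < x -> Dr (fun s => e * (Wt A s * (s - 1))) x (e * (N * x * om A x * (x - 1) + Wt A x)).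
  move=> x1; have D2 := DrM (Dr_cst e x) (DrM (Dr_Wt A x1) (DrB (Dr_id x) (Dr_cst 1 x))).
  by apply: (Dr_eq D2); rewrite -/N; ring.
have Wc := @Wt_continuous R A hA.
have Pc : continuous (fun s => v s - P s).
  move=> x; have D := Dr_continuous (DrD (Dr_cst b0 x) (DrM (Dr_cst b1 x) (DrB (Dr_id x) (Dr_cst 1 x)))).
  exact: continuousB (vc x) D.
have Qc : continuous (fun s => e * (Wt A s * (s - 1))).
  move=> x; have D := Dr_continuous (DrB (Dr_id x) (Dr_cst 1 x)).
  exact: continuousM (@cst_continuous _ _ e x) (continuousM (Wc x) D).
have : `|Wt A s * (v s - P s) - Wt A 1 * (v 1 - P 1)| <=
    e * (Wt A s * (s - 1)) - e * (Wt A 1 * (1 - 1)).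
  apply: (@Dr_dom _ (fun s => Wt A s * (v s - P s)) (fun s => e * (Wt A s * (s - 1)))
    (fun x => - (om A x * Bk x)) (fun x => e * (N * x * om A x * (x - 1) + Wt A x)) 1 s (ltW s1)).
  - by move=> x /andP[x1 _]; exact: DWP.
  - by move=> x /andP[x1 _]; exact: DWe.
  - by move=> x _; exact: continuousM (Wc x) (Pc x).
  - by move=> x _; exact: Qc.
  - move=> x /andP[x1 xs]; rewrite normrN normrM ger0_norm ?om_ge0//.
    have o0 := om_ge0 A x; have Wx := Wt_gt0 A x1.
    have h1 : om A x * `|Bk x| <= om A x * (e * (x - 1)).
      by apply: ler_wpM2l => //; apply: HB => //; trim_lra.
    apply: le_trans h1 _; have -> : om A x * (e * (x - 1)) = e * (om A x * (x - 1)) by ring.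
    rewrite ler_pM2l//.
    have h2 : 1 <= N * x by have h := N1; nra.
    have h3 : 0 <= om A x * (x - 1) by apply: mulr_ge0 => //; trim_lra.
    have h4 : om A x * (x - 1) <= N * x * (om A x * (x - 1)) by rewrite ler_peMl.
    by move: h4 Wx; rewrite mulrA; set X := _ * (x - 1); set Y := Wt A x; trim_lra.
rewrite Wt1// !mul0r mulr0 !subr0 normrM gtr0_norm// mulrCA ler_pM2l//.
Qed.

Lemma Dr_paste (h1 h2 h : R -> R) (d : R) : Dr h1 1 d ->
  h1 1 = h2 1 -> (forall e : R, 0 < e -> exists2 de : R, 0 < de & forall s, 1 < s -> s < 1 + de ->
     `|h2 s - h2 1 - d * (s - 1)| <= e * (s - 1)) ->
  (forall s, h s = if s <= 1 then h1 s else h2 s) -> Dr h 1 d.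
Proof.
move=> D1 h12 D2 hE; apply/Dr_epsP => e e0.
have [d1 d10 H1] := (Dr_epsP h1 1 d).1 D1 e e0; have [d2 d20 H2] := D2 e e0.
exists (Num.min d1 d2) => [|y]; first by rewrite lt_min d10.
rewrite lt_min => /andP[y1 y2]; rewrite !hE lexx; case: (leP y 1) => yl; first exact: H1.
rewrite h12; have E : `|y - 1| = y - 1 by rewrite gtr0_norm// subr_gt0.
by rewrite E; apply: H2 => //; move: y2; rewrite E; trim_lra.
Qed.

Lemma Dr_ext0 s : Dr ext0 s (ext1 s).
Proof.
have [f1 fD vc v1 HW] := S; have vb : v 1 = b0 by rewrite v1.
have Dl x : Dr (fun s => al + b0 * (s - 1) + b1 * (s - 1) ^+ 2 / 2) x (b0 + b1 * (x - 1)).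
  have D := DrD (DrD (Dr_cst al x) (DrM (Dr_cst b0 x) (DrB (Dr_id x) (Dr_cst 1 x))))
    (DrM (DrM (Dr_cst b1 x) (DrX 2 (DrB (Dr_id x) (Dr_cst 1 x)))) (Dr_cst 2^-1 x)).
  by apply: (Dr_eq D); field.
have [s1|s1|->] := ltgtP s 1.
- rewrite /ext1 ltW//; apply: (Dr_near _ (Dl s)).
  by near=> t; rewrite /ext0 ltW//; near: t; exact: lt_nbhsl.
- rewrite /ext1 leNgt s1/=; apply: (Dr_near _ (fD s)).
  by near=> t; rewrite /ext0 leNgt ifN// negbK; near: t; exact: lt_nbhsr.
rewrite /ext1 lexx subrr mulr0 addr0.
apply: (@Dr_paste (fun s => al + b0 * (s - 1) + b1 * (s - 1) ^+ 2 / 2) f) => //.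
- by apply: (Dr_eq (Dl 1)); rewrite subrr mulr0 addr0.
- by rewrite f1 subrr; ring.
- move=> e e0; have [d d0 Hd] := (Dr_epsP f 1 b0).1 (Dr_eq (fD 1) vb) e e0.
  exists d => // t t1 td; have E : `|t - 1| = t - 1 by rewrite gtr0_norm// subr_gt0.
  by have := Hd t; rewrite E; apply; trim_lra.
Unshelve. all: by end_near. Qed.

Lemma Dr_ext1 s : Dr ext1 s (ext2 s).
Proof.
have [f1 fD vc v1 HW] := S; have vb : v 1 = b0 by rewrite v1.
have Dl x : Dr (fun s => b0 + b1 * (s - 1)) x b1.
  have D := DrD (Dr_cst b0 x) (DrM (Dr_cst b1 x) (DrB (Dr_id x) (Dr_cst 1 x))).
  by apply: (Dr_eq D); ring.
have [s1|s1|->] := ltgtP s 1.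
- rewrite /ext2 ltW//; apply: (Dr_near _ (Dl s)).
  by near=> t; rewrite /ext1 ltW//; near: t; exact: lt_nbhsl.
- rewrite /ext2 leNgt s1/=; apply: (Dr_near _ (issol_v S s1)).
  by near=> t; rewrite /ext1 leNgt ifN// negbK; near: t; exact: lt_nbhsr.
rewrite /ext2 lexx.
apply: (@Dr_paste (fun s => b0 + b1 * (s - 1)) v) => //.
- by rewrite vb subrr mulr0 addr0.
- move=> e e0; have [d d0 Hd] := centre_expansion e0.
  exists d => // t t1 td; have [h _] := Hd t t1 td.
  by rewrite vb; move: h; rewrite /P opprD addrA.
Unshelve. all: by end_near. Qed.

Lemma ext2_continuous : continuous ext2.
Proof.
have [f1 fD vc v1 HW] := S; move=> s.
have N0 : 0 < N by have h := N1; trim_lra.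
have gc x := Dr_continuous (Dr_comp (fD x) (Dr_gnl lam p1 (f x))).
have rc x : 1 < x -> {for x, continuous (fun s => - (N * s * v s + g (f s)) / (s ^+ 2 - 1))}.
  move=> x1; have sx : x ^+ 2 - 1 != 0 by rewrite gt_eqF// sq1_gt0.
  have e1 := Dr_continuous (DrM (Dr_cst N x) (Dr_id x)).
  have e2 := Dr_continuous (@DrV _ (fun s => s ^+ 2 - 1) x _ sx (DrB (DrX 2 (Dr_id x)) (Dr_cst 1 x))).
  exact: continuousM (continuousN (continuousD (continuousM e1 (vc x)) (gc x))) e2.
have [s1|s1|->] := ltgtP s 1.
- apply: (@near_cst_continuous _ _ b1).
  by near=> t; rewrite /ext2 ltW//; near: t; exact: lt_nbhsl.
- apply: (cvg_trans _ (_ : (fun s => - (N * s * v s + g (f s)) / (s ^+ 2 - 1)) @ s --> ext2 s)).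
    apply: near_eq_cvg; near=> t; rewrite /ext2 leNgt ifN// negbK; near: t; exact: lt_nbhsr.
  by rewrite /ext2 leNgt s1; exact: rc.
apply/cvgrPdist_le => e e0; have k0 : 0 < e / (N + 1) by apply: divr_gt0 => //; trim_lra.
have [d d0 Hd] := centre_expansion k0.
exists d => //= t; rewrite /ball/= => td; rewrite /ext2 lexx.
case: (leP t 1) => t1; first by rewrite subrr normr0 ltW.
have t1d : t < 1 + d by move: td; rewrite distrC gtr0_norm ?subr_gt0//; trim_lra.
have [h1 h2] := Hd t t1 t1d.
have q0 := sq1_gt0 t1.
(* The difference is written through the two small quantities of [centre_expansion], each o(t - 1),
   against a denominator of order t - 1. *)
have -> : b1 - - (N * t * v t + g (f t)) / (t ^+ 2 - 1) = (N * t * (v t - P t) + Bk t) / (t ^+ 2 - 1).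
  by rewrite /Bk; field; rewrite gt_eqF.
rewrite normrM (gtr0_norm (_ : 0 < (_)^-1)) ?invr_gt0// ler_pdivrMr//.
apply: le_trans (ler_normD _ _) _; rewrite normrM gtr0_norm; last by rewrite mulr_gt0//; trim_lra.
have h3 : N * t * `|v t - P t| <= N * t * (e / (N + 1) * (t - 1)).
  by apply: ler_wpM2l => //; rewrite mulr_ge0//; trim_lra.
apply: le_trans (lerD h3 h2) _.
have -> : e * (t ^+ 2 - 1) = e / (N + 1) * (t - 1) * ((N + 1) * (t + 1)) by field; rewrite gt_eqF//; trim_lra.
have -> : N * t * (e / (N + 1) * (t - 1)) + e / (N + 1) * (t - 1) = e / (N + 1) * (t - 1) * (N * t + 1) by ring.
apply: ler_wpM2l; first by apply: mulr_ge0; trim_lra.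
by nra.
Unshelve. all: by end_near. Qed.

Lemma ext_ode s : 1 <= s -> (s ^+ 2 - 1) * ext2 s + N * s * ext1 s + g (ext0 s) = 0.
Proof.
have N0 : 0 < N by have h := N1; trim_lra.
rewrite le_eqVlt => /predU1P[<-|s1].
  have -> : ext1 1 = b0 by rewrite /ext1 lexx subrr mulr0 addr0.
  have -> : ext0 1 = al by rewrite /ext0 lexx subrr expr0n/= !mulr0 mul0r !addr0.
  by rewrite expr1n subrr mul0r add0r mulr1 /b0; field; rewrite gt_eqF.
rewrite /ext0 /ext1 /ext2 leNgt s1/=; field.
by rewrite gt_eqF// sq1_gt0.
Qed.

Lemma ext0E s : 1 <= s -> ext0 s = f s.
Proof.
rewrite le_eqVlt => /predU1P[<-|s1]; last by rewrite /ext0 leNgt s1.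
by have [-> _ _ _ _] := S; rewrite /ext0 lexx subrr expr0n/= !mulr0 mul0r !addr0.
Qed.

Lemma ext1E s : 1 <= s -> ext1 s = v s.
Proof.
rewrite le_eqVlt => /predU1P[<-|s1]; last by rewrite /ext1 leNgt s1.
by have [_ _ _ -> //] := S; rewrite /ext1 lexx subrr mulr0 addr0.
Qed.

End Solution.

(** C^2 on the whole line, so that chain rules in x need no one-sided derivatives at points with s =
    1. The equation is kept undivided and holds at s = 1 as well. *)
Definition profile (f v w : R -> R) := [/\ forall s, Dr f s (v s), forall s, Dr v s (w s),
  continuous w & forall s, 1 <= s -> (s ^+ 2 - 1) * w s + N * s * v s + g (f s) = 0].

Lemma issol_profile al f v : issol A g al f v -> exists f' v' w,
  [/\ profile f' v' w, forall s, 1 <= s -> f' s = f s & forall s, 1 <= s -> v' s = v s].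
Proof.
move=> S; exists (ext0 al f), (ext1 al v), (ext2 al f v); split.
- by split; [exact: Dr_ext0 S|exact: Dr_ext1 S|exact: ext2_continuous S|exact: ext_ode].
- by move=> s s1; apply: (ext0E S).
- by move=> s s1; apply: (ext1E S).
Qed.

End Centre.

(** * Smooth functions of one variable *)

Section Smooth1.
Context {R : realType}.
Implicit Types (f g h v w : R -> R) (s x y : R).

(** The functions s^(-m) exp(-1/s) extended by 0: the span of this family is closed under
    differentiation, unlike exp(-1/s) alone. *)
Definition bump_pow (m : nat) s : R := if s <= 0 then 0 else s^-1 ^+ m * expR (- s^-1).

Lemma bump_pow_pos m s : 0 < s -> bump_pow m s = s^-1 ^+ m * expR (- s^-1).
Proof. by move=> s0; rewrite /bump_pow leNgt s0. Qed.

Lemma bump_pow_ge0 m s : 0 <= bump_pow m s.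
Proof.
rewrite /bump_pow; case: (leP s 0) => // s0.
by rewrite mulr_ge0 ?expR_ge0// exprn_ge0// invr_ge0 ltW.
Qed.

Lemma bump_pow_le m s : `|bump_pow m s| <= m.+2%:R ^+ m.+2 * s ^+ 2.
Proof.
rewrite ger0_norm ?bump_pow_ge0//; rewrite /bump_pow; case: (leP s 0) => s0.
  by rewrite mulr_ge0 ?sqr_ge0// exprn_ge0.
set k : R := m.+2%:R; have k0 : 0 < k by rewrite /k ltr0n.
have h1 : (k * s)^-1 ^+ m.+2 <= expR s^-1.
  have -> : s^-1 = k * (k * s)^-1 by field; rewrite !gt_eqF.
  rewrite /k expRM_natl -/k; apply: lerXn2r; rewrite ?nnegrE ?expR_ge0//.
    by rewrite invr_ge0 mulr_ge0 ?ltW.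
  by apply: le_trans (expR_ge1Dx _); rewrite lerDr.
rewrite expRN; apply: (@le_trans _ _ (s^-1 ^+ m * (k * s) ^+ m.+2)).
  apply: ler_wpM2l; first by rewrite exprn_ge0// invr_ge0 ltW.
  rewrite -[leRHS]invrK lef_pV2 ?posrE ?expR_gt0 ?invr_gt0 ?exprn_gt0 ?mulr_gt0//.
  by rewrite -exprVn.
rewrite exprMn mulrCA; apply: ler_wpM2l; first by rewrite exprn_ge0// ltW.
by rewrite -addn2 exprD mulrA -exprMn mulVf ?gt_eqF// expr1n mul1r.
Qed.

Lemma Dr_bump_pow m s : Dr (bump_pow m) s (- m%:R * bump_pow m.+1 s + bump_pow m.+2 s).
Proof.
have [s0|s0|->] := ltgtP s 0.
- rewrite /bump_pow ltW// mulr0 addr0; apply: (Dr_near _ (Dr_cst 0 s)).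
  by near=> t; rewrite ltW//; near: t; exact: lt_nbhsl.
- rewrite !bump_pow_pos//.
  apply: (@Dr_near _ (fun t => t^-1 ^+ m * expR (- t^-1))).
    by near=> t; rewrite bump_pow_pos//; near: t; exact: lt_nbhsr.
  have DI := DrV (lt0r_neq0 s0) (Dr_id s).
  have D := DrM (DrX m DI) (Dr_comp (DrN DI) (Dr_expR (- s^-1))).
  apply: (Dr_eq D); case: m {D} => [|m] /=.
    by rewrite mulr0n !mul0r !mulr0 oppr0 mul0r add0r addr0 expr0 mul1r -!exprVn; ring.
  rewrite !exprS; set y := s^-1 ^+ m; set E := expR _.
  by field; rewrite gt_eqF.
apply/Dr_epsP => e e0; pose c : R := m.+2%:R ^+ m.+2.
have c0 : 0 < c by rewrite /c exprn_gt0// ltr0n.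
exists (e / c) => [|y]; first exact: divr_gt0.
rewrite /bump_pow lexx mulr0 addr0 mul0r !subr0 => yc.
apply: le_trans (bump_pow_le m y) _; rewrite -/c -real_normK ?num_real// expr2 mulrA.
by apply: ler_wpM2r => //; move: yc; rewrite ltr_pdivlMr// mulrC => /ltW.
Unshelve. all: by end_near. Qed.

(** A class generated by the operations used below and stable under differentiation, so that
    smoothness is never proved by iterated derivatives. Closure under primitives admits the smooth
    step, an integral of a bump, and the approximations in C^1. *)
Inductive Sm : (R -> R) -> Prop :=
| Sm_cst c : Sm (fun=> c)
| Sm_id : Sm (fun s => s)
| Sm_bump m : Sm (bump_pow m)
| Sm_add f g : Sm f -> Sm g -> Sm (fun s => f s + g s)
| Sm_mul f g : Sm f -> Sm g -> Sm (fun s => f s * g s)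
| Sm_affine f a b : Sm f -> Sm (fun s => f (a * s + b))
| Sm_int f g : (forall s, Dr f s (g s)) -> Sm g -> Sm f.

Lemma Sm_Dr f : Sm f -> exists2 g, Sm g & forall s, Dr f s (g s).
Proof.
elim=> {f} [c||m|f g _ [f' Sf Df] _ [g' Sg Dg]|f g Sf0 [f' Sf Df] Sg0 [g' Sg Dg]|f a b _ [f' Sf Df]|f g D Sg _].
- by exists (fun=> 0); [exact: Sm_cst|move=> s; exact: Dr_cst].
- by exists (fun=> 1); [exact: Sm_cst|move=> s; exact: Dr_id].
- exists (fun s => - m%:R * bump_pow m.+1 s + bump_pow m.+2 s); last exact: Dr_bump_pow.
  by apply: Sm_add (Sm_bump _); apply: Sm_mul (Sm_bump _); exact: Sm_cst.
- by exists (fun s => f' s + g' s); [exact: Sm_add|move=> s; exact: DrD].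
- exists (fun s => f s * g' s + g s * f' s); first by apply: Sm_add; apply: Sm_mul.
  by move=> s; apply: (Dr_eq (DrM (Df s) (Dg s))).
- exists (fun s => f' (a * s + b) * a); first by apply: Sm_mul (Sm_cst _); exact: Sm_affine.
  move=> s; have D1 := DrD (DrM (Dr_cst a s) (Dr_id s)) (Dr_cst b s).
  by apply: (Dr_eq (Dr_comp D1 (Df (a * s + b)))); ring.
- by exists g.
Qed.

Lemma Sm_continuous f : Sm f -> continuous f.
Proof. by move=> /Sm_Dr[g _ D] s; exact: Dr_continuous (D s). Qed.

Lemma Sm_step : exists S dS K, [/\ Sm S, forall s, Dr S s (dS s),
  forall s, s <= 0 -> S s = 0 /\ dS s = 0, forall s, 1 <= s -> S s = 1 /\ dS s = 0 &
  forall s, 0 <= S s <= 1 /\ 0 <= dS s <= K].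
Proof.
pose B s := bump_pow 0 s * bump_pow 0 (- 1 * s + 1).
have SB : Sm B by apply: Sm_mul; [exact: Sm_bump|exact: Sm_affine (Sm_bump _)].
have [F [F0 DF]] := primitive 0 (Sm_continuous SB).
have B0 s : 0 <= B s by rewrite mulr_ge0 ?bump_pow_ge0.
have Fc x := Dr_continuous (DF x).
have Fmon a b : a <= b -> F a <= F b.
  by move=> ab; apply: (@Dr_ndecr _ F B).
have b1 s : bump_pow 0 s <= 1.
  rewrite /bump_pow; case: (leP s 0) => // s0; rewrite expr0 mul1r -[leRHS](@expR0 R) ler_expR.
  by rewrite oppr_le0 invr_ge0 ltW.
have B1 s : B s <= 1 by rewrite -[leRHS]mulr1; apply: ler_pM; rewrite ?bump_pow_ge0.
have Bz s : s <= 0 -> B s = 0 by move=> s0; rewrite /B /bump_pow s0 mul0r.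
have Bo s : 1 <= s -> B s = 0.
  move=> s1; rewrite /B [X in _ * X]/bump_pow ifT ?mulr0//.
  by rewrite mulN1r addrC subr_le0.
have F1 : 0 < F 1.
  have [c /andP[c0 c1]] := @mvt _ F B 0 1 ltr01 (fun x _ => DF x) (fun x _ => Fc x).
  rewrite F0 subr0 subr0 mulr1 => ->; rewrite /B !bump_pow_pos ?mulr_gt0 ?expR_gt0//; trim_lra.
have Fz s : s <= 0 -> F s = 0.
  move=> s0; apply/eqP; rewrite -F0 eq_le Fmon//=.
  apply: (@Dr_nincr _ F B) => // x /andP[_ x0]; by rewrite Bz// ltW.
have Fo s : 1 <= s -> F s = F 1.
  move=> s0; apply/eqP; rewrite eq_le [X in _ && X]Fmon// andbT.
  apply: (@Dr_nincr _ F B) => // x /andP[x1 _]; by rewrite Bo// ltW.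
exists (fun s => (F 1)^-1 * F s), (fun s => (F 1)^-1 * B s), (F 1)^-1.
have i0 : 0 <= (F 1)^-1 by rewrite invr_ge0 ltW.
have DS s : Dr (fun s => (F 1)^-1 * F s) s ((F 1)^-1 * B s).
  by apply: (Dr_eq (DrM (Dr_cst _ s) (DF s))); rewrite mulr0 addr0.
split=> //.
- by apply: Sm_mul (Sm_int DF SB); exact: Sm_cst.
- by move=> s s0; rewrite (Fz s s0) (Bz s s0) mulr0.
- by move=> s s0; rewrite (Fo s s0) (Bo s s0) mulr0 mulVf ?gt_eqF.
have Fg s : 0 <= F s.
  by have [s0|/ltW s0] := leP s 0; [rewrite Fz|rewrite -[leLHS]F0 Fmon].
move=> s; split; apply/andP; split.
- exact: mulr_ge0.
- rewrite mulrC ler_pdivrMr// mul1r; have [s1|/ltW s1] := leP s 1; first exact: Fmon.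
  by rewrite Fo.
- exact: mulr_ge0.
- by rewrite -[leRHS]mulr1 ler_wpM2l.
Qed.

(** Nodes at distance d are joined by smooth steps. On each cell the approximant is a convex
    combination of the two nodal values, hence within L d of v. *)
Lemma Sm_approx v (L T e : R) : 0 <= L -> 0 < T -> 0 < e ->
  (forall x y, 0 <= x <= T -> 0 <= y <= T -> `|v x - v y| <= L * `|x - y|) ->
  exists2 g, Sm g & forall s, 0 <= s <= T -> `|g s - v s| <= e.
Proof.
move=> L0 T0 e0 vL; have [S [dS [K [SS _ S0 S1 S01]]]] := Sm_step.
pose n := (Num.bound (L * T / e)).+1.
have Hn : L * T / e < n%:R.
  apply: lt_le_trans (archi_boundP _) _; first by rewrite divr_ge0 ?mulr_ge0// ltW.
  by rewrite ler_nat.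
pose d := T / n%:R.
have n0 : 0 < n%:R :> R by rewrite ltr0n.
have d0 : 0 < d by rewrite /d divr_gt0.
have Ld : L * d <= e.
  by rewrite /d mulrA ler_pdivrMr// (mulrC e) -ler_pdivrMr// ltW.
have nd : n%:R * d = T by rewrite /d mulrC divfK// gt_eqF.
have H m : (m <= n)%N -> exists2 g, Sm g & (forall s, 0 <= s <= m%:R * d -> `|g s - v s| <= L * d) /\
    (forall s, m%:R * d <= s -> g s = v (m%:R * d)).
  elim: m => [|m IH] mn.
    exists (fun=> v 0); first exact: Sm_cst.
    rewrite mul0r; split=> // s /andP[s0 s1]; have -> : s = 0 by apply/eqP; rewrite eq_le s0 s1.
    by rewrite subrr normr0 mulr_ge0// ltW.
  have [g Sg [g1 g2]] := IH (ltnW mn).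
  set a := m%:R * d in g1 g2; set b := m.+1%:R * d.
  have ba : b = a + d by rewrite /a /b -natr1 mulrDl mul1r.
  have a0 : 0 <= a by rewrite /a mulr_ge0// ltW.
  have bT : b <= T by rewrite -nd /b ler_pM2r// ler_nat.
  exists (fun s => g s + (v b - v a) * S (d^-1 * s + - (a / d))).
    by apply: Sm_add => //; apply: Sm_mul (Sm_affine _ _ SS); exact: Sm_cst.
  have arg s : d^-1 * s + - (a / d) = (s - a) / d by field; rewrite gt_eqF.
  split=> [s /andP[s0 sb]|s bs]; rewrite arg.
    have [sa|/ltW as_] := leP s a.
      have [-> _] : S ((s - a) / d) = 0 /\ dS ((s - a) / d) = 0.
        by apply: S0; rewrite pmulr_lle0 ?invr_gt0// subr_le0.
      by rewrite mulr0 addr0; apply: g1; rewrite s0.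
    rewrite g2//; set c := S _; have [/andP[c0 c1] _] := S01 ((s - a) / d); rewrite -/c in c0 c1.
    have -> : v a + (v b - v a) * c - v s = (1 - c) * (v a - v s) + c * (v b - v s) by ring.
    have va : `|v a - v s| <= L * d.
      apply: le_trans (vL _ _ _ _) _; [by apply/andP; split; trim_lra|by apply/andP; split; trim_lra|].
      by apply: ler_wpM2l => //; rewrite distrC ger0_norm; trim_lra.
    have vb : `|v b - v s| <= L * d.
      apply: le_trans (vL _ _ _ _) _; [by apply/andP; split; trim_lra|by apply/andP; split; trim_lra|].
      by apply: ler_wpM2l => //; rewrite ger0_norm; trim_lra.
    apply: le_trans (ler_normD _ _) _; rewrite !normrM (ger0_norm c0) ger0_norm ?subr_ge0//.
    have h1 : (1 - c) * `|v a - v s| <= (1 - c) * (L * d) by apply: ler_wpM2l => //; trim_lra.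
    have h2 : c * `|v b - v s| <= c * (L * d) by apply: ler_wpM2l.
    trim_lra.
  have [-> _] : S ((s - a) / d) = 1 /\ dS ((s - a) / d) = 0.
    by apply: S1; rewrite ler_pdivlMr// mul1r; trim_lra.
  by rewrite mulr1 g2; [ring|trim_lra].
have [g Sg [g1 _]] := H n (leqnn n); exists g => // s; rewrite -nd => hs.
exact: le_trans (g1 s hs) Ld.
Qed.

(** The derivative is approximated and then integrated from the exact value [f 0]; the tolerance e /
    (T + 1) allows for the integration over [0, T]. *)
Lemma C1_approx f v w (T e : R) : (forall s, Dr f s (v s)) -> (forall s, Dr v s (w s)) ->
  continuous w -> 0 < T -> 0 < e ->
  exists g dg, [/\ Sm g, forall s, Dr g s (dg s) &
    forall s, 0 <= s <= T -> `|g s - f s| <= e /\ `|dg s - v s| <= e].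
Proof.
move=> Df Dv wc T0 e0.
have wac : continuous (fun s => `|w s|).
  by move=> x; apply: continuous_comp; [exact: wc|exact: norm_continuous].
have [c _ Hc] := evt_max (ltW T0) (fun x _ => wac x).
have vL x y : 0 <= x <= T -> 0 <= y <= T -> `|v x - v y| <= `|w c| * `|x - y|.
  wlog yx : x y / y <= x => [H hx hy|].
    by have [|/ltW] := leP y x => h; [exact: H|rewrite distrC (distrC x); exact: H].
  move=> /andP[x0 xT] /andP[y0 yT].
  have D2 z : Dr (fun s => `|w c| * s) z `|w c|.
    by apply: (Dr_eq (DrM (Dr_cst _ z) (Dr_id z))); rewrite mulr1 mulr0 addr0.
  rewrite (ger0_norm (_ : 0 <= x - y)) ?subr_ge0// mulrBr.
  apply: (@Dr_dom _ v (fun s => `|w c| * s) w (fun=> `|w c|)) => //.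
  - by move=> z _; exact: Dr_continuous (Dv z).
  - by move=> z _; exact: Dr_continuous (D2 z).
  - by move=> z /andP[yz zx]; apply: Hc; apply/andP; split; trim_lra.
have k0 : 0 < e / (T + 1) by apply: divr_gt0 => //; trim_lra.
have [g Sg Hg] := Sm_approx (normr_ge0 (w c)) T0 k0 vL.
have [G [G0 DG]] := primitive 0 (Sm_continuous Sg).
have ke : e / (T + 1) <= e by rewrite ler_pdivrMr; [rewrite ler_peMr ?ltW//; trim_lra|trim_lra].
have DH s : Dr (fun s => f 0 + G s) s (g s).
  by apply: (Dr_eq (DrD (Dr_cst _ s) (DG s))); rewrite add0r.
exists (fun s => f 0 + G s), g; split=> //.
  by apply: Sm_add (Sm_int DG Sg); exact: Sm_cst.
move=> s /andP[s0 sT]; split; last by apply: le_trans (Hg s _) ke; rewrite s0.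
have D2 z : Dr (fun s => e / (T + 1) * s) z (e / (T + 1)).
  by apply: (Dr_eq (DrM (Dr_cst _ z) (Dr_id z))); rewrite mulr1 mulr0 addr0.
have : `|(f 0 + G s - f s) - (f 0 + G 0 - f 0)| <= e / (T + 1) * s - e / (T + 1) * 0.
  apply: (@Dr_dom _ (fun s => f 0 + G s - f s) (fun s => e / (T + 1) * s)
    (fun s => g s - v s) (fun=> e / (T + 1))) => //.
  - by move=> z _; apply: DrB.
  - by move=> z _; exact: Dr_continuous (DrB (DH z) (Df z)).
  - by move=> z _; exact: Dr_continuous (D2 z).
  - by move=> z /andP[z0 zs]; apply: Hg; apply/andP; split; trim_lra.
rewrite G0 addr0 subrr subr0 mulr0 subr0 => h; apply: le_trans h _.
rewrite mulrAC ler_pdivrMr; last trim_lra.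
by rewrite ler_pM2l//; trim_lra.
Qed.

(** One minus the average of m + 1 unit steps, the n-th rising over the dyadic interval from M 2^n
    to M 2^(n+1). At each s at most one step is moving, and its logarithmic slope is at most 2K, so
    averaging divides the slope by m + 1. *)
Lemma dyadic_cutoff : exists2 K : R, 0 <= K & forall m : nat, exists X dX,
  [/\ Sm X, forall s, Dr X s (dX s), forall s, 0 <= X s <= 1,
    forall s, s <= 2 ^+ m.+1 -> X s = 1 /\ dX s = 0 &
    (forall s, 2 ^+ m.+1 * 2 ^+ m.+1 <= s -> X s = 0 /\ dX s = 0) /\
    (forall s, 0 <= s -> s * `|dX s| <= K / m.+1%:R)].
Proof.
have [S [dS [K [SS DS S0 S1 S01]]]] := Sm_step.
have K0 : 0 <= K by have [_ /andP[h1 h2]] := S01 0; trim_lra.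
exists (2 * K) => [|m]; first by rewrite mulr_ge0.
set M : R := 2 ^+ m.+1; have M0 : 0 < M by rewrite /M exprn_gt0.
have H n : exists X dX, [/\ Sm X, forall s, Dr X s (dX s), forall s, 0 <= X s <= n%:R,
    forall s, s <= M -> X s = 0 /\ dX s = 0 & (forall s, M * 2 ^+ n <= s -> X s = n%:R /\ dX s = 0) /\
    (forall s, 0 <= s -> 0 <= s * dX s <= 2 * K)].
  elim: n => [|n [X [dX [SX DX X01 X0 [X1 XK]]]]].
    exists (fun=> 0), (fun=> 0); split=> [|s|s|s _|]; [exact: Sm_cst|exact: Dr_cst|by rewrite lexx|by []|].
    by split=> // s _; rewrite mulr0 lexx/= mulr_ge0.
  set a := M * 2 ^+ n in X1.
  have a0 : 0 < a by rewrite /a mulr_gt0// exprn_gt0.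
  have Ma : M <= a by rewrite /a -[leLHS]mulr1 ler_pM2l// exprn_ege1// ler1n.
  have a2 : M * 2 ^+ n.+1 = 2 * a by rewrite /a exprS mulrCA.
  have arg s : a^-1 * s + - 1 = (s - a) / a by field; rewrite gt_eqF.
  exists (fun s => X s + S (a^-1 * s + - 1)), (fun s => dX s + dS (a^-1 * s + - 1) * a^-1).
  rewrite a2; split=> [|s|s|s sM|].
  - by apply: Sm_add => //; exact: Sm_affine.
  - have D1 := DrD (DrM (Dr_cst a^-1 s) (Dr_id s)) (Dr_cst (- 1) s).
    by apply: (Dr_eq (DrD (DX s) (Dr_comp D1 (DS _)))); ring.
  - have /andP[h1 h2] := X01 s; have [/andP[h3 h4] _] := S01 (a^-1 * s + - 1).
    by rewrite -natr1 addr_ge0//= lerD.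
  - have [-> ->] := X0 s sM.
    have [|-> ->] := S0 (a^-1 * s + - 1); last by rewrite mul0r !addr0.
    by rewrite arg pmulr_lle0 ?invr_gt0// subr_le0; exact: le_trans Ma.
  split=> s s0.
    have [|-> ->] := X1 s; first trim_lra.
    have [|-> ->] := S1 (a^-1 * s + - 1); last by rewrite natr1 mul0r !addr0.
    by rewrite arg ler_pdivlMr// mul1r; trim_lra.
  have [sa|/ltW sa] := leP s a.
    have [|_ ->] := S0 (a^-1 * s + - 1); last by rewrite mul0r addr0; exact: XK.
    by rewrite arg pmulr_lle0 ?invr_gt0// subr_le0.
  have [_ ->] := X1 s sa; rewrite add0r.
  have [_ /andP[d0 dK]] := S01 (a^-1 * s + - 1).
  have q0 : 0 <= s / a by rewrite divr_ge0// ltW.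
  have -> : s * (dS (a^-1 * s + - 1) / a) = s / a * dS (a^-1 * s + - 1) by ring.
  rewrite mulr_ge0//=; have [s2|/ltW s2] := leP s (2 * a).
    by apply: ler_pM => //; rewrite ler_pdivrMr.
  have [|_ ->] := S1 (a^-1 * s + - 1); last by rewrite mulr0 mulr_ge0.
  by rewrite arg ler_pdivlMr// mul1r; trim_lra.
have [X [dX [SX DX X01 X0 [X1 XK]]]] := H m.+1.
have n0 : 0 < m.+1%:R :> R by rewrite ltr0n.
exists (fun s => 1 + - m.+1%:R^-1 * X s), (fun s => - m.+1%:R^-1 * dX s); split=> [|s|s|s sM|].
- by apply: Sm_add; [exact: Sm_cst|apply: Sm_mul => //; exact: Sm_cst].
- by apply: (Dr_eq (DrD (Dr_cst 1 s) (DrM (Dr_cst _ s) (DX s)))); ring.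
- have /andP[h1 h2] := X01 s.
  have h3 : 0 <= m.+1%:R^-1 * X s by rewrite mulr_ge0// invr_ge0 ltW.
  have h4 : m.+1%:R^-1 * X s <= 1 by rewrite mulrC ler_pdivrMr// mul1r.
  by rewrite mulNr subr_ge0 h4 gerBl h3.
- by have [-> ->] := X0 s sM; rewrite !mulr0 addr0.
split=> s hs; first by have [-> ->] := X1 s hs; rewrite mulr0 mulNr mulVf ?gt_eqF// subrr.
have /andP[h1 h2] := XK s hs.
rewrite normrM normrN normfV normr_nat mulrCA mulrC; apply: ler_wpM2r; first by rewrite invr_ge0 ltW.
by apply: le_trans h2; rewrite -{1}(ger0_norm hs) -normrM ger0_norm.
Qed.

End Smooth1.

(** * Lebesgue measure on row vectors *)

(* Fubini needs a bundled sigma-finite measure, which [lebesgue_rV] is not. *)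
Section WithSigmaFinite.
Context d (T : measurableType d) (R : realType) (m : {measure set T -> \bar R}).

Definition with_sigma_finite (_ : sigma_finite setT m) : set T -> \bar R := m.

Context (sf : sigma_finite setT m).
HB.instance Definition _ := Measure.copy (with_sigma_finite sf) m.
HB.instance Definition _ := Measure_isSigmaFinite.Build d T R (with_sigma_finite sf) sf.

End WithSigmaFinite.

Section RowMeasure.
Context {R : realType}.
Implicit Types n : nat.
Local Open Scope ereal_scope.

Notation mu n := (lebesgue_rV R n).

Lemma rV_cons0 n (p : 'rV[R]_n) (t : R) : rV_cons (p, t) ord0 ord0 = t.
Proof.
rewrite /rV_cons; have -> : ord0 = lshift n ord0 :> 'I_(1 + n) by apply/val_inj.
by rewrite (row_mxEl (const_mx t : 'rV_1)) mxE.
Qed.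

Lemma rV_consS n (p : 'rV[R]_n) (t : R) j : rV_cons (p, t) ord0 (lift ord0 j) = p ord0 j.
Proof.
rewrite /rV_cons; have -> : lift ord0 j = rshift 1 j :> 'I_(1 + n) by apply/val_inj.
by rewrite (row_mxEr (const_mx t : 'rV_1)).
Qed.

Lemma measurable_fun_rV d (T : measurableType d) n (f : 'rV[R]_n.+1 -> T) :
  measurable_fun [set: 'rV[R]_n.+1] f -> measurable_fun setT (f \o @rV_cons R n).
Proof. by move=> mf; apply: measurableT_comp => //; exact: measurable_rV_cons. Qed.

Definition rbox n (a b : 'I_n -> R) : set 'rV[R]_n := [set x | forall i, a i <= x ord0 i <= b i]%R.

Lemma rboxE n (a b : 'I_n -> R) : rbox a b = \bigcap_(i in setT) ((fun x : 'rV[R]_n => x ord0 i) @^-1` `[a i, b i]).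
Proof. by apply/seteqP; split => x /= h i; have := h i; rewrite /= in_itv/=; [move=> h' _|apply]. Qed.

Lemma measurable_rbox n (a b : 'I_n -> R) : measurable (rbox a b).
Proof.
rewrite rboxE; apply: fin_bigcap_measurable => // i _.
by rewrite -[X in measurable X]setTI; apply: measurable_coord.
Qed.

Lemma lebesgue_rbox n (a b : 'I_n -> R) : (forall i, a i <= b i)%R ->
  mu n (rbox a b) = (\prod_(i < n) (b i - a i))%:E.
Proof.
elim: n a b => [|n IH] a b ab.
  rewrite big_ord0 /= diracE mem_set//; by case.
rewrite /= /pushforward.
have -> : @rV_cons R n @^-1` rbox a b = rbox (fun j => a (lift ord0 j)) (fun j => b (lift ord0 j)) `*`
    `[a ord0, b ord0]%classic.
  apply/seteqP; split => [[p t] h|[p t] [h1 h2] i] /=.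
    split; first by move=> j; have := h (lift ord0 j); rewrite rV_consS.
    by have := h ord0; rewrite /= rV_cons0 in_itv.
  have [j ->|->] := unliftP (ord0 : 'I_n.+1) i; last by move: h2; rewrite rV_cons0 /= in_itv.
  by rewrite rV_consS; exact: h1.
rewrite product_measure1E//; last exact: measurable_rbox.
rewrite IH// [X in _ * X](_ : _ = @lebesgue_measure R `[a ord0, b ord0]%classic)//.
rewrite lebesgue_measure_itv/= lte_fin big_ord_recl.
have := ab ord0; rewrite le_eqVlt => /predU1P[->|h].
  by rewrite ltxx subrr mul0r mule0.
by rewrite h -EFinD -EFinM mulrC.
Qed.

Lemma sigma_finite_rV n : sigma_finite setT (mu n).
Proof.
exists (fun k => rbox (fun=> - k%:R)%R (fun=> k%:R)%R).
  apply/seteqP; split => // x _; pose M := (\sum_(i < n) `|x ord0 i|)%R.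
  have M0 : (0 <= M)%R by exact: sumr_ge0.
  exists (Num.bound M) => // i; rewrite -ler_norml; apply/ltW.
  apply: le_lt_trans (archi_boundP M0); rewrite /M (bigD1 i)//= lerDl.
  exact: sumr_ge0.
move=> k; split; first exact: measurable_rbox.
by rewrite lebesgue_rbox ?ltry// => i; rewrite ge0_cp.
Qed.

Lemma ge0_integral_rVS n (f : 'rV[R]_n.+1 -> \bar R) :
  measurable_fun [set: 'rV[R]_n.+1] f ->
  (forall x, 0 <= f x) ->
  \int[mu n.+1]_x f x = \int[mu n]_p \int[lebesgue_measure]_t f (rV_cons (p, t)).
Proof.
move=> mf f0.
have := @ge0_integral_pushforward _ _ ('rV[R]_n * measurableTypeR R)%type 'rV[R]_n.+1 R
  (@rV_cons R n) (@measurable_rV_cons R n) (mu n \x @lebesgue_measure R) setT f measurableT mf (fun y _ => f0 y).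
rewrite preimage_setT => H; apply: (etrans H).
(* The measure is generalised together with its sigma-finiteness, so that [with_sigma_finite] can
   supply the bundled structure to Fubini-Tonelli. *)
move: (mu n) (@sigma_finite_rV n) {H} => [m cm] sf.
exact: (@fubini_tonelli1 _ _ 'rV[R]_n (measurableTypeR R) R (with_sigma_finite sf) (@lebesgue_measure R)
  (f \o @rV_cons R n) (measurable_fun_rV mf) (fun x => f0 _)).
Qed.

Lemma measurable_inner n (f : 'rV[R]_n.+1 -> \bar R) :
  measurable_fun [set: 'rV[R]_n.+1] f ->
  (forall x, 0 <= f x) ->
  measurable_fun [set: 'rV[R]_n] (fun p => \int[lebesgue_measure]_t f (rV_cons (p, t))).
Proof.
move=> mf f0.
apply: (@measurable_fun_fubini_tonelli_F _ _ _ _ R (@lebesgue_measure R) (f \o @rV_cons R n)) => [|x].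
  exact: measurable_fun_rV.
exact: f0.
Qed.

Lemma measurable_rV_cons1 n (p : 'rV[R]_n) : measurable_fun [set: R] (fun t : R => rV_cons (p, t)).
Proof.
apply: measurable_fun_coordP => i; have [j ->|->] := unliftP (ord0 : 'I_n.+1) i.
  apply: (eq_measurable_fun (fun=> p ord0 j)) => // t _; by rewrite rV_consS.
by apply: (eq_measurable_fun id) => // t _; rewrite rV_cons0.
Qed.

Lemma lebesgue_translate (a : R) (A : set R) : measurable A ->
  pushforward (@lebesgue_measure R) ((fun x => x + a)%R : _ -> measurableTypeR R) A = lebesgue_measure A.
Proof.
move=> mA; have mt : measurable_fun setT ((fun x => x + a)%R : measurableTypeR R -> measurableTypeR R).
  by apply: measurable_funD.
apply/esym; have := @lebesgue_measure_unique R
  (measure_function_pushforward__canonical__measure_function_Measure (@lebesgue_measure R) mt).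
apply => // _ [[c d]] _ <-.
have -> : measure_function_pushforward__canonical__measure_function_Measure (@lebesgue_measure R) mt `](c, d).1, (c, d).2]%classic
  = @lebesgue_measure R ((fun x => x + a)%R @^-1` `]c, d]%classic) by [].
have -> : (fun x => x + a)%R @^-1` `]c, d]%classic = `](c - a)%R, (d - a)%R]%classic.
  by apply/seteqP; split => x /=; rewrite !in_itv/= ltrBlDr lerBrDr.
rewrite !lebesgue_measure_itv/= !lte_fin ltrD2r; case: ifP => // _.
by rewrite -!EFinD; congr (_%:E); ring.
Qed.

Lemma ge0_integral_translate1 (a : R) (f : R -> \bar R) : measurable_fun setT f ->
  (forall x, 0 <= f x) ->
  \int[lebesgue_measure]_t f (t + a)%R = \int[lebesgue_measure]_t f t.
Proof.
move=> mf f0.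
have mt : measurable_fun setT ((fun x => x + a)%R : measurableTypeR R -> measurableTypeR R).
  by apply: measurable_funD.
have := @ge0_integral_pushforward _ _ _ _ R _ mt (@lebesgue_measure R) setT f measurableT mf (fun y _ => f0 y).
rewrite preimage_setT => <-; apply: eq_measure_integral => A mA _.
exact: lebesgue_translate.
Qed.

Lemma measurable_translate n (a : 'rV[R]_n) : measurable_fun [set: 'rV[R]_n] (fun x : 'rV[R]_n => (x + a)%R).
Proof.
apply: measurable_fun_coordP => i.
have -> : (fun x : 'rV[R]_n => (x + a)%R ord0 i) = (fun x => x ord0 i + a ord0 i)%R.
  by apply/funext => x; rewrite mxE.
by apply: measurable_funD => //; exact: measurable_coord.
Qed.

Lemma ge0_integral_translate n (a : 'rV[R]_n) (f : 'rV[R]_n -> \bar R) :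
  measurable_fun [set: 'rV[R]_n] f ->
  (forall x, 0 <= f x) -> \int[mu n]_x f (x + a)%R = \int[mu n]_x f x.
Proof.
elim: n a f => [|n IH] a f mf f0.
  by apply: eq_integral => x _; congr (f _); apply/rowP; case.
have mt : measurable_fun [set: 'rV[R]_n.+1] (fun x => f (x + a)%R).
  by apply: measurableT_comp => //; exact: measurable_translate.
rewrite (ge0_integral_rVS mt (fun x => f0 _)) (ge0_integral_rVS mf f0); pose b := (\row_j a ord0 (lift ord0 j))%R : 'rV[R]_n.
have E p t : (rV_cons (p, t) + a)%R = rV_cons ((p + b)%R, (t + a ord0 ord0)%R).
  apply/rowP => i; rewrite mxE; have [j ->|->] := unliftP (ord0 : 'I_n.+1) i; last by rewrite !rV_cons0.
  by rewrite !rV_consS !mxE.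
pose h p := \int[lebesgue_measure]_t f (rV_cons (p, t)).
have mh : measurable_fun [set: 'rV[R]_n] h by exact: measurable_inner.
rewrite -[RHS](IH b h mh); last by move=> p; apply: integral_ge0.
apply: eq_integral => p _; under eq_integral do rewrite E.
apply: (@ge0_integral_translate1 _ (fun t => f (rV_cons ((p + b)%R, t)))) => //.
apply: (@measurableT_comp _ _ _ _ _ _ f) => //; exact: measurable_rV_cons1.
Qed.

Lemma integral_translate n (a : 'rV[R]_n) (f : 'rV[R]_n -> \bar R) :
  measurable_fun [set: 'rV[R]_n] f ->
  \int[mu n]_x f (x + a)%R = \int[mu n]_x f x.
Proof.
move=> mf; rewrite integralE [RHS]integralE; congr (_ - _).
  rewrite -[RHS](ge0_integral_translate a); last by move=> x; exact: funepos_ge0.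
    by apply: eq_integral => x _; rewrite !funeposE.
  exact: measurable_funepos.
rewrite -[RHS](ge0_integral_translate a); last by move=> x; exact: funeneg_ge0.
  by apply: eq_integral => x _; rewrite !funenegE.
exact: measurable_funeneg.
Qed.

(* A continuous function is the limit of its discretisations, which take
   countably many values. *)
Lemma continuous_measurable_rV n (f : 'rV[R]_n -> R) : continuous f -> measurable_fun [set: 'rV[R]_n] f.
Proof.
move=> fc; pose grid (m : nat) (x : 'rV[R]_n) : 'rV[int]_n := (\row_i Num.floor (m.+1%:R * x ord0 i))%R.
pose back (m : nat) (z : 'rV[int]_n) : 'rV[R]_n := (\row_i ((z ord0 i)%:~R / m.+1%:R))%R.
apply: (@measurable_fun_cvg _ _ _ setT (fun m x => f (back m (grid m x)))).
  move=> m _ Y mY; rewrite setTI.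
  have -> : (fun x => f (back m (grid m x))) @^-1` Y = \bigcup_(z in setT) (if `[< Y (f (back m z)) >] then grid m @^-1` [set z] else set0).
    apply/seteqP; split => [x /= Yx|x [z _]].
      by exists (grid m x) => //; rewrite ifT//; exact/asboolP.
    by case: ifP => // /asboolP Yz /= ->.
  apply: countable_bigcupT_measurable => [|z]; first exact: countableP.
  case: ifP => // _.
  have -> : grid m @^-1` [set z] = \bigcap_(i in setT) ((fun x : 'rV[R]_n => x ord0 i) @^-1`
       `[((z ord0 i)%:~R / m.+1%:R)%R, (((z ord0 i) + 1)%:~R / m.+1%:R)%R[).
    have fE (c : R) k : (Num.floor (m.+1%:R * c) == k)%R = (c \in `[(k%:~R / m.+1%:R)%R, ((k + 1)%:~R / m.+1%:R)%R[).
      rewrite in_itv/= ler_pdivrMr ?ltr0n// ltr_pdivlMr ?ltr0n// mulrC.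
      apply/eqP/idP => [<-|/andP[h1 h2]]; first exact: floor_itv.
      by apply: floor_def; apply/andP.
    apply/seteqP; split => [x /= gx i _|x h].
      by rewrite /= -fE -gx mxE.
    by apply/rowP => i; have := h i I; rewrite /= -fE mxE => /eqP.
  apply: fin_bigcap_measurable => // i _.
  by rewrite -[X in measurable X]setTI; apply: measurable_coord.
move=> x _; have xc : (fun m => back m (grid m x)) @ \oo --> x.
  apply/cvg_ballP => e e0; near=> m; split=> // i j; rewrite /ball/= !mxE ord1.
  have m0 : (0 < m.+1%:R :> R)%R by rewrite ltr0n.
  have /andP[h1 h2] := floor_itv (m.+1%:R * x ord0 j)%R.
  rewrite -(@ltr_pM2l _ m.+1%:R)// -[X in (X * `|_|)%R](gtr0_norm m0) -normrM mulrBr mulrCA divff ?gt_eqF// mulr1.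
  have me : (1 < m.+1%:R * e)%R.
    by rewrite -ltr_pdivrMl// mulr1; near: m; exact: (near_infty_natSinv_lt (PosNum e0)).
  rewrite ger0_norm ?subr_ge0//; apply: lt_trans me.
  by move: h2; rewrite intrD; trim_lra.
exact: (cvg_comp _ _ xc (fc x)).
Unshelve. all: by end_near. Qed.

End RowMeasure.

(** * Integration by parts *)

Lemma dominated_convergence_EFin d (T : measurableType d) (R : realType) (mu : {measure set T -> \bar R})
    (f_ : nat -> T -> R) (f g : T -> R) :
  (forall m, measurable_fun setT (f_ m)) -> (forall x, (fun m => f_ m x) @ \oo --> f x) ->
  (forall m x, `|f_ m x| <= g x) -> mu.-integrable setT (EFin \o g) ->
  mu.-integrable setT (EFin \o f) /\
  (fun m => \int[mu]_x (f_ m x)%:E)%E @ \oo --> (\int[mu]_x (f x)%:E)%E.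
Proof.
move=> mf ff fg ig.
have mf' : measurable_fun setT f by apply: (measurable_fun_cvg mf) => x _; exact: ff.
have [] := @dominated_convergence _ T R mu setT measurableT (fun m => EFin \o f_ m) (EFin \o f) (EFin \o g).
- by move=> m; exact/measurable_EFinP.
- exact/measurable_EFinP.
- by apply: aeW => x _; apply: cvg_EFin; [exact: nearW|exact: ff].
- exact: ig.
- by apply: aeW => x m _ /=; rewrite lee_fin.
by move=> h _ h'; split.
Qed.

Section Parts.
Context {R : realType} (n : nat).
Implicit Types (x y : 'rV[R]_n) (i j : 'I_n) (L r : R).

Notation mu := (lebesgue_rV R n).

Definition ei i : 'rV[R]_n := delta_mx ord0 i.

Lemma eiE x i j (t : R) : (x + t *: ei i) ord0 j = x ord0 j + t * (j == i)%:R.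
Proof. by rewrite !mxE eqxx. Qed.

Definition cube r : set 'rV[R]_n := [set x | forall i, `|x ord0 i| <= r].

Lemma cubeE r : cube r = rbox (fun=> - r) (fun=> r).
Proof. by apply/seteqP; split => x h i; have := h i; rewrite ler_norml. Qed.

Lemma measurable_cube r : measurable (cube r).
Proof. by rewrite cubeE; exact: measurable_rbox. Qed.

Lemma cube_fin r : (mu (cube r) < +oo)%E.
Proof.
have [r0|r0] := leP 0 r; first by rewrite cubeE lebesgue_rbox ?ltry// => i; trim_lra.
apply: le_lt_trans (_ : (mu (cube 0) < +oo)%E).
  apply: le_measure; rewrite ?inE; [exact: measurable_cube|exact: measurable_cube|].
  by move=> x h i; apply: le_trans (h i) (ltW r0).
by rewrite cubeE lebesgue_rbox ?ltry// => i; trim_lra.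
Qed.

Lemma integrable_cube L r : 0 <= L -> mu.-integrable setT (fun x => (L * \1_(cube r) x)%:E).
Proof.
move=> L0; have mi : measurable_fun setT (fun x => L * \1_(cube r) x).
  by apply: measurable_funM => //; apply: measurable_indic; exact: measurable_cube.
apply/integrableP; split; first exact/measurable_EFinP.
rewrite (eq_integral (fun x => L%:E * (\1_(cube r) x)%:E)%E); last first.
  by move=> x _; rewrite gee0_abs ?lee_fin ?mulr_ge0// EFinM.
rewrite ge0_integralZl//; last first.
  by apply/measurable_EFinP; apply: measurable_indic; exact: measurable_cube.
rewrite integral_indic ?setIT//; last exact: measurable_cube.
by apply: lte_mul_pinfty => //; exact: cube_fin.
Qed.

Lemma bounded_support_integrable (f : 'rV[R]_n -> R) L r : measurable_fun [set: 'rV[R]_n] f ->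
  (forall x, `|f x| <= L) -> (forall x, f x != 0 -> cube r x) -> mu.-integrable setT (EFin \o f).
Proof.
move=> mf fL fr; have L0 : 0 <= L by apply: le_trans (fL 0).
apply: (le_integrable measurableT _ _ (integrable_cube r L0)); first exact/measurable_EFinP.
move=> x _ /=; rewrite lee_fin [leRHS]ger0_norm ?mulr_ge0//.
have [->|fx] := eqVneq (f x) 0; first by rewrite normr0 mulr_ge0.
by rewrite indicE mem_set ?mulr1//; exact: fr.
Qed.

Lemma Dr_line (F dF : 'rV[R]_n -> R) i : (forall x, Dr (fun t => F (x + t *: ei i)) 0 (dF x)) ->
  forall x t, Dr (fun t => F (x + t *: ei i)) t (dF (x + t *: ei i)).
Proof.
move=> D x t; have D1 : Dr (fun s : R => s - t) t 1.
  by apply: (Dr_eq (DrB (Dr_id t) (Dr_cst t t))); rewrite subr0.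
have D2 : Dr (fun s => F (x + t *: ei i + s *: ei i)) (t - t) (dF (x + t *: ei i)).
  by rewrite subrr; exact: D.
have -> : (fun s => F (x + s *: ei i)) = fun s => F (x + t *: ei i + (s - t) *: ei i).
  by apply/funext => s; rewrite -addrA -scalerDl (addrC t) subrK.
by apply: (Dr_eq (Dr_comp D1 D2)); rewrite mulr1.
Qed.

(** Difference quotients along a coordinate have integral 0 by translation invariance. By the mean
    value inequality they are dominated by L on a slightly larger cube, so the limit [dF] is
    integrable with integral 0. *)
Lemma integral_partial (F dF : 'rV[R]_n -> R) i L r : measurable_fun [set: 'rV[R]_n] F ->
  (forall x, Dr (fun t => F (x + t *: ei i)) 0 (dF x)) ->
  (forall x, `|F x| <= L) -> (forall x, `|dF x| <= L) -> (forall x, F x != 0 -> cube r x) ->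
  mu.-integrable setT (EFin \o dF) /\ (\int[mu]_x (dF x)%:E = 0)%E.
Proof.
move=> mF D FL dFL Fr; have L0 : 0 <= L by apply: le_trans (FL 0).
pose h m : R := m.+1%:R^-1.
have h0 m : 0 < h m by rewrite invr_gt0 ltr0n.
have h1 m : h m <= 1 by rewrite invf_le1 ?ltr0n// ler1n.
pose Fh m x := F (x + h m *: ei i).
have mFh m : measurable_fun setT (Fh m).
  by apply: measurableT_comp => //; exact: measurable_translate.
pose q m x := (h m)^-1 * (Fh m x - F x).
have mq m : measurable_fun setT (q m) by apply: measurable_funM => //; exact: measurable_funB.
have DL := Dr_line D.
have cube_shift m x : cube r (x + h m *: ei i) -> cube (r + 1) x.
  move=> H j; have := H j; rewrite eiE => Hj.
  have -> : x ord0 j = (x ord0 j + h m * (j == i)%:R) - h m * (j == i)%:R by rewrite addrK.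
  apply: le_trans (ler_normB _ _) _; apply: lerD => //.
  rewrite normrM (gtr0_norm (h0 m)) -[leRHS]mulr1; apply: ler_pM => //; first exact: ltW.
  by case: (j == i); rewrite ?normr1 ?normr0.
have cube_le x : cube r x -> cube (r + 1) x.
  by move=> H j; apply: le_trans (H j) _; rewrite lerDl.
have qb m x : `|q m x| <= L * \1_(cube (r + 1)) x.
  have [xr|xr] := pselect (cube (r + 1) x); last first.
    rewrite indicE memNset// mulr0 normr_le0 /q /Fh.
    have -> : F x = 0 by apply/eqP; apply: contrapT => /negP/Fr/cube_le.
    have -> : F (x + h m *: ei i) = 0 by apply/eqP; apply: contrapT => /negP/Fr/cube_shift.
    by rewrite subrr mulr0.
  rewrite indicE mem_set// mulr1 /q normrM ger0_norm; last by rewrite invr_ge0 ltW.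
  rewrite mulrC ler_pdivrMr// /Fh.
  have := @Dr_dom _ (fun t => F (x + t *: ei i)) (fun t => L * t) (fun t => dF (x + t *: ei i)) (fun=> L)
    0 (h m) (ltW (h0 m)).
  rewrite scale0r addr0 mulr0 subr0; apply.
  - by move=> t _; exact: DL.
  - by move=> t _; apply: (Dr_eq (DrM (Dr_cst L t) (Dr_id t))); rewrite mulr1 mulr0 addr0.
  - by move=> t _; exact: Dr_continuous (DL x t).
  - by move=> t _; exact: Dr_continuous (DrM (Dr_cst L t) (Dr_id t)).
  - by move=> t _; exact: dFL.
have qc x : (fun m => q m x) @ \oo --> dF x.
  apply/cvgrPdist_le => e e0; have [d d0 Hd] := (Dr_epsP _ 0 (dF x)).1 (D x) e e0.
  near=> m; have hd : `|h m - 0| < d.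
    rewrite subr0 gtr0_norm//; near: m; exact: (near_infty_natSinv_lt (PosNum d0)).
  have := Hd (h m) hd; rewrite scale0r addr0 subr0 (gtr0_norm (h0 m)) => H.
  rewrite distrC -(ler_pM2r (h0 m)) -[X in _ * X](gtr0_norm (h0 m)) -normrM mulrBl.
  by rewrite /q mulrAC mulVf ?gt_eqF// mul1r.
have iF : mu.-integrable setT (EFin \o F) by exact: bounded_support_integrable FL Fr.
have iFh m : mu.-integrable setT (EFin \o Fh m).
  apply: (@bounded_support_integrable (Fh m) L (r + 1)) => // x; first exact: FL.
  by move=> /Fr/cube_shift.
have [idF cv] := dominated_convergence_EFin mq qc qb (integrable_cube (r + 1) L0); split=> //.
have q0 m : (\int[mu]_x (q m x)%:E = 0)%E.
  have -> : (fun x => (q m x)%:E) = (fun x => ((h m)^-1)%:E * ((Fh m x)%:E - (F x)%:E))%E.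
    by apply/funext => x; rewrite /q EFinM EFinB.
  rewrite integralZl//; last exact: (integrableB measurableT (iFh m) iF).
  rewrite integralB_EFin// /Fh (@integral_translate _ n (h m *: ei i) (EFin \o F)); last exact/measurable_EFinP.
  by rewrite subee ?mule0//; exact: integrable_fin_num.
have := cv; rewrite (_ : (fun m => _) = fun=> 0%E); last by apply/funext.
by move=> /(cvg_lim (@ereal_hausdorff _)); rewrite lim_cst//; exact: ereal_hausdorff.
Unshelve. all: by end_near. Qed.

End Parts.

(** * Cylindrical geometry *)

Section PowerTwo.
Context {R : realType}.
Implicit Types (a r t : R).

Notation P t := ((2 : R) `^ t).

Lemma pow2_gt0 t : 0 < P t. Proof. exact: powR_gt0. Qed.

Lemma pow2D s t : P (s + t) = P s * P t. Proof. exact: powRDp. Qed.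

Lemma pow2_le s t : s <= t -> P s <= P t.
Proof. by move=> st; apply: ler_powR => //; rewrite ler1n. Qed.

Lemma pow2_lt1 t : t < 0 -> P t < 1.
Proof.
move=> t0; rewrite /powR gt_eqF// expR_lt1 nmulr_rlt0//.
by apply: ln_gt0; rewrite ltr1n.
Qed.

Lemma powR_antimono (x y r : R) : 0 < x -> x <= y -> r <= 0 -> y `^ r <= x `^ r.
Proof.
move=> x0 xy r0; have y0 : 0 < y by trim_lra.
rewrite -[r]opprK !(powRN _ (- r)) lef_pV2 ?posrE ?powR_gt0//.
by apply: ge0_ler_powR; rewrite ?nnegrE; trim_lra.
Qed.

Lemma powR_mono (x y r : R) : 0 <= x -> x <= y -> 0 <= r -> x `^ r <= y `^ r.
Proof. by move=> x0 xy r0; apply: ge0_ler_powR; rewrite ?nnegrE//; trim_lra. Qed.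

Lemma geom_partial r N : 0 <= r < 1 -> \sum_(i < N) r ^+ i <= (1 - r)^-1.
Proof.
move=> /andP[r0 r1]; have h : 0 < 1 - r by trim_lra.
have E : (\sum_(i < N) r ^+ i) * (1 - r) = 1 - r ^+ N.
  elim: N => [|N IH]; first by rewrite big_ord0 mul0r expr0 subrr.
  by rewrite big_ord_recr/= mulrDl IH exprSr; ring.
rewrite -[leRHS]mul1r ler_pdivlMr// E lerBlDr lerDl; exact: exprn_ge0.
Qed.

End PowerTwo.

Section IntegralBounds.
Context d (T : measurableType d) (R : realType) (mu : {measure set T -> \bar R}).
Implicit Types (f : T -> R).

Lemma integral_le_sum N f (g : nat -> T -> R) (b : nat -> R) :
  measurable_fun setT f -> (forall l, measurable_fun setT (g l)) ->
  (forall x, 0 <= f x) -> (forall l x, 0 <= g l x) ->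
  (forall x, f x <= \sum_(l < N) g l x) ->
  (forall l, (\int[mu]_x (g l x)%:E <= (b l)%:E)%E) ->
  (\int[mu]_x (f x)%:E <= (\sum_(l < N) b l)%:E)%E.
Proof.
move=> mf mg f0 g0 fg gb.
apply: (@le_trans _ _ (\int[mu]_x (\sum_(l < N) (g l x)%:E))%E).
  apply: ge0_le_integral => //.
  - by move=> x _; rewrite lee_fin.
  - exact/measurable_EFinP.
  - rewrite (_ : (fun x => _) = EFin \o (fun x => \sum_(l < N) g l x)).
      by apply/measurable_EFinP; apply: measurable_sum => l; exact: mg.
    by apply/funext => x /=; rewrite sumEFin.
  - by move=> x _; rewrite sumEFin lee_fin.
rewrite (@ge0_integral_sum _ _ _ mu setT measurableT _ (fun (l : 'I_N) x => (g l x)%:E)); last 2 first.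
- by move=> l; apply/measurable_EFinP; exact: mg.
- by move=> l x _; rewrite lee_fin.
by rewrite -sumEFin; apply: lee_sum => l _; exact: gb.
Qed.

Lemma integrable_series f (g : nat -> T -> R) (C r : R) :
  measurable_fun setT f -> (forall l, measurable_fun setT (g l)) ->
  (forall x, 0 <= f x) -> (forall l x, 0 <= g l x) -> 0 <= C -> 0 <= r < 1 ->
  (forall x, exists l, f x <= g l x) ->
  (forall l, (\int[mu]_x (g l x)%:E <= (C * r ^+ l)%:E)%E) ->
  mu.-integrable setT (EFin \o f).
Proof.
move=> mf mg f0 g0 C0 r01 fg gb; apply/integrableP; split; first exact/measurable_EFinP.
apply: (@le_lt_trans _ _ (C / (1 - r))%:E); last by rewrite ltry.
apply: (@le_trans _ _ (\int[mu]_x (\sum_(l <oo) (g l x)%:E))%E).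
  apply: ge0_le_integral => //.
  - by apply: measurableT_comp => //; exact/measurable_EFinP.
  - by apply: ge0_emeasurable_sum => [l x _ _|l _]; [rewrite lee_fin|exact/measurable_EFinP].
  - move=> x _ /=; rewrite ger0_norm//; have [l Hl] := fg x.
    have := @nneseries_lim_ge R (fun l => (g l x)%:E) xpredT 0%N l.+1 (fun l _ _ => g0 l x).
    apply: le_trans; rewrite big_nat_recr//= sumEFin -EFinD lee_fin.
    by apply: le_trans Hl _; rewrite lerDr sumr_ge0.
rewrite integral_nneseries//; last 2 first.
- by move=> l; exact/measurable_EFinP.
- by move=> l x _; rewrite lee_fin.
apply: lime_le.
  by apply: is_cvg_nneseries => l _ _; apply: integral_ge0 => x _; rewrite lee_fin.
apply: nearW => N.
apply: (@le_trans _ _ (\sum_(0 <= l < N) (C * r ^+ l)%:E)%E); first by apply: lee_sum => l _; exact: gb.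
rewrite sumEFin lee_fin -mulr_sumr; apply: ler_wpM2l => //.
by rewrite big_mkord; exact: geom_partial.
Qed.

End IntegralBounds.

Section Geometry.
Context {R : realType} (n k : nat) (k2 : (2 <= k)%N) (kn : (k < n)%N).
Implicit Types (x : 'rV[R]_n) (i j : 'I_n) (a e r : R).

Notation mu := (lebesgue_rV R n).
Notation Q x := (head_norm k x).

Definition sqn x := \sum_(i < n) x ord0 i ^+ 2.
Definition ss x := (1 + sqn x) / (2 * Q x).

Lemma ss_def x : ss x = (1 + sqn x) / (2 * Q x). Proof. by []. Qed.

Lemma Q_ge0 x : 0 <= Q x. Proof. exact: sqrtr_ge0. Qed.

Lemma Q_sq x : Q x ^+ 2 = \sum_(i < n | (i < k)%N) x ord0 i ^+ 2.
Proof. by rewrite sqr_sqrtr// sumr_ge0// => i _; exact: sqr_ge0. Qed.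

Lemma Q_sqn x : Q x ^+ 2 <= sqn x.
Proof.
rewrite Q_sq /sqn [leRHS](bigID (fun i : 'I_n => (i < k)%N))/= lerDl sumr_ge0// => i _.
exact: sqr_ge0.
Qed.

Lemma ssE x : 0 < Q x -> 2 * Q x * ss x = 1 + sqn x.
Proof. by move=> Q0; rewrite /ss mulrC divfK// mulf_neq0 ?gt_eqF. Qed.

Lemma ss_ge1 x : 0 < Q x -> 1 <= ss x.
Proof.
move=> Q0; have h := ssE Q0; have h2 := Q_sqn x.
rewrite -(ler_pM2l (_ : 0 < 2 * Q x)) ?mulr1; last by rewrite mulr_gt0.
by have := sqr_ge0 (Q x - 1); rewrite sqrrB1; trim_lra.
Qed.

Lemma Q_le x : 0 < Q x -> Q x <= 2 * ss x.
Proof.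
move=> Q0; have h := ssE Q0; have h2 := Q_sqn x.
by rewrite -(ler_pM2l Q0) -expr2; trim_lra.
Qed.

Lemma sqn_ge0 x : 0 <= sqn x.
Proof. by rewrite sumr_ge0// => i _; exact: sqr_ge0. Qed.

Lemma Q_ge x : 0 < Q x -> 1 <= 2 * Q x * ss x.
Proof. by move=> Q0; rewrite ssE// lerDl sqn_ge0. Qed.

Lemma coord_head x i : (i < k)%N -> `|x ord0 i| <= Q x.
Proof.
move=> ik; rewrite -sqrtr_sqr ler_wsqrtr// (bigD1 i)//= lerDl sumr_ge0// => j _.
exact: sqr_ge0.
Qed.

Lemma coord_sq x i : x ord0 i ^+ 2 <= sqn x.
Proof. by rewrite /sqn (bigD1 i)//= lerDl sumr_ge0// => j _; exact: sqr_ge0. Qed.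

Lemma measurable_sqn : measurable_fun setT sqn.
Proof.
by apply: measurable_sum => i; apply: measurable_funX; exact: measurable_coord.
Qed.

Lemma measurable_Q : measurable_fun setT (fun x => Q x).
Proof.
have -> : (fun x => Q x) = (fun x => Num.sqrt (\sum_(i < n) (if (i < k)%N then x ord0 i ^+ 2 else 0))).
  by apply/funext => x; rewrite /head_norm big_mkcond.
apply: (measurableT_comp (continuous_measurable_fun (@sqrt_continuous R))).
apply: measurable_sum => i /=; case: (i < k)%N; last exact: measurable_cst.
by apply: measurable_funX; exact: measurable_coord.
Qed.

Lemma measurable_Qpow a : measurable_fun setT (fun x => Q x `^ a).
Proof. exact: measurableT_comp (measurable_powR a) measurable_Q. Qed.

Lemma measurable_ss : measurable_fun setT ss.
Proof.
have -> : ss = fun x => (1 + sqn x) * 2^-1 * Q x `^ (- 1).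
  by apply/funext => x; rewrite /ss powR_inv1 ?Q_ge0// invfM mulrA.
apply: measurable_funM (measurable_Qpow _); apply: measurable_funM => //.
by apply: measurable_funD => //; exact: measurable_sqn.
Qed.

Lemma measurable_ss_comp (f : R -> R) : measurable_fun setT f -> measurable_fun setT (fun x => f (ss x)).
Proof. by move=> mf; exact: measurableT_comp mf measurable_ss. Qed.

Let A : R := (n%:R - k%:R) / 2.
Notation P t := ((2 : R) `^ t).

Definition shell (l : nat) : set 'rV[R]_n := [set x | 0 < Q x /\ P l%:R <= ss x < P l.+1%:R].

Lemma measurable_shell l : measurable (shell l).
Proof.
have -> : shell l = (fun x => Q x) @^-1` `]0, +oo[ `&` ss @^-1` `[P l%:R, P l.+1%:R[.
  by apply/seteqP; split => x /=; rewrite !in_itv/= andbT.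
apply: measurableI; rewrite -[X in measurable X]setTI.
  by apply: measurable_Q => //; exact: measurable_itv.
by apply: measurable_ss => //; exact: measurable_itv.
Qed.

Lemma shell_cover x : 0 < Q x -> exists l, shell l x.
Proof.
move=> Q0; have s1 := ss_ge1 Q0.
have ex : exists l, ss x < P l.+1%:R.
  exists (Num.bound (ss x)).
  rewrite powR_mulrn//; apply: lt_le_trans (archi_boundP _) _; first trim_lra.
  rewrite -natrX ler_nat; apply: leq_trans (ltnW (ltn_expl _ (isT : (1 < 2)%N))) _.
  by rewrite leq_exp2l.
case: (ex_minnP ex) => l Hl Hmin; exists l; split=> //; apply/andP; split=> //.
case: l Hl Hmin => [|l] Hl Hmin; first by rewrite powRr0.
by rewrite leNgt; apply/negP => /Hmin; rewrite ltnn.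
Qed.

Lemma sum_head (u v : R) : \sum_(j < n) (if (j < k)%N then u else v) = k%:R * u + (n%:R - k%:R) * v.
Proof.
have -> : \sum_(j < n) (if (j < k)%N then u else v) = \sum_(j < n) (v + (if (j < k)%N then u - v else 0)).
  by apply: eq_bigr => j _; case: ifP => _; [rewrite addrC subrK|rewrite addr0].
rewrite big_split/= sumr_const card_ord -mulr_natl -big_mkcond/=.
rewrite -(big_ord_widen n (fun _ => u - v) (ltnW kn)) sumr_const card_ord -mulr_natl; ring.
Qed.

(** On the shell s ~ 2^i one has 2^(-i-2) < |y| < 2^(i+2). The part with |y| ~ 2^(l-i) satisfies
    |x|^2 <= 2 |y| s, so it lies in a box with k sides of order 2^(l-i) and n - k sides of order
    2^(l/2). Its volume times the weight is a multiple of 2^(i(2A-a)) 2^(-l(A-a)), and a < A makes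
    the sum over l geometric. *)
Lemma shell_integral a : 0 <= a -> a < A -> exists2 C : R, 0 <= C & forall i : nat,
  (\int[mu]_x (Q x `^ (a - n%:R) * \1_(shell i) x)%:E <= (C * P (i%:R * (2 * A - a)))%:E)%E.
Proof.
move=> a0 aA; pose C0 := P (2 * (n%:R - a) + 3 * A); pose q := P (- (A - a)).
have nA : n%:R = k%:R + 2 * A :> R by rewrite /A; field.
have kpos : 0 < k%:R :> R by rewrite ltr0n; lia.
have q01 : 0 <= q < 1.
  by rewrite ltW ?pow2_gt0//=; apply: pow2_lt1; trim_lra.
exists (C0 * (1 - q)^-1) => [|i].
  by rewrite mulr_ge0 ?invr_ge0 ?ltW ?pow2_gt0//; move/andP: q01 => [_]; trim_lra.
pose rho (l : nat) (j : 'I_n) : R := if (j < k)%N then P (l%:R - i%:R - 1) else P ((l%:R + 1) / 2).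
pose box l := rbox (fun j => - rho l j) (rho l).
pose c (l : nat) := P ((l%:R - i%:R - 2) * (a - n%:R)).
pose b (l : nat) := C0 * P (i%:R * (2 * A - a)) * q ^+ l.
have rho0 l j : 0 < rho l j by rewrite /rho; case: ifP => _; exact: pow2_gt0.
apply: (@le_trans _ _ (\sum_(l < i.*2.+4) b l)%:E); last first.
  rewrite lee_fin /b -mulr_sumr [leRHS]mulrAC; apply: ler_wpM2l; last exact: geom_partial.
  by rewrite mulr_ge0 ?ltW ?pow2_gt0.
apply: (@integral_le_sum _ _ _ mu _ _ (fun l x => c l * \1_(box l) x)).
- apply: measurable_funM; first exact: measurable_Qpow.
  by apply: measurable_indic; exact: measurable_shell.
- by move=> l; apply: measurable_funM => //; apply: measurable_indic; exact: measurable_rbox.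
- by move=> x; rewrite mulr_ge0 ?powR_ge0.
- by move=> l x; rewrite mulr_ge0 ?powR_ge0.
- move=> x; have s0 : 0 <= \sum_(l < i.*2.+4) c l * \1_(box l) x.
    by rewrite sumr_ge0// => l _; rewrite mulr_ge0 ?powR_ge0.
  have [xs|xs] := pselect (shell i x); last by rewrite indicE memNset// mulr0.
  rewrite indicE mem_set// mulr1; have [Q0 /andP[s1 s2]] := xs.
  have i1 : i.+1%:R = i%:R + 1 :> R by rewrite -natr1.
  have Q1 : Q x < P (i%:R + 2).
    apply: le_lt_trans (Q_le Q0) _; have -> : i%:R + 2 = 1 + i.+1%:R :> R by rewrite i1; ring.
    by rewrite pow2D powRr1// ltr_pM2l.
  have Q2 : P (- i%:R - 2) < Q x.
    have -> : - i%:R - 2 = - (i%:R + 2) :> R by ring.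
    rewrite powRN -[X in X < _]mul1r ltr_pdivrMr ?pow2_gt0//; apply: le_lt_trans (Q_ge Q0) _.
    have -> : i%:R + 2 = 1 + i.+1%:R :> R by rewrite i1; ring.
    have -> : Q x * P (1 + i.+1%:R) = 2 * Q x * P i.+1%:R by rewrite pow2D powRr1//; ring.
    by rewrite ltr_pM2l// mulr_gt0.
  have ex : exists l : nat, Q x < P (l%:R - i%:R - 1).
    exists (i.*2.+3)%N; apply: lt_le_trans Q1 _; apply: pow2_le.
    by rewrite -addn3 -muln2 natrD natrM; trim_lra.
  case: (ex_minnP ex) => l Hl Hmin.
  have ll : (l < i.*2.+4)%N.
    rewrite ltnS; apply: Hmin; apply: lt_le_trans Q1 _; apply: pow2_le.
    by rewrite -addn3 -muln2 natrD natrM; trim_lra.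
  have Ql : P (l%:R - i%:R - 2) <= Q x.
    case: l Hl Hmin ll => [|l] Hl Hmin _; first by rewrite sub0r ltW.
    rewrite leNgt; apply/negP => h; have : (l.+1 <= l)%N; last by rewrite ltnn.
    by apply: Hmin; apply: lt_le_trans h _; apply: pow2_le; rewrite -natr1; trim_lra.
  have xb : box l x.
    move=> j; rewrite -ler_norml /rho; case: ifP => jk; first exact: le_trans (coord_head x jk) (ltW Hl).
    rewrite -ler_sqr ?nnegrE ?powR_ge0// real_normK ?num_real//; apply: le_trans (coord_sq x j) _.
    apply: (@le_trans _ _ (2 * Q x * ss x)); first by rewrite ssE// lerDr.
    rewrite -powR_mulrn ?powR_ge0// -powRrM divfK//.
    have -> : l%:R + 1 = 1 + (l%:R - i%:R - 1) + i.+1%:R :> R by rewrite i1; ring.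
    rewrite pow2D (pow2D 1) powRr1//; apply: ler_pM; [by rewrite mulr_ge0 ?Q_ge0|by have := ss_ge1 Q0; trim_lra| |exact: ltW].
    by rewrite ler_pM2l// ltW.
  rewrite (bigD1 (Ordinal ll))//= indicE mem_set// mulr1.
  apply: (@le_trans _ _ (c l)); last first.
    by rewrite lerDl sumr_ge0// => m _; rewrite mulr_ge0 ?powR_ge0.
  rewrite /c powRrM; apply: (powR_antimono (pow2_gt0 _) Ql).
  by move: aA; rewrite nA; trim_lra.
- move=> l; under eq_integral do rewrite EFinM.
  rewrite ge0_integralZl//; last 2 first.
  + by apply/measurable_EFinP; apply: measurable_indic; exact: measurable_rbox.
  + by rewrite lee_fin powR_ge0.
  rewrite integral_indic ?setIT//; last exact: measurable_rbox.
  rewrite lebesgue_rbox; last by move=> j; have := rho0 l j; trim_lra.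
  rewrite -EFinM lee_fin.
  have -> : \prod_(j < n) (rho l j - - rho l j) = P (\sum_(j < n) (if (j < k)%N then l%:R - i%:R else (l%:R + 3) / 2)).
    rewrite (big_morph (fun t => P t) (@pow2D R) (powRr0 2)); apply: eq_bigr => j _.
    have P2 (t : R) : P t - - P t = P (1 + t) by rewrite pow2D powRr1// opprK; ring.
    by rewrite /rho; case: ifP => _; rewrite P2; congr (_ `^ _); field.
  rewrite sum_head /c /b /C0 /q -powR_mulrn ?powR_ge0// -powRrM -!pow2D le_eqVlt; apply/orP; left; apply/eqP.
  by congr (_ `^ _); rewrite nA; field.
Qed.

Definition shell_majorant a e x := Q x `^ (a - n%:R) * ss x `^ (- (2 * A - a) - e).

Lemma shell_majorant_ge0 a e x : 0 <= shell_majorant a e x.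
Proof. by rewrite mulr_ge0 ?powR_ge0. Qed.

Lemma measurable_shell_majorant a e : measurable_fun setT (shell_majorant a e).
Proof.
apply: measurable_funM; first exact: measurable_Qpow.
by apply: (measurable_ss_comp (f := fun t => t `^ _)); exact: measurable_powR.
Qed.

(** By [shell_integral] the l-th shell contributes O(2^(-e l)). *)
Lemma shell_majorant_integrable a e : 0 <= a -> a < A -> 0 < e -> mu.-integrable setT (EFin \o shell_majorant a e).
Proof.
move=> a0 aA e0; have [C C0 HC] := shell_integral a0 aA.
have nA : n%:R = k%:R + 2 * A :> R by rewrite /A; field.
have kpos : 0 < k%:R :> R by rewrite ltr0n; lia.
pose w := 2 * A - a + e.
have w0 : 0 < w by rewrite /w; trim_lra.
have e1 : 0 <= P (- e) < 1.
  by rewrite ltW ?pow2_gt0//=; apply: pow2_lt1; trim_lra.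
apply: (@integrable_series _ _ _ mu _ (fun l x => P (- (l%:R * w)) * (Q x `^ (a - n%:R) * \1_(shell l) x)) C (P (- e))) => //.
- exact: measurable_shell_majorant.
- move=> l; apply: measurable_funM => //; apply: measurable_funM; first exact: measurable_Qpow.
  by apply: measurable_indic; exact: measurable_shell.
- by move=> x; exact: shell_majorant_ge0.
- by move=> l x; rewrite !mulr_ge0 ?powR_ge0.
- move=> x; have [Q0|Q0] := ltP 0 (Q x); last first.
    exists 0%N; rewrite /shell_majorant (_ : Q x = 0); last by apply/eqP; rewrite eq_le Q0 Q_ge0.
    by rewrite powR0 ?mul0r ?mulr0//; apply/eqP; move: aA; rewrite nA; trim_lra.
  have [l xl] := shell_cover Q0; exists l; rewrite indicE mem_set// mulr1 /shell_majorant [leRHS]mulrC.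
  apply: ler_wpM2l; first exact: powR_ge0.
  have [_ /andP[s1 _]] := xl.
  have -> : - (2 * A - a) - e = - w by rewrite /w; ring.
  have -> : - (l%:R * w) = l%:R * - w by ring.
  by rewrite powRrM; apply: (powR_antimono (pow2_gt0 _) s1); trim_lra.
- move=> l; under eq_integral do rewrite EFinM.
  rewrite ge0_integralZl//; last 2 first.
  + apply/measurable_EFinP; apply: measurable_funM; first exact: measurable_Qpow.
    by apply: measurable_indic; exact: measurable_shell.
  + by move=> *; rewrite lee_fin ?mulr_ge0 ?powR_ge0.
  apply: (@le_trans _ _ ((P (- (l%:R * w)))%:E * (C * P (l%:R * (2 * A - a)))%:E)%E).
    by apply: lee_wpmul2l; [rewrite lee_fin powR_ge0|exact: HC].
  rewrite -EFinM lee_fin mulrCA; apply: ler_wpM2l => //.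
  rewrite -pow2D -powR_mulrn ?powR_ge0// -powRrM; apply: pow2_le.
  by rewrite /w; trim_lra.
Qed.

Lemma measurable_ss_lt r : measurable [set x | 0 < Q x /\ ss x < r].
Proof.
have -> : [set x | 0 < Q x /\ ss x < r] = (fun x => Q x) @^-1` `]0, +oo[ `&` ss @^-1` `]-oo, r[.
  by apply/seteqP; split => x /=; rewrite !in_itv/= andbT.
apply: measurableI; rewrite -[X in measurable X]setTI.
  by apply: measurable_Q => //; exact: measurable_itv.
by apply: measurable_ss => //; exact: measurable_itv.
Qed.

(** The borderline case without the gain e: each shell contributes a bounded amount, so cutting at
    2^m costs only a factor m. The squared slope of the logarithmic cutoff will pay for it. *)
Lemma log_integral : exists2 C : R, 0 <= C & forall m : nat,
  (\int[mu]_x (Q x `^ (- n%:R) * ss x `^ (- (2 * A)) * \1_[set x | 0 < Q x /\ ss x < P m%:R] x)%:E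
    <= (C * m%:R)%:E)%E.
Proof.
have nA : n%:R = k%:R + 2 * A :> R by rewrite /A; field.
have A0 : 0 < A by rewrite /A divr_gt0// subr_gt0 ltr_nat.
have [C C0 HC] := shell_integral (lexx 0) A0; exists C => // m.
have -> : C * m%:R = \sum_(l < m) C by rewrite sumr_const card_ord mulr_natr.
have mS := measurable_ss_lt (P m%:R).
have mQs : measurable_fun setT (fun x => Q x `^ (- n%:R) * ss x `^ (- (2 * A))).
  apply: measurable_funM; first exact: measurable_Qpow.
  by apply: (measurable_ss_comp (f := fun t => t `^ _)); exact: measurable_powR.
apply: (@integral_le_sum _ _ _ mu m _ (fun l x => P (- (l%:R * (2 * A))) * (Q x `^ (0 - n%:R) * \1_(shell l) x)) (fun=> C)).
- by apply: measurable_funM => //; exact: measurable_indic.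
- move=> l; apply: measurable_funM => //; apply: measurable_funM; first exact: measurable_Qpow.
  by apply: measurable_indic; exact: measurable_shell.
- by move=> x; rewrite !mulr_ge0 ?powR_ge0.
- by move=> l x; rewrite !mulr_ge0 ?powR_ge0.
- move=> x; have S0 : 0 <= \sum_(l < m) P (- (l%:R * (2 * A))) * (Q x `^ (0 - n%:R) * \1_(shell l) x).
    by rewrite sumr_ge0// => l _; rewrite !mulr_ge0 ?powR_ge0.
  have [xm|xm] := pselect ([set x | 0 < Q x /\ ss x < P m%:R] x); last by rewrite indicE memNset// mulr0.
  rewrite indicE mem_set// mulr1; have [Q0 sm] := xm.
  have [l xl] := shell_cover Q0; have [_ /andP[s1 _]] := xl.
  have lm : (l < m)%N.
    rewrite ltnNge; apply/negP => ml; have : P m%:R <= P l%:R by apply: pow2_le; rewrite ler_nat.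
    by trim_lra.
  rewrite (bigD1 (Ordinal lm))//= indicE mem_set// mulr1 sub0r.
  apply: (@le_trans _ _ (P (- (l%:R * (2 * A))) * Q x `^ (- n%:R))); last first.
    by rewrite lerDl sumr_ge0// => j _; rewrite !mulr_ge0 ?powR_ge0.
  rewrite mulrC; apply: ler_wpM2r; first exact: powR_ge0.
  have -> : - (l%:R * (2 * A)) = l%:R * - (2 * A) by ring.
  by rewrite powRrM; apply: (powR_antimono (pow2_gt0 _) s1); trim_lra.
- move=> l; under eq_integral do rewrite EFinM.
  rewrite ge0_integralZl//; last 2 first.
  + apply/measurable_EFinP; apply: measurable_funM; first exact: measurable_Qpow.
    by apply: measurable_indic; exact: measurable_shell.
  + by move=> *; rewrite lee_fin ?mulr_ge0 ?powR_ge0.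
  apply: (@le_trans _ _ ((P (- (l%:R * (2 * A))))%:E * (C * P (l%:R * (2 * A - 0)))%:E)%E).
    by apply: lee_wpmul2l; [rewrite lee_fin powR_ge0|exact: HC].
  by rewrite -EFinM lee_fin mulrCA -pow2D subr0 addNr powRr0 mulr1.
Qed.

End Geometry.

(** * Cylindrical functions *)

Section Cylindrical.
Context {R : realType} (n k : nat).
Implicit Types (x : 'rV[R]_n) (i j : 'I_n) (b : R) (h dh : R -> R).

Notation Q x := (head_norm k x).
Notation ss x := (ss k x).

Lemma differentiable_near0 (f : 'rV[R]_n -> R) x :
  (\forall y \near x, f y = 0) -> differentiable f x.
Proof.
move=> f0; have fx : f x = 0 by exact: (nbhs_singleton f0).
apply/diffP => /=.
(* The differential is a chosen linear map, so the zero map is offered as a witness of the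
   first-order expansion. *)
apply: (@getPex _ (fun (df : {linear 'rV[R]_n -> R}) => continuous df /\
  forall y, f y = f (lim (nbhs x)) + df (y - lim (nbhs x))
                  +o_(y \near x) (y - lim (nbhs x)))).
exists (\0 : {linear 'rV[R]_n -> R}); split; first by move=> y; exact: cst_continuous.
move=> y; rewrite littleoE.
  by rewrite lim_id// fx /= !add0r subr0.
move=> e e0; apply: filterS f0 => z /= ->.
by rewrite lim_id// fx /= addr0 subr0 normr0 mulr_ge0// ltW.
Qed.

Lemma line_quotient i (F : 'rV[R]_n -> R) x :
  (fun t => t^-1 *: ((F \o shift x) (t *: ei i) - F x)) =
  fun t : R => t^-1 *: (((fun t => F (x + t *: ei i)) \o shift 0) (t *: (1 : R)) - F (x + 0 *: ei i)).
Proof.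
apply/funext => t /=; have -> : t *: (1 : R) = t by exact: mulr1.
by rewrite addr0 scale0r addr0 [X in F X - _]addrC.
Qed.

Lemma partial_Dr i (F : 'rV[R]_n -> R) x (d : R) :
  Dr (fun t => F (x + t *: ei i)) 0 d -> partial i F x = d.
Proof. by move=> [_ <-]; rewrite /partial /derive line_quotient. Qed.

Lemma Dr_partial i (F : 'rV[R]_n -> R) x :
  differentiable F x -> Dr (fun t => F (x + t *: ei i)) 0 (partial i F x).
Proof.
move=> dF; have := @diff_derivable _ _ _ F x (ei i) dF.
rewrite /derivable => cF; apply: DeriveDef; first by rewrite /derivable -line_quotient.
by rewrite /partial /derive -line_quotient.
Qed.

Definition hd i : R := ((i < k)%N)%:R.

Lemma hd_sq i : hd i * hd i = hd i.
Proof. by rewrite /hd -natrM mulnb andbb. Qed.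

Lemma sqn_line x i (t : R) : sqn (x + t *: ei i) = sqn x + (2 * x ord0 i * t + t ^+ 2).
Proof.
rewrite /sqn (bigD1 i)//= [in RHS](bigD1 i)//= !eiE eqxx mulr1.
rewrite (eq_bigr (fun j => x ord0 j ^+ 2)) => [|j ji]; first ring.
by rewrite eiE (negbTE ji) mulr0 addr0.
Qed.

Lemma Q_line x i (t : R) : Q (x + t *: ei i) = (Q x ^+ 2 + hd i * (2 * x ord0 i * t + t ^+ 2)) `^ 2^-1.
Proof.
have E : \sum_(j < n | (j < k)%N) (x + t *: ei i) ord0 j ^+ 2 = Q x ^+ 2 + hd i * (2 * x ord0 i * t + t ^+ 2).
  rewrite Q_sq /hd; have [ik|ik] := boolP (i < k)%N.
    rewrite (bigD1 i)//= [in RHS](bigD1 i)//= !eiE eqxx mulr1.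
    rewrite (eq_bigr (fun j => x ord0 j ^+ 2)) => [|j /andP[_ ji]]; first ring.
    by rewrite eiE (negbTE ji) mulr0 addr0.
  rewrite mul0r addr0; apply: eq_bigr => j jk; rewrite eiE.
  have [ji|ji] := eqVneq j i; last by rewrite mulr0 addr0.
  by move: ik; rewrite -ji jk.
by rewrite -E powR12_sqrt// sumr_ge0// => j _; exact: sqr_ge0.
Qed.

Lemma Dr_quad x i : Dr (fun t : R => 2 * x ord0 i * t + t ^+ 2) 0 (2 * x ord0 i).
Proof.
apply: (Dr_eq (DrD (DrM (Dr_cst (2 * x ord0 i) 0) (Dr_id 0)) (DrX 2 (Dr_id 0)))).
by rewrite expr1; ring.
Qed.

Lemma Dr_Q x i : 0 < Q x -> Dr (fun t => Q (x + t *: ei i)) 0 (hd i * x ord0 i / Q x).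
Proof.
move=> Q0; have -> : (fun t => Q (x + t *: ei i)) =
    fun t => (Q x ^+ 2 + hd i * (2 * x ord0 i * t + t ^+ 2)) `^ 2^-1.
  by apply/funext => t; exact: Q_line.
have D := DrD (Dr_cst (Q x ^+ 2) 0) (DrM (Dr_cst (hd i) 0) (Dr_quad x i)).
have E : Q x ^+ 2 + hd i * (2 * x ord0 i * 0 + 0 ^+ 2) = Q x ^+ 2 by rewrite expr0n/=; ring.
have P : 0 < Q x ^+ 2 + hd i * (2 * x ord0 i * 0 + 0 ^+ 2) by rewrite E exprn_gt0.
apply: (Dr_eq (Dr_powR (f := fun t => Q x ^+ 2 + hd i * (2 * x ord0 i * t + t ^+ 2)) 2^-1 P D)).
rewrite E.
have -> : (Q x ^+ 2) `^ (2^-1 - 1) = (Q x)^-1.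
  rewrite -powR_mulrn ?ltW// -powRrM -[RHS]powR_inv1 ?ltW//; congr (_ `^ _); by field.
by field; exact: lt0r_neq0.
Qed.

Lemma Dr_ss x i : 0 < Q x ->
  Dr (fun t => ss (x + t *: ei i)) 0 (x ord0 i / Q x - hd i * x ord0 i * ss x / Q x ^+ 2).
Proof.
move=> Q0.
have -> : (fun t => ss (x + t *: ei i)) = fun t =>
    (1 + (sqn x + (2 * x ord0 i * t + t ^+ 2))) * (2 * Q (x + t *: ei i))^-1.
  by apply/funext => t; rewrite -sqn_line.
have D1 := DrD (Dr_cst (1 : R) 0) (DrD (Dr_cst (sqn x) 0) (Dr_quad x i)).
have D2 := DrM (Dr_cst (2 : R) 0) (Dr_Q i Q0).
have E : x + 0 *: ei i = x by rewrite scale0r addr0.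
have N0 : 2 * Q (x + 0 *: ei i) != 0 by rewrite E gt_eqF// mulr_gt0.
apply: (Dr_eq (DrM D1 (DrV (f := fun t => 2 * Q (x + t *: ei i)) N0 D2))); rewrite E ss_def expr0n/=.
by field; rewrite gt_eqF.
Qed.

Definition cyl b h x : R := Q x `^ b * h (ss x).

(** From dQ = hd_i x_i / Q and ds = x_i / Q - hd_i x_i s / Q^2 in the direction i. The result is
    again x_i times cylindrical functions, so repeated differentiation stays in one class. *)
Definition dcyl b h dh i x : R :=
  x ord0 i * (hd i * cyl (b - 2) (fun s => b * h s - s * dh s) x + cyl (b - 1) dh x).

Lemma Qpow_pred b x : 0 < Q x -> Q x `^ b = Q x * Q x `^ (b - 1).
Proof.
move=> Q0; transitivity (Q x `^ 1 * Q x `^ (b - 1)); last by rewrite powRr1 ?Q_ge0.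
by rewrite -powRDp//; congr (_ `^ _); ring.
Qed.

Lemma Qpow_pred2 b x : 0 < Q x -> Q x `^ b = Q x ^+ 2 * Q x `^ (b - 2).
Proof.
by move=> Q0; rewrite -[in RHS]powR_mulrn ?ltW// -powRDp//; congr (_ `^ _); ring.
Qed.

Lemma Dr_cyl b h dh x i : 0 < Q x -> Dr h (ss x) (dh (ss x)) ->
  Dr (fun t => cyl b h (x + t *: ei i)) 0 (dcyl b h dh i x).
Proof.
move=> Q0 Dh; have E : x + 0 *: ei i = x by rewrite scale0r addr0.
have D1 : Dr (fun t => Q (x + t *: ei i) `^ b) 0 (b * Q x `^ (b - 1) * (hd i * x ord0 i / Q x)).
  by have := @Dr_powR R (fun t => Q (x + t *: ei i)) 0 _ b; rewrite E; apply => //; exact: Dr_Q.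
have D2 : Dr (fun t => h (ss (x + t *: ei i))) 0
    (dh (ss x) * (x ord0 i / Q x - hd i * x ord0 i * ss x / Q x ^+ 2)).
  by apply: (Dr_comp (f := fun t => ss (x + t *: ei i)) (Dr_ss i Q0)); rewrite E.
apply: (Dr_eq (DrM D1 D2)); rewrite E /dcyl /cyl (Qpow_pred2 b Q0).
have -> : Q x `^ (b - 1) = Q x * Q x `^ (b - 2).
  by rewrite (Qpow_pred _ Q0); congr (_ * _ `^ _); ring.
by field; rewrite gt_eqF.
Qed.

Lemma cyl0 b h x : b != 0 -> Q x = 0 -> cyl b h x = 0.
Proof. by move=> b0 Q0; rewrite /cyl Q0 powR0// mul0r. Qed.

Lemma Q0_gt0 x : Q x != 0 -> 0 < Q x.
Proof. by rewrite lt0r Q_ge0 andbT. Qed.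

Lemma dcyl0 b h dh i x : b < 0 -> Q x = 0 -> dcyl b h dh i x = 0.
Proof. by move=> b0 Q0; rewrite /dcyl !cyl0 ?mulr0 ?addr0 ?mulr0//; apply/eqP; trim_lra. Qed.

Lemma ss_large x (S : R) : 0 < Q x -> 0 < S -> 2 * Q x * S < 1 -> S < ss x.
Proof.
move=> Q0 S0 h; have := Q_ge Q0; rewrite -(ltr_pM2l (_ : 0 < 2 * Q x)) ?mulr_gt0//; trim_lra.
Qed.

Lemma continuous_Q : continuous (fun x => Q x).
Proof.
move=> x; apply: (continuous_comp (f := fun x : 'rV[R]_n => \sum_(i < n | (i < k)%N) x ord0 i ^+ 2));
  last exact: sqrt_continuous.
rewrite (_ : (fun x => _) = (fun x => \sum_(i < n | (i < k)%N) (fun x : 'rV[R]_n => x ord0 i ^+ 2) x))//.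
apply: continuous_big => // [|i _].
  by move=> y; exact: add_continuous.
move=> y; apply: (@continuous_comp _ _ _ (fun x : 'rV[R]_n => x ord0 i) (fun z : R => z ^+ 2)).
  exact: coord_continuous.
exact: exprn_continuous.
Qed.

(** Since 2 |y| s >= 1, s exceeds any bound near y = 0; a profile vanishing for large s thus gives a
    function vanishing in a neighbourhood of the singular set. *)
Lemma cyl_near0 b h (S : R) x : b != 0 -> (forall s, S <= s -> h s = 0) -> Q x = 0 ->
  \forall y \near x, cyl b h y = 0.
Proof.
move=> b0 hS Q0; pose S' := `|S| + 1; have S0 : 0 < S' by rewrite /S'; have := normr_ge0 S; trim_lra.
have : \forall y \near x, Q y < (2 * S')^-1.
  have /cvgrPdist_lt/(_ (2 * S')^-1) := @continuous_Q x.
  rewrite invr_gt0 mulr_gt0// => /(_ isT); apply: filterS => y.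
  by rewrite Q0 sub0r normrN ger0_norm// Q_ge0.
apply: filterS => y Qy; have [Qy0|/Q0_gt0 Qy0] := eqVneq (Q y) 0; first exact: cyl0.
rewrite /cyl hS ?mulr0//; apply: le_trans (ltW (ss_large Qy0 S0 _)).
  by rewrite /S'; have := ler_norm S; trim_lra.
by move: Qy; rewrite -[X in _ < X]mul1r ltr_pdivlMr ?mulr_gt0//; trim_lra.
Qed.

Lemma line_continuous x i : continuous (fun t : R => x + t *: ei i).
Proof.
move=> t; apply: (@continuousD _ _ _ (fun=> x) (fun t : R => t *: ei i)); first exact: cst_continuous.
exact: scalel_continuous.
Qed.

Lemma Dr_cyl_all b h dh (S : R) x i : b < 0 -> (forall s, Dr h s (dh s)) ->
  (forall s, S <= s -> h s = 0) ->
  Dr (fun t => cyl b h (x + t *: ei i)) 0 (dcyl b h dh i x).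
Proof.
move=> b0 Dh hS; have [Q0|/Q0_gt0 Q0] := eqVneq (Q x) 0; last exact: Dr_cyl.
rewrite dcyl0//; apply: (@Dr_near _ (fun=> 0)); last exact: Dr_cst.
have bn : b != 0 by apply/eqP; trim_lra.
have E : nbhs (x + 0 *: ei i) [set y | cyl b h y = 0].
  by rewrite scale0r addr0; exact: cyl_near0 hS Q0.
have : \forall t \near (0 : R), cyl b h (x + t *: ei i) = 0 := @line_continuous x i 0 _ E.
by apply: filterS => t ->.
Qed.

Lemma differentiable_sumsq (P : pred 'I_n) x :
  differentiable (fun y : 'rV[R]_n => \sum_(j < n | P j) y ord0 j ^+ 2) x.
Proof.
rewrite (_ : (fun y => _) = \sum_(j < n) (if P j then (fun y : 'rV[R]_n => y ord0 j) ^+ 2 else cst 0)).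
  apply: differentiable_sum => j; case: (P j); last exact: differentiable_cst.
  by apply: differentiableX; exact: differentiable_coord.
apply/funext => y; rewrite fct_sumE big_mkcond/=; apply: eq_bigr => j _; by case: (P j).
Qed.

Lemma differentiable_comp1 (g : R -> R) (f : 'rV[R]_n -> R) x (d : R) :
  differentiable f x -> Dr g (f x) d -> differentiable (fun y => g (f y)) x.
Proof.
by move=> df [/derivable1_diffP dg _]; exact: differentiable_comp.
Qed.

Lemma differentiable_cyl_pos b h x (d : R) : 0 < Q x -> Dr h (ss x) d -> differentiable (cyl b h) x.
Proof.
move=> Q0 Dh; pose q2 (y : 'rV[R]_n) := \sum_(j < n | (j < k)%N) y ord0 j ^+ 2.
have q2E y : q2 y = Q y ^+ 2 by rewrite Q_sq.
have q2x : 0 < q2 x by rewrite q2E exprn_gt0.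
have pE y (r : R) : q2 y `^ (r / 2) = Q y `^ r.
  by rewrite q2E -powR_mulrn ?Q_ge0// -powRrM mulrCA divff// mulr1.
have dp (r : R) : differentiable (fun y => Q y `^ r) x.
  rewrite (_ : (fun y => _) = fun y => q2 y `^ (r / 2)); last by apply/funext => y; rewrite pE.
  apply: (@differentiable_comp1 (fun z => z `^ (r / 2)) q2 x); first exact: differentiable_sumsq.
  exact: (Dr_powR _ q2x (Dr_id _)).
have dss : differentiable (fun y => ss y) x.
  rewrite (_ : (fun y => _) = (cst 2^-1 * ((cst 1 + @sqn R n) * (fun y => Q y `^ (- 1))))%R).
    apply: differentiableM; first exact: differentiable_cst.
    apply: differentiableM (dp _); apply: differentiableD; first exact: differentiable_cst.
    exact: (@differentiable_sumsq xpredT).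
  by apply/funext => y; rewrite !fctE powR_inv1 ?Q_ge0// ss_def invfM; ring.
exact: (differentiableM (dp b) (differentiable_comp1 dss Dh)).
Qed.

Lemma differentiable_cyl b h dh (S : R) x : b < 0 -> (forall s, Dr h s (dh s)) ->
  (forall s, S <= s -> h s = 0) -> differentiable (cyl b h) x.
Proof.
move=> b0 Dh hS; have [Q0|/Q0_gt0 Q0] := eqVneq (Q x) 0; last exact: differentiable_cyl_pos (Dh _).
by apply: differentiable_near0; apply: cyl_near0 hS Q0; apply/eqP; trim_lra.
Qed.

End Cylindrical.

(** * Test functions *)

Section TestFunctions.
Context {R : realType} (n k : nat).
Implicit Types (x : 'rV[R]_n) (i j : 'I_n) (b : R) (h : R -> R) (F : 'rV[R]_n -> R).

Notation Q x := (head_norm k x).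

Lemma norm_coord x i : `|x ord0 i| <= `|x|.
Proof.
by rewrite [leRHS]mx_normrE; apply: (@le_bigmax _ _ _ 0 (fun ij : 'I_1 * 'I_n => `|x ij.1 ij.2|) (ord0, i)).
Qed.

Lemma norm_cube x r : 0 <= r -> cube r x -> `|x| <= r.
Proof.
by move=> r0 xr; rewrite [leLHS]mx_normrE; apply: bigmax_le => // -[i0 i] _ /=; rewrite (ord1 i0).
Qed.

Lemma closed_cube r : closed (@cube R n r).
Proof.
have -> : cube r = \bigcap_(i in setT) ((fun x : 'rV[R]_n => `|x ord0 i|) @^-1` [set y | y <= r]).
  by apply/seteqP; split => x /= h; [move=> i _; exact: h|move=> i; exact: h].
apply: closed_bigI => i _; apply: closed_comp; last exact: closed_le.
move=> x _; apply: (@continuous_comp _ _ _ (fun x : 'rV[R]_n => x ord0 i) (fun y : R => `|y|)).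
  exact: coord_continuous.
exact: norm_continuous.
Qed.

Lemma compact_support F r : 0 <= r -> (forall x, F x != 0 -> cube r x) ->
  compact (closure [set x | F x != 0]).
Proof.
move=> r0 Fr; apply: bounded_closed_compact; last exact: closed_closure.
have : closure [set x | F x != 0] `<=` cube r.
  by rewrite [X in _ `<=` X](closure_id (cube r)).1; [apply: closure_subset => x /=; exact: Fr|exact: closed_cube].
move=> sub; exists r; split; first exact: num_real.
by move=> M rM x /sub xr; apply: le_trans (norm_cube r0 xr) (ltW rM).
Qed.

(** Differentiable functions stable under partial derivatives: smoothness of a cutoff cylindrical
    function follows by induction on the word of derivatives. *)
Inductive cylS : ('rV[R]_n -> R) -> Prop :=
| cylS_cyl b h (S : R) : b < 0 -> Sm h -> (forall s, S <= s -> h s = 0) -> cylS (cyl k b h)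
| cylS_coord i F : cylS F -> cylS (fun x => x ord0 i * F x)
| cylS_add F G : cylS F -> cylS G -> cylS (fun x => F x + G x)
| cylS_scale (c : R) F : cylS F -> cylS (fun x => c * F x).

Lemma cylS_differentiable F x : cylS F -> differentiable F x.
Proof.
elim=> {F} [b h S b0 Sh hS|i F _ IH|F G _ IF _ IG|c F _ IF].
- by have [dh _ Dh] := Sm_Dr Sh; exact: differentiable_cyl b0 Dh hS.
- by apply: differentiableM IH; exact: differentiable_coord.
- exact: differentiableD.
- by apply: differentiableM IF; exact: differentiable_cst.
Qed.

Lemma Dr_coord x i j : Dr (fun t => (x + t *: ei i) ord0 j) 0 (j == i)%:R.
Proof.
have -> : (fun t => (x + t *: ei i) ord0 j) = fun t : R => x ord0 j + t * (j == i)%:R.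
  by apply/funext => t; rewrite eiE.
by apply: (Dr_eq (DrD (Dr_cst _ 0) (DrM (Dr_id 0) (Dr_cst _ 0)))); ring.
Qed.

Lemma Sm_vanish_Dr h (S : R) : Sm h -> (forall s, S <= s -> h s = 0) ->
  exists dh, [/\ Sm dh, forall s, Dr h s (dh s) & forall s, S + 1 <= s -> dh s = 0].
Proof.
move=> Sh hS; have [dh Sdh Dh] := Sm_Dr Sh; exists dh; split => // s sS.
apply: (Dr_unique (Dh s)); apply: (@Dr_near _ (fun=> 0)); last exact: Dr_cst.
near=> y; rewrite hS// ltW//; near: y; apply: lt_nbhsr; trim_lra.
Unshelve. all: by end_near. Qed.

Lemma cylS_partial F i : cylS F -> cylS (partial i F).
Proof.
elim=> {F} [b h S b0 Sh hS|j F SF IH|F G SF IF SG IG|c F SF IF].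
- have [dh [Sdh Dh dhS]] := Sm_vanish_Dr Sh hS.
  have -> : partial i (cyl k b h) = fun x => x ord0 i * (hd k i *
      cyl k (b - 2) (fun s => b * h s + (- 1) * (s * dh s)) x + cyl k (b - 1) dh x).
    apply/funext => x; rewrite (partial_Dr (Dr_cyl_all k x i b0 Dh hS)) /dcyl.
    by congr (_ * (_ * cyl _ _ _ _ + _)); apply/funext => s; ring.
  apply: cylS_coord; apply: cylS_add.
    apply: cylS_scale; apply: (@cylS_cyl _ _ (S + 1)); first by trim_lra.
      apply: Sm_add; apply: Sm_mul; [exact: Sm_cst|exact: Sh|exact: Sm_cst|].
      by apply: Sm_mul Sdh; exact: Sm_id.
    by move=> s sS; rewrite hS ?dhS//; [ring|trim_lra].
  by apply: cylS_cyl Sdh dhS; trim_lra.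
- have -> : partial i (fun x => x ord0 j * F x) =
      fun x => (j == i)%:R * F x + x ord0 j * partial i F x.
    apply/funext => x; apply: partial_Dr.
    apply: (Dr_eq (DrM (Dr_coord x i j) (Dr_partial i (cylS_differentiable x SF)))).
    by rewrite scale0r addr0; ring.
  by apply: cylS_add; [exact: cylS_scale|exact: cylS_coord].
- have -> : partial i (fun x => F x + G x) = fun x => partial i F x + partial i G x.
    apply/funext => x; apply: partial_Dr.
    by apply: DrD; apply: Dr_partial; exact: cylS_differentiable.
  exact: cylS_add.
- have -> : partial i (fun x => c * F x) = fun x => c * partial i F x.
    apply/funext => x; apply: partial_Dr.
    apply: (Dr_eq (DrM (Dr_cst c 0) (Dr_partial i (cylS_differentiable x SF)))).
    by rewrite mulr0 addr0.
  exact: cylS_scale.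
Qed.

Lemma cyl_support b h (S : R) x : b < 0 -> 0 <= S -> (forall s, S <= s -> h s = 0) ->
  cyl k b h x != 0 -> [/\ 0 < Q x, ss k x <= S & cube (2 * S) x].
Proof.
move=> b0 S0 hS cx; have Q0 : 0 < Q x.
  apply: Q0_gt0; apply: contraNneq cx => Q0; rewrite cyl0//; apply/eqP; trim_lra.
have sS : ss k x <= S.
  by rewrite leNgt; apply/negP => /ltW/hS h0; move: cx; rewrite /cyl h0 mulr0 eqxx.
split=> // i; rewrite -ler_sqr ?nnegrE ?mulr_ge0// real_normK ?num_real//.
apply: le_trans (coord_sq x i) _; have E := ssE Q0; have Ql := Q_le Q0; have s1 := ss_ge1 Q0.
apply: (@le_trans _ _ (2 * Q x * ss k x)); first by rewrite E; trim_lra.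
have -> : (2 * S) ^+ 2 = (4 * S) * S by ring.
by apply: ler_pM; trim_lra.
Qed.

Lemma test_cyl b h (S : R) : b < 0 -> 0 <= S -> Sm h -> (forall s, S <= s -> h s = 0) ->
  test_function (cyl k b h : 'rV[R]_n -> R).
Proof.
move=> b0 S0 Sh hS; split.
  move=> s x; apply: cylS_differentiable; elim: s => [|i s IH] /=; first exact: cylS_cyl hS.
  exact: cylS_partial.
apply: (@compact_support _ (2 * S)) => [|x /(cyl_support b0 S0 hS)[]//].
by rewrite mulr_ge0.
Qed.

Lemma test_bounded F : test_function F -> exists L r, [/\ 0 <= L, 0 <= r,
  forall x, `|F x| <= L /\ (F x != 0 -> cube r x) &
  forall i x, `|partial i F x| <= L /\ (partial i F x != 0 -> cube r x)].
Proof.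
move=> [SF KF]; set K := closure _ in KF.
have [N [_ HN]] := compact_bounded KF.
have Kr x : K x -> cube (`|N| + 1) x.
  move=> Kx i; apply: le_trans (norm_coord x i) (HN _ _ x Kx).
  by have := ler_norm N; trim_lra.
have bnd (G : 'rV[R]_n -> R) : continuous G -> exists2 L : R, 0 <= L & forall x, K x -> `|G x| <= L.
  move=> Gc; have [M [_ HM]] := compact_bounded (continuous_compact (continuous_subspaceT Gc) KF).
  exists (`|M| + 1); first by have := normr_ge0 M; trim_lra.
  by move=> x Kx; apply: (HM (`|M| + 1)); [have := ler_norm M; trim_lra|exists x].
have FK x : F x != 0 -> K x by move=> Fx; exact: subset_closure.
have pK i x : partial i F x != 0 -> K x.
  move=> px; apply: contrapT => nK; move/eqP: px; apply.
  have oK : open (~` K) by apply: closed_openC; exact: closed_closure.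
  apply: partial_Dr; apply: (@Dr_near _ (fun=> 0)); last exact: Dr_cst.
  have nx : nbhs (x + 0 *: ei i) (~` K) by rewrite scale0r addr0; exact: open_nbhs_nbhs.
  have : \forall t \near (0 : R), (~` K) (x + t *: ei i) := @line_continuous _ _ x i 0 _ nx.
  apply: filterS => t nt; apply/esym/eqP; apply: contraPT nt => Ft nt.
  by apply: nt; exact: FK.
have cF s : continuous (foldr (@partial R n) F s).
  by move=> x; apply: differentiable_continuous; exact: SF.
have [L0 L00 HL0] := bnd F (cF [::]).
have Hp i : {L : R | 0 <= L & forall x, K x -> `|partial i F x| <= L}.
  by apply: cid2; exact: bnd (cF [:: i]).
pose L := L0 + \sum_(i < n) s2val (Hp i).
have Ls i : s2val (Hp i) <= L.
  rewrite /L (bigD1 i)//= addrCA lerDl addr_ge0// sumr_ge0// => j _.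
  exact: (s2valP (Hp j)).
have L0L : L0 <= L by rewrite lerDl sumr_ge0// => j _; exact: (s2valP (Hp j)).
exists L, (`|N| + 1); split.
- exact: le_trans L0L.
- by have := normr_ge0 N; trim_lra.
- move=> x; split=> [|/FK/Kr//].
  have [->|/FK/HL0] := eqVneq (F x) 0; first by rewrite normr0 (le_trans L00).
  by move/le_trans; apply.
- move=> i x; split=> [|/pK/Kr//].
  have [->|/pK/(s2valP' (Hp i))] := eqVneq (partial i F x) 0; first by rewrite normr0 (le_trans L00).
  by move/le_trans; apply.
Qed.

End TestFunctions.

(** * The weak equation *)

Section Sums.
Context {R : realType} (n k : nat) (kn : (k < n)%N).
Implicit Types (x : 'rV[R]_n) (i : 'I_n) (a b : R).

Notation Q x := (head_norm k x).

Lemma sum_coord x a b : \sum_(i < n) x ord0 i * (x ord0 i * (hd k i * a + b)) = Q x ^+ 2 * a + sqn x * b.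
Proof.
have -> : Q x ^+ 2 = \sum_(i < n) hd k i * x ord0 i ^+ 2.
  rewrite Q_sq big_mkcond/=; apply: eq_bigr => i _.
  by rewrite /hd; case: (i < k)%N; rewrite ?mul1r ?mul0r.
by rewrite /sqn !mulr_suml -big_split/=; apply: eq_bigr => i _; ring.
Qed.

Lemma sum_hd : \sum_(i < n) (hd k i : R) = k%:R.
Proof.
rewrite /hd (eq_bigr (fun i : 'I_n => if (i < k)%N then 1 else 0)); last by move=> i _; case: (i < k)%N.
by rewrite (sum_head kn) mulr1 mulr0 addr0.
Qed.

Lemma sum_coord2 x a b a' b' :
  \sum_(i < n) (x ord0 i * (hd k i * a + b)) * (x ord0 i * (hd k i * a' + b')) =
  Q x ^+ 2 * (a * a' + a * b' + b * a') + sqn x * (b * b').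
Proof.
rewrite -sum_coord; apply: eq_bigr => i _.
have -> : hd k i * (a * a' + a * b' + b * a') = hd k i * hd k i * (a * a') + hd k i * (a * b' + b * a') :> R.
  by rewrite hd_sq; ring.
ring.
Qed.

Lemma dcyl_sq b (h dh : R -> R) x : 0 < Q x ->
  \sum_(i < n) dcyl k b h dh i x ^+ 2 =
  Q x `^ (2 * b - 2) * ((b * h (ss k x) - ss k x * dh (ss k x)) ^+ 2
    - dh (ss k x) ^+ 2 + 2 * b * Q x * h (ss k x) * dh (ss k x)).
Proof.
move=> Q0; rewrite (eq_bigr (fun i => dcyl k b h dh i x * dcyl k b h dh i x)); last first.
  by move=> i _; rewrite expr2.
rewrite /dcyl sum_coord2 /cyl.
have -> : Q x `^ (b - 1) = Q x * Q x `^ (b - 2).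
  by rewrite (Qpow_pred _ Q0); congr (_ * _ `^ _); ring.
have -> : Q x `^ (2 * b - 2) = Q x ^+ 2 * (Q x `^ (b - 2) * Q x `^ (b - 2)).
  by rewrite (Qpow_pred2 _ Q0) -powRDp//; congr (_ * _ `^ _); ring.
have -> : sqn x = 2 * Q x * ss k x - 1 by rewrite ssE//; ring.
ring.
Qed.

End Sums.

Section Majorant.
Context {R : realType} (n k : nat) (k2 : (2 <= k)%N) (kn : (k < n)%N).
Implicit Types (x : 'rV[R]_n) (i : 'I_n) (b e : R).

Notation Q x := (head_norm k x).
Notation mu := (lebesgue_rV R n).
Let A : R := (n%:R - k%:R) / 2.
Let c : R := (n%:R - 2) / 2.

(** The density |y|^(-n) s^(-2A), exactly at the threshold of integrability; every integrand below
    is [base] times a factor that gains a little. *)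
Definition base x := Q x `^ (- n%:R) * ss k x `^ (- (2 * A)).

(** The two gains that occur: a power s^(-e), and the ratio |y| / s coming from the mixed part of
    the gradient. As |y| <= 2 s the ratio is at most a multiple of its fourth root, and 1/4 < A is
    admissible in [shell_majorant_integrable]. *)
Definition majorant e x := shell_majorant k 0 e x + shell_majorant k 4^-1 2^-1 x.

Lemma base_ge0 x : 0 <= base x. Proof. by rewrite mulr_ge0 ?powR_ge0. Qed.

Lemma majorant_ge0 e x : 0 <= majorant e x. Proof. by rewrite addr_ge0 ?shell_majorant_ge0. Qed.

Lemma A_half : 2^-1 <= A.
Proof.
have : k.+1%:R <= n%:R :> R by rewrite ler_nat.
by rewrite -natr1 /A; lra.
Qed.

Lemma majorant_integrable e : 0 < e -> mu.-integrable setT (EFin \o majorant e).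
Proof.
move=> e0; have hA := A_half; rewrite /A in hA; apply: (@integrableD _ _ _ mu setT measurableT (EFin \o shell_majorant k 0 e) (EFin \o shell_majorant k 4^-1 2^-1)).
  by apply: shell_majorant_integrable => //; trim_lra.
by apply: shell_majorant_integrable => //; trim_lra.
Qed.

Lemma measurable_majorant e : measurable_fun setT (majorant e).
Proof. by apply: measurable_funD; exact: measurable_shell_majorant. Qed.

Lemma base_pow x e r : 0 < Q x -> e <= r -> base x * ss k x `^ (- r) <= majorant e x.
Proof.
move=> Q0 er; have s1 := ss_ge1 Q0; apply: (@le_trans _ _ (shell_majorant k 0 e x)); last by rewrite lerDl shell_majorant_ge0.
rewrite /shell_majorant /base sub0r subr0 -mulrA -powRDp; last by trim_lra.
by apply: ler_wpM2l; [exact: powR_ge0|apply: ler_powR => //; rewrite /A; trim_lra].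
Qed.

Lemma base_Q x e : 0 < Q x -> base x * (Q x / ss k x) <= 2 * majorant e x.
Proof.
move=> Q0; have s1 := ss_ge1 Q0; have s0 : 0 < ss k x by trim_lra.
apply: (@le_trans _ _ (2 * shell_majorant k 4^-1 2^-1 x)); last first.
  by rewrite ler_pM2l// lerDr shell_majorant_ge0.
have h : Q x / ss k x <= 2 * (Q x `^ 4^-1 * ss k x `^ (- 4^-1)).
  rewrite ler_pdivrMr//.
  have -> : Q x = Q x `^ (3/4) * Q x `^ 4^-1 by rewrite -powRDp// -[LHS]powRr1 ?ltW//; congr (_ `^ _); field.
  have -> : 2 * ((Q x `^ (3 / 4) * Q x `^ 4^-1) `^ 4^-1 * ss k x `^ (- 4^-1)) * ss k x =
      2 * ss k x `^ (3/4) * Q x `^ 4^-1.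
    have -> : Q x `^ (3 / 4) * Q x `^ 4^-1 = Q x by rewrite -powRDp// -[RHS]powRr1 ?ltW//; congr (_ `^ _); field.
    have -> : ss k x `^ (3/4) = ss k x `^ (- 4^-1) * ss k x.
      transitivity (ss k x `^ (- 4^-1) * ss k x `^ 1); last by rewrite powRr1// ltW.
      by rewrite -powRDp//; congr (_ `^ _); field.
    ring.
  apply: ler_wpM2r; first exact: powR_ge0.
  apply: (@le_trans _ _ ((2 * ss k x) `^ (3/4))); first by apply: powR_mono (Q_le Q0) _; trim_lra.
  rewrite powRM; [|trim_lra|trim_lra]; apply: ler_wpM2r; first exact: powR_ge0.
  by rewrite -[leRHS]powRr1//; apply: ler_powR; trim_lra.
apply: le_trans (ler_wpM2l (base_ge0 x) h) _; rewrite le_eqVlt; apply/orP; left; apply/eqP.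
rewrite /base /shell_majorant mulrCA; congr (2 * _).
have -> : 4^-1 - n%:R = - n%:R + 4^-1 :> R by ring.
have -> : - (2 * ((n%:R - k%:R) / 2) - 4^-1) - 2^-1 = - (2 * A) + - 4^-1 :> R by rewrite /A; field.
by rewrite !powRDp//; ring.
Qed.

(** On a bounded set both |y| and |y| s are bounded, and |y|^(-c) s^(-A) equals |y|^(-(c - A)) (|y|
    s)^(-A) with c - A = (k - 2) / 2 >= 0, so it is bounded below there. A test function thus
    behaves like a fast decaying solution. *)
Lemma test_decay (phi : 'rV[R]_n -> R) (L r : R) : 0 <= r -> 0 <= L ->
  (forall x, `|phi x| <= L /\ (phi x != 0 -> cube r x)) ->
  exists2 C : R, 0 <= C & forall x, 0 < Q x -> `|phi x| <= C * (Q x `^ (- c) * ss k x `^ (- A)).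
Proof.
move=> r0 L0 H; pose B := 1 + n%:R * r ^+ 2.
have nr0 : 0 <= n%:R * r ^+ 2 :> R by rewrite mulr_ge0 ?ler0n ?sqr_ge0.
have B1 : 1 <= B by rewrite /B; trim_lra.
have hA := A_half.
have cA : c - A = (k%:R - 2) / 2 :> R by rewrite /c /A; field.
have k2' : 2 <= k%:R :> R by rewrite (ler_nat _ 2).
exists (L * (B `^ (c - A) * B `^ A)) => [|x Q0]; first by rewrite !mulr_ge0 ?powR_ge0.
have [->|px] := eqVneq (phi x) 0; first by rewrite normr0 !mulr_ge0 ?powR_ge0.
have [pL /(_ px) xr] := H x; rewrite -mulrA -[leLHS]mulr1; apply: ler_pM => //.
have s1 := ss_ge1 Q0; have s0 : 0 < ss k x by trim_lra.
have sB : sqn x <= n%:R * r ^+ 2.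
  rewrite /sqn -[n in n%:R]card_ord mulr_natl -sumr_const; apply: ler_sum => i _.
  by rewrite -real_normK ?num_real// ler_sqr ?nnegrE.
have QB : Q x <= B.
  have h1 := Q_sqn k x; have h2 := sqr_ge0 (Q x - 1); rewrite /B.
  by move: h2; rewrite sqrrB1; nra.
have QsB : Q x * ss k x <= B by have := ssE Q0; rewrite /B; nra.
have e1 : Q x `^ (- c) * ss k x `^ (- A) = Q x `^ (- (c - A)) * (Q x * ss k x) `^ (- A).
  by rewrite powRM ?ltW// mulrA -powRDp//; congr (_ `^ _ * _); ring.
have h1 : B `^ (- (c - A)) <= Q x `^ (- (c - A)) by apply: powR_antimono => //; trim_lra.
have h2 : B `^ (- A) <= (Q x * ss k x) `^ (- A) by apply: powR_antimono => //; [exact: mulr_gt0|trim_lra].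
rewrite e1; apply: (@le_trans _ _ (B `^ (c - A) * B `^ A * (B `^ (- (c - A)) * B `^ (- A)))).
  have B0 : 0 < B by trim_lra.
  by rewrite mulrACA -!powRDp// !addrN ?addr0 !powRr0 ?mulr1.
by apply: ler_wpM2l; [rewrite mulr_ge0 ?powR_ge0|apply: ler_pM => //; exact: powR_ge0].
Qed.

End Majorant.

(** * The weak identity with a cutoff, and its limit *)

Section Weak.
Context {R : realType} (n k : nat) (k2 : (2 <= k)%N) (kn : (k < n)%N).
Implicit Types (x : 'rV[R]_n) (i : 'I_n) (b : R) (h : R -> R).

Notation Q x := (head_norm k x).
Notation ss x := (ss k x).
Notation mu := (lebesgue_rV R n).
Let A : R := (n%:R - k%:R) / 2.
Let c : R := (n%:R - 2) / 2.

Lemma measurable_cyl b h : continuous h -> measurable_fun setT (cyl k b h : 'rV[R]_n -> R).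
Proof.
move=> hc; apply: measurable_funM; first exact: measurable_Qpow.
by apply: measurable_ss_comp; exact: continuous_measurable_fun.
Qed.

Lemma continuous_scale_sub (a : R) (h g : R -> R) : continuous h -> continuous g ->
  continuous (fun s => a * h s - s * g s).
Proof.
move=> hc gc s; apply: (@continuousB _ _ _ (fun s => a * h s) (fun s => s * g s)).
  exact: (continuousM (@cst_continuous _ _ a s) (hc s)).
exact: (@continuousM _ _ (fun s => s) g s (fun _ => id) (gc s)).
Qed.

Lemma measurable_dcyl b (h g : R -> R) i : continuous h -> continuous g ->
  measurable_fun setT (dcyl k b h g i : 'rV[R]_n -> R).
Proof.
move=> hc gc; apply: measurable_funM; first exact: measurable_coord.
apply: measurable_funD; last exact: measurable_cyl.
by apply: measurable_funM => //; apply: measurable_cyl; exact: continuous_scale_sub.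
Qed.

Lemma cyl_bounded b h (S : R) : b < 0 -> 1 <= S -> continuous h -> (forall s, S <= s -> h s = 0) ->
  exists L : R, forall x : 'rV[R]_n, `|cyl k b h x| <= L.
Proof.
move=> b0 S1 hc hS.
have hac : continuous (fun s => `|h s|).
  by move=> s; apply: continuous_comp; [exact: hc|exact: norm_continuous].
have [z _ Hz] := evt_max S1 (fun s _ => hac s).
exists ((2 * S)^-1 `^ b * `|h z|) => x.
have P : 0 <= (2 * S)^-1 `^ b * `|h z| by rewrite mulr_ge0 ?powR_ge0.
have [Q0|/Q0_gt0 Q0] := eqVneq (Q x) 0.
  by rewrite cyl0 ?normr0//; apply/eqP; lra.
have s1 := ss_ge1 Q0; have [sS|/ltW sS] := leP S (ss x); first by rewrite /cyl hS// mulr0 normr0.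
rewrite /cyl normrM ger0_norm ?powR_ge0//; apply: ler_pM; rewrite ?powR_ge0//; last by apply: Hz; rewrite s1 sS.
apply: powR_antimono; [by rewrite invr_gt0; lra| |by lra].
rewrite -[leLHS]mul1r ler_pdivrMr; last by lra.
apply: le_trans (Q_ge Q0) _; rewrite [X in X * _]mulrC -mulrA; apply: ler_wpM2l; lra.
Qed.

Definition bounded_over (D : set 'rV[R]_n) (F : 'rV[R]_n -> R) := exists L : R, forall x, D x -> `|F x| <= L.

Lemma bounded_over_cst D (a : R) : bounded_over D (fun=> a). Proof. by exists `|a|. Qed.

Lemma bounded_over_coord r i : bounded_over (cube r) (fun x => x ord0 i).
Proof. by exists r => x; exact. Qed.

Lemma bounded_overD D F G : bounded_over D F -> bounded_over D G -> bounded_over D (fun x => F x + G x).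
Proof.
move=> [L HL] [M HM]; exists (L + M) => x Dx; apply: le_trans (ler_normD _ _) _.
by apply: lerD; [exact: HL|exact: HM].
Qed.

Lemma bounded_overM D F G : bounded_over D F -> bounded_over D G -> bounded_over D (fun x => F x * G x).
Proof.
move=> [L HL] [M HM]; exists (L * M) => x Dx; rewrite normrM.
by apply: ler_pM => //; [exact: HL|exact: HM].
Qed.

Section Flux.
Variables (eta t lam p : R) (f v w : R -> R).
Hypothesis p1 : 1 < p.
Hypothesis cpE : c * p + t = c + 2.
Hypothesis lamE : lam = c ^+ 2 - c * (k%:R - 2) + eta.
Hypothesis prof : profile A lam p f v w.

Let c_gt0 : 0 < c.
Proof.
have : (2 : R) < n%:R by rewrite (ltr_nat _ 2); exact: leq_ltn_trans k2 kn.
by rewrite /c; lra.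
Qed.

Let fc : continuous f. Proof. by have [D _ _ _] := prof => s; exact: Dr_continuous (D s). Qed.
Let vc : continuous v. Proof. by have [_ D _ _] := prof => s; exact: Dr_continuous (D s). Qed.
Let wc : continuous w. Proof. by have [_ _ ? _] := prof. Qed.

Definition energy_term (phi : 'rV[R]_n -> R) x := \sum_(i < n) dcyl k (- c) f v i x * partial i phi x.
Definition hardy_term (phi : 'rV[R]_n -> R) x := eta * cyl k (- c) f x * phi x / Q x ^+ 2.
Definition source_term (phi : 'rV[R]_n -> R) x :=
  `|cyl k (- c) f x| `^ (p - 1) * cyl k (- c) f x * phi x / Q x `^ t.

Lemma hardy_termE phi x : 0 < Q x -> hardy_term phi x = eta * cyl k (- c - 2) f x * phi x.
Proof.
move=> Q0; rewrite /hardy_term /cyl (Qpow_pred2 (- c) Q0); field; exact: lt0r_neq0.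
Qed.

Lemma source_termE phi x : 0 < Q x -> source_term phi x = cyl k (- c - 2) (fun s => spow p (f s)) x * phi x.
Proof.
move=> Q0; rewrite /source_term /cyl /spow normrM (ger0_norm (powR_ge0 _ _)) powRM ?powR_ge0// -powRrM.
have -> : Q x `^ (- c - 2) = Q x `^ (- c * (p - 1)) * Q x `^ (- c) / Q x `^ t.
  rewrite -powRN -!powRDp//; congr (_ `^ _); have := cpE; lra.
field; exact/lt0r_neq0/powR_gt0.
Qed.

(* The product of the gradients of [u] and of [s]. *)
Definition cross_term x := cyl k (- c - 2) (fun s => s * (c * f s + s * v s) - v s) x - c * cyl k (- c - 1) f x.

Section Cutoff.
Variables (X dX : R -> R) (S : R).
Hypothesis DX : forall s, Dr X s (dX s).
Hypothesis dXc : continuous dX.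
Hypothesis S1 : 1 <= S.
Hypothesis XS : forall s, S <= s -> X s = 0 /\ dX s = 0.

Let h1 s := X s * (- c * f s - s * v s).
Let dh1 s := X s * (- c * v s - (s * w s + v s)) + (- c * f s - s * v s) * dX s.
Let h2 s := X s * v s.
Let dh2 s := X s * w s + v s * dX s.

Let Dh1 s : Dr h1 s (dh1 s).
Proof.
have [Df Dv _ _] := prof.
apply: (Dr_eq (DrM (DX s) (DrB (DrM (Dr_cst (- c) s) (Df s)) (DrM (Dr_id s) (Dv s))))).
by rewrite /dh1; ring.
Qed.

Let Dh2 s : Dr h2 s (dh2 s).
Proof. by have [_ Dv _ _] := prof; exact: DrM. Qed.

Let Xc : continuous X. Proof. by move=> s; exact: Dr_continuous (DX s). Qed.
Let h1c : continuous h1. Proof. by move=> s; exact: Dr_continuous (Dh1 s). Qed.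
Let h2c : continuous h2. Proof. by move=> s; exact: Dr_continuous (Dh2 s). Qed.
Let gc : continuous (fun s => - c * f s - s * v s).
Proof. exact: continuous_scale_sub. Qed.

Let dh2c : continuous dh2.
Proof.
move=> s; exact: (@continuousD _ _ _ (fun s => X s * w s) (fun s => v s * dX s) s
  (continuousM (Xc (x:=s)) (wc (x:=s))) (continuousM (vc (x:=s)) (dXc (x:=s)))).
Qed.

Let dh1c : continuous dh1.
Proof.
have swc : continuous (fun s : R => s * w s + v s).
  move=> s; apply: (@continuousD _ _ _ (fun s : R => s * w s) v s); last exact: vc.
  exact: (@continuousM _ _ (fun s : R => s) w s (fun _ => id) (wc (x:=s))).
have uc : continuous (fun s => - c * v s - (s * w s + v s)).
  move=> s; exact: (@continuousB _ _ _ (fun s => - c * v s) (fun s => s * w s + v s) s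
    (continuousM (@cst_continuous _ _ (- c) s) (vc (x:=s))) (swc s)).
move=> s; exact: (@continuousD _ _ _ (fun s => X s * (- c * v s - (s * w s + v s)))
  (fun s => (- c * f s - s * v s) * dX s) s (continuousM (Xc (x:=s)) (uc s)) (continuousM (gc (x:=s)) (dXc (x:=s)))).
Qed.

Let h1S s : S <= s -> h1 s = 0. Proof. by rewrite /h1 => /XS[-> _]; rewrite mul0r. Qed.
Let h2S s : S <= s -> h2 s = 0. Proof. by rewrite /h2 => /XS[-> _]; rewrite mul0r. Qed.
Let dh1S s : S <= s -> dh1 s = 0. Proof. by rewrite /dh1 => /XS[-> ->]; rewrite mul0r mulr0 addr0. Qed.
Let dh2S s : S <= s -> dh2 s = 0. Proof. by rewrite /dh2 => /XS[-> ->]; rewrite mul0r mulr0 addr0. Qed.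

(** The field X(s) grad u, rewritten with the profiles [h1] and [h2] that vanish for large s, so
    that it is differentiable across y = 0. *)
Definition flux i x := x ord0 i * (hd k i * cyl k (- c - 2) h1 x + cyl k (- c - 1) h2 x).
Definition dflux i x :=
  x ord0 i * (hd k i * dcyl k (- c - 2) h1 dh1 i x + dcyl k (- c - 1) h2 dh2 i x)
  + (hd k i * cyl k (- c - 2) h1 x + cyl k (- c - 1) h2 x).

Lemma fluxE i x : flux i x = X (ss x) * dcyl k (- c) f v i x.
Proof. by rewrite /flux /dcyl /cyl /h1 /h2; ring. Qed.

Lemma Dr_flux i x : Dr (fun t => flux i (x + t *: ei i)) 0 (dflux i x).
Proof.
have b1 : - c - 2 < 0 by have := c_gt0; lra.
have b2 : - c - 1 < 0 by have := c_gt0; lra.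
have D1 := Dr_cyl_all k x i b1 Dh1 h1S; have D2 := Dr_cyl_all k x i b2 Dh2 h2S.
apply: (Dr_eq (DrM (Dr_coord x i i) (DrD (DrM (Dr_cst (hd k i) 0) D1) D2))).
have E : x + 0 *: ei i = x by rewrite scale0r addr0.
rewrite E eqxx mulr1 /dflux; ring.
Qed.

(** The divergence of X(s) grad u is X times the Laplacian of u plus X' grad s . grad u. With sqn =
    2 |y| s - 1 all terms depend on |y| and s only, and the radial equation turns the Laplacian into
    the Hardy and source terms. *)
Lemma sum_dflux x : 0 < Q x -> \sum_(i < n) dflux i x =
  - X (ss x) * (eta * cyl k (- c - 2) f x + cyl k (- c - 2) (fun s => spow p (f s)) x)
  + dX (ss x) * cross_term x.
Proof.
move=> Q0; rewrite /dflux big_split/= big_split/= -mulr_suml sum_hd// sumr_const card_ord -[_ *+ n]mulr_natl.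
rewrite /dcyl.
set a1 := cyl k (- c - 2 - 2) _ x; set b1 := cyl k (- c - 2 - 1) _ x.
set a2 := cyl k (- c - 1 - 2) _ x; set b2 := cyl k (- c - 1 - 1) _ x.
rewrite (eq_bigr (fun i => x ord0 i * (x ord0 i * (hd k i * (a1 + b1 + a2) + b2)))); last first.
  move=> i _; have e : hd k i * (x ord0 i * (hd k i * a1 + b1)) = x ord0 i * (hd k i * hd k i * a1 + hd k i * b1) by ring.
  by rewrite e hd_sq; ring.
rewrite sum_coord /a1 /b1 /a2 /b2 /cross_term /cyl /h1 /dh1 /h2 /dh2.
set q := Q x `^ (- c - 2 - 2).
have -> : Q x `^ (- c - 2 - 1) = Q x * q.
  by rewrite (Qpow_pred _ Q0); congr (_ * _ `^ _); ring.
have -> : Q x `^ (- c - 1 - 2) = Q x * q.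
  by rewrite (Qpow_pred _ Q0); congr (_ * _ `^ _); ring.
have e2 : Q x `^ (- c - 2) = Q x ^+ 2 * q.
  by rewrite (Qpow_pred2 _ Q0); congr (_ * _ `^ _); ring.
have -> : Q x `^ (- c - 1 - 1) = Q x ^+ 2 * q by rewrite -e2; congr (_ `^ _); ring.
have -> : Q x `^ (- c - 1) = Q x ^+ 2 * q * Q x.
  by rewrite (Qpow_pred _ Q0) mulrC -e2; congr (_ `^ _ * _); ring.
rewrite e2; have -> : sqn x = 2 * Q x * ss x - 1 by rewrite ssE//; ring.
have [_ _ _ /(_ _ (ss_ge1 Q0))] := prof; rewrite /gnl lamE => ode.
have -> : spow p (f (ss x)) = - ((ss x ^+ 2 - 1) * w (ss x) + (2 * A + 1) * ss x * v (ss x)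
    + (c ^+ 2 - c * (k%:R - 2) + eta) * f (ss x)) by lra.
have -> : n%:R = 2 * c + 2 :> R by rewrite /c; field.
have -> : A = c + 1 - k%:R / 2 by rewrite /A /c; field.
by field.
Qed.

Lemma flux_bounded i : bounded_over setT (fun x => hd k i * cyl k (- c - 2) h1 x + cyl k (- c - 1) h2 x)
  /\ forall r, bounded_over (cube r) (dflux i).
Proof.
have b (a : R) h : 0 <= a -> continuous h -> (forall s, S <= s -> h s = 0) -> bounded_over setT (cyl k (- c - 1 - a) h).
  move=> a0 hc hS; have b0 : - c - 1 - a < 0 by have := c_gt0; lra.
  by have [L HL] := cyl_bounded b0 S1 hc hS; exists L.
have b' (a : R) h : a <= - c - 1 -> continuous h -> (forall s, S <= s -> h s = 0) -> bounded_over setT (cyl k a h).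
  move=> a0 hc hS; have -> : a = - c - 1 - (- c - 1 - a) by ring.
  by apply: b => //; lra.
have H : bounded_over setT (fun x => hd k i * cyl k (- c - 2) h1 x + cyl k (- c - 1) h2 x).
  by apply: bounded_overD; [apply: bounded_overM; [exact: bounded_over_cst|apply: b' => //; lra]|exact: b'].
split=> // r; have sub F : bounded_over setT F -> bounded_over (cube r) F by move=> [L HL]; exists L => x _; exact: HL.
have hS (a : R) h g : (forall s, S <= s -> h s = 0) -> (forall s, S <= s -> g s = 0) ->
    forall s, S <= s -> a * h s - s * g s = 0.
  by move=> h0 g0 s sS; rewrite h0// g0// !mulr0 subrr.
apply: bounded_overD (sub _ H); apply: bounded_overM; first exact: bounded_over_coord.
apply: bounded_overD.
  apply: bounded_overM; first exact: bounded_over_cst.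
  apply: bounded_overM; first exact: bounded_over_coord.
  apply: bounded_overD; apply: sub; last by apply: b' => //; lra.
  by apply: bounded_overM; [exact: bounded_over_cst|apply: b'; [lra|exact: continuous_scale_sub|exact: hS]].
apply: bounded_overM; first exact: bounded_over_coord.
apply: bounded_overD; apply: sub; last by apply: b' => //; lra.
by apply: bounded_overM; [exact: bounded_over_cst|apply: b'; [lra|exact: continuous_scale_sub|exact: hS]].
Qed.

(** The integrand is the divergence of phi X(s) grad u, also on y = 0, where every term is 0 because
    negative powers of 0 are 0. Each partial derivative integrates to 0 by [integral_partial]. *)
Lemma weak_step (phi : 'rV[R]_n -> R) : test_function phi ->
  let F x := X (ss x) * (energy_term phi x - hardy_term phi x - source_term phi x) + dX (ss x) * cross_term x * phi x in
  measurable_fun setT F /\ (\int[mu]_x (F x)%:E = 0)%E.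
Proof.
move=> Tphi F; have [L [r [L0 r0 Hphi Hp]]] := test_bounded Tphi.
have Dphi x : differentiable phi x by case: Tphi => /(_ [::] x).
have Cphi i : continuous (partial i phi).
  by move=> x; apply: differentiable_continuous; case: Tphi => /(_ [:: i] x).
pose dF i x := dflux i x * phi x + flux i x * partial i phi x.
have FE x : F x = \sum_(i < n) dF i x.
  have -> : \sum_(i < n) dF i x = (\sum_(i < n) dflux i x) * phi x + X (ss x) * energy_term phi x.
    rewrite /dF big_split/= -mulr_suml /energy_term mulr_sumr; congr (_ + _).
    by apply: eq_bigr => i _; rewrite fluxE; ring.
  rewrite /F; have [Q0|/Q0_gt0 Q0] := eqVneq (Q x) 0; last first.
    by rewrite (sum_dflux Q0) hardy_termE// source_termE//; ring.
  have b0 (a : R) h : a <= - c -> cyl k a h x = 0.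
    by move=> ac; apply: cyl0 => //; apply/eqP; have := c_gt0; lra.
  have d0 (a : R) h g i : a <= - c -> dcyl k a h g i x = 0.
    by move=> ac; apply: dcyl0 => //; have := c_gt0; lra.
  rewrite big1 => [|i _]; last first.
    by rewrite /dflux !d0 ?b0; [ring|lra|lra|lra|lra].
  by rewrite /hardy_term /source_term /cross_term !b0; [ring|lra|lra|lra].
have H i : mu.-integrable setT (EFin \o dF i) /\ (\int[mu]_x (dF i x)%:E = 0)%E.
  have [[B HB] /(_ r)[B' HB']] := flux_bounded i.
  have HB0 : 0 <= B by apply: le_trans (HB 0 I).
  have fb x : cube r x -> `|flux i x| <= r * B.
    by move=> xr; rewrite normrM; apply: ler_pM => //; exact: HB.
  have B'0 : 0 <= B' by apply: le_trans (HB' 0 _); rewrite // => j; rewrite mxE normr0.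
  have out x : ~ cube r x -> phi x = 0 /\ partial i phi x = 0.
    move=> nx; split; apply/eqP; apply: contraPT nx => px nx; apply: nx.
      exact: (Hphi x).2.
    exact: (Hp i x).2.
  have rBL : 0 <= r * B * L by rewrite !mulr_ge0.
  have BL : 0 <= B' * L by rewrite mulr_ge0.
  apply: (@integral_partial _ _ (fun x => flux i x * phi x) _ i (r * B * L + B' * L) r).
  - apply: measurable_funM; last by apply: continuous_measurable_rV => x; exact: differentiable_continuous.
    apply: measurable_funM; first exact: measurable_coord.
    apply: measurable_funD; last exact: measurable_cyl.
    by apply: measurable_funM => //; exact: measurable_cyl.
  - move=> x; apply: (Dr_eq (DrM (Dr_flux i x) (Dr_partial i (Dphi x)))).
    have E : x + 0 *: ei i = x by rewrite scale0r addr0.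
    by rewrite E /dF; ring.
  - move=> x; have [xr|/out[-> _]] := pselect (cube r x); last by rewrite mulr0 normr0 addr_ge0.
    rewrite normrM; apply: (@le_trans _ _ (r * B * L)); last by rewrite lerDl.
    by apply: ler_pM => //; [exact: fb|exact: (Hphi x).1].
  - move=> x; have [xr|/out[p0 dp0]] := pselect (cube r x); last first.
      by rewrite /dF p0 dp0 !mulr0 addr0 normr0 addr_ge0.
    apply: le_trans (ler_normD _ _) _; rewrite addrC; apply: lerD; rewrite normrM; apply: ler_pM => //.
    + exact: fb.
    + exact: (Hp i x).1.
    + exact: HB'.
    + exact: (Hphi x).1.
  - by move=> x fx; apply: (Hphi x).2; apply: contraNneq fx => ->; rewrite mulr0.
have -> : F = fun x => \sum_(i < n) dF i x by apply/funext.
split.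
  by apply: measurable_sum => i /=; apply/measurable_EFinP; exact: (measurable_int _ (H i).1).
under eq_integral do rewrite -sumEFin.
rewrite (integral_sum measurableT (fun i => (H i).1)) big1// => i _; exact: (H i).2.
Qed.

End Cutoff.

Lemma n2c : n%:R = 2 * c + 2 :> R. Proof. by rewrite /c; field. Qed.

Lemma Qn_base x : 0 < Q x -> Q x `^ (- n%:R) * (ss x `^ (- A) * ss x `^ (- A)) = base k x.
Proof.
by move=> Q0; rewrite /base -powRDp; [congr (_ * _ `^ _); rewrite /A; ring|have := ss_ge1 Q0; lra].
Qed.

(** The leading part of the gradient is c h + s g, which is why extra decay is demanded of that
    combination; the mixed term carries the gain |y| / s. *)
Lemma dcyl_sq_le h g x : 0 < Q x ->
  \sum_(i < n) dcyl k (- c) h g i x ^+ 2 <= Q x `^ (- n%:R) *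
    ((c * h (ss x) + ss x * g (ss x)) ^+ 2 + 2 * c * (Q x / ss x * (`|h (ss x)| * `|ss x * g (ss x)|))).
Proof.
move=> Q0; have s1 := ss_ge1 Q0; rewrite dcyl_sq//.
have -> : 2 * - c - 2 = - n%:R by rewrite n2c; ring.
apply: ler_wpM2l; first exact: powR_ge0.
have -> : Q x / ss x * (`|h (ss x)| * `|ss x * g (ss x)|) = Q x * `|h (ss x) * g (ss x)|.
  have sn : `|ss x| = ss x by apply: ger0_norm; lra.
  by rewrite (normrM (ss x)) (normrM (h (ss x))) sn; field; apply/eqP; lra.
have e1 : (- c * h (ss x) - ss x * g (ss x)) ^+ 2 = (c * h (ss x) + ss x * g (ss x)) ^+ 2 by ring.
have e2 : 2 * - c * Q x * h (ss x) * g (ss x) = - (2 * c * (Q x * (h (ss x) * g (ss x)))) by ring.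
rewrite e1 e2 -addrA; apply: lerD => //.
have h1 : - (h (ss x) * g (ss x)) <= `|h (ss x) * g (ss x)| by rewrite lerNl lerNnormlW.
have cp := c_gt0; have h2 : 0 <= 2 * c * Q x by apply: mulr_ge0 (ltW Q0); apply: mulr_ge0; lra.
have h3 := ler_wpM2l h2 h1; have h4 := sqr_ge0 (g (ss x)); nra.
Qed.

Section Limit.
Variables (C e : R).
Hypothesis e0 : 0 < e.
Hypothesis e1 : e <= 1.
Hypothesis eA : e <= A * (p - 1).
Hypothesis decay : forall s, 1 <= s ->
  [/\ `|f s| <= C * s `^ (- A), `|s * v s| <= C * s `^ (- A),
    `|c * f s + s * v s| <= C * (s `^ (- A) * s `^ (- e)) &
    `|eta * f s| <= C * (s `^ (- A) * s `^ (- e))].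

Let C0 : 0 <= C.
Proof.
have [h _ _ _] := decay (lexx 1); rewrite powR1 mulr1 in h; exact: le_trans h.
Qed.

Lemma energy_bound x : \sum_(i < n) dcyl k (- c) f v i x ^+ 2 <= C ^+ 2 * (1 + 4 * c) * majorant k e x.
Proof.
have cp := c_gt0; have [Q0|/Q0_gt0 Q0] := eqVneq (Q x) 0.
  rewrite big1 => [|i _]; first by rewrite !mulr_ge0 ?majorant_ge0 ?exprn_ge0//; lra.
  by rewrite dcyl0 ?expr0n//; lra.
have s1 := ss_ge1 Q0; have [d1 d2 d3 _] := decay s1; apply: le_trans (dcyl_sq_le f v Q0) _.
apply: (@le_trans _ _ (C ^+ 2 * (base k x * ss x `^ (- (2 * e))) + 2 * c * C ^+ 2 * (base k x * (Q x / ss x)))).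
  rewrite -(Qn_base Q0) [- (2 * e)](_ : _ = - e + - e); last by ring.
  rewrite powRDp; last by lra.
  set q := Q x `^ _; set a := ss x `^ (- A); set b := ss x `^ (- e).
  have -> : C ^+ 2 * (q * (a * a) * (b * b)) + 2 * c * C ^+ 2 * (q * (a * a) * (Q x / ss x)) =
      q * ((C * (a * b)) ^+ 2 + 2 * c * (Q x / ss x * ((C * a) * (C * a)))) by ring.
  apply: ler_wpM2l; first exact: powR_ge0.
  apply: lerD; first by rewrite -real_normK ?num_real// ler_sqr ?nnegrE ?mulr_ge0 ?powR_ge0.
  apply: ler_wpM2l; first by rewrite mulr_ge0// ltW.
  by apply: ler_wpM2l; [rewrite divr_ge0; lra|exact: ler_pM].
have h1 := base_pow (e := e) (r := 2 * e) Q0; have h2 := base_Q e Q0.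
have h3 : base k x * ss x `^ (- (2 * e)) <= majorant k e x by apply: h1; have := e0; lra.
have -> : C ^+ 2 * (1 + 4 * c) * majorant k e x = C ^+ 2 * majorant k e x + 2 * c * C ^+ 2 * (2 * majorant k e x) by ring.
apply: lerD; apply: ler_wpM2l => //; first exact: sqr_ge0.
by apply: mulr_ge0 (sqr_ge0 _); apply: mulr_ge0; lra.
Qed.

Lemma measurable_energy_term phi : test_function phi -> measurable_fun setT (energy_term phi).
Proof.
move=> Tphi; apply: measurable_sum => i /=; apply: measurable_funM; first exact: measurable_dcyl.
apply: continuous_measurable_rV => x; apply: differentiable_continuous.
by case: Tphi => /(_ [:: i] x).
Qed.

Lemma measurable_test phi : test_function phi -> measurable_fun setT (phi : 'rV[R]_n -> R).
Proof.
move=> Tphi; apply: continuous_measurable_rV => x; apply: differentiable_continuous.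
by case: Tphi => /(_ [::] x).
Qed.

Lemma measurable_hardy_term phi : test_function phi -> measurable_fun setT (hardy_term phi).
Proof.
move=> Tphi.
have -> : hardy_term phi = fun x => eta * cyl k (- c) f x * phi x * Q x `^ (- 2).
  by apply/funext => x; rewrite /hardy_term powRN powR_mulrn ?Q_ge0.
apply: measurable_funM; last exact: measurable_Qpow.
apply: measurable_funM; last exact: measurable_test.
by apply: measurable_funM => //; exact: measurable_cyl.
Qed.

Lemma measurable_source_term phi : test_function phi -> measurable_fun setT (source_term phi).
Proof.
move=> Tphi.
have -> : source_term phi = fun x => `|cyl k (- c) f x| `^ (p - 1) * cyl k (- c) f x * phi x * Q x `^ (- t).
  by apply/funext => x; rewrite /source_term powRN.
have mU : measurable_fun setT (cyl k (- c) f : 'rV[R]_n -> R) by exact: measurable_cyl.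
apply: measurable_funM; last exact: measurable_Qpow.
apply: measurable_funM; last exact: measurable_test.
apply: measurable_funM => //; apply: (measurableT_comp (measurable_powR _)).
by apply: measurableT_comp mU; exact: normr_measurable.
Qed.

Lemma energy_term_integrable phi : test_function phi -> mu.-integrable setT (EFin \o energy_term phi).
Proof.
move=> Tphi; have [L [r [L0 r0 Hphi Hp]]] := test_bounded Tphi.
pose g x := C ^+ 2 * (1 + 4 * c) * majorant k e x + n%:R * L ^+ 2 * \1_(cube r) x.
have cp := c_gt0; have C1 : 0 <= C ^+ 2 * (1 + 4 * c) by rewrite mulr_ge0 ?sqr_ge0//; lra.
have gi : mu.-integrable setT (EFin \o g).
  apply: (@integrableD _ _ _ mu setT measurableT (EFin \o (fun x => C ^+ 2 * (1 + 4 * c) * majorant k e x))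
    (EFin \o (fun x => n%:R * L ^+ 2 * \1_(cube r) x))).
    have -> : EFin \o (fun x => C ^+ 2 * (1 + 4 * c) * majorant k e x) =
        (fun x => (C ^+ 2 * (1 + 4 * c))%:E * (EFin \o majorant k e) x)%E.
      by apply/funext => x /=; rewrite EFinM.
    exact: (integrableZl measurableT _ (majorant_integrable k2 kn e0)).
  by apply: integrable_cube; rewrite mulr_ge0 ?sqr_ge0.
apply: (le_integrable measurableT _ _ gi); first by apply/measurable_EFinP; exact: measurable_energy_term.
move=> x _ /=; rewrite lee_fin [leRHS]ger0_norm; last first.
  by rewrite addr_ge0// mulr_ge0 ?majorant_ge0// ?mulr_ge0 ?sqr_ge0.
apply: (@le_trans _ _ (\sum_(i < n) (dcyl k (- c) f v i x ^+ 2 + partial i phi x ^+ 2))).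
  apply: le_trans (ler_norm_sum _ _ _) _; apply: ler_sum => i _; rewrite normrM.
  have h1 := sqr_ge0 (`|dcyl k (- c) f v i x| - `|partial i phi x|).
  have h2 := sqr_ge0 (`|dcyl k (- c) f v i x| + `|partial i phi x|).
  by rewrite -(real_normK (num_real (dcyl k (- c) f v i x))) -(real_normK (num_real (partial i phi x))); nra.
rewrite big_split/=; apply: lerD; first exact: energy_bound.
have -> : n%:R * L ^+ 2 * \1_(cube r) x = \sum_(i < n) L ^+ 2 * \1_(cube r) x.
  by rewrite sumr_const card_ord -[RHS]mulr_natl; ring.
apply: ler_sum => i _; have [->|px] := eqVneq (partial i phi x) 0.
  by rewrite expr0n/= mulr_ge0 ?sqr_ge0.
rewrite indicE mem_set ?mulr1; last exact: (Hp i x).2.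
by rewrite -real_normK ?num_real// ler_sqr ?nnegrE//; exact: (Hp i x).1.
Qed.

(** A term |y|^(-c-2) T times the bound |y|^(-c) s^(-A) on phi is [base] times what T gains over
    s^(-A): s^(-e) for the Hardy term, s^(-A(p-1)) for the source, and s^(-e), s^(-2), |y| / s for
    the three parts of the cross term. The last clause is meant for [D = X'(s)]. *)
Lemma term_bounds phi : test_function phi -> exists B : R, forall x,
  [/\ `|hardy_term phi x| <= B * majorant k e x, `|source_term phi x| <= B * majorant k e x &
    forall (D K : R), 0 <= K -> (0 < Q x -> ss x * `|D| <= K) -> `|D * cross_term x * phi x| <= K * B * majorant k e x].
Proof.
move=> Tphi; have [L [r [L0 r0 Hphi _]]] := test_bounded Tphi.
have [Cp Cp0 HCp] := test_decay k2 kn r0 L0 Hphi.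
have cp := c_gt0; have A0 := A_half (R := R) kn; rewrite -/A in A0.
pose B := Cp * C + Cp * (C `^ (p - 1) * C) + Cp * C * (2 + 2 * c).
have B1 : 0 <= Cp * C by rewrite mulr_ge0.
have B2 : 0 <= Cp * (C `^ (p - 1) * C) by rewrite !mulr_ge0 ?powR_ge0.
have B3 : 0 <= Cp * C * (2 + 2 * c) by rewrite mulr_ge0//; lra.
have B0 : 0 <= B by rewrite !addr_ge0.
exists B => x; have m0 := majorant_ge0 k e x.
have [Q0|/Q0_gt0 Q0] := eqVneq (Q x) 0.
  have bb (a : R) h : a <= - c -> cyl k a h x = 0.
    by move=> ac; apply: cyl0 => //; apply/eqP; lra.
  split=> [||D K K0 _]; rewrite ?/hardy_term ?/source_term ?/cross_term !bb; try lra.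
  - by rewrite !(mulr0, mul0r) normr0 mulr_ge0.
  - by rewrite !(mulr0, mul0r) normr0 mulr_ge0.
  - by rewrite !(mulr0, mul0r, subrr) normr0 !mulr_ge0.
have s1 := ss_ge1 Q0; have s0 : 0 < ss x by lra.
have [d1 d2 d3 d4] := decay s1; have ph := HCp x Q0; rewrite -/c -/A in ph.
have Qc2 : Q x `^ (- c - 2) * Q x `^ (- c) = Q x `^ (- n%:R).
  by rewrite -powRDp//; congr (_ `^ _); rewrite n2c; ring.
have bp (r' : R) : e <= r' -> base k x * ss x `^ (- r') <= majorant k e x by move=> er; exact: base_pow.
have bQ := base_Q e Q0; rewrite -(Qn_base Q0) in bQ bp.
move: ph d1 d2 d3 d4 bQ bp; set q1 := Q x `^ (- c); set q2 := Q x `^ (- c - 2) in Qc2 *.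
set a := ss x `^ (- A); set b := ss x `^ (- e) => ph d1 d2 d3 d4 bQ bp.
have q20 : 0 <= q2 by exact: powR_ge0.
have q10 : 0 <= q1 by exact: powR_ge0.
have a0 : 0 <= a by exact: powR_ge0.
have key (T C' z y : R) : 0 <= C' -> `|T| <= C' * (a * z) -> Q x `^ (- n%:R) * (a * a) * z <= y ->
    `|q2 * T * phi x| <= Cp * C' * y.
  move=> C'0 hT hy; rewrite !normrM (ger0_norm q20).
  apply: (@le_trans _ _ (q2 * (C' * (a * z)) * (Cp * (q1 * a)))).
    by apply: ler_pM => //; [rewrite mulr_ge0|apply: ler_wpM2l].
  have -> : q2 * (C' * (a * z)) * (Cp * (q1 * a)) = Cp * C' * (Q x `^ (- n%:R) * (a * a) * z).
    by rewrite -Qc2 -/q1; ring.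
  by apply: ler_wpM2l => //; rewrite mulr_ge0.
have BE (u : R) : u <= B -> u * majorant k e x <= B * majorant k e x by move=> uB; apply: ler_wpM2r.
split.
- rewrite hardy_termE// /cyl -/q2; apply: le_trans (BE (Cp * C) _); last by rewrite /B; lra.
  have -> : eta * (q2 * f (ss x)) * phi x = q2 * (eta * f (ss x)) * phi x by ring.
  by apply: (key _ _ b) => //; exact: bp.
- rewrite source_termE// /cyl -/q2; apply: le_trans (BE (Cp * (C `^ (p - 1) * C)) _); last by rewrite /B; lra.
  apply: (key _ _ (ss x `^ (- (A * (p - 1))))); first by rewrite mulr_ge0 ?powR_ge0.
    rewrite /spow normrM (ger0_norm (powR_ge0 _ _)).
    have -> : C `^ (p - 1) * C * (a * ss x `^ (- (A * (p - 1)))) = (C * a) `^ (p - 1) * (C * a).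
      by rewrite powRM// -powRrM mulNr; ring.
    by apply: ler_pM => //; apply: powR_mono => //; have := p1; lra.
  exact: bp.
- move=> D K K0 /(_ Q0) DK.
  have -> : D * cross_term x * phi x = q2 * (D * ss x * (c * f (ss x) + ss x * v (ss x))) * phi x
      - q2 * (D * v (ss x)) * phi x - q2 * (D * (c * Q x * f (ss x))) * phi x.
    rewrite /cross_term /cyl -/q2; have -> : Q x `^ (- c - 1) = Q x * q2.
      by rewrite (Qpow_pred _ Q0) /q2; congr (_ * _ `^ _); ring.
    ring.
  have T1 : `|q2 * (D * ss x * (c * f (ss x) + ss x * v (ss x))) * phi x| <= Cp * (K * C) * majorant k e x.
    apply: (key _ _ b); [by rewrite mulr_ge0| |exact: bp].
    rewrite normrM -mulrA; apply: ler_pM => //.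
    by rewrite normrM (ger0_norm (ltW s0)) mulrC.
  have T2 : `|q2 * (D * v (ss x)) * phi x| <= Cp * (K * C) * majorant k e x.
    apply: (key _ _ (ss x `^ (- 2))); [by rewrite mulr_ge0| |by apply: bp; have := e1; lra].
    have -> : D * v (ss x) = (ss x * D) * (ss x * v (ss x)) * (ss x)^-2 by field; exact: lt0r_neq0.
    rewrite powRN powR_mulrn ?(ltW s0)// normrM [leRHS]mulrA (ger0_norm (_ : 0 <= (ss x)^-2)); last first.
      by rewrite invr_ge0 sqr_ge0.
    apply: ler_wpM2r; first by rewrite invr_ge0 sqr_ge0.
    rewrite normrM -mulrA; apply: ler_pM => //.
    by rewrite normrM (ger0_norm (ltW s0)).
  have T3 : `|q2 * (D * (c * Q x * f (ss x))) * phi x| <= Cp * (K * (c * C)) * (2 * majorant k e x).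
    apply: (key _ _ (Q x / ss x)) => //; first by apply: mulr_ge0 => //; apply: mulr_ge0 => //; exact: ltW.
    have -> : D * (c * Q x * f (ss x)) = (ss x * D) * (c * f (ss x)) * (Q x / ss x).
      by field; exact: lt0r_neq0.
    have qs : 0 <= Q x / ss x by exact: divr_ge0 (ltW Q0) (ltW s0).
    rewrite normrM [leRHS]mulrA (ger0_norm qs); apply: ler_wpM2r => //.
    rewrite normrM -mulrA; apply: ler_pM => //; first by rewrite normrM (ger0_norm (ltW s0)).
    by rewrite normrM (gtr0_norm cp) -mulrA; apply: ler_wpM2l => //; exact: ltW.
  apply: le_trans (ler_normB _ _) _; apply: le_trans (lerD (ler_normB _ _) (lexx _)) _.
  apply: le_trans (lerD (lerD T1 T2) T3) _.
  have -> : Cp * (K * C) * majorant k e x + Cp * (K * C) * majorant k e x + Cp * (K * (c * C)) * (2 * majorant k e x) =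
    K * (Cp * C * (2 + 2 * c)) * majorant k e x by ring.
  by apply: ler_wpM2r => //; apply: ler_wpM2l => //; rewrite /B; lra.
Qed.

Lemma dominated_integrable (g : 'rV[R]_n -> R) (B : R) : measurable_fun setT g ->
  (forall x, `|g x| <= B * majorant k e x) -> mu.-integrable setT (EFin \o g).
Proof.
move=> mg gB; have H := integrableZl measurableT B (majorant_integrable k2 kn e0).
apply: (le_integrable measurableT _ _ H); first exact/measurable_EFinP.
move=> x _ /=; rewrite lee_fin; apply: le_trans (gB x) _; exact: ler_norm.
Qed.

(** At each point the cutoffs are eventually 1 with zero derivative, so the identity of [weak_step]
    passes to the limit pointwise. A bounded logarithmic slope is enough for domination, thanks to
    the gain in the cross term. *)
Lemma weak_limit phi : test_function phi ->
  [/\ mu.-integrable setT (EFin \o energy_term phi), mu.-integrable setT (EFin \o hardy_term phi),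
    mu.-integrable setT (EFin \o source_term phi) &
    (\int[mu]_x energy_term phi x) - (\int[mu]_x hardy_term phi x) = \int[mu]_x source_term phi x].
Proof.
move=> Tphi; have [B HB] := term_bounds Tphi.
have ei := energy_term_integrable Tphi.
have hi : mu.-integrable setT (EFin \o hardy_term phi).
  by apply: (@dominated_integrable _ B (measurable_hardy_term Tphi)) => x; have [] := HB x.
have si : mu.-integrable setT (EFin \o source_term phi).
  by apply: (@dominated_integrable _ B (measurable_source_term Tphi)) => x; have [] := HB x.
split=> //; have [K K0 HK] := dyadic_cutoff (R := R).
have [X /choice[dX HX]] := choice HK.
pose F m x := X m (ss x) * (energy_term phi x - hardy_term phi x - source_term phi x) + dX m (ss x) * cross_term x * phi x.
pose tot x := energy_term phi x - hardy_term phi x - source_term phi x.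
have HF m : measurable_fun setT (F m) /\ (\int[mu]_x (F m x)%:E = 0)%E.
  have [SX DX _ _ [X0 _]] := HX m; have [g Sg Dg] := Sm_Dr SX.
  have E : dX m = g by apply/funext => s; exact: Dr_unique (DX s) (Dg s).
  have dXc : continuous (dX m) by rewrite E; exact: Sm_continuous.
  apply: (weak_step DX dXc _ X0 Tphi).
  have h : 1 <= (2 : R) ^+ m.+1 by apply: exprn_ege1; rewrite ler1n.
  by rewrite -[leLHS]mulr1; apply: ler_pM.
have cvF x : (fun m => F m x) @ \oo --> tot x.
  apply: cvg_near_cst; exists (Num.bound `|ss x|) => //= m hm; rewrite /F.
  have sm : ss x <= 2 ^+ m.+1.
    apply: le_trans (ler_norm _) _; apply: ltW; apply: lt_le_trans (archi_boundP (normr_ge0 _)) _.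
    rewrite -natrX ler_nat; apply: leq_trans hm _; apply: leq_trans (leqnSn m) _.
    exact: ltnW (ltn_expl m.+1 (isT : (1 < 2)%N)).
  have [_ _ _ /(_ _ sm)[-> ->] _] := HX m.
  by rewrite mul1r !mul0r addr0.
pose G x := `|energy_term phi x| + (2 * B + K * B) * majorant k e x.
have FG m x : `|F m x| <= G x.
  have [b1 b2 b3] := HB x; have [_ _ X01 _ [_ sX]] := HX m.
  have [x0 x1] := andP (X01 (ss x)).
  have b4 : `|dX m (ss x) * cross_term x * phi x| <= K * B * majorant k e x.
    apply: b3 => // Q0; have s1 := ss_ge1 Q0.
    apply: le_trans (sX _ _) _; first by lra.
    by rewrite ler_pdivrMr ?ltr0n// ler_peMr// ler1n.
  apply: le_trans (ler_normD _ _) _; rewrite normrM (ger0_norm x0).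
  have b5 : X m (ss x) * `|energy_term phi x - hardy_term phi x - source_term phi x| <= `|energy_term phi x| + 2 * B * majorant k e x.
    apply: (@le_trans _ _ (1 * `|energy_term phi x - hardy_term phi x - source_term phi x|)); first exact: ler_wpM2r.
    rewrite mul1r; apply: le_trans (ler_normB _ _) _; apply: le_trans (lerD (ler_normB _ _) (lexx _)) _.
    lra.
  by rewrite /G mulrDl; lra.
have iG : mu.-integrable setT (EFin \o G).
  have H := integrableZl measurableT (2 * B + K * B) (majorant_integrable k2 kn e0).
  have := integrableD measurableT (integrable_norm ei) H.
  by apply: eq_integrable => // x _ /=; rewrite -EFinM -EFinD.
have [it ct] := dominated_convergence_EFin (fun m => (HF m).1) cvF FG iG.
have t0 : (\int[mu]_x (tot x)%:E = 0)%E.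
  have : (fun m => \int[mu]_x (F m x)%:E)%E @ \oo --> 0%E.
    by apply: cvg_near_cst; apply: nearW => m; exact: (HF m).2.
  by move=> c0; exact: (cvg_unique _ ct c0).
have t1 : \int[mu]_x tot x = 0 by rewrite /Rintegral t0.
apply/eqP; rewrite -subr_eq0 -t1.
by rewrite -RintegralB// -RintegralB//; exact: (integrableB measurableT ei hi).
Qed.

End Limit.

End Flux.

End Weak.

(** * Approximation by test functions *)

Lemma Lnorm_cvg0 d (T : measurableType d) (R : realType) (mu : {measure set T -> \bar R})
    (q : R) (F : nat -> T -> R) (a : nat -> R) : 0 < q ->
  (forall m, (\int[mu]_x (`|F m x| `^ q)%:E <= (a m)%:E)%E) -> a @ \oo --> (0 : R) ->
  (fun m => 'N[mu]_(q%:E) [EFin \o F m])%E @ \oo --> 0%E.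
Proof.
move=> q0 Fa a0.
have I0 m : (0 <= \int[mu]_x (`|F m x| `^ q)%:E)%E.
  by apply: integral_ge0 => x _; rewrite lee_fin powR_ge0.
have am m : 0 <= a m by rewrite -lee_fin; apply: le_trans (I0 m) (Fa m).
apply: (@squeeze_cvge _ _ _ _ (fun=> 0%E) _ (fun m => ((a m) `^ q^-1)%:E)).
- apply: nearW => m; rewrite Lnorm_ge0/= unlock.
  rewrite -poweR_EFin; apply: gt0_ler_poweR.
  + by rewrite invr_ge0 ltW.
  + by rewrite in_itv/= I0 leey.
  + by rewrite in_itv/= lee_fin am leey.
  + exact: Fa.
- exact: cvg_cst.
- apply: cvg_EFin; first exact: nearW.
  apply/cvgrPdist_lt => e e0; have /cvgrPdist_lt/(_ (e `^ q)) := a0.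
  rewrite powR_gt0// => /(_ isT); apply: filterS => m /=.
  rewrite !sub0r !normrN !ger0_norm ?powR_ge0// => h.
  have -> : e = (e `^ q) `^ q^-1 by rewrite -powRrM mulfV ?gt_eqF// powRr1// ltW.
  by apply: gt0_ltr_powR; rewrite ?invr_gt0// nnegrE// powR_ge0.
Qed.

Lemma norm_leD (R : realType) (x y a b : R) : `|x| <= a -> `|y| <= b -> `|x + y| <= a + b.
Proof. by move=> xa yb; apply: le_trans (ler_normD _ _) (lerD xa yb). Qed.

Lemma norm_leM (R : realType) (x y a b : R) : `|x| <= a -> `|y| <= b -> `|x * y| <= a * b.
Proof. by move=> xa yb; rewrite normrM; apply: ler_pM. Qed.

(* Here [X] is a cutoff, [z = s X'], [F = f], [V = s f'], and [u], [U] are the errors made on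
   [f] and [s f'] by the approximation. *)
Lemma cutoff_errors (R : realType) (C C1 K c o tau a ab X z F V u U ep : R) :
  0 <= C -> 0 <= K -> 0 < c -> 2 * K + K * C + C + c + 2 <= C1 ->
  0 <= o -> 0 <= tau -> 0 <= ab -> ab <= a ->
  `|X| <= 1 -> `|1 - X| <= o -> `|z| <= K * tau -> tau <= 1 ->
  `|F| <= C * a -> `|V| <= C * a -> `|c * F + V| <= C * ab ->
  `|u| <= ep -> `|U| <= tau * ab -> ep <= tau * ab ->
  [/\ `|X * u - (1 - X) * F| <= C1 * ((o + tau) * a),
    `|X * U - (1 - X) * V + z * (u + F)| <= C1 * ((o + tau) * a) &
    `|X * (c * u + U) - (1 - X) * (c * F + V) + z * u + z * F| <=
      C1 * ((o + tau) * ab + tau * a)].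
Proof.
move=> C0 K0 c0 C1l o0 t0 ab0 aba x1 y1 z1 t1 hF hV hD hu hU hep.
have a0 : 0 <= a by exact: le_trans aba.
have KC : 0 <= K * C by exact: mulr_ge0.
have oa : 0 <= o * a by exact: mulr_ge0.
have ta : 0 <= tau * a by exact: mulr_ge0.
have oab : 0 <= o * ab by exact: mulr_ge0.
have tab : 0 <= tau * ab by exact: mulr_ge0.
have taba : tau * ab <= tau * a by exact: ler_wpM2l.
have up (y t : R) : 0 <= t -> y <= C1 -> y * t <= C1 * t by move=> tt yC; exact: ler_wpM2r.
have uo : C * (o * a) <= C1 * (o * a) by apply: up => //; lra.
have uoab : C * (o * ab) <= C1 * (o * ab) by apply: up => //; lra.
have Dr : C1 * ((o + tau) * a) = C1 * (o * a) + C1 * (tau * a) by ring.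
have hKt : K * tau * ep <= K * (tau * ab).
  rewrite -mulrA; apply: ler_wpM2l => //; apply: le_trans (ler_wpM2l t0 hep) _.
  exact: ler_piMl.
have nN (q r : R) : `|q| <= r -> `|- q| <= r by rewrite normrN.
have hc : `|c| <= c by rewrite ger0_norm// ltW.
split.
- apply: le_trans (norm_leD (norm_leM x1 hu) (nN _ _ (norm_leM y1 hF))) _.
  have h1 : 1 * (tau * a) <= C1 * (tau * a) by apply: up => //; lra.
  by rewrite Dr mul1r (mulrCA o); lra.
- apply: le_trans (norm_leD (norm_leD (norm_leM x1 hU) (nN _ _ (norm_leM y1 hV))) (norm_leM z1 (norm_leD hu hF))) _.
  have h1 : (1 + K + K * C) * (tau * a) <= C1 * (tau * a) by apply: up => //; lra.
  have h2 : K * (tau * ab) <= K * (tau * a) by exact: ler_wpM2l.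
  have -> : 1 * (tau * ab) + o * (C * a) + K * tau * (ep + C * a) =
    tau * ab + C * (o * a) + (K * tau * ep + K * C * (tau * a)) by ring.
  by rewrite Dr; lra.
- apply: le_trans (norm_leD (norm_leD (norm_leD (norm_leM x1 (norm_leD (norm_leM hc hu) hU))
    (nN _ _ (norm_leM y1 hD))) (norm_leM z1 hu)) (norm_leM z1 hF)) _.
  have h1 : (c + 1 + K) * (tau * ab) <= C1 * (tau * ab) by apply: up => //; lra.
  have h2 : K * C * (tau * a) <= C1 * (tau * a) by apply: up => //; lra.
  have h3 : c * ep <= c * (tau * ab) by apply: ler_wpM2l => //; exact: ltW.
  have -> : 1 * (c * ep + tau * ab) + o * (C * ab) + K * tau * ep + K * tau * (C * a) =
    c * ep + tau * ab + C * (o * ab) + K * tau * ep + K * C * (tau * a) by ring.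
  have -> : C1 * ((o + tau) * ab + tau * a) = C1 * (o * ab) + C1 * (tau * ab) + C1 * (tau * a) by ring.
  by lra.
Qed.

Section Approximation.
Context {R : realType} (n k : nat) (k2 : (2 <= k)%N) (kn : (k < n)%N).
Implicit Types (x : 'rV[R]_n) (i : 'I_n).

Notation Q x := (head_norm k x).
Notation ss x := (ss k x).
Notation mu := (lebesgue_rV R n).
Let A : R := (n%:R - k%:R) / 2.
Let c : R := (n%:R - 2) / 2.

Variables (f v w : R -> R) (C e : R).
Hypothesis Df : forall s, Dr f s (v s).
Hypothesis Dv : forall s, Dr v s (w s).
Hypothesis wc : continuous w.
Hypothesis e0 : 0 < e.
Hypothesis e1 : e <= 1.
Hypothesis ec : e <= 2 * A / c.
Hypothesis decay : forall s, 1 <= s ->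
  [/\ `|f s| <= C * s `^ (- A), `|s * v s| <= C * s `^ (- A) &
    `|c * f s + s * v s| <= C * (s `^ (- A) * s `^ (- e))].

Let c0 : 0 < c.
Proof.
have : (2 : R) < n%:R by rewrite (ltr_nat _ 2); exact: leq_ltn_trans k2 kn.
by rewrite /c; lra.
Qed.

Let C0 : 0 <= C.
Proof.
have [h _ _] := decay (lexx 1); rewrite powR1 mulr1 in h; exact: le_trans h.
Qed.

Let tau (m : nat) : R := m.+1%:R^-1.
(** The indicator of the region where the m-th cutoff may differ from 1; [tau m] is the order of its
    logarithmic slope and also the tolerance of the smoothing. *)
Let om (m : nat) (s : R) : R := if 2 ^+ m.+1 < s then 1 else 0.

Let tau0 m : 0 < tau m. Proof. by rewrite invr_gt0 ltr0n. Qed.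
Let tau1 m : tau m <= 1. Proof. by rewrite invf_le1 ?ltr0n// ler1n. Qed.
Let om0 m s : 0 <= om m s. Proof. by rewrite /om; case: ifP. Qed.
Let om1 m s : om m s <= 1. Proof. by rewrite /om; case: ifP. Qed.

(** In the last estimate the term s X' f has no gain s^(-e), since f may be exactly of order s^(-A).
    It is of size tau s^(-A) and occurs only where the cutoff is still moving, below 2^(2m+3). *)
Definition approximant (C1 : R) (m : nat) (h dh : R -> R) :=
  [/\ Sm h, forall s, Dr h s (dh s), exists2 S : R, 0 <= S & forall s, S <= s -> h s = 0 &
   forall s, 1 <= s ->
   [/\ `|h s - f s| <= C1 * ((om m s + tau m) * s `^ (- A)),
       `|s * (dh s - v s)| <= C1 * ((om m s + tau m) * s `^ (- A)) &
       `|c * (h s - f s) + s * (dh s - v s)| <= C1 * ((om m s + tau m) * (s `^ (- A) * s `^ (- e)) +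
           (if s < 2 ^+ (2 * m + 3) then tau m * s `^ (- A) else 0))]].

Lemma approximant_ex : exists2 C1 : R, 0 <= C1 & forall m, exists h dh, approximant C1 m h dh.
Proof.
have [K K0 HK] := dyadic_cutoff (R := R).
have cp := c0; have Cp := C0; have KC : 0 <= K * C by rewrite mulr_ge0.
exists (2 * K + K * C + C + c + 2); first lra.
move=> m; have [X [dX [SX DX X01 X1 [X0 sX]]]] := HK m.
set M : R := 2 ^+ m.+1 in X1 X0; have M1 : 1 <= M by apply: exprn_ege1; rewrite ler1n.
have T1 : 1 <= M * M by rewrite -[leLHS]mulr1; apply: ler_pM.
have T0 : 0 < M * M by lra.
have tm := tau0 m; have tm1 := tau1 m.
(* So small that [s * ep <= tau * s^(-A) * s^(-e)] up to the end M^2 of the cutoff: one power pays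
   for the factor s and another for s^(-e), as e <= 1. *)
pose ep := tau m * (M * M) `^ (- (A + 2)).
have ep0 : 0 < ep by rewrite mulr_gt0 ?powR_gt0.
have A0 : 2^-1 <= A by exact: A_half.
have [g [dg [Sg Dg Hg]]] := C1_approx Df Dv wc T0 ep0.
exists (fun s => X s * g s), (fun s => X s * dg s + g s * dX s); split.
- exact: Sm_mul.
- by move=> s; exact: DrM.
- by exists (M * M); [lra|move=> s /X0[-> _]; rewrite mul0r].
move=> s s1; have [d1 d2 d3] := decay s1; have o0 := om0 m s; have o1 := om1 m s.
set a := s `^ (- A) in d1 d2 d3 *; set b := s `^ (- e) in d3 *.
have a0 : 0 < a by rewrite powR_gt0; lra.
have b0 : 0 < b by rewrite powR_gt0; lra.
have b1 : b <= 1 by rewrite -(powRr0 s) /b; apply: ler_powR => //; have := e0; lra.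
have if0 : 0 <= if s < 2 ^+ (2 * m + 3) then tau m * a else 0.
  by case: ifP => // _; rewrite mulr_ge0// ltW.
have ab0 : 0 <= a * b by rewrite mulr_ge0// ltW.
have [sT|sT] := leP (M * M) s.
  have [-> ->] := X0 s sT; rewrite !mul0r mulr0 !add0r !mulrN !normrN.
  have omE : om m s = 1.
    rewrite /om ifT//; apply: lt_le_trans sT; rewrite -[X in X < _]mulr1 ltr_pM2l.
      by rewrite /M exprn_egt1// ltr1n.
    exact: lt_le_trans M1.
  have up (z : R) : 0 <= z -> C * z <= (2 * K + K * C + C + c + 2) * ((om m s + tau m) * z).
    move=> z0; apply: ler_pM => //; first by lra.
    by apply: ler_peMl => //; rewrite omE lerDl ltW.
  split; [exact: le_trans d1 (up _ (ltW a0))|exact: le_trans d2 (up _ (ltW a0))|].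
  rewrite -opprD normrN; apply: le_trans d3 (le_trans (up _ ab0) _).
  by apply: ler_wpM2l; [lra|rewrite lerDl].
have s0 : 0 < s by exact: lt_le_trans s1.
have [u1 u2] : `|g s - f s| <= ep /\ `|dg s - v s| <= ep by apply: Hg; rewrite !ltW.
have Eab : s * ep <= tau m * (a * b).
  rewrite /ep mulrCA; apply: ler_wpM2l; first exact: ltW.
  apply: (@le_trans _ _ (s * s `^ (- (A + 2)))).
    by apply: ler_wpM2l; [exact: ltW|apply: powR_antimono => //; [exact: ltW|lra]].
  rewrite -[X in X * _](powRr1 (ltW s0)) -!powRDp//; apply: ler_powR => //.
  by have := e1; lra.
have Es : ep <= s * ep by rewrite ler_peMl// ltW.
have y1 : `|1 - X s| <= om m s.
  rewrite /om -/M; have [sM|sM] := ltP M s; last by have [-> _] := X1 s sM; rewrite subrr normr0.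
  have [x0 x1] := andP (X01 s); rewrite ger0_norm ?subr_ge0//.
  by rewrite lerBlDr lerDl.
have z1 : `|s * dX s| <= K * tau m.
  by rewrite normrM (gtr0_norm s0); exact: sX (ltW s0).
have x1 : `|X s| <= 1 by have [x0 x1] := andP (X01 s); rewrite ger0_norm.
have su2 : `|s * (dg s - v s)| <= tau m * (a * b).
  by apply: le_trans Eab; apply: norm_leM => //; rewrite gtr0_norm.
have aba : a * b <= a by apply: ler_piMr => //; exact: ltW.
rewrite ifT; last first.
  apply: lt_le_trans sT _; rewrite /M -exprD; apply: ler_weXn2l; first by rewrite ler1n.
  by rewrite mul2n -addnn addSn addnS -[(m + m).+2]addn2 leq_add2l.
have [h1 h2 h3] := cutoff_errors Cp K0 cp (lexx _) o0 (ltW tm) ab0 aba x1 y1 z1 tm1 d1 d2 d3 u1 su2 (le_trans Es Eab).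
by split; [apply: le_trans h1| apply: le_trans h2|apply: le_trans h3]; rewrite le_eqVlt; apply/orP; left; apply/eqP; congr `|_|; ring.
Qed.

Definition weight m x := (om m (ss x) + tau m) * majorant k e x.

Lemma measurable_weight m : measurable_fun setT (weight m).
Proof.
apply: measurable_funM; last exact: measurable_majorant.
apply: measurable_funD => //; apply: (@measurable_ss_comp _ _ k (om m)).
have -> : om m = \1_[set s | 2 ^+ m.+1 < s].
  apply/funext => s; rewrite indicE /om; case: (ltP (2 ^+ m.+1) s) => h.
    by rewrite mem_set.
  by rewrite memNset//= => h'; have := lt_le_trans h' h; rewrite ltxx.
apply: measurable_indic.
have -> : [set s : R | 2 ^+ m.+1 < s] = [set` `]2 ^+ m.+1, +oo[].
  by apply/seteqP; split => s /=; rewrite in_itv/= andbT.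
exact: measurable_itv.
Qed.

Lemma weight_ge0 m x : 0 <= weight m x.
Proof. by rewrite mulr_ge0 ?majorant_ge0// addr_ge0// ltW. Qed.

Lemma tau_cvg0 : tau @ \oo --> (0 : R).
Proof. exact: cvg_harmonic. Qed.

Lemma weight_cvg x : (fun m => weight m x) @ \oo --> (0 : R).
Proof.
suff ot : (fun m => om m (ss x) + tau m) @ \oo --> (0 : R).
  by rewrite -(mul0r (majorant k e x)); exact: cvgM ot (cvg_cst (majorant k e x)).
rewrite -[X in _ --> X]add0r; apply: cvgD tau_cvg0; apply: cvg_near_cst; exists (Num.bound `|ss x|) => //= m hm.
rewrite /om ltNge ifN// negbK.
apply: le_trans (ler_norm _) _; apply: ltW; apply: lt_le_trans (archi_boundP (normr_ge0 _)) _.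
rewrite -natrX ler_nat; apply: leq_trans hm _; apply: leq_trans (leqnSn m) _.
exact: ltnW (ltn_expl m.+1 (isT : (1 < 2)%N)).
Qed.

Lemma weight_integral : exists I : nat -> R, [/\ forall m, 0 <= I m, I @ \oo --> (0 : R),
  forall m, mu.-integrable setT (EFin \o weight m) &
  forall m, (\int[mu]_x (weight m x)%:E = (I m)%:E)%E].
Proof.
have im := majorant_integrable k2 kn e0.
have i2 : mu.-integrable setT (EFin \o (fun x => 2 * majorant k e x)).
  have -> : EFin \o (fun x => 2 * majorant k e x) = (fun x => 2%:E * (EFin \o majorant k e) x)%E.
    by apply/funext => x /=; rewrite EFinM.
  exact: (integrableZl measurableT _ im).
have w2 m x : `|weight m x| <= 2 * majorant k e x.
  rewrite ger0_norm ?weight_ge0//; apply: ler_wpM2r; first exact: majorant_ge0.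
  by have := om1 m (ss x); have := tau1 m; lra.
have [_ cv] := dominated_convergence_EFin measurable_weight weight_cvg w2 i2.
have iw m : mu.-integrable setT (EFin \o weight m).
  apply: (le_integrable measurableT _ _ i2); first by apply/measurable_EFinP; exact: measurable_weight.
  by move=> x _ /=; rewrite lee_fin; apply: le_trans (w2 m x) (ler_norm _).
have fw m : (\int[mu]_x (weight m x)%:E)%E \is a fin_num by exact: integrable_fin_num (iw m).
exists (fun m => fine (\int[mu]_x (weight m x)%:E)%E); split=> //.
- by move=> m; apply: fine_ge0; apply: integral_ge0 => x _; rewrite lee_fin weight_ge0.
- apply: (fine_cvg (f := fun m => (\int[mu]_x (weight m x)%:E)%E)).
  by move: cv; rewrite integral0_eq.
- by move=> m; rewrite fineK.
Qed.

(** By linearity [dcyl_sq_le] applies to the difference of profiles. What has a gain is collected in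
    [weight]; the remainder, tau^2 [base] on a truncated region, is the part left to
    [log_integral]. *)
Lemma grad_error C1 m h dh x : 0 <= C1 -> approximant C1 m h dh -> 0 < Q x ->
  \sum_(i < n) (dcyl k (- c) h dh i x - dcyl k (- c) f v i x) ^+ 2 <=
    C1 ^+ 2 * (4 + 8 * c) * weight m x +
    2 * C1 ^+ 2 * (tau m ^+ 2 * (base k x * \1_[set x | 0 < Q x /\ ss x < 2 `^ (2 * m + 3)%:R] x)).
Proof.
move=> C10 [_ _ _ H] Q0; have s1 := ss_ge1 Q0; have [b1 b2 b3] := H _ s1; have cp := c0.
pose D s := h s - f s; pose E s := dh s - v s.
have -> : \sum_(i < n) (dcyl k (- c) h dh i x - dcyl k (- c) f v i x) ^+ 2 =
    \sum_(i < n) dcyl k (- c) D E i x ^+ 2.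
  by apply: eq_bigr => i _; congr (_ ^+ 2); rewrite /dcyl /cyl /D /E; ring.
apply: le_trans (dcyl_sq_le k2 kn D E Q0) _; rewrite -/c.
have o0 := om0 m (ss x); have o1 := om1 m (ss x); have t0 := tau0 m; have t1 := tau1 m.
have ind : (if ss x < 2 ^+ (2 * m + 3) then tau m * ss x `^ (- A) else 0) =
   tau m * ss x `^ (- A) * \1_[set x | 0 < Q x /\ ss x < 2 `^ (2 * m + 3)%:R] x.
  rewrite indicE powR_mulrn//; case: ltP => h'; first by rewrite mem_set ?mulr1.
  by rewrite memNset ?mulr0//= => -[_]; rewrite ltNge h'.
rewrite ind in b3; set I := \1_ _ x in b3 *; have I01 : I = 0 \/ I = 1.
  by rewrite /I indicE; case: (_ \in _); [right|left].
set a := ss x `^ (- A) in b1 b2 b3; set b := ss x `^ (- e) in b3; set d := om m (ss x) + tau m in b1 b2 b3.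
have a0 : 0 <= a by exact: powR_ge0.
have b0 : 0 <= b by exact: powR_ge0.
have bl1 : b <= 1 by rewrite -(powRr0 (ss x)) /b; apply: ler_powR => //; have := e0; lra.
have d0 : 0 <= d by rewrite /d; lra.
have d2 : d ^+ 2 <= 2 * d by rewrite expr2; apply: ler_wpM2r => //; rewrite /d; lra.
have I0 : 0 <= I by case: I01 => ->.
have II : I ^+ 2 = I by case: I01 => ->; rewrite ?expr0n ?expr1n.
have h1 : (c * D (ss x) + ss x * E (ss x)) ^+ 2 <= C1 ^+ 2 * (4 * (d * (a * a * b)) + 2 * (tau m ^+ 2 * (a * a * I))).
  rewrite -real_normK ?num_real//; apply: (@le_trans _ _ ((C1 * (d * (a * b) + tau m * a * I)) ^+ 2)).
    by rewrite ler_sqr ?nnegrE// mulr_ge0// addr_ge0// !mulr_ge0// ltW.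
  rewrite exprMn; apply: ler_wpM2l; first exact: sqr_ge0.
  apply: (@le_trans _ _ (2 * (d ^+ 2 * (a * a * (b * b))) + 2 * (tau m ^+ 2 * (a * a * I ^+ 2)))).
    have := sqr_ge0 (d * (a * b) - tau m * a * I).
    set u := (X in 0 <= X -> _); set y := (X in _ -> X <= _).
    have -> : 2 * (d ^+ 2 * (a * a * (b * b))) + 2 * (tau m ^+ 2 * (a * a * I ^+ 2)) = y + u.
      by rewrite /u /y; ring.
    by move=> u0; rewrite lerDl.
  rewrite II; apply: lerD => //.
  have -> : 4 * (d * (a * a * b)) = 2 * (2 * d * (a * a * b)) by ring.
  apply: ler_wpM2l => //; apply: ler_pM; rewrite ?sqr_ge0 ?mulr_ge0//.
  by apply: ler_wpM2l; [exact: mulr_ge0|exact: ler_piMl].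
have h2 : `|D (ss x)| * `|ss x * E (ss x)| <= C1 ^+ 2 * (2 * d * (a * a)).
  apply: le_trans (ler_pM _ _ b1 b2) _ => //.
  have -> : C1 * (d * a) * (C1 * (d * a)) = C1 ^+ 2 * (d ^+ 2 * (a * a)) by ring.
  by apply: ler_wpM2l; [exact: sqr_ge0|apply: ler_wpM2r d2; exact: mulr_ge0].
have qs : 0 <= Q x / ss x by apply: divr_ge0 (ltW Q0) _; lra.
have q0 : 0 <= Q x `^ (- n%:R) by exact: powR_ge0.
apply: le_trans (ler_wpM2l q0 (lerD h1 (ler_wpM2l (mulr_ge0 (ler0n _ 2) (ltW cp)) (ler_wpM2l qs h2)))) _.
have Bb := base_pow Q0 (lexx e); have BQ := base_Q e Q0; have Bq := Qn_base Q0.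
rewrite -/A -/a in Bq; rewrite -/b in Bb.
have -> : Q x `^ (- n%:R) * (C1 ^+ 2 * (4 * (d * (a * a * b)) + 2 * (tau m ^+ 2 * (a * a * I))) +
    2 * c * (Q x / ss x * (C1 ^+ 2 * (2 * d * (a * a))))) =
  C1 ^+ 2 * 4 * d * (base k x * b) + C1 ^+ 2 * (4 * c) * d * (base k x * (Q x / ss x))
   + 2 * C1 ^+ 2 * (tau m ^+ 2 * (base k x * I)) by rewrite -Bq; ring.
apply: lerD => //.
have -> : C1 ^+ 2 * (4 + 8 * c) * weight m x =
  C1 ^+ 2 * 4 * d * majorant k e x + C1 ^+ 2 * (4 * c) * d * (2 * majorant k e x).
  by rewrite /weight -/d; ring.
have C10' := sqr_ge0 C1.
apply: lerD; apply: ler_wpM2l => //; first by rewrite !mulr_ge0.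
by apply: mulr_ge0 d0; apply: mulr_ge0 => //; lra.
Qed.

(** The exponent n / c is the critical Sobolev exponent 2 + 2 / c. It turns |y|^(-c) into |y|^(-n)
    and s^(-A) into s^(-2A) with the spare power 2A / c, hence the condition on e. The factor d / 2
    is at most 1, so raising it to a power only decreases it. *)
Lemma value_error C1 m h dh x : 0 <= C1 -> approximant C1 m h dh -> 0 < Q x ->
  `|cyl k (- c) h x - cyl k (- c) f x| `^ (n%:R / c) <= (2 * C1) `^ (n%:R / c) * weight m x.
Proof.
move=> C10 [_ _ _ H] Q0; have s1 := ss_ge1 Q0; have [b1 _ _] := H _ s1; have cp := c0.
have nE : n%:R = 2 * c + 2 :> R by exact: n2c.
have q2 : n%:R / c = 2 + 2 / c :> R by rewrite nE; field; exact: lt0r_neq0.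
have c2 : 0 < 2 / c by rewrite divr_gt0.
have o0 := om0 m (ss x); have o1 := om1 m (ss x); have t0 := tau0 m; have t1 := tau1 m.
set d := om m (ss x) + tau m in b1.
have d0 : 0 < d by rewrite /d; lra.
have -> : cyl k (- c) h x - cyl k (- c) f x = Q x `^ (- c) * (h (ss x) - f (ss x)) by rewrite /cyl; ring.
rewrite normrM (ger0_norm (powR_ge0 _ _)) powRM ?powR_ge0// -powRrM.
have -> : - c * (n%:R / c) = - n%:R by field; exact: lt0r_neq0.
have h1 : `|h (ss x) - f (ss x)| `^ (n%:R / c) <= (2 * C1) `^ (n%:R / c) * (d * ss x `^ (- A * (n%:R / c))).
  apply: (@le_trans _ _ ((2 * C1 * (d / 2 * ss x `^ (- A))) `^ (n%:R / c))).
    apply: powR_mono => //; last by rewrite q2; lra.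
    by have -> : 2 * C1 * (d / 2 * ss x `^ (- A)) = C1 * (d * ss x `^ (- A)) by field.
  rewrite powRM; [|lra|by rewrite mulr_ge0 ?powR_ge0//; lra].
  apply: ler_wpM2l; first exact: powR_ge0.
  rewrite powRM ?powR_ge0//; last by lra.
  rewrite -powRrM; apply: ler_wpM2r; first exact: powR_ge0.
  apply: (@le_trans _ _ (d / 2)); last by lra.
  rewrite -[leRHS]powRr1; last by lra.
  apply: ger_powR; last by rewrite q2; lra.
  by rewrite /d; lra.
apply: le_trans (ler_wpM2l (powR_ge0 _ _) h1) _; rewrite mulrCA; apply: ler_wpM2l; first exact: powR_ge0.
rewrite mulrCA /weight -/d; apply: ler_wpM2l; first exact: ltW.
have er : e <= 2 * A / c by exact: ec.
apply: le_trans (base_pow Q0 er); rewrite /base -mulrA -powRDp; last by lra.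
by rewrite le_eqVlt; apply/orP; left; apply/eqP; congr (_ * _ `^ _); rewrite q2 -/A; field; exact: lt0r_neq0.
Qed.

Lemma D12_cyl : D12 (cyl k (- c) f) (fun x => \row_i dcyl k (- c) f v i x).
Proof.
have cp := c0; have fc : continuous f by move=> s; exact: Dr_continuous (Df s).
have vc : continuous v by move=> s; exact: Dr_continuous (Dv s).
have [C1 C10 /choice[h /choice[dh Hh]]] := approximant_ex.
have [I [I0 Ic iw Iw]] := weight_integral.
have [Cl Cl0 HCl] := log_integral (R := R) k2 kn.
have cn : - c < 0 by lra.
split; [exact: measurable_cyl| |].
  apply: measurable_fun_coordP => i; rewrite (_ : (fun x => _) = dcyl k (- c) f v i).
    exact: measurable_dcyl.
  by apply/funext => x; rewrite mxE.
exists (fun m => cyl k (- c) (h m)); split.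
- by move=> m; have [Sh _ [S S0 hS] _] := Hh m; exact: test_cyl cn S0 Sh hS.
- pose a m := C1 ^+ 2 * (4 + 8 * c) * I m + 2 * C1 ^+ 2 * (3 * Cl) * tau m.
  apply: (Lnorm_cvg0 (a := a)) => // [m|]; last first.
    rewrite -[X in _ --> X]addr0; apply: cvgD.
      by rewrite -(mulr0 (C1 ^+ 2 * (4 + 8 * c))); exact: cvgM (cvg_cst _) Ic.
    by rewrite -(mulr0 (2 * C1 ^+ 2 * (3 * Cl))); exact: cvgM (cvg_cst _) tau_cvg0.
  have [Sh Dh [S S0 hS] _] := Hh m.
  have hc : continuous (h m) by exact: Sm_continuous.
  have dhc : continuous (dh m).
    have [g Sg Dg] := Sm_Dr Sh; have -> : dh m = g by apply/funext => s; exact: Dr_unique (Dh s) (Dg s).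
    exact: Sm_continuous.
  pose F x := \sum_(i < n) (dcyl k (- c) (h m) (dh m) i x - dcyl k (- c) f v i x) ^+ 2.
  have F0 x : 0 <= F x by apply: sumr_ge0 => i _; exact: sqr_ge0.
  rewrite (eq_integral (fun x => (F x)%:E)); last first.
    move=> x _; congr EFin; rewrite /enorm.
    have -> : \sum_(i < n) (grad (cyl k (- c) (h m)) x - \row_i dcyl k (- c) f v i x) ord0 i ^+ 2 = F x.
      apply: eq_bigr => i _; rewrite !mxE; congr ((_ - _) ^+ 2).
      exact: partial_Dr (Dr_cyl_all k x i cn Dh hS).
    by rewrite powR_mulrn// ger0_norm ?sqrtr_ge0// sqr_sqrtr.
  pose J x := base k x * \1_[set x | 0 < Q x /\ ss x < 2 `^ (2 * m + 3)%:R] x.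
  have mJ : measurable_fun setT J.
    apply: measurable_funM; last by apply: measurable_indic; exact: measurable_ss_lt.
    apply: measurable_funM; first exact: measurable_Qpow.
    by apply: (@measurable_ss_comp _ _ k (fun t => t `^ _)); exact: measurable_powR.
  have J0 x : 0 <= J x by rewrite mulr_ge0 ?base_ge0.
  pose g (l : nat) x := if l is 0%N then C1 ^+ 2 * (4 + 8 * c) * weight m x else 2 * C1 ^+ 2 * tau m ^+ 2 * J x.
  pose b (l : nat) := if l is 0%N then C1 ^+ 2 * (4 + 8 * c) * I m else 2 * C1 ^+ 2 * (3 * Cl) * tau m.
  have k1 : 0 <= C1 ^+ 2 * (4 + 8 * c) by apply: mulr_ge0; [exact: sqr_ge0|lra].
  have k2' : 0 <= 2 * C1 ^+ 2 * tau m ^+ 2 by apply: mulr_ge0 (sqr_ge0 _); apply: mulr_ge0 => //; exact: sqr_ge0.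
  have -> : a m = \sum_(l < 2) b l by rewrite !big_ord_recl big_ord0 /= addr0.
  apply: (@integral_le_sum _ _ _ mu 2 F g b) => //.
  + apply: measurable_sum => i /=; apply: measurable_funX; apply: measurable_funB; exact: measurable_dcyl.
  + case=> [|l] /=; apply: measurable_funM => //; exact: measurable_weight.
  + by case=> [|l] x /=; rewrite mulr_ge0 ?weight_ge0.
  + move=> x; rewrite !big_ord_recl big_ord0 /= addr0.
    have [Q0|/Q0_gt0 Q0] := eqVneq (Q x) 0; last by rewrite -[X in _ + X]mulrA; exact: grad_error.
    rewrite /F big1 => [|i _]; last by rewrite !dcyl0// subrr expr0n.
    by apply: addr_ge0; apply: mulr_ge0 => //; exact: weight_ge0.
  + case=> [|l] /=.
      under eq_integral do rewrite EFinM; rewrite ge0_integralZl//.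
      * by rewrite Iw EFinM.
      * by apply/measurable_EFinP; exact: measurable_weight.
      * by move=> x _; rewrite lee_fin weight_ge0.
    under eq_integral do rewrite EFinM; rewrite ge0_integralZl//; last 2 first.
    * exact/measurable_EFinP.
    * by move=> x _; rewrite lee_fin.
    apply: le_trans (lee_wpmul2l _ (HCl (2 * m + 3)%N)) _; first by rewrite lee_fin.
    rewrite -EFinM lee_fin.
    have t0 := tau0 m.
    (* One factor of tau^2 cancels the logarithmic loss 2m + 3; the other tends to 0. *)
    have tm : tau m * (2 * m + 3)%:R <= 3.
      rewrite mulrC ler_pdivrMr ?ltr0n// -natrM ler_nat.
      by rewrite mulnS [X in (X <= _)%N]addnC leq_add2l leq_mul2r orbT.
    have -> : 2 * C1 ^+ 2 * tau m ^+ 2 * (Cl * (2 * m + 3)%:R) =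
      2 * C1 ^+ 2 * (tau m * (2 * m + 3)%:R * Cl) * tau m by ring.
    apply: ler_wpM2r; first exact: ltW.
    apply: ler_wpM2l; first by rewrite mulr_ge0 ?sqr_ge0.
    exact: ler_wpM2r.
- have nE : sobolev_exponent R n = n%:R / c.
    by rewrite /sobolev_exponent /c; field; apply/eqP; move: cp; rewrite /c; lra.
  rewrite nE; pose a m := (2 * C1) `^ (n%:R / c) * I m.
  have n0 : 0 < n%:R :> R by rewrite ltr0n; exact: leq_ltn_trans kn.
  apply: (Lnorm_cvg0 (a := a)) => // [|m|]; first by rewrite divr_gt0.
    have [Sh Dh [S S0 hS] _] := Hh m.
    have hc : continuous (h m) by exact: Sm_continuous.
    apply: (@le_trans _ _ (\int[mu]_x ((2 * C1) `^ (n%:R / c) * weight m x)%:E)%E); last first.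
      under eq_integral do rewrite EFinM.
      rewrite ge0_integralZl//; first by rewrite Iw EFinM.
      * by apply/measurable_EFinP; exact: measurable_weight.
      * by move=> x _; rewrite lee_fin weight_ge0.
      * by rewrite lee_fin powR_ge0.
    apply: ge0_le_integral => //.
    + apply/measurable_EFinP; apply: (measurableT_comp (measurable_powR _)).
      apply: measurableT_comp; first exact: normr_measurable.
      by apply: measurable_funB; exact: measurable_cyl.
    + by apply/measurable_EFinP; apply: measurable_funM => //; exact: measurable_weight.
    move=> x _; rewrite lee_fin.
    have [Q0|/Q0_gt0 Q0] := eqVneq (Q x) 0; last exact: value_error (Hh m) Q0.
    have cn0 : - c != 0 by apply/eqP; lra.
    rewrite /= !cyl0// subrr normr0 powR0; first by rewrite mulr_ge0 ?weight_ge0 ?powR_ge0.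
    by apply/eqP => z0; have := divr_gt0 n0 cp; rewrite z0 ltxx.
  by rewrite -(mulr0 ((2 * C1) `^ (n%:R / c))); exact: cvgM (cvg_cst _) Ic.
Qed.

End Approximation.

(** * Energy and sign of cylindrical functions *)

Lemma Dr_line_at (R : realType) n (F : 'rV[R]_n -> R) i x (t d : R) :
  Dr (fun h => F (x + t *: ei i + h *: ei i)) 0 d -> Dr (fun u => F (x + u *: ei i)) t d.
Proof.
move=> D; have D1 : Dr (fun s : R => s - t) t 1.
  by apply: (Dr_eq (DrB (Dr_id t) (Dr_cst t t))); rewrite subr0.
have -> : (fun s => F (x + s *: ei i)) = fun s => F (x + t *: ei i + (s - t) *: ei i).
  by apply/funext => s; rewrite -addrA -scalerDl (addrC t) subrK.
rewrite -(subrr t) in D.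
by apply: (Dr_eq (Dr_comp (g := fun h => F (x + t *: ei i + h *: ei i)) D1 D)); rewrite mulr1.
Qed.

(* From [2 |g| <= g^2 + 1]. *)
Lemma energy_line (R : realType) (U g : R -> R) (a b : R) : a < b ->
  (forall t, a <= t <= b -> Dr U t (g t)) -> (forall t, a <= t <= b -> cont_at g t) ->
  ((2 * `|U b - U a| - (b - a))%:E <= \int[lebesgue_measure]_(t in `[a, b]) (g t ^+ 2)%:E)%E.
Proof.
move=> ab DU gc; have Uc t : a <= t <= b -> cont_at U t by move=> /DU; exact: Dr_continuous.
have gw := cont_within gc.
have mg : measurable_fun `[a, b] g.
  by apply: subspace_continuous_measurable_fun => //; exact: measurable_itv.
have mab : measurable (`[a, b] : set R) by exact: measurable_itv.
have FTC : (\int[lebesgue_measure]_(x in `[a, b]) (g x)%:E = (U b)%:E - (U a)%:E)%E.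
  apply: continuous_FTC2 => //; first split.
  - by move=> t /=; rewrite in_itv/= => /andP[at_ tb]; have [] := DU t _; rewrite ?ltW.
  - by apply: cvg_at_right_filter; apply: Uc; rewrite lexx ltW.
  - by apply: cvg_at_left_filter; apply: Uc; rewrite lexx ltW.
  - move=> t; rewrite in_itv/= => /andP[at_ tb]; rewrite derive1E.
    have tab : a <= t <= b by rewrite !ltW.
    by have [_ h] := DU t tab; exact: h.
have h1 : (`|\int[lebesgue_measure]_(x in `[a, b]) (g x)%:E| <=
    \int[lebesgue_measure]_(x in `[a, b]) (`|g x|)%:E)%E.
  by apply: le_abse_integral => //; exact/measurable_EFinP.
rewrite FTC -EFinB /= in h1.
have h2 : (2%:E * \int[lebesgue_measure]_(x in `[a, b]) (`|g x|)%:E <=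
    \int[lebesgue_measure]_(x in `[a, b]) (g x ^+ 2)%:E + (b - a)%:E)%E.
  have -> : (b - a)%:E = (\int[lebesgue_measure]_(x in `[a, b]) (cst 1%E) x)%E.
    rewrite integral_cst// mul1e.
    by have := @lebesgue_measure_itv R `[a, b]; rewrite /= lte_fin ab.
  rewrite -ge0_integralD//; last 2 first.
  - by move=> x _; rewrite lee_fin sqr_ge0.
  - by apply/measurable_EFinP; exact: measurable_funX.
  rewrite -ge0_integralZl//; last first.
    by apply/measurable_EFinP; exact: measurableT_comp.
  apply: ge0_le_integral => //.
  - by apply: emeasurable_funM => //; apply/measurable_EFinP; exact: measurableT_comp.
  - by apply: emeasurable_funD => //; apply/measurable_EFinP; exact: measurable_funX.
  move=> x _; rewrite -EFinM -EFinD lee_fin -(real_normK (num_real (g x))).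
  by have := sqr_ge0 (`|g x| - 1); rewrite sqrrB1; lra.
have h3 : ((2 * `|U b - U a|)%:E <= \int[lebesgue_measure]_(x in `[a, b]) (g x ^+ 2)%:E + (b - a)%:E)%E.
  by apply: le_trans h2; rewrite EFinM; apply: lee_wpmul2l.
by rewrite EFinB leeBlDr.
Qed.

Section Energy.
Context {R : realType} (n' k : nat) (k2 : (2 <= k)%N) (kn : (k < n'.+1)%N).
Let n := n'.+1.
Implicit Types (x : 'rV[R]_n) (i : 'I_n) (p : 'rV[R]_n').

Notation Q x := (head_norm k x).
Notation ss x := (ss k x).
Notation mu := (lebesgue_rV R n).
Let c : R := (n%:R - 2) / 2.

Variables (f v w : R -> R).
Hypothesis Df : forall s, Dr f s (v s).
Hypothesis Dv : forall s, Dr v s (w s).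

Let c0 : 0 < c.
Proof.
have : (2 : R) < n%:R by rewrite (ltr_nat _ 2); exact: leq_ltn_trans k2 kn.
by rewrite /c; lra.
Qed.

Let i0 : 'I_n := ord0.

Lemma rV_cons_line p (t : R) : rV_cons (p, t) = rV_cons (p, 0) + t *: ei i0.
Proof.
apply/rowP => j; rewrite eiE; have [l ->|->] := unliftP (ord0 : 'I_n'.+1) j.
  by rewrite !rV_consS mulr0 addr0.
by rewrite !rV_cons0 eqxx mulr1 add0r.
Qed.

Lemma Q_line_ge p (t : R) : t <= Q (rV_cons (p, t)).
Proof.
apply: le_trans (ler_norm t) _; have := @coord_head R n k (rV_cons (p, t)) ord0.
by rewrite rV_cons0; apply; exact: leq_trans k2.
Qed.

Lemma Dr_cyl_line b h dh p (t : R) : 0 < t -> (forall s, Dr h s (dh s)) ->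
  Dr (fun t => cyl k b h (rV_cons (p, t))) t (dcyl k b h dh i0 (rV_cons (p, t))).
Proof.
move=> t0 Dh; have -> : (fun t => cyl k b h (rV_cons (p, t))) = fun t => cyl k b h (rV_cons (p, 0) + t *: ei i0).
  by apply/funext => u; rewrite rV_cons_line.
apply: Dr_line_at; rewrite -rV_cons_line; apply: Dr_cyl => //.
exact: lt_le_trans t0 (Q_line_ge p t).
Qed.

Lemma dcyl_line_continuous p (t : R) : 0 < t ->
  cont_at (fun t => dcyl k (- c) f v i0 (rV_cons (p, t))) t.
Proof.
move=> t0; have Dh s : Dr (fun s => - c * f s - s * v s) s (- c * v s - (s * w s + v s)).
  apply: (Dr_eq (DrB (DrM (Dr_cst (- c) s) (Df s)) (DrM (Dr_id s) (Dv s)))); ring.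
have D1 := Dr_cyl_line (- c - 2) p t0 Dh; have D2 := Dr_cyl_line (- c - 1) p t0 Dv.
have D3 : Dr (fun t => rV_cons (p, t) ord0 i0) t 1.
  have -> : (fun t => rV_cons (p, t) ord0 i0) = fun t => t by apply/funext => u; rewrite rV_cons0.
  exact: Dr_id.
exact: Dr_continuous (DrM D3 (DrD (DrM (Dr_cst (hd k i0) t) D1) D2)).
Qed.

(** Along the first coordinate, which belongs to y, s is at most 2 at t = 1 because |y| >= 1 and
    |x|^2 <= 2, and at least 3 at t = 7 because s >= |y| / 2 >= 7/2. *)
Lemma hits p (z : R) : 2 <= z <= 3 -> sqn p <= 1 ->
  exists2 t : R, 1 <= t <= 7 & ss (rV_cons (p, t)) = z.
Proof.
move=> /andP[z2 z3] p1; have sE t : sqn (rV_cons (p, t)) = t ^+ 2 + sqn p.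
  rewrite /sqn big_ord_recl rV_cons0; congr (_ + _).
  by apply: eq_bigr => j _; rewrite rV_consS.
have [||| t tI ht] := @ivt0 R (fun t => ss (rV_cons (p, t)) - z) 1 7; first lra.
- move=> t /andP[t1 _]; have t0 : 0 < t by lra.
  have D0 := Dr_ss i0 (lt_le_trans t0 (Q_line_ge p t)).
  rewrite (rV_cons_line p t) in D0; have D := Dr_line_at (F := fun x => ss x) D0.
  have E : (fun t => ss (rV_cons (p, t)) - z) = fun t => ss (rV_cons (p, 0) + t *: ei i0) - z.
    by apply/funext => u; rewrite rV_cons_line.
  rewrite E; exact: Dr_continuous (DrB D (Dr_cst z t)).
- have h1 := Q_line_ge p 1; have h7 := Q_line_ge p 7.
  have q1 : 0 < Q (rV_cons (p, 1)) by lra.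
  have q7 : 0 < Q (rV_cons (p, 7)) by lra.
  have s1 : ss (rV_cons (p, 1)) <= 2.
    by rewrite -(ler_pM2l (_ : 0 < 2 * Q (rV_cons (p, 1)))) ?ssE ?sE ?expr1n//; lra.
  have s7 : 3 <= ss (rV_cons (p, 7)).
    rewrite -(ler_pM2l (_ : 0 < 2 * Q (rV_cons (p, 7)))) ?ssE//; last lra.
    have h2 := Q_sqn k (rV_cons (p, 7)); have h3 := ler_wpM2r (ltW q7) h7.
    by rewrite -expr2 in h3; lra.
  by apply: mulr_le0_ge0; lra.
- by exists t => //; apply/eqP; rewrite -subr_eq0 ht.
Qed.

Definition energy_density x := \sum_(i < n) dcyl k (- c) f v i x ^+ 2.

Lemma energy_density_ge0 x : 0 <= energy_density x.
Proof. by apply: sumr_ge0 => i _; exact: sqr_ge0. Qed.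

Hypothesis vc : continuous v.

Lemma measurable_energy_density : measurable_fun setT energy_density.
Proof.
have fc : continuous f by move=> s; exact: Dr_continuous (Df s).
by apply: measurable_sum => i /=; apply: measurable_funX; exact: measurable_dcyl.
Qed.

(** On each fibre u goes from 0 to at least 8^(-c) M in absolute value within a length of at most 6,
    so [energy_line] applies. The 8 bounds |y|, since |y|^2 <= 49 + 1. *)
Lemma energy_fibre p (z y M : R) : 2 <= z <= 3 -> 2 <= y <= 3 -> f z = 0 -> M <= `|f y| -> 0 < M ->
  sqn p <= 1 ->
  ((2 * (8 `^ (- c) * M) - 6)%:E <= \int[lebesgue_measure]_t (energy_density (rV_cons (p, t)))%:E)%E.
Proof.
move=> zI yI fz My M0 p1; have [tz tzI sz] := hits zI p1; have [ty tyI sy] := hits yI p1.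
pose U t := cyl k (- c) f (rV_cons (p, t)); pose g t := dcyl k (- c) f v i0 (rV_cons (p, t)).
have Uz : U tz = 0 by rewrite /U /cyl sz fz mulr0.
have Uy : 8 `^ (- c) * M <= `|U ty|.
  rewrite /U /cyl sy normrM ger0_norm ?powR_ge0//; apply: ler_pM; rewrite ?powR_ge0 ?(ltW M0)//.
  move/andP: tyI => [t1 t7]; have h := Q_line_ge p ty.
  apply: powR_antimono; [by lra| |by have := c0; lra].
  rewrite -ler_sqr ?nnegrE ?Q_ge0//; apply: le_trans (Q_sqn _ _) _.
  have -> : sqn (rV_cons (p, ty)) = ty ^+ 2 + sqn p.
    rewrite /sqn big_ord_recl rV_cons0; congr (_ + _).
    by apply: eq_bigr => j _; rewrite rV_consS.
  by nra.
have mF : measurable_fun setT (fun t => (energy_density (rV_cons (p, t)))%:E).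
  apply/measurable_EFinP; apply: (measurableT_comp measurable_energy_density).
  exact: measurable_rV_cons1.
have main a b : a < b -> 1 <= a -> b <= 7 -> 8 `^ (- c) * M <= `|U b - U a| ->
    ((2 * (8 `^ (- c) * M) - 6)%:E <= \int[lebesgue_measure]_t (energy_density (rV_cons (p, t)))%:E)%E.
  move=> ab a1 b7 h.
  apply: (@le_trans _ _ (2 * `|U b - U a| - (b - a))%:E); first by rewrite lee_fin; lra.
  apply: (@le_trans _ _ (\int[lebesgue_measure]_(t in `[a, b]) (g t ^+ 2)%:E)%E).
    apply: energy_line => // t /andP[at_ _]; have t0 : 0 < t by lra.
      exact: Dr_cyl_line t0 Df.
    exact: dcyl_line_continuous.
  apply: (@le_trans _ _ (\int[lebesgue_measure]_(t in `[a, b]) (energy_density (rV_cons (p, t)))%:E)%E).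
    apply: ge0_le_integral => //.
    - by move=> t _; rewrite lee_fin sqr_ge0.
    - apply/measurable_EFinP; apply: measurable_funX; apply: measurable_funTS.
      apply: (measurableT_comp (f := dcyl k (- c) f v i0)); last exact: measurable_rV_cons1.
      by apply: measurable_dcyl => // s; exact: Dr_continuous (Df s).
    - exact: measurable_funTS.
    - move=> t _; rewrite lee_fin /energy_density (bigD1 i0)//= lerDl.
      by apply: sumr_ge0 => i _; exact: sqr_ge0.
  by apply: ge0_subset_integral => // t _; rewrite lee_fin energy_density_ge0.
move/andP: tzI => [z1 z7]; move/andP: tyI => [y1 y7].
have [tt|tt|tt] := ltgtP tz ty.
- by apply: (main tz ty) => //; rewrite Uz subr0.
- by apply: (main ty tz) => //; rewrite Uz sub0r normrN.
- have h : 0 < 8 `^ (- c) * M by rewrite mulr_gt0 ?powR_gt0.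
  by move: Uy; rewrite -tt Uz normr0 leNgt h.
Qed.

End Energy.

(** The fibre bound is integrated over a small cube of transverse variables p with |p| <= 1, of
    volume V. The threshold M is independent of the solution, which allows it to be fixed before
    [radial_solution] is applied. *)
Lemma L2norm_large (R : realType) (n k : nat) : (2 <= k)%N -> (k < n)%N -> forall B : R, 0 <= B ->
  exists M : R, forall f v w : R -> R, (forall s, Dr f s (v s)) -> (forall s, Dr v s (w s)) ->
  forall z y : R, 2 <= z <= 3 -> 2 <= y <= 3 -> f z = 0 -> M <= `|f y| ->
  (B%:E <= L2norm_field (fun x : 'rV[R]_n => \row_i dcyl k (- ((n%:R - 2) / 2)) f v i x))%E.
Proof.
case: n => // n k2 kn B B0; set c := (_ - 2) / 2.
pose r : R := n.+1%:R^-1; have r0 : 0 < r by rewrite invr_gt0 ltr0n.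
pose V : R := \prod_(i < n) (r - - r).
have V0 : 0 < V by apply: prodr_gt0 => i _; lra.
have q0 : 0 < 8 `^ (- c) :> R by exact: powR_gt0.
(* Makes the fibre bound [2 * (8^(-c) * M) - 6] equal to B^2 / V + 1. *)
pose M := (B ^+ 2 / V + 6 + 1) / (2 * 8 `^ (- c)).
have BV : 0 <= B ^+ 2 / V by apply: divr_ge0 (sqr_ge0 _) (ltW V0).
have M0 : 0 < M by apply: divr_gt0; [lra|rewrite mulr_gt0].
exists M => f v w Df Dv z y zI yI fz My.
have vc : continuous v by move=> s; exact: Dr_continuous (Dv s).
pose F (x : 'rV[R]_n.+1) := energy_density k f v x.
have F0 (x : 'rV[R]_n.+1) : 0 <= F x by exact: energy_density_ge0.
have mF : measurable_fun [set: 'rV[R]_n.+1] (EFin \o F).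
  by apply/measurable_EFinP; exact: measurable_energy_density Df vc.
have b1 : B ^+ 2 / V <= 2 * (8 `^ (- c) * M) - 6.
  have -> : 2 * (8 `^ (- c) * M) = B ^+ 2 / V + 6 + 1 by rewrite /M; field; rewrite !gt_eqF.
  lra.
have E : ((B ^+ 2)%:E <= \int[lebesgue_rV R n.+1]_x (F x)%:E)%E.
  rewrite (ge0_integral_rVS mF); last by move=> x; rewrite lee_fin.
  pose I (p : 'rV[R]_n) := (\int[lebesgue_measure]_t (F (rV_cons (p, t)))%:E)%E.
  have mI : measurable_fun setT I by apply: (measurable_inner mF) => x; rewrite lee_fin.
  apply: (@le_trans _ _ (\int[lebesgue_rV R n]_p ((B ^+ 2 / V)%:E * (\1_(cube r) p)%:E))%E).
    rewrite ge0_integralZl//; last by apply/measurable_EFinP; apply: measurable_indic; exact: measurable_cube.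
    rewrite integral_indic ?setIT//; last exact: measurable_cube.
    rewrite cubeE lebesgue_rbox; last by move=> i; lra.
    by rewrite -EFinM lee_fin -/V divfK ?gt_eqF.
  apply: ge0_le_integral => //.
  - by move=> p _; rewrite mule_ge0// lee_fin.
  - by apply: emeasurable_funM => //; apply/measurable_EFinP; apply: measurable_indic; exact: measurable_cube.
  move=> p _; have [pr|pr] := pselect (cube r p); last first.
    by rewrite indicE memNset// mule0; apply: integral_ge0 => t _; rewrite lee_fin.
  rewrite indicE mem_set// mule1; apply: (@le_trans _ _ (2 * (8 `^ (- c) * M) - 6)%:E); first by rewrite lee_fin.
  apply: (energy_fibre k2 kn Df Dv vc zI yI fz My M0).
  have : sqn p <= \sum_(i < n) r ^+ 2.
    by apply: ler_sum => i _; rewrite -real_normK ?num_real// ler_sqr ?nnegrE ?(ltW r0)//; exact: pr.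
  move=> h; apply: le_trans h _; rewrite sumr_const card_ord -[_ *+ _]mulr_natl.
  have rn : n%:R * r <= 1 by rewrite ler_pdivrMr ?ltr0n// mul1r ler_nat.
  have r1 : r <= 1 by rewrite invf_le1 ?ltr0n// ler1n.
  by rewrite expr2 mulrA -[leRHS]mulr1; apply: ler_pM => //; rewrite ?mulr_ge0// ltW.
rewrite /L2norm_field unlock.
have -> : (\int[lebesgue_rV R n.+1]_x `|(EFin \o (fun x => enorm (\row_i dcyl k (- c) f v i x))) x| `^ 2)%E =
    (\int[lebesgue_rV R n.+1]_x (F x)%:E)%E.
  apply: eq_integral => x _; rewrite /=; congr EFin.
  rewrite powR_mulrn// ger0_norm ?sqrtr_ge0// sqr_sqrtr; last by apply: sumr_ge0 => i _; exact: sqr_ge0.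
  by apply: eq_bigr => i _; rewrite mxE.
have -> : B%:E = ((B ^+ 2)%:E `^ 2^-1)%E.
  by rewrite poweR_EFin powR12_sqrt ?sqr_ge0// sqrtr_sqr ger0_norm.
apply: gt0_ler_poweR => //.
- by rewrite in_itv/= lee_fin sqr_ge0 leey.
- by rewrite in_itv/= leey andbT; apply: le_trans E; rewrite lee_fin sqr_ge0.
Qed.

(** * Sign changes *)

Section Sign.
Context {R : realType} (n k : nat) (k2 : (2 <= k)%N) (kn : (k < n)%N).

Lemma ss_onto (s : R) : 1 <= s -> exists2 x : 'rV[R]_n, 0 < head_norm k x & ss k x = s.
Proof.
move=> s1; have n0 : (0 < n)%N by exact: leq_ltn_trans kn.
pose i := Ordinal n0; have k0 : (0 < k)%N by exact: leq_trans k2.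
(* The larger root of 1 + t^2 = 2 t s; on the first axis |y| = t and |x|^2 = t^2. *)
pose t := s + Num.sqrt (s ^+ 2 - 1); have t0 : 0 < t by rewrite /t; have := sqrtr_ge0 (s ^+ 2 - 1); lra.
have h : 0 <= s ^+ 2 - 1 by have := sqr_ge0 (s - 1); nra.
have tt : 1 + t ^+ 2 = 2 * t * s by rewrite /t sqrrD sqr_sqrtr//; ring.
have co j : (t *: ei i) ord0 j = t * (j == i)%:R by rewrite !mxE eqxx.
have q : head_norm k (t *: ei i) = t.
  rewrite /head_norm (bigD1 i)//= big1 ?addr0 => [|j /andP[_ ji]].
    by rewrite co eqxx mulr1 sqrtr_sqr gtr0_norm.
  by rewrite co (negbTE ji) mulr0 expr0n.
have sq : sqn (t *: ei i) = t ^+ 2.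
  rewrite /sqn (bigD1 i)//= big1 ?addr0 => [|j ji]; first by rewrite co eqxx mulr1.
  by rewrite co (negbTE ji) mulr0 expr0n.
exists (t *: ei i); first by rewrite q.
by rewrite /ss q sq tt; field; rewrite gt_eqF.
Qed.

Lemma pos_not_ae (u : 'rV[R]_n -> R) (x : 'rV[R]_n) : {for x, continuous u} -> 0 < u x ->
  ~ {ae lebesgue_rV R n, forall x, u^\+ x = 0}.
Proof.
move=> uc ux [N [mN N0 sub]].
have : nbhs x [set y | 0 < u y] by apply: (uc [set z | 0 < z]); exact: lt_nbhsr.
move=> /nbhs_ballP[e /= e0 He].
pose a i : R := x ord0 i - e / 2; pose b i : R := x ord0 i + e / 2.
have bx : rbox a b `<=` N.
  move=> y yb; apply: sub => /= uy; have : 0 < u y.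
    apply: He; split=> // i j; rewrite (ord1 i); have /andP[] := yb j; rewrite /a /b => h1 h2.
    by rewrite /ball/= ltr_distl; lra.
  have : u y <= u^\+ y by rewrite /funrpos le_max lexx.
  by rewrite uy; lra.
have : (lebesgue_rV R n (rbox a b) <= lebesgue_rV R n N)%E.
  by apply: le_measure; rewrite ?inE//; exact: measurable_rbox.
rewrite N0 lebesgue_rbox; last by move=> i; rewrite /a /b; lra.
rewrite lee_fin leNgt => /negP; apply; apply: prodr_gt0 => i _; rewrite /a /b; lra.
Qed.

(** A simple zero beyond 1 gives both signs of f at arguments >= 1, all of which are values of s.
    Continuity of u off y = 0 spreads each sign over a set of positive measure. *)
Lemma sign_changing_cyl b (f v : R -> R) z : (forall s, Dr f s (v s)) -> 1 < z -> f z = 0 -> v z != 0 ->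
  sign_changing (cyl k b f : 'rV[R]_n -> R).
Proof.
move=> Df z1 fz vz.
have cu x : 0 < head_norm k x -> {for x, continuous (cyl k b f : 'rV[R]_n -> R)}.
  by move=> Q0; apply: differentiable_continuous; exact: differentiable_cyl_pos Q0 (Df _).
have [s1 [s2 [h1 h2 p1 p2]]] : exists s1 s2 : R, [/\ 1 <= s1, 1 <= s2, 0 < f s1 & f s2 < 0].
  have nv : 0 < `|v z| by rewrite normr_gt0.
  have e0 : 0 < `|v z| / 2 by rewrite divr_gt0.
  have [de de0 Hde] := (Dr_epsP f z (v z)).1 (Df z) _ e0.
  pose h := Num.min (de / 2) (z - 1); have h0 : 0 < h by rewrite lt_min; apply/andP; split; lra.
  have hde : h < de by apply: le_lt_trans (_ : h <= de / 2) _; [rewrite ge_min lexx|lra].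
  have hz : h <= z - 1 by rewrite ge_min lexx orbT.
  have := Hde (z + h); have := Hde (z - h).
  have -> : z - h - z = - h by ring.
  have -> : z + h - z = h by ring.
  rewrite normrN gtr0_norm// fz !subr0 => /(_ hde); rewrite ler_norml => /andP[a1 a2] /(_ hde).
  rewrite ler_norml => /andP[b1 b2]; have P := mulr_gt0 e0 h0.
  have [v0|v0] := ltP 0 (v z).
    rewrite gtr0_norm// in a1 a2 b1 b2 P.
    by exists (z + h), (z - h); split; nra.
  rewrite ler0_norm// in a1 a2 b1 b2 P.
  by exists (z - h), (z + h); split; nra.
have [x1 Q1 E1] := ss_onto h1; have [x2 Q2 E2] := ss_onto h2; split.
  by apply: (@pos_not_ae _ x1 (cu _ Q1)); rewrite /cyl E1 mulr_gt0 ?powR_gt0.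
move=> H; apply: (@pos_not_ae (fun x => - cyl k b f x) x2).
- by apply: continuousN; exact: cu.
- by rewrite /cyl E2 oppr_gt0 pmulr_rlt0 ?powR_gt0.
- by apply: filterS H => x; rewrite /funrpos /funrneg.
Qed.

End Sign.

(** * Choice of the constants and assembly *)

Lemma large_solution (R : realType) (n k : nat) (eta t B : R) : (2 <= k)%N -> (k < n)%N ->
  0 <= eta -> ((2 < k)%N -> eta < (k%:R - 2) ^+ 2 / 4) -> (k = 2%N -> eta = 0) ->
  0 <= t -> t < 2 -> 0 <= B ->
  exists (u : 'rV[R]_n -> R) (G : 'rV[R]_n -> 'rV[R]_n),
    [/\ D12 u G, hsm_weak_solution k eta t u G, sign_changing u & (B%:E <= L2norm_field G)%E].
Proof.
move=> k2 kn eta0 etal etaE t0 t2 B0.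
pose A : R := (n%:R - k%:R) / 2; pose c : R := (n%:R - 2) / 2; pose p := hsm_exponent n t.
pose nu := Num.sqrt ((k%:R - 2) ^+ 2 / 4 - eta); pose lam := A ^+ 2 - nu ^+ 2.
have k2R : 2 <= k%:R :> R by rewrite (ler_nat _ 2).
have knR : k%:R + 1 <= n%:R :> R by rewrite natr1 ler_nat.
have A1 : 1 / 2 <= A by rewrite /A; trim_lra.
have c0 : 0 < c by rewrite /c; trim_lra.
have nu2 : nu ^+ 2 = (k%:R - 2) ^+ 2 / 4 - eta.
  rewrite sqr_sqrtr// subr_ge0; move: k2; rewrite leq_eqVlt => /predU1P[E|/etal/ltW//].
  by rewrite etaE// mulr_ge0// sqr_ge0.
have nu0 : 0 <= nu by exact: sqrtr_ge0.
have nuE : nu = 0 -> k%:R = 2 :> R /\ eta = 0.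
  move=> nuz; move: nu2; rewrite nuz expr0n/= => h; move: k2; rewrite leq_eqVlt => /predU1P[E|/etal]; last trim_lra.
  by rewrite -E etaE.
have n2 : n%:R - 2 != 0 :> R by apply/eqP; move: c0; rewrite /c; trim_lra.
have cpE : c * p + t = c + 2 by rewrite /c /p /hsm_exponent; field.
have p1 : 1 < p by rewrite -(ltr_pM2l c0) mulr1; trim_lra.
have lamE : lam = c ^+ 2 - c * (k%:R - 2) + eta by rewrite /lam nu2 /A /c; field.
(* With c p = c + 2 - t and t >= 0 it is enough that A - 1/2 < c, and indeed c = A + (k - 2) / 2. *)
have subcrit : (2 * A - 1) / 2 < (2 * A + 1) / (p + 1).
  rewrite ltr_pdivlMr; last by trim_lra.
  rewrite -(ltr_pM2r c0); have -> : (2 * A - 1) / 2 * (p + 1) * c = (2 * A - 1) / 2 * (c * p + c) by ring.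
  have -> : c * p = c + 2 - t by trim_lra.
  have h : 0 <= (2 * A - 1) / 2 * t by apply: mulr_ge0 => //; trim_lra.
  have cA : c = A + (k%:R - 2) / 2 by rewrite /c /A; field.
  rewrite cA; nra.
have [M HM] := L2norm_large k2 kn B0.
have [al [f0 [v0 [So [C [e [e0 Hfast]]] [z [y [zI fz vz yI fy]]]]]]] :=
  radial_solution A1 p1 nu0 subcrit M.
have [f [v [w [prof fE vE]]]] := issol_profile A1 p1 So.
have [Df Dv wc _] := prof.
have C0 : 0 <= C.
  by have [h _ _ _] := Hfast 1 (lexx 1); rewrite powR1 mulr1 in h; exact: le_trans h.
(* Besides the gain e of the radial solution and the normalisation by 1, A (p - 1) is the gain of
   the source term and 2 A / c the room in the critical Lebesgue norm. *)
pose e' := Num.min (Num.min e 1) (Num.min (A * (p - 1)) (2 * A / c)).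
have A0 : 0 < A by trim_lra.
have e'0 : 0 < e'.
  have h1 : 0 < A * (p - 1) by apply: mulr_gt0 => //; trim_lra.
  have h2 : 0 < 2 * A / c by apply: divr_gt0 => //; trim_lra.
  by rewrite !lt_min e0 ltr01 h1 h2.
have e'e : e' <= e by rewrite !ge_min lexx.
have e'1 : e' <= 1 by rewrite !ge_min lexx orbT.
have e'A : e' <= A * (p - 1) by rewrite !ge_min lexx !orbT.
have e'c : e' <= 2 * A / c by rewrite !ge_min lexx !orbT.
(* One constant for c f + s v, which costs c + 1, and for eta f. *)
pose C' := (c + 1 + eta) * C.
have decay s : 1 <= s -> [/\ `|f s| <= C' * s `^ (- A), `|s * v s| <= C' * s `^ (- A),
    `|c * f s + s * v s| <= C' * (s `^ (- A) * s `^ (- e')) &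
    `|eta * f s| <= C' * (s `^ (- A) * s `^ (- e'))].
  move=> s1; have [d1 d2 d3 d4] := Hfast s s1; rewrite -(fE _ s1) -(vE _ s1) in d1 d2 d3 d4.
  have s0 : 0 < s by trim_lra.
  have se : s `^ (- (A + e)) <= s `^ (- A) * s `^ (- e').
    by rewrite -powRDp//; apply: ler_powR => //; trim_lra.
  have CC : C <= C' by rewrite -[leLHS]mul1r; apply: ler_wpM2r => //; trim_lra.
  have q0 := powR_ge0 s (- A); have q1 : 0 <= s `^ (- A) * s `^ (- e') by rewrite mulr_ge0 ?powR_ge0.
  split; [exact: le_trans d1 (ler_wpM2r q0 CC)|exact: le_trans d2 (ler_wpM2r q0 CC)| |].
    (* When nu = 0 one has k = 2 and c = A, so the combination whose extra decay is known is
       precisely the leading part of the gradient. *)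
    have [/esym nuz|nup] := eqVneq 0 nu.
      have [k2E _] := nuE nuz; have -> : c = A by rewrite /c /A k2E.
      by apply: le_trans (d3 nuz) _; apply: ler_pM; rewrite ?powR_ge0.
    have nu1 : 0 < nu by rewrite lt_neqAle nup.
    have [h1 h2] := d4 nu1.
    have cn : `|c| <= c by rewrite ger0_norm// ltW.
    apply: le_trans (norm_leD (norm_leM cn h1) h2) _.
    apply: (@le_trans _ _ ((c + 1) * C * s `^ (- (A + e)))); first trim_lra.
    apply: ler_pM; rewrite ?powR_ge0 ?mulr_ge0//; first trim_lra.
    by apply: ler_wpM2r => //; trim_lra.
  have [/esym nuz|nup] := eqVneq 0 nu.
    by have [_ ->] := nuE nuz; rewrite mul0r normr0 mulr_ge0// mulr_ge0//; trim_lra.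
  have nu1 : 0 < nu by rewrite lt_neqAle nup.
  have [h1 _] := d4 nu1.
  have neta : `|eta| <= eta by rewrite ger0_norm.
  apply: le_trans (norm_leM neta h1) _; rewrite mulrA.
  apply: ler_pM; rewrite ?powR_ge0 ?mulr_ge0//.
  by apply: ler_wpM2r => //; trim_lra.
have zs : 1 <= z by case/andP: zI; trim_lra.
have ys : 1 <= y by case/andP: yI; trim_lra.
exists (cyl k (- c) f), (fun x => \row_i dcyl k (- c) f v i x); split.
- apply: (@D12_cyl R n k k2 kn f v w C' e' Df Dv wc e'0 e'1 e'c) => s s1.
  by have [? ? ? _] := decay s s1.
- move=> phi Tphi energy hardy source.
  have [H1 H2 H3 H4] := weak_limit k2 kn p1 cpE lamE prof e'0 e'1 e'A decay Tphi.
  have E1 : energy = energy_term k f v phi.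
    by apply/funext => x; rewrite /energy /dotrV /energy_term; apply: eq_bigr => i _; rewrite !mxE.
  by rewrite E1; split.
- apply: (@sign_changing_cyl R n k k2 kn _ f v z) => //; first by case/andP: zI; trim_lra.
    by rewrite fE.
  by rewrite vE.
- by apply: (HM f v w Df Dv z y) => //; rewrite fE.
Qed.

Theorem theorem5p2 (R : realType) (n k : nat) (eta t : R)
    (k_ge2 : (2 <= k)%N) (k_lt_n : (k < n)%N)
    (eta_ge0 : 0 <= eta)
    (eta_lt : (2 < k)%N -> eta < (k%:R - 2) ^+ 2 / 4)
    (eta_eq0 : k = 2%N -> eta = 0)
    (t_ge0 : 0 <= t) (t_lt2 : t < 2) :
  exists (v : nat -> 'rV[R]_n -> R) (Dv : nat -> 'rV[R]_n -> 'rV[R]_n),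
    (forall j, [/\ D12 (v j) (Dv j),
                   hsm_weak_solution k eta t (v j) (Dv j) &
                   sign_changing (v j)]) /\
    (fun j => L2norm_field (Dv j)) @ \oo --> +oo%E.
Proof.
have H (j : nat) := large_solution k_ge2 k_lt_n eta_ge0 eta_lt eta_eq0 t_ge0 t_lt2 (ler0n R j).
have [v /choice[Dv Hv]] := choice H.
exists v, Dv; split; first by move=> j; have [] := Hv j.
apply/cvgeyPge => M; exists (Num.bound `|M|) => // j /= hj.
have [_ _ _ h] := Hv j; apply: le_trans h; rewrite lee_fin.
apply: le_trans (ler_norm M) _; apply: ltW; apply: lt_le_trans (archi_boundP (normr_ge0 _)) _.
by rewrite ler_nat.
Qed.
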